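(* Let $\mathbb D\subset\mathbb C$ be the unit disk or $\mathbb C$ itself, with complex coordinate $z$, and let $y=[Y]:\mathbb D\to S^{2m}$ be an H-totally isotropic surface with a local adjoint transform $\hat y=[\hat Y]$. Let $\mathcal F=Y\wedge\hat Y$ be the corresponding isotropic harmonic map into $G/K=SO^+(1,2m+1)/(SO^+(1,1)\times SO(2m))$, and assume that $\mathcal F|_{z=0}=I \bmod K$. Then, up to a conjugation (by a constant element of $K$), the normalized potential of $\mathcal F$ has the form $$\eta=\lambda^{-1}\begin{pmatrix}0&\hat B_1\\-\hat B_1^tI_{1,1}&0\end{pmatrix}dz,\qquad \hat B_1=\begin{pmatrix}h_{11}&ih_{11}&\cdots&h_{m1}&ih_{m1}\\ \hat h_{11}&i\hat h_{11}&\cdots&\hat h_{m1}&i\hat h_{m1}\end{pmatrix},$$ with $\{h_{j1}\,dz,\ \hat h_{j1}\,dz \mid j=1,\dots,m\}$ being meromorphic $1$-forms on $\mathbb D$.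
   Context: **Light cone model.** $\mathbb R^{2m+2}_1$ is $\mathbb R^{2m+2}$ with $\langle x,w\rangle=-x_1w_1+\sum_{j\ge2}x_jw_j$, extended complex bilinearly; $I_{1,1}=\mathrm{diag}(-1,1)$. $S^{2m}$ is identified with the projectivized forward light cone $\{[x]:\langle x,x\rangle=0,\ x_1>0\}$. For a conformal immersion $y:M\to S^{2m}$ of a Riemann surface and a local complex coordinate $z$, the canonical lift $Y$ is the lift of $y$ to the forward light cone with $|dY|^2=|dz|^2$. Put $V=\mathrm{Span}_{\mathbb R}\{Y,\mathrm{Re}\,Y_z,\mathrm{Im}\,Y_z,Y_{z\bar z}\}$ (a Lorentzian rank-4 bundle), $V^\perp$ its orthogonal complement (the normal bundle), $D$ the normal connection on $V^\perp$. $N\in\Gamma(V)$ is determined by $\langle N,Y_z\rangle=\langle N,Y_{\bar z}\rangle=\langle N,N\rangle=0$, $\langle N,Y\rangle=-1$. The conformal Hopf differential $\kappa\in\Gamma(V^\perp_{\mathbb C})$ and the Schwarzian $s$ are defined by $Y_{zz}=-\frac s2Y+\kappa$. $y$ is Willmore (a critical point of $2i\int\langle\kappa,\bar\kappa\rangle dz\wedge d\bar z$) iff $D_{\bar z}D_{\bar z}\kappa+\frac{\bar s}2\kappa=0$. **H-totally isotropic.** $y$ is totally isotropic if $\langle\partial_z^jY,\partial_z^lY\rangle=0$ for all $j,l\ge1$. Then locally there is an isotropic frame $E_1,\dots,E_m$ (so $\langle E_j,E_l\rangle=0$) with $\langle E_j,\bar E_l\rangle=2\delta_{jl}$, $Y_z\in\mathrm{Span}_{\mathbb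 C}\{E_1\}\bmod Y$, $\partial_z^jY\in\mathrm{Span}_{\mathbb C}\{E_j\}\bmod\mathrm{Span}_{\mathbb C}\{Y,E_1,\dots,E_{j-1}\}$ for $j=2,\dots,m$, and $\{E_j,\bar E_j\}_{j=2}^m$ a basis of $V^\perp_{\mathbb C}$. $y$ is H-totally isotropic if moreover $D_{\bar z}E_j\in\mathrm{Span}_{\mathbb C}\{E_2,\dots,E_m\}$ for all $j=2,\dots,m$. (Such surfaces are Willmore.) **Local adjoint transform.** On an open set $U$ (on which $y$ is umbilic free) and for a complex function $\mu$ on $U$ put $\hat Y=N+\bar\mu Y_z+\mu Y_{\bar z}+\frac12|\mu|^2Y$. The map $\hat y=[\hat Y]$ on $U$ is an adjoint transform of the Willmore surface $y$ if $\mu_z-\frac{\mu^2}2-s=0$ and $\langle D_{\bar z}\kappa+\frac{\bar\mu}2\kappa,\,D_{\bar z}\kappa+\frac{\bar\mu}2\kappa\rangle=0$ on $U$. ''Local'' means that $\hat y$, hence $\mathcal F$, need not be defined on all of $\mathbb D$; the assumption on $\mathcal F|_{z=0}$ presupposes that it is defined near $z=0$. The map $\mathcal F=Y\wedge\hat Y$ (the oriented Lorentzian 2-plane spanned by $Y,\hat Y$) is a conformal harmonic map into $SO^+(1,2m+1)/(SO^+(1,1)\times SO(2m))$, called an isotropic harmonic map. A lift of $\mathcal F$ is a frame in $SO^+(1,2m+1)$ whose first two columns are $\frac1{\sqrt2}(Y+\hat Y),\frac1{\sqrt2}(-Y+\hat Y)$ (up to right multiplication by $K$). **Normalized potential.**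 $G=SO^+(1,2m+1)$, $K=SO^+(1,1)\times SO(2m)$, $\sigma=\mathrm{Ad}(\mathrm{diag}(-I_2,I_{2m}))$, $\mathfrak g=\mathfrak k\oplus\mathfrak p$ the Cartan decomposition. Let $\mathcal F$ be harmonic into $G/K$ with $\mathcal F(0)=eK$ and lift $F$, $F(0)=I$, and $\alpha=F^{-1}dF=\alpha_0+\alpha_1'+\alpha_1''$ with $\alpha_0$ the $\mathfrak k$-part and $\alpha_1',\alpha_1''$ the $(1,0)$- and $(0,1)$-parts of the $\mathfrak p$-part. The extended frame $F(z,\bar z,\lambda)$, $\lambda\in S^1$, solves $F^{-1}dF=\lambda^{-1}\alpha_1'+\alpha_0+\lambda\alpha_1''$, $F(0,0,\lambda)=I$. Its Birkhoff decomposition is $F_-=FF_+$, with $F_+$ a $\sigma$-twisted loop in $G^{\mathbb C}$ extending holomorphically to $|\lambda|\le1$ and $F_-(z,\lambda)$ a $\sigma$-twisted loop extending holomorphically to $|\lambda|\ge1$ including $\infty$ with value $I$ at $\lambda=\infty$; $F_-$ is meromorphic in $z$. The normalized potential of $\mathcal F$ (with respect to the base point $0$) is $\eta=F_-^{-1}dF_-=\lambda^{-1}\eta_{-1}(z)dz$. **Conjugation.** For constant $Q\in K$, the map $Q\mathcal F$ has normalized potential $Q\eta Q^{-1}$; normalized potentials are identified up to such conjugation.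
   Formalization: Conjugation is by K if a positively oriented isotropic frame with the H-property exists near 0, otherwise by an element of SO^+(1,1)×O(2m); the forms are meromorphic on any connected open subset of D containing the domain of F on which η is meromorphic, not always on D. *)

(* Defs.v *)
From HB Require Import structures.
From mathcomp Require Import all_boot all_order all_algebra complex.
From mathcomp Require Import all_classical all_reals all_analysis.
Set Implicit Arguments.
Unset Strict Implicit.
Unset Printing Implicit Defensive.
Import Order.TTheory GRing.Theory Num.Theory numFieldNormedType.Exports.
Local Open Scope classical_set_scope.
Local Open Scope ring_scope.

(* With this carrier, open sets, limits and [derivable] (over the scalar field
   [cplx R], i.e. complex differentiability) are those of MathComp-Analysis. *)
Definition cplx (R : realType) : numClosedFieldType := R[i].

Section RealCalculus.
Variables (R : realType) (V : normedModType (cplx R)).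
Local Notation C := (cplx R).

(* Real directional derivatives: unlike in ['D_v f], the increment [t] is real. *)
Definition rquot (f : C -> V) (v z : C) (t : R) : V :=
  ((t%:C)%C : C)^-1 *: (f (z + ((t%:C)%C : C) * v) - f z).

Definition rderivable (f : C -> V) (v z : C) : Prop :=
  cvg (rquot f v z t @[t --> (0 : R)^']).

Definition rderive (v : C) (f : C -> V) (z : C) : V :=
  lim (rquot f v z t @[t --> (0 : R)^']).

(* Wirtinger operators *)
Definition dz (f : C -> V) (z : C) : V :=
  2^-1 *: (rderive 1 f z - 'i *: rderive 'i f z).
Definition dzb (f : C -> V) (z : C) : V :=
  2^-1 *: (rderive 1 f z + 'i *: rderive 'i f z).

Fixpoint Ck (k : nat) (U : set C) (f : C -> V) : Prop :=
  (forall z, U z -> {for z, continuous f}) /\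
  match k with
  | 0 => True
  | k'.+1 => [/\ forall z, U z -> rderivable f 1 z /\ rderivable f 'i z,
                 Ck k' U (rderive 1 f) & Ck k' U (rderive 'i f)]
  end.

Definition smooth (U : set C) (f : C -> V) : Prop := forall k, Ck k U f.

Definition holo_at (f : C -> V) (p : C) : Prop :=
  \forall z \near p, derivable f z 1.

(* [f] has a removable singularity or a pole at each point of [U]; its value at
   a singular point is irrelevant. *)
Definition meromorphic (U : set C) (f : C -> V) : Prop :=
  forall p, U p -> exists (k : nat) (g : C -> V),
    holo_at g p /\ \forall z \near p^', g z = (z - p) ^+ k *: f z.

End RealCalculus.

Section LightCone.
Variable R : realType.
Local Notation C := (cplx R).

Definition real_mx p q (A : 'M[C]_(p, q)) : Prop := map_mx Num.conj A = A.

(* diag(-1, 1, ..., 1) *)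
Definition Jmx (n : nat) : 'M[C]_n :=
  diag_mx (\row_(j < n) (-1) ^+ (nat_of_ord j == 0%N)).

Definition ip n (x w : 'cV[C]_n) : C := (x^T *m Jmx n *m w) 0 0.

(* SO^+(1, n-1) *)
Definition in_SOplus n (A : 'M[C]_n) : Prop :=
  [/\ real_mx A, A^T *m Jmx n *m A = Jmx n, \det A = 1
    & forall i : 'I_n, nat_of_ord i = 0%N -> 0 < A i i].

(* the complexification SO(1, n-1; C) *)
Definition in_SOC n (A : 'M[C]_n) : Prop :=
  A^T *m Jmx n *m A = Jmx n /\ \det A = 1.

Definition in_O n (b : 'M[C]_n) : Prop := real_mx b /\ b^T *m b = 1%:M.

Section Surface.
Variables (n : nat) (Y : C -> 'cV[C]_n).

(* The canonical lift of the conformal immersion y = [Y]; the last clause is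
   |dY|^2 = |dz|^2, which also says that y is a conformal immersion. *)
Definition canonical_lift (D : set C) : Prop :=
  smooth D Y /\ forall z, D z ->
  [/\ real_mx (Y z), ip (Y z) (Y z) = 0,
      forall i : 'I_n, nat_of_ord i = 0%N -> 0 < Y z i 0
    & forall v : C, ip (rderive v Y z) (rderive v Y z) = `|v| ^+ 2].

(* columns Y, Y_z, Y_zb, Y_zzb: a basis of V_C *)
Definition Vmx (z : C) : 'M[C]_(n, 2 + 2) :=
  row_mx (row_mx (Y z) (dz Y z)) (row_mx (dzb Y z) (dz (dzb Y) z)).

Definition in_V (z : C) (v : 'cV[C]_n) : Prop := (v^T <= (Vmx z)^T)%MS.

Definition in_Vperp (z : C) (v : 'cV[C]_n) : Prop :=
  (Vmx z)^T *m Jmx n *m v = 0.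

(* the orthogonal projection C^n -> V^perp_C along V_C, through the Gram matrix
   of the columns of [Vmx z] *)
Definition nproj (z : C) (v : 'cV[C]_n) : 'cV[C]_n :=
  let X := Vmx z in
  v - X *m invmx (X^T *m Jmx n *m X) *m (X^T *m Jmx n *m v).

(* the normal connection D_zb, on sections of V^perp_C *)
Definition Dzb (psi : C -> 'cV[C]_n) (z : C) : 'cV[C]_n := nproj z (dzb psi z).

Definition is_N (D : set C) (N : C -> 'cV[C]_n) : Prop :=
  forall z, D z ->
  [/\ real_mx (N z) /\ in_V z (N z),
      ip (N z) (dz Y z) = 0 /\ ip (N z) (dzb Y z) = 0,
      ip (N z) (N z) = 0 & ip (N z) (Y z) = -1].

Definition hopf_schwarzian (D : set C) (kappa : C -> 'cV[C]_n) (s : C -> C) :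
  Prop := forall z, D z ->
  in_Vperp z (kappa z) /\ dz (dz Y) z = - (s z / 2) *: Y z + kappa z.

Definition totally_isotropic (D : set C) : Prop :=
  forall j l, (0 < j)%N -> (0 < l)%N -> forall z, D z ->
  ip (iter j (@dz R _) Y z) (iter l (@dz R _) Y z) = 0.

(* The indices are shifted by one: [E j] is E_{j+1}. *)
Record H_frame (m : nat) (W : set C) (E : 'I_m -> C -> 'cV[C]_n) : Prop := {
  H_smooth : forall j, smooth W (E j);
  H_isotropic : forall z, W z -> forall j l, ip (E j z) (E l z) = 0;
  H_unitary : forall z, W z -> forall j l,
    ip (E j z) (map_mx Num.conj (E l z)) = (j == l)%:R * 2;
  H_osculating : forall z, W z -> forall j : 'I_m,
    exists (a : C) (c : 'I_m -> C),
      iter j.+1 (@dz R _) Y z = a *: Y z + \sum_(l : 'I_m | (l <= j)%N) c l *: E l z;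
  H_normal : forall z, W z -> forall v : 'cV[C]_n,
    in_Vperp z v <-> exists a b : 'I_m -> C,
      v = \sum_(j : 'I_m | (0 < j)%N)
            (a j *: E j z + b j *: map_mx Num.conj (E j z));
  H_condition : forall z, W z -> forall j : 'I_m, (0 < j)%N ->
    exists c : 'I_m -> C,
      Dzb (E j) z = \sum_(l : 'I_m | (0 < l)%N) c l *: E l z }.

Definition H_totally_isotropic (m : nat) (D : set C) : Prop :=
  totally_isotropic D /\
  forall p, D p -> exists (W : set C) (E : 'I_m -> C -> 'cV[C]_n),
    [/\ open W, W p, W `<=` D & H_frame W E].

Definition adjoint_lift (N : C -> 'cV[C]_n) (mu : C -> C) (z : C) : 'cV[C]_n :=
  N z + (mu z)^* *: dz Y z + mu z *: dzb Y z
  + (2^-1 * `|mu z| ^+ 2) *: Y z.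

Definition adjoint_transform (U : set C) (kappa : C -> 'cV[C]_n)
    (s mu : C -> C) : Prop :=
  smooth U (mu : C -> C^o) /\ forall z, U z ->
  [/\ kappa z != 0,
      dz (mu : C -> C^o) z - mu z ^+ 2 / 2 - s z = 0
    & let xi := Dzb kappa z + ((mu z)^* / 2) *: kappa z in ip xi xi = 0].

(* the first two columns of a frame of Y /\ Yh *)
Definition plane_frame (Yh : C -> 'cV[C]_n) (z : C) : 'M[C]_(n, 2) :=
  row_mx ((sqrtC 2)^-1 *: (Y z + Yh z)) ((sqrtC 2)^-1 *: (- Y z + Yh z)).

End Surface.

Section SymmetricSpace.
Variable m : nat.
Local Notation mat := 'M[C]_(2 + m * 2).

(* SO^+(1,1) x O(2m): the two families of maximal isotropic subspaces of C^(2m)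
   are exchanged by O(2m) but are each preserved by SO(2m), so this larger group
   is needed when the isotropic frame is negatively oriented. *)
Definition in_Kpm (Q : mat) : Prop := exists (a : 'M[C]_2) (b : 'M[C]_(m * 2)),
  [/\ Q = block_mx a 0 0 b, in_SOplus a & in_O b].

(* K = SO^+(1,1) x SO(2m) *)
Definition in_K (Q : mat) : Prop := exists (a : 'M[C]_2) (b : 'M[C]_(m * 2)),
  [/\ Q = block_mx a 0 0 b, in_SOplus a, in_O b & \det b = 1].

Definition sigma (A : mat) : mat :=
  let s : mat := block_mx (- 1%:M) 0 0 1%:M in s *m A *m s.

Definition kpart (A : mat) : mat := 2^-1 *: (A + sigma A).
Definition ppart (A : mat) : mat := 2^-1 *: (A - sigma A).

(* [phi z] has for columns the basis of the plane distinguished by the definition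
   of a lift; this says that A K is the point of G/K given by that plane. *)
Definition represents (A : mat) (phi : 'M[C]_(2 + m * 2, 2)) : Prop :=
  exists k : mat, in_K k /\ lsubmx (A *m k) = phi.

Definition is_lift (U : set C) (phi : C -> 'M[C]_(2 + m * 2, 2)) (F : C -> mat) :
  Prop :=
  smooth U F /\ forall z, U z -> in_SOplus (F z) /\ represents (F z) (phi z).

Definition extended_frame (U : set C) (F : C -> mat) (Fl : C -> C -> mat) :
  Prop :=
  let az z := invmx (F z) *m dz F z in
  let azb z := invmx (F z) *m dzb F z in
  forall lam : C, `|lam| = 1 ->
  [/\ smooth U (Fl lam), Fl lam 0 = 1%:M &
      forall z, U z ->
      [/\ in_SOplus (Fl lam z),
          invmx (Fl lam z) *m dz (Fl lam) z
            = lam^-1 *: ppart (az z) + kpart (az z)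
        & invmx (Fl lam z) *m dzb (Fl lam) z
            = kpart (azb z) + lam *: ppart (azb z)]].

(* Loops are maps on the unit circle; their values elsewhere are ignored. *)
Definition twisted_loop (L : C -> mat) : Prop :=
  forall lam : C, `|lam| = 1 -> in_SOC (L lam) /\ sigma (L lam) = L (- lam).

Definition plus_loop (L : C -> mat) : Prop :=
  twisted_loop L /\ exists (r : C) (H : C -> mat),
  [/\ 1 < r, forall w, `|w| < r -> derivable H w 1
    & forall lam, `|lam| = 1 -> L lam = H lam].

(* the extension to |lam| >= 1 is expressed in the coordinate 1/lam at infinity *)
Definition minus_loop (L : C -> mat) : Prop :=
  twisted_loop L /\ exists (r : C) (H : C -> mat),
  [/\ 1 < r, forall w, `|w| < r -> derivable H w 1, H 0 = 1%:M
    & forall lam, `|lam| = 1 -> L lam = H lam^-1].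

(* lam^-1 [eta] dz is the normalized potential, based at 0, of the map U -> G/K
   given by the planes [phi].  [S] is the discrete set where the Birkhoff
   decomposition fails. *)
Definition normalized_potential (U : set C) (phi : C -> 'M[C]_(2 + m * 2, 2))
    (eta : C -> mat) : Prop :=
  exists (F : C -> mat) (Fl Fm Fp : C -> C -> mat) (S : set C),
  [/\ is_lift U phi F /\ F 0 = 1%:M,
      extended_frame U F Fl,
      ~ S 0 /\ (forall p, U p -> \forall z \near p^', ~ S z),
      forall lam : C, `|lam| = 1 -> meromorphic U (Fm lam)
    & forall z, U z -> ~ S z ->
      [/\ minus_loop (fun lam => Fm lam z),
          plus_loop (fun lam => Fp lam z)
        & forall lam : C, `|lam| = 1 ->
          [/\ Fm lam z = Fl lam z *m Fp lam z,
              holo_at (Fm lam) z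
            & invmx (Fm lam z) *m dz (Fm lam) z = lam^-1 *: eta z]]].

(* the row (h_1, i h_1, ..., h_m, i h_m) *)
Definition isotropic_row (h : 'I_m -> C) : 'rV[C]_(m * 2) :=
  mxvec (\matrix_(j < m, e < 2) ('i ^+ e * h j)).

Definition isotropic_potential (h hh : 'I_m -> C) : mat :=
  let B : 'M[C]_(2, m * 2) := col_mx (isotropic_row h) (isotropic_row hh) in
  block_mx 0 B (- (B^T *m Jmx 2)) 0.

(* (Y, N, Re E_1, Im E_1, ..., Re E_m, Im E_m) is a positive basis *)
Definition positive_frame (Y N : C -> 'cV[C]_(2 + m * 2))
    (E : 'I_m -> C -> 'cV[C]_(2 + m * 2)) (z : C) : Prop :=
  let A : mat := row_mx (row_mx (Y z) (N z))
    (\matrix_(i < 2 + m * 2)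
       mxvec (\matrix_(j < m, e < 2)
                if e == 0 then 'Re (E j z i 0) else 'Im (E j z i 0))) in
  0 < \det A.

End SymmetricSpace.

End LightCone.

(* Main.v *)
(* Set e_1 = 2 Y_z + mu Y and e_k = E_k for k >= 2.  Near generic points E_k is orthogonal to
   all dz^j Y; differentiating in zb, where dzb E_k lies in Span(E_2, ..., E_m, Y, Y_z) because
   y is H-totally isotropic, it is orthogonal to all dz^j Y_zb, hence to all dz^j Yhat.  The
   same holds for e_1, as dz e_1 = 2 kappa + (mu / 2) e_1 by the Riccati equation.  Pulled back
   by the lift F, this says that the blocks of the (1,0)-part of the p-component of F^-1 dF and
   of its covariant z-derivatives span an isotropic space, orthogonal to the pulled back e_k.

   Near a generic point z1 these spaces form a parallel bundle.  With l the projection to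
   the first two coordinates, pi the orthogonal projection onto the conjugate bundle and
   tau_lam = 1 + (lam - 1) l + (lam^2 - 1) pi, the map Fl(lam) tau_lam Fl(1)^-1 is therefore
   locally constant in z.  Put G = Fm(z)^-1 Fm(z1), and let u be the image of the pulled back
   e_k(z1) under Fp(z1)^-1 at lam = 0.  Then lam (G u - u) extends holomorphically to both
   sides of the circle, so G u = u and eta u = 0 near z1, thus near 0 by analytic
   continuation.  As z1 tends to 0, Fp(z1) tends to 1 by Gronwall's inequality, and
   eta(z) e_k(0) = 0 results.  Up to multiples of Y(0), the real and imaginary parts of the
   e_k(0) form an orthonormal basis of R^2m; the corresponding orthogonal matrix conjugates eta
   to the asserted form near 0, and the identity theorem spreads this to Omega.

   Holomorphy is exploited through the mean value property over roots of unity, which follows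
   from a dyadic Goursat subdivision of left Riemann sums. *)
Require Import Defs.
From HB Require Import structures.
From mathcomp Require Import all_boot all_order all_algebra complex.
From mathcomp Require Import all_classical all_reals all_analysis.
From mathcomp Require Import perm.
From mathcomp Require Import ring lra.
Set Implicit Arguments.
Unset Strict Implicit.
Unset Printing Implicit Defensive.
Import Order.TTheory GRing.Theory Num.Theory numFieldNormedType.Exports.
Local Open Scope classical_set_scope.
Local Open Scope ring_scope.

(** * Real directional derivatives *)

Section Embedding.
Variable R : realType.
Local Notation C := (cplx R).

Definition rc (r : R) : C := (r%:C)%C.
Definition re (z : C) : R := complex.Re z.
Definition im (z : C) : R := complex.Im z.

Lemma rc0 : rc 0 = 0. Proof. by []. Qed.
Lemma rc1 : rc 1 = 1. Proof. by []. Qed.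
Lemma rcD x y : rc (x + y) = rc x + rc y.
Proof. exact: (rmorphD (real_complex R)). Qed.
Lemma rcM x y : rc (x * y) = rc x * rc y.
Proof. exact: (rmorphM (real_complex R)). Qed.
Lemma rcN x : rc (- x) = - rc x.
Proof. exact: (rmorphN (real_complex R)). Qed.
Lemma rcB x y : rc (x - y) = rc x - rc y.
Proof. exact: (rmorphB (real_complex R)). Qed.
Lemma rcV x : rc x^-1 = (rc x)^-1.
Proof. exact: (fmorphV (real_complex R)). Qed.
Lemma rcX x n : rc (x ^+ n) = rc x ^+ n.
Proof. exact: (rmorphXn (real_complex R)). Qed.
Lemma rc_nat n : rc n%:R = n%:R.
Proof. exact: (rmorph_nat (real_complex R)). Qed.
Lemma rc_inj : injective rc. Proof. exact: complexI. Qed.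
Lemma rc_eq0 x : (rc x == 0) = (x == 0).
Proof. exact: (fmorph_eq0 (real_complex R)). Qed.
Lemma rc_le x y : (rc x <= rc y) = (x <= y). Proof. exact: lecR. Qed.
Lemma rc_lt x y : (rc x < rc y) = (x < y). Proof. exact: ltcR. Qed.
Lemma rc_conj x : (rc x)^* = rc x. Proof. exact: conjc_real. Qed.
Lemma norm_rc x : `|rc x| = rc `|x|.
Proof. by rewrite [LHS]normc_def /= expr0n /= addr0 sqrtr_sqr. Qed.
Lemma re_rc x : re (rc x) = x. Proof. by []. Qed.
Lemma im_rc x : im (rc x) = 0. Proof. by []. Qed.
Lemma rcE (z : C) : z = rc (re z) + 'i * rc (im z).
Proof. exact: complexE. Qed.
Lemma reD (x y : C) : re (x + y) = re x + re y.
Proof. by case: x y => [a b] [c d]. Qed.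
Lemma reB (x y : C) : re (x - y) = re x - re y.
Proof. by case: x y => [a b] [c d]. Qed.
Lemma imD (x y : C) : im (x + y) = im x + im y.
Proof. by case: x y => [a b] [c d]. Qed.
Lemma re_rcM r (y : C) : re (rc r * y) = r * re y.
Proof. by case: y => c d; rewrite /re /= mul0r subr0. Qed.
Lemma re_le_norm (z : C) : rc `|re z| <= `|z|.
Proof. exact: normc_ge_Re. Qed.
Lemma norm_i : `|'i : C| = 1. Proof. exact: normCi. Qed.
Lemma im_le_norm (z : C) : rc `|im z| <= `|z|.
Proof.
have -> : im z = - re ('i * z) by case: z => a b; rewrite /re /im /= mul0r mul1r sub0r opprK.
rewrite normrN; apply: le_trans (re_le_norm _) _.
by rewrite normrM norm_i mul1r.
Qed.
Definition cabs (z : C) : R := re `|z|.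
Lemma cabsE (z : C) : rc (cabs z) = `|z|.
Proof. by rewrite /cabs normc_def. Qed.
Lemma cabs_ge0 z : 0 <= cabs z.
Proof. by rewrite -rc_le cabsE rc0. Qed.
Lemma cabsM x y : cabs (x * y) = cabs x * cabs y.
Proof. by apply: rc_inj; rewrite rcM !cabsE normrM. Qed.
Lemma cabsD x y : cabs (x + y) <= cabs x + cabs y.
Proof. by rewrite -rc_le rcD !cabsE ler_normD. Qed.
Lemma cabsB x y : cabs (x - y) <= cabs x + cabs y.
Proof. by rewrite -rc_le rcD !cabsE ler_normB. Qed.
Lemma cabsN x : cabs (- x) = cabs x.
Proof. by rewrite /cabs normrN. Qed.
Lemma cabs_distC x y : cabs (x - y) = cabs (y - x).
Proof. by rewrite -cabsN opprB. Qed.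
Lemma cabs0 : cabs 0 = 0. Proof. by rewrite /cabs normr0. Qed.
Lemma cabs1 : cabs 1 = 1. Proof. by rewrite /cabs normr1. Qed.
Lemma cabs_i : cabs 'i = 1. Proof. by rewrite /cabs norm_i. Qed.
Lemma cabs_rc x : cabs (rc x) = `|x|. Proof. by rewrite /cabs norm_rc. Qed.
Lemma cabs_eq0 x : (cabs x == 0) = (x == 0).
Proof. by rewrite -rc_eq0 cabsE normr_eq0. Qed.
Lemma cabs_gt0 x : (0 < cabs x) = (x != 0).
Proof. by rewrite lt_def cabs_eq0 cabs_ge0 andbT. Qed.
Lemma cabsV x : cabs x^-1 = (cabs x)^-1.
Proof. by apply: rc_inj; rewrite rcV !cabsE normfV. Qed.
Lemma cabsX x n : cabs (x ^+ n) = cabs x ^+ n.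
Proof. by apply: rc_inj; rewrite rcX !cabsE normrX. Qed.
Lemma cabs_conj (x : C) : cabs x^* = cabs x.
Proof. by apply: rc_inj; rewrite !cabsE norm_conjC. Qed.
Lemma cabs_sum (I : Type) (r : seq I) (P : pred I) (F : I -> C) :
  cabs (\sum_(i <- r | P i) F i) <= \sum_(i <- r | P i) cabs (F i).
Proof.
elim/big_rec2: _ => [|i x y _ le]; first by rewrite cabs0.
by rewrite (le_trans (cabsD _ _)) // lerD2l.
Qed.
Lemma re_le_cabs z : `|re z| <= cabs z.
Proof. by rewrite -rc_le cabsE re_le_norm. Qed.
Lemma im_le_cabs z : `|im z| <= cabs z.
Proof. by rewrite -rc_le cabsE im_le_norm. Qed.
Lemma cabs_sqr (z : C) : rc (cabs z ^+ 2) = z * z^*.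
Proof. by rewrite rcX cabsE normCK. Qed.

Lemma gt0_rc (e : C) : 0 < e -> exists2 r : R, 0 < r & e = rc r.
Proof.
case: e => a b; rewrite ltcE /= => /andP[/eqP -> a0].
by exists a.
Qed.

Lemma cvg_cabsP (T : Type) (F : set_system T) (FF : Filter F) (f : T -> C) (l : C) :
  f x @[x --> F] --> l <-> forall e : R, 0 < e -> \forall x \near F, cabs (f x - l) <= e.
Proof.
split=> [/cvgrPdist_le fl e e0|fl].
  have := fl (rc e); rewrite -rc0 rc_lt e0 => /(_ isT).
  by apply: filterS => x; rewrite -cabsE rc_le cabs_distC.
apply/cvgrPdist_le => e /gt0_rc[r r0 ->].
by apply: filterS (fl r r0) => x; rewrite -cabsE rc_le cabs_distC.
Qed.

Lemma nbhs_cabsP (z : C) (A : set C) :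
  nbhs z A <-> exists2 d : R, 0 < d & forall w, cabs (w - z) < d -> A w.
Proof.
split=> [/nbhs_ballP[e /= /gt0_rc[r r0 ->] sub]|[d d0 sub]].
  exists r => // w wz; apply: sub.
  by rewrite /ball /= -cabsE rc_lt cabs_distC.
apply/nbhs_ballP; exists (rc d); first by rewrite /= -rc0 rc_lt.
move=> w; rewrite /ball /= -cabsE rc_lt cabs_distC; exact: sub.
Qed.

Lemma dnbhs_cabsP (z : C) (A : set C) :
  (\forall w \near z^', A w) <-> exists2 d : R, 0 < d & forall w, cabs (w - z) < d -> w != z -> A w.
Proof.
split=> [/nbhs_cabsP[d d0 sub]|[d d0 sub]]; first by exists d.
by apply/nbhs_cabsP; exists d.
Qed.

Lemma open_cabsP (A : set C) :
  open A <-> forall z, A z -> exists2 d : R, 0 < d & forall w, cabs (w - z) < d -> A w.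
Proof.
rewrite openE; split=> AA z Az; first exact/nbhs_cabsP/AA.
by apply/nbhs_cabsP/AA.
Qed.

Lemma open_cball (z : C) (d : R) : open [set w | cabs (w - z) < d].
Proof.
apply/open_cabsP => w /= wz; exists (d - cabs (w - z)); first by rewrite subr_gt0.
move=> x xw; have -> : x - z = (x - w) + (w - z) by rewrite addrA subrK.
have := cabsD (x - w) (w - z); lra.
Qed.

Lemma near0P (A : set R) :
  (\forall t \near 0^', A t) <-> exists2 d : R, 0 < d & forall t, `|t| < d -> t != 0 -> A t.
Proof.
split=> [/nbhs_ballP[d /= d0 sub]|[d d0 sub]].
  exists d => // t td t0; apply: sub => //.
  by rewrite /ball /= sub0r normrN.
apply/nbhs_ballP; exists d => // t.
by rewrite /ball /= sub0r normrN => td t0; apply: sub.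
Qed.

End Embedding.

Section DirectionalDerivative.
Variable R : realType.
Local Notation C := (cplx R).
Implicit Types (f g : C -> C) (v z a b : C).

Definition isrd (V : normedModType C) (f : C -> V) (v z : C) (d : V) : Prop :=
  rquot f v z t @[t --> (0 : R)^'] --> d.

Lemma isrd_derivable (V : normedModType C) (f : C -> V) v z d :
  isrd f v z d -> rderivable f v z.
Proof. by move=> fd; apply/cvg_ex; exists d. Qed.

Lemma isrd_rderive (V : normedModType C) (f : C -> V) v z d :
  isrd f v z d -> rderive v f z = d.
Proof. by move=> fd; apply/cvg_lim => //; exact: norm_hausdorff. Qed.

Lemma rderivableP (V : normedModType C) (f : C -> V) v z :
  rderivable f v z -> isrd f v z (rderive v f z).
Proof. by []. Qed.

Variant srd (f : C -> C) (v z d : C) : Prop := Srd of isrd (f : C -> C^o) v z d.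

Lemma srdP f v z (d : C) : srd f v z d <->
  forall e : R, 0 < e -> exists2 de : R, 0 < de & forall t : R, `|t| < de ->
    cabs (f (z + rc t * v) - f z - rc t * d) <= e * `|t|.
Proof.
split=> [[/cvg_cabsP fd] e e0|fd].
  have /near0P[de de0 H] := fd e e0.
  exists de => // t tde; have [->|t0] := eqVneq t 0.
    by rewrite rc0 !mul0r addr0 subrr subr0 cabs0 normr0 mulr0.
  have := H t tde t0.
  rewrite /rquot -[X in _ -> cabs X <= _](_ : rc t * ((rc t)^-1 * (f (z + rc t * v) - f z) - d) = _).
    by rewrite cabsM cabs_rc [e * _]mulrC ler_pM2l // normr_gt0.
  by rewrite mulrBr mulVKf // rc_eq0.
constructor; apply/cvg_cabsP => e e0; apply/near0P.
have [de de0 H] := fd e e0; exists de => // t tde t0.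
have := H t tde.
rewrite /rquot -[X in cabs X <= _ -> _](_ : rc t * ((rc t)^-1 * (f (z + rc t * v) - f z) - d) = _).
  by rewrite cabsM cabs_rc [e * _]mulrC ler_pM2l // normr_gt0.
by rewrite mulrBr mulVKf // rc_eq0.
Qed.

Lemma isrd_cst (V : normedModType C) (c : V) v z : isrd (fun=> c) v z 0.
Proof.
rewrite /isrd /rquot; under eq_fun do rewrite subrr scaler0.
exact: cvg_cst.
Qed.

Lemma isrdD (V : normedModType C) (f g : C -> V) v z (a b : V) :
  isrd f v z a -> isrd g v z b -> isrd (fun x => f x + g x) v z (a + b).
Proof.
rewrite /isrd => fa gb.
have -> : rquot (fun x => f x + g x) v z = (fun t => rquot f v z t + rquot g v z t).
  by apply/funext => t; rewrite /rquot -scalerDr opprD addrACA.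
exact: (cvgD fa gb).
Qed.

Lemma isrdZ (V : normedModType C) (f : C -> V) c v z (a : V) :
  isrd f v z a -> isrd (fun x => c *: f x) v z (c *: a).
Proof.
rewrite /isrd => fa.
have -> : rquot (fun x => c *: f x) v z = (fun t => c *: rquot f v z t).
  by apply/funext => t; rewrite /rquot -scalerBr !scalerA mulrC.
exact: (cvgZl_tmp fa).
Qed.

Lemma isrdN (V : normedModType C) (f : C -> V) v z (a : V) :
  isrd f v z a -> isrd (fun x => - f x) v z (- a).
Proof.
move=> /(isrdZ (c := -1)); rewrite scaleN1r.
by congr (isrd _ _ _ _); apply/funext => x; rewrite scaleN1r.
Qed.

Lemma srd_rderive f v z d : srd f v z d -> rderive v (f : C -> C^o) z = d.
Proof. by case=> /isrd_rderive. Qed.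

Lemma srd_derivable f v z d : srd f v z d -> rderivable (f : C -> C^o) v z.
Proof. by case=> /isrd_derivable. Qed.

Lemma rderivable_srd f v z : rderivable (f : C -> C^o) v z -> srd f v z (rderive v (f : C -> C^o) z).
Proof. by move=> fd; constructor. Qed.

Lemma srd_cst c v z : srd (fun=> c) v z 0.
Proof. by constructor; exact: isrd_cst. Qed.

Lemma srdD f g v z a b : srd f v z a -> srd g v z b -> srd (fun x => f x + g x) v z (a + b).
Proof. by move=> [fa] [gb]; constructor; exact: (isrdD fa gb). Qed.

Lemma srdN f v z a : srd f v z a -> srd (fun x => - f x) v z (- a).
Proof. by move=> [fa]; constructor; exact: (isrdN fa). Qed.

Lemma srd_cvg f v z (d : C) : srd f v z d ->
  f (z + rc t * v) @[t --> (0 : R)^'] --> f z.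
Proof.
move=> /srdP H; apply/cvg_cabsP => e e0; apply/near0P.
have [de de0 {}H] := H 1 ltr01.
pose K := 1 + cabs d; have K0 : 0 < K by rewrite ltr_wpDr // cabs_ge0.
exists (Num.min de (e / K)); first by rewrite lt_min de0 divr_gt0.
move=> t; rewrite lt_min => /andP[tde teK] t0.
have {}H := H t tde.
have -> : f (z + rc t * v) - f z = (f (z + rc t * v) - f z - rc t * d) + rc t * d by rewrite subrK.
apply: le_trans (cabsD _ _) _.
rewrite cabsM cabs_rc.
have : `|t| * K <= e by rewrite -ler_pdivlMr // ltW.
rewrite /K; lra.
Qed.

Lemma srd_ctn f v z (d : C) : srd f v z d ->
  forall e : R, 0 < e -> exists2 de : R, 0 < de & forall t : R, `|t| < de ->
    cabs (f (z + rc t * v) - f z) <= e.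
Proof.
move=> /srd_cvg/cvg_cabsP H e e0; have /near0P[de de0 {}H] := H e e0.
exists de => // t tde; have [->|/H] := eqVneq t 0; last exact.
by rewrite rc0 mul0r addr0 subrr cabs0 ltW.
Qed.

Lemma srdM f g v z a b :
  srd f v z a -> srd g v z b ->
  srd (fun x => f x * g x) v z (a * g z + f z * b).
Proof.
move=> fa gb; apply/srdP => e e0.
have cg := srd_ctn gb; move: fa gb => /srdP fa /srdP gb.
pose G := 1 + cabs (g z); pose A := 1 + cabs a; pose B := 1 + cabs (f z).
have G0 : 0 < G by rewrite ltr_wpDr // cabs_ge0.
have A0 : 0 < A by rewrite ltr_wpDr // cabs_ge0.
have B0 : 0 < B by rewrite ltr_wpDr // cabs_ge0.
have e3 : 0 < e / 3 by rewrite divr_gt0.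
have [d1 d10 H1] := fa (e / 3 / G) (divr_gt0 e3 G0).
have [d2 d20 H2] := cg (e / 3 / A) (divr_gt0 e3 A0).
have [d3 d30 H3] := gb (e / 3 / B) (divr_gt0 e3 B0).
have [d4 d40 H4] := cg 1 ltr01.
exists (Num.min (Num.min d1 d2) (Num.min d3 d4)); first by rewrite !lt_min d10 d20 d30.
move=> t; rewrite !lt_min => /andP[/andP[t1 t2] /andP[t3 t4]].
move: (H1 t t1) (H2 t t2) (H3 t t3) (H4 t t4) => {}H1 {}H2 {}H3 {}H4.
set z' := z + rc t * v in H1 H2 H3 H4 *.
have -> : f z' * g z' - f z * g z - rc t * (a * g z + f z * b) =
  (f z' - f z - rc t * a) * g z' + rc t * a * (g z' - g z) + f z * (g z' - g z - rc t * b) by ring.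
have gz' : cabs (g z') <= G.
  have -> : g z' = (g z' - g z) + g z by rewrite subrK.
  by rewrite (le_trans (cabsD _ _)) // lerD2r.
have t0 := normr_ge0 t.
apply: le_trans (cabsD _ _) _; apply: le_trans (lerD (cabsD _ _) (lexx _)) _.
have -> : e * `|t| = e / 3 * `|t| + `|t| * (e / 3) + e / 3 * `|t| by field.
apply: lerD; first apply: lerD; rewrite !cabsM ?cabs_rc.
- apply: le_trans (ler_pM _ _ H1 gz') _; rewrite ?cabs_ge0 //.
  by rewrite mulrAC divfK // gt_eqF.
- rewrite -mulrA ler_wpM2l //.
  apply: (@le_trans _ _ (A * (e / 3 / A))); last by rewrite mulrC divfK // gt_eqF.
  by apply: ler_pM; rewrite ?cabs_ge0 // lerDr.
- apply: (@le_trans _ _ (B * (e / 3 / B * `|t|))); last by rewrite mulrA [B * _]mulrC divfK // gt_eqF.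
  by apply: ler_pM; rewrite ?cabs_ge0 // lerDr.
Qed.

Lemma srd_sum (I : Type) (r : seq I) (P : pred I) (f : I -> C -> C) v z (a : I -> C) :
  (forall i, srd (f i) v z (a i)) ->
  srd (fun x => \sum_(i <- r | P i) f i x) v z (\sum_(i <- r | P i) a i).
Proof.
move=> fa; elim: r => [|i r IH].
  rewrite big_nil.
  have -> : (fun x => \sum_(i <- [::] | P i) f i x) = (fun=> 0) by apply/funext => x; rewrite big_nil.
  exact: srd_cst.
rewrite big_cons.
have -> : (fun x => \sum_(j <- i :: r | P j) f j x) =
    (fun x => (if P i then f i x else 0) + \sum_(j <- r | P j) f j x).
  by apply/funext => x; rewrite big_cons; case: ifP => //; rewrite add0r.
rewrite (_ : (if P i then _ else _) = (if P i then a i else 0) + \sum_(j <- r | P j) a j); last first.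
  by case: ifP => //; rewrite add0r.
by apply: srdD => //; case: ifP => _; [exact: fa|exact: srd_cst].
Qed.

Lemma srd_conj f v z a : srd f v z a ->
  srd (fun x => (f x)^*) v z a^*.
Proof.
move=> /srdP H; apply/srdP => e e0; have [de de0 {}H] := H e e0.
exists de => // t tde.
have -> : (f (z + rc t * v))^* - (f z)^* - rc t * a^* = (f (z + rc t * v) - f z - rc t * a)^*.
  by rewrite !rmorphB rmorphM /= rc_conj.
by rewrite cabs_conj; exact: H.
Qed.

Lemma isrd_eq_near (V : normedModType C) (f g : C -> V) v z d :
  (\forall x \near z, f x = g x) -> isrd f v z d -> isrd g v z d.
Proof.
move=> /nbhs_cabsP[de de0 H]; rewrite /isrd => fd.
apply: cvg_trans fd; apply: near_eq_cvg; apply/near0P.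
exists (de / (1 + cabs v)); first by rewrite divr_gt0 // ltr_wpDr // cabs_ge0.
have K0 : 0 < 1 + cabs v by rewrite ltr_wpDr // cabs_ge0.
move=> t tde t0; rewrite /rquot -/(rc t).
have -> : f z = g z by apply: H; rewrite subrr cabs0.
have -> // : f (z + rc t * v) = g (z + rc t * v).
apply: H; rewrite addrAC subrr add0r cabsM cabs_rc.
move: tde; rewrite ltr_pdivlMr //; have := normr_ge0 t; nra.
Qed.

Lemma srd_inv f v z a : f z != 0 -> srd f v z a ->
  srd (fun x => (f x)^-1) v z (- a / f z ^+ 2).
Proof.
move=> fz fa; apply/srdP => e e0.
have cf := srd_ctn fa; move: fa => /srdP fa.
pose F := cabs (f z); have F0 : 0 < F by rewrite cabs_gt0.
pose A := 1 + cabs a; have A0 : 0 < A by rewrite ltr_wpDr // cabs_ge0.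
have e2 : 0 < e / 2 by rewrite divr_gt0.
have F20 : 0 < F ^+ 2 by rewrite exprn_gt0.
have F30 : 0 < F ^+ 3 by rewrite exprn_gt0.
have [d1 d10 H1] := fa (e / 2 * F ^+ 2) (mulr_gt0 e2 F20).
have [d2 d20 H2] := fa 1 ltr01.
have [d3 d30 H3] := cf (e / 4 * F ^+ 3 / A) (divr_gt0 (mulr_gt0 (divr_gt0 e0 (ltr0Sn _ 3)) F30) A0).
have [d4 d40 H4] := cf (F / 2) (divr_gt0 F0 (ltr0Sn _ 1)).
exists (Num.min (Num.min d1 d2) (Num.min d3 d4)); first by rewrite !lt_min d10 d20 d30.
move=> t; rewrite !lt_min => /andP[/andP[t1 t2] /andP[t3 t4]].
move: (H1 t t1) (H2 t t2) (H3 t t3) (H4 t t4) => {}H1 {}H2 {}H3 {}H4.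
set z' := z + rc t * v in H1 H2 H3 H4 *.
have F' : F / 2 <= cabs (f z').
  have -> : f z' = f z + (f z' - f z) by rewrite addrC subrK.
  have := cabsB (f z + (f z' - f z)) (f z' - f z); rewrite addrK -/F; lra.
have fz' : f z' != 0 by rewrite -cabs_gt0; apply: lt_le_trans F'; rewrite divr_gt0.
have -> : (f z')^-1 - (f z)^-1 - rc t * (- a / f z ^+ 2) =
  - (f z' - f z - rc t * a) / f z ^+ 2 + (f z' - f z) * (f z' - f z) / (f z ^+ 2 * f z').
  by field; rewrite fz fz'.
have t0 := normr_ge0 t.
apply: le_trans (cabsD _ _) _.
have pE : cabs (f z ^+ 2) = F ^+ 2 by rewrite cabsX.
move: (f z ^+ 2) pE => p pE.
rewrite !cabsM !cabsV !cabsM cabsN pE.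
have -> : e * `|t| = e / 2 * `|t| + e / 2 * `|t| by field.
apply: lerD; first by rewrite ler_pdivrMr // mulrAC.
have F'0 : 0 < cabs (f z') by rewrite cabs_gt0.
have Hd : cabs (f z' - f z) <= A * `|t|.
  have -> : f z' - f z = (f z' - f z - rc t * a) + rc t * a by rewrite subrK.
  apply: le_trans (cabsD _ _) _; rewrite mulrDl lerD // cabsM cabs_rc mulrC //.
rewrite ler_pdivrMr ?mulr_gt0 //.
apply: le_trans (ler_pM (cabs_ge0 _) (cabs_ge0 _) H3 Hd) _.
have -> : e / 4 * F ^+ 3 / A * (A * `|t|) = e / 2 * `|t| * (F ^+ 2 * (F / 2)).
  by field; rewrite gt_eqF.
apply: ler_wpM2l; first by rewrite mulr_ge0 // ltW.
by apply: ler_wpM2l => //; exact: ltW.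
Qed.

Lemma mx_cvgP (T : Type) (F : set_system T) (FF : Filter F) p q (f : T -> 'M[C]_(p, q)) (l : 'M[C]_(p, q)) :
  f x @[x --> F] --> l <-> forall i j, (f x i j) @[x --> F] --> l i j.
Proof.
split=> [fl i j|fl].
  by apply: (@cvg_comp _ _ _ f (fun M : 'M[C]_(p, q) => M i j) F _ _ fl); exact: coord_continuous.
apply/cvg_ballP => e e0.
have H i j : \forall x \near F, ball (l i j) e (f x i j) by have /cvg_ballP/(_ e e0) := fl i j.
have : \forall x \near F, forall i j, ball (l i j) e (f x i j).
  by apply: filter_forall => i; apply: filter_forall => j; exact: H.
by apply: filterS => x Hx; split.
Qed.

Lemma isrd_mxP p q (f : C -> 'M[C]_(p, q)) v z (d : 'M[C]_(p, q)) :
  isrd f v z d <-> forall i j, srd (fun x => f x i j) v z (d i j).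
Proof.
have E i j : (fun t => rquot f v z t i j) = rquot ((fun x => f x i j) : C -> C^o) v z.
  by apply/funext => t; rewrite /rquot !mxE.
rewrite /isrd; split=> [/mx_cvgP H i j|H]; first by constructor; rewrite /isrd -E; exact: H.
by apply/mx_cvgP => i j; rewrite E; have [] := H i j.
Qed.

Lemma isrd_mulmx p q r (f : C -> 'M[C]_(p, q)) (g : C -> 'M[C]_(q, r)) v z (a : 'M[C]_(p, q)) (b : 'M[C]_(q, r)) :
  isrd f v z a -> isrd g v z b ->
  isrd (fun x => f x *m g x) v z (a *m g z + f z *m b).
Proof.
move=> /isrd_mxP fa /isrd_mxP gb; apply/isrd_mxP => i j.
have -> : (fun x => (f x *m g x) i j) = (fun x => \sum_k f x i k * g x k j) by apply/funext => x; rewrite mxE.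
by rewrite !mxE -big_split /=; apply: srd_sum => k; exact: srdM.
Qed.

Lemma isrd_conjmx p q (f : C -> 'M[C]_(p, q)) v z (a : 'M[C]_(p, q)) :
  isrd f v z a -> isrd (fun x => map_mx Num.conj (f x)) v z (map_mx Num.conj a).
Proof.
move=> /isrd_mxP fa; apply/isrd_mxP => i j.
have -> : (fun x => map_mx Num.conj (f x) i j) = (fun x => (f x i j)^*) by apply/funext => x; rewrite mxE.
by rewrite mxE; exact: srd_conj.
Qed.

Lemma derivable_cabsP f z :
  derivable (f : C -> C^o) z 1 <-> exists d : C, forall e : R, 0 < e ->
    exists2 de : R, 0 < de & forall h : C, cabs h < de ->
      cabs (f (z + h) - f z - h * d) <= e * cabs h.
Proof.
have E h d : h != 0 -> cabs (f (z + h) - f z - h * d) =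
    cabs h * cabs (h^-1 *: (((f : C -> C^o) \o shift z) (h *: 1) - f z) - d).
  move=> h0; rewrite -cabsM; congr cabs; rewrite /GRing.scale /= mulr1 [h + z]addrC.
  by rewrite mulrBr mulVKf.
rewrite /derivable; split.
  move=> /cvg_ex[d /cvg_cabsP H]; exists d => e e0.
  have /dnbhs_cabsP[de de0 {}H] := H e e0; exists de => // h hde.
  have [->|h0] := eqVneq h 0; first by rewrite addr0 subrr mul0r subr0 cabs0 mulr0.
  rewrite E // [e * _]mulrC ler_wpM2l ?cabs_ge0 //.
  by have := H h; rewrite subr0; apply.
move=> [d H]; apply/cvg_ex; exists d; apply/cvg_cabsP => e e0.
have [de de0 {}H] := H e e0.
apply/dnbhs_cabsP; exists de => // h; rewrite subr0 => hde h0.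
by have := H h hde; rewrite E // [e * _]mulrC ler_pM2l ?cabs_gt0.
Qed.

End DirectionalDerivative.

(** * One complex variable *)

Section MeanValueInequality.
Variable R : realType.
Local Notation C := (cplx R).
Implicit Types (f g : C -> C) (v z : C).

Lemma real_derivP (phi : R -> R) (x l : R) :
  is_derive x 1 phi l <-> forall e : R, 0 < e -> exists2 de : R, 0 < de & forall t : R, `|t| < de ->
    `|phi (x + t) - phi x - t * l| <= e * `|t|.
Proof.
have E h : h != 0 -> `|phi (x + h) - phi x - h * l| =
    `|h| * `|l - h^-1 *: ((phi \o shift x) (h *: 1) - phi x)|.
  move=> h0; rewrite -normrM distrC mulrBr; congr `|_|.
  by rewrite /GRing.scale /= mulr1 [h + x]addrC mulVKf.
split.
  move=> [dphi lE]; move: dphi; rewrite /derivable => /cvg_ex[l' fl].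
  have {}lE : l = l' by rewrite -lE; apply/cvg_lim.
  rewrite {}lE in E * => e e0; move/cvgrPdist_le : fl => /(_ e e0)/near0P[de de0 H].
  exists de => // t tde; have [->|t0] := eqVneq t 0.
    by rewrite addr0 subrr mul0r subr0 !normr0 mulr0.
  by rewrite E // [e * _]mulrC ler_wpM2l //; exact: H.
move=> H.
have fl : (fun h => h^-1 *: ((phi \o shift x) (h *: 1) - phi x)) @ (0 : R)^' --> l.
  apply/cvgrPdist_le => e e0; apply/near0P; have [de de0 {}H] := H e e0.
  exists de => // t tde t0; have := H t tde; rewrite E // [e * _]mulrC ler_pM2l // normr_gt0 //.
by apply: DeriveDef; [apply/cvg_ex; exists l|apply/cvg_lim].
Qed.

Lemma mvt_ineq f v z (h K : R) : 0 <= h ->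
  (forall t, 0 <= t <= h -> exists2 d : C, srd f v (z + rc t * v) d & cabs d <= K) ->
  cabs (f (z + rc h * v) - f z) <= K * h.
Proof.
move=> h0 H; move: h0; rewrite le_eqVlt => /predU1P[<-|h0].
  by rewrite rc0 mul0r addr0 subrr cabs0 mulr0.
set c := f (z + rc h * v) - f z.
have [->|c0] := eqVneq c 0.
  have h00 : 0 <= (0 : R) <= h by rewrite lexx /= ltW.
  have [d _ dK] := H 0 h00.
  by rewrite cabs0; apply: mulr_ge0; [exact: le_trans (cabs_ge0 d) dK|exact: ltW].
pose phi (t : R) : R := re (c^* * f (z + rc t * v)).
pose dphi (t : R) : R := re (c^* * rderive v (f : C -> C^o) (z + rc t * v)).
have dP t : 0 <= t <= h -> is_derive t 1 phi (dphi t).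
  move=> th; have [d fd dK] := H t th.
  rewrite /dphi (srd_rderive fd); apply/real_derivP => e e0.
  have cc0 : 0 < cabs c by rewrite cabs_gt0.
  move/srdP : fd => /(_ (e / cabs c) (divr_gt0 e0 cc0))[de de0 {}H].
  exists de => // s sde; have {}H := H s sde.
  rewrite /phi -re_rcM -!reB.
  have -> : z + rc (t + s) * v = z + rc t * v + rc s * v by rewrite rcD mulrDl addrA.
  apply: le_trans (re_le_cabs _) _.
  have -> : c^* * f (z + rc t * v + rc s * v) - c^* * f (z + rc t * v) - rc s * (c^* * d) =
    c^* * (f (z + rc t * v + rc s * v) - f (z + rc t * v) - rc s * d) by ring.
  rewrite cabsM cabs_conj; apply: le_trans (ler_wpM2l (cabs_ge0 _) H) _.
  by rewrite mulrA mulrCA divff ?gt_eqF // mulr1.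
have [||xi xiI E] := @MVT R phi dphi 0 h h0.
- by move=> x; rewrite in_itv /= => /andP[x0 xh]; apply: dP; rewrite !ltW.
- apply: derivable_within_continuous => x; rewrite in_itv /= => xh.
  by have [] := dP x xh.
have {}xiI : 0 <= xi <= h by move: xiI; rewrite in_itv /= => /andP[x0 xh]; rewrite !ltW.
have [d fd dK] := H xi xiI.
have cc : cabs c ^+ 2 = phi h - phi 0.
  rewrite /phi -reB rc0 mul0r addr0 -mulrBr -/c mulrC -cabs_sqr re_rc //.
have : cabs c * cabs c <= cabs c * (K * h).
  rewrite -expr2 cc E subr0 /dphi (srd_rderive fd) mulrA ler_wpM2r ?(ltW h0) //.
  apply: le_trans (ler_norm _) _; apply: le_trans (re_le_cabs _) _.
  by rewrite cabsM cabs_conj ler_wpM2l ?cabs_ge0.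
by rewrite ler_pM2l // cabs_gt0.
Qed.

Lemma srd_linear (c : C) v z : srd (fun w => w * c) v z (v * c).
Proof.
apply/srdP => e e0; exists 1 => // t _.
have -> : (z + rc t * v) * c - z * c - rc t * (v * c) = 0 by ring.
by rewrite cabs0 mulr_ge0 // ltW.
Qed.

Lemma srd_oppdir f v z (d : C) : srd f v z d -> srd f (- v) z (- d).
Proof.
move=> /srdP H; apply/srdP => e e0; have [de de0 {}H] := H e e0; exists de => // t tde.
have := H (- t); rewrite normrN => /(_ tde).
by rewrite rcN !mulrN !mulNr.
Qed.

Lemma srd_shift f u z (c d : C) :
  srd f u (z + c) d -> srd (fun w => f (w + c)) u z d.
Proof.
move=> /srdP H; apply/srdP => e e0; have [de de0 {}H] := H e e0; exists de => // t tde.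
by have -> : z + rc t * u + c = z + c + rc t * u; [rewrite addrAC|exact: H].
Qed.

Lemma second_diff_ineq (f fu fuv : C -> C) (u v z : C) (h e : R) (c : C) : 0 <= h -> u != 0 -> v != 0 ->
  (forall s t, 0 <= s <= h -> 0 <= t <= h -> let w := z + rc s * u + rc t * v in
     [/\ srd f u w (fu w), srd fu v w (fuv w) & cabs (fuv w - c) <= e]) ->
  cabs (f (z + rc h * u + rc h * v) - f (z + rc h * u) - f (z + rc h * v) + f z - rc h ^+ 2 * c)
    <= e * h ^+ 2.
Proof.
move=> h0 u0 v0 H.
pose psi w := f (w + rc h * v) - f w - w * (rc h * c / u).
have hh : 0 <= h <= h by rewrite h0 lexx.
have z0h : 0 <= (0 : R) <= h by apply/andP; split.
have -> : f (z + rc h * u + rc h * v) - f (z + rc h * u) - f (z + rc h * v) + f z - rc h ^+ 2 * c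
   = psi (z + rc h * u) - psi z.
  by rewrite /psi; field.
rewrite expr2 mulrA; apply: mvt_ineq => // s sh.
pose w := z + rc s * u.
have w0 : w = z + rc s * u + rc 0 * v by rewrite rc0 mul0r addr0.
exists (fu (w + rc h * v) - fu w - rc h * c).
  rewrite /psi; apply: srdD; last first.
    by apply: srdN; have := srd_linear (rc h * c / u) u w; rewrite mulrCA divff // mulr1.
  apply: srdD; first by apply: srd_shift; have [] := H s h sh hh.
  by apply: srdN; rewrite -/w w0; have [] := H s 0 sh z0h.
pose chi x := fu x - x * (c / v).
have -> : fu (w + rc h * v) - fu w - rc h * c = chi (w + rc h * v) - chi w.
  by rewrite /chi; field.
apply: mvt_ineq => // t th.
have [_ f2 f3] := H s t sh th; exists (fuv (w + rc t * v) - c) => //.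
rewrite /chi; apply: srdD => //; apply: srdN.
by have := srd_linear (c / v) v (w + rc t * v); rewrite mulrCA divff // mulr1.
Qed.

Lemma srd_mixed (f fu fv fuv fvu : C -> C) (u v z : C) : u != 0 -> v != 0 ->
  (\forall w \near z, [/\ srd f u w (fu w), srd f v w (fv w),
     srd fu v w (fuv w) & srd fv u w (fvu w)]) ->
  {for z, continuous fuv} -> {for z, continuous fvu} -> fuv z = fvu z.
Proof.
move=> u0 v0 /nbhs_cabsP[r r0 H] c1 c2.
apply/eqP; rewrite -subr_eq0 -cabs_eq0; apply/eqP/le_anti; rewrite cabs_ge0 andbT.
apply/ler_addgt0Pr => e e0; rewrite add0r.
have e2 : 0 < e / 2 by rewrite divr_gt0.
move/cvg_cabsP : c1 => /(_ _ e2)/nbhs_cabsP[r1 r10 H1].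
move/cvg_cabsP : c2 => /(_ _ e2)/nbhs_cabsP[r2 r20 H2].
pose K := 1 + cabs u + cabs v.
have K0 : 0 < K by rewrite /K; have := cabs_ge0 u; have := cabs_ge0 v; lra.
pose h := Num.min r (Num.min r1 r2) / (2 * K).
have m0 : 0 < Num.min r (Num.min r1 r2) by rewrite !lt_min r0 r10.
have h0 : 0 < h by rewrite divr_gt0 // mulr_gt0.
have near s t : 0 <= s <= h -> 0 <= t <= h ->
    cabs (z + rc s * u + rc t * v - z) < Num.min r (Num.min r1 r2).
  move=> /andP[s0 sh] /andP[t0 th].
  have -> : z + rc s * u + rc t * v - z = rc s * u + rc t * v by ring.
  apply: le_lt_trans (cabsD _ _) _; rewrite !cabsM !cabs_rc !ger0_norm //.
  have : h * (2 * K) = Num.min r (Num.min r1 r2) by rewrite /h divfK // gt_eqF // mulr_gt0.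
  move=> <-; rewrite /K; have := cabs_ge0 u; have := cabs_ge0 v => cv cu.
  have : s * cabs u <= h * cabs u by rewrite ler_wpM2r.
  have : t * cabs v <= h * cabs v by rewrite ler_wpM2r.
  have : 0 <= h * cabs u by rewrite mulr_ge0 // ltW.
  have : 0 <= h * cabs v by rewrite mulr_ge0 // ltW.
  lra.
have Ha := @second_diff_ineq f fu fuv u v z h (e / 2) (fuv z) (ltW h0) u0 v0.
have Hb := @second_diff_ineq f fv fvu v u z h (e / 2) (fvu z) (ltW h0) v0 u0.
have h2 : 0 < h ^+ 2 by rewrite exprn_gt0.
rewrite -(ler_pM2l h2).
have -> : h ^+ 2 * cabs (fuv z - fvu z) = cabs (rc h ^+ 2 * (fuv z - fvu z)).
  by rewrite cabsM cabsX cabs_rc ger0_norm ?ltW.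
set w := z + rc h * u + rc h * v in Ha.
have wE : z + rc h * v + rc h * u = w by rewrite /w addrAC.
rewrite wE in Hb.
have -> : rc h ^+ 2 * (fuv z - fvu z) =
  (f w - f (z + rc h * v) - f (z + rc h * u) + f z - rc h ^+ 2 * fvu z) -
  (f w - f (z + rc h * u) - f (z + rc h * v) + f z - rc h ^+ 2 * fuv z) by ring.
apply: le_trans (cabsB _ _) _.
have -> : h ^+ 2 * e = e / 2 * h ^+ 2 + e / 2 * h ^+ 2 by field.
apply: lerD; [apply: Hb|apply: Ha] => s t sh th w'.
  have := near t s th sh; rewrite (addrAC z (rc t * u)) -/w' !lt_min => /and3P[w1 w2 w3].
  by have [] := H w' w1; split=> //; exact: H2.
have := near s t sh th; rewrite -/w' !lt_min => /and3P[w1 w2 w3].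
by have [] := H w' w1; split=> //; exact: H1.
Qed.

Lemma srd_bound f (p : C) (r K : R) :
  (forall w, cabs (w - p) < r -> exists d1 d2, [/\ srd f 1 w d1, srd f 'i w d2,
     cabs d1 <= K & cabs d2 <= K]) ->
  forall w, cabs (w - p) < r -> cabs (f w - f p) <= K * 2 * cabs (w - p).
Proof.
move=> H w wp.
have axis (q u : C) (x : R) : (u = 1) \/ (u = 'i) ->
    (forall t, `|t| <= `|x| -> cabs (q + rc t * u - p) < r) -> cabs (f (q + rc x * u) - f q) <= K * `|x|.
  move=> uE Hq.
  have Hd t : `|t| <= `|x| -> exists2 d, srd f u (q + rc t * u) d & cabs d <= K.
    move=> tx; have [d1 [d2 [D1 D2 k1 k2]]] := H _ (Hq t tx).
    by case: uE D1 D2 => -> D1 D2; [exists d1|exists d2].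
  have [x0|x0] := leP 0 x.
    rewrite ger0_norm //; apply: mvt_ineq => // t /andP[t0 tx]; apply: Hd.
    by rewrite !ger0_norm.
  rewrite ltr0_norm //.
  have -> : rc x * u = rc (- x) * (- u) by rewrite rcN mulrNN.
  apply: mvt_ineq => [|t /andP[t0 tx]]; first by rewrite oppr_ge0 ltW.
  have [|d D k] := Hd (- t); first by rewrite normrN ger0_norm // ltr0_norm.
  exists (- d); last by rewrite cabsN.
  by apply: srd_oppdir; move: D; rewrite rcN mulNr mulrN.
pose x := re (w - p); pose y := im (w - p).
have wE : w = p + rc x * 1 + rc y * 'i by rewrite mulr1 -addrA [rc y * _]mulrC -rcE addrC subrK.
have n2 (a b : R) : cabs (rc a + rc b * 'i) ^+ 2 = a ^+ 2 + b ^+ 2.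
  apply: rc_inj; rewrite cabs_sqr rmorphD rmorphM /= !rc_conj conjCi rcD !rcX.
  have := sqrCi C; set ii := 'i; move=> i2.
  transitivity (rc a ^+ 2 - rc b ^+ 2 * ii ^+ 2); first by ring.
  by rewrite i2 mulrN1 opprK.
have n2w : cabs (w - p) ^+ 2 = x ^+ 2 + y ^+ 2.
  by rewrite -n2; congr (cabs _ ^+ 2); rewrite [rc y * _]mulrC -rcE.
have h1 : cabs (f (p + rc x * 1) - f p) <= K * `|x|.
  apply: axis; [by left|move=> t tx]; apply: le_lt_trans wp.
  rewrite addrAC subrr add0r mulr1 cabs_rc (le_trans tx) //; exact: re_le_cabs.
have h2 : cabs (f (p + rc x * 1 + rc y * 'i) - f (p + rc x * 1)) <= K * `|y|.
  apply: axis; [by right|move=> t ty]; apply: le_lt_trans wp.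
  have -> : p + rc x * 1 + rc t * 'i - p = rc x + rc t * 'i by ring.
  rewrite -(@ler_pXn2r _ 2) ?nnegrE ?cabs_ge0 // n2w n2 lerD2l.
  by rewrite -[leLHS]real_normK ?num_real // -[leRHS]real_normK ?num_real // ler_pXn2r // nnegrE.
have K0 : 0 <= K.
  have [|d1 [d2 [_ _ k1 _]]] := H p; last exact: le_trans (cabs_ge0 _) k1.
  by rewrite subrr cabs0; apply: le_lt_trans wp; exact: cabs_ge0.
have -> : f w - f p = (f (p + rc x * 1 + rc y * 'i) - f (p + rc x * 1)) + (f (p + rc x * 1) - f p).
  by rewrite addrA subrK -wE.
apply: le_trans (cabsD _ _) _; apply: le_trans (lerD h2 h1) _.
rewrite -mulrDr -mulrA ler_wpM2l //.
have := re_le_cabs (w - p); have := im_le_cabs (w - p); rewrite -/x -/y; lra.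
Qed.

Lemma srd0_cst f (p : C) (r : R) :
  (forall w, cabs (w - p) < r -> srd f 1 w 0 /\ srd f 'i w 0) ->
  forall w, cabs (w - p) < r -> f w = f p.
Proof.
move=> H w wp; apply/eqP; rewrite -subr_eq0 -cabs_eq0; apply/eqP/le_anti; rewrite cabs_ge0 andbT.
have -> : 0 = 0 * 2 * cabs (w - p) by rewrite !mul0r.
apply: srd_bound wp => x xp; exists 0, 0; have [h1 h2] := H x xp.
by rewrite cabs0 lexx.
Qed.

End MeanValueInequality.

Section DiscreteGoursat.
Variable R : realType.
Local Notation C := (cplx R).
Implicit Types (u : C -> C) (p v a d : C) (N : nat).

(* Left Riemann sums over dyadic subdivisions; they replace contour integrals. *)
Definition dsum u N a d : C := d / 2 ^+ N * \sum_(k < 2 ^ N) u (a + (k%:R / 2 ^+ N) * d).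

Definition dsquare u N p v : C :=
  dsum u N p v - dsum u N (p + 'i * v) v + dsum u N (p + v) ('i * v) - dsum u N p ('i * v).

Lemma two_neq0 : (2 : C) != 0. Proof. by rewrite pnatr_eq0. Qed.

Lemma le_of_eq (x y : R) : x = y -> x <= y. Proof. by move=> ->. Qed.

Lemma dsumS u N a d : dsum u N.+1 a d = dsum u N a (d / 2) + dsum u N (a + d / 2) (d / 2).
Proof.
have t0 : (2 : C) ^+ N != 0 by rewrite expf_neq0 // two_neq0.
have E : (2 ^ N.+1 = 2 ^ N + 2 ^ N)%N by rewrite expnS mul2n addnn.
rewrite /dsum E big_split_ord /= -mulrDr.
have -> : d / 2 ^+ N.+1 = d / 2 / 2 ^+ N by rewrite exprS invfM mulrA.
congr (_ * (_ + _)); apply: eq_bigr => k _; congr u.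
  by rewrite exprS; field.
by rewrite natrD natrX exprS; field.
Qed.

Lemma dsquareS u N p v : dsquare u N.+1 p v =
  dsquare u N p (v / 2) + dsquare u N (p + v / 2) (v / 2) +
  dsquare u N (p + 'i * v / 2) (v / 2) + dsquare u N (p + v / 2 + 'i * v / 2) (v / 2).
Proof.
rewrite /dsquare !dsumS.
have -> : p + v / 2 + v / 2 = p + v by field.
have -> : p + 'i * v / 2 + 'i * (v / 2) = p + 'i * v by field.
have -> : p + v / 2 + 'i * v / 2 + 'i * (v / 2) = p + 'i * v + v / 2 by field.
have -> : p + v / 2 + 'i * v / 2 + v / 2 = p + v + 'i * v / 2 by field.
have -> : p + v / 2 + 'i * (v / 2) = p + v / 2 + 'i * v / 2 by rewrite mulrA.
have -> : p + 'i * v / 2 + v / 2 = p + v / 2 + 'i * v / 2 by rewrite addrAC.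
rewrite -!mulrA; ring.
Qed.

Lemma dsum_linear (A B x : C) N a d :
  dsum (fun w => A + B * (w - x)) N (a + 'i * d) d - dsum (fun w => A + B * (w - x)) N a d = 'i * B * d ^+ 2.
Proof.
have t0 : (2 : C) ^+ N != 0 by rewrite expf_neq0 // two_neq0.
rewrite /dsum -mulrBr -sumrB.
rewrite (eq_bigr (fun=> B * ('i * d))); last by move=> k _; ring.
rewrite sumr_const card_ord -[_ *+ (2 ^ N)]mulr_natr natrX; field; exact: t0.
Qed.

Lemma dsquare_linear (A B x : C) N p v : dsquare (fun w => A + B * (w - x)) N p v = 0.
Proof.
have h1 := dsum_linear A B x N p v.
have h2 : dsum (fun w => A + B * (w - x)) N (p + v) ('i * v) - dsum (fun w => A + B * (w - x)) N p ('i * v)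
   = 'i * B * v ^+ 2.
  have t0 : (2 : C) ^+ N != 0 by rewrite expf_neq0 // two_neq0.
  rewrite /dsum -mulrBr -sumrB.
  rewrite (eq_bigr (fun=> B * v)); last by move=> k _; ring.
  by rewrite sumr_const card_ord -[_ *+ (2 ^ N)]mulr_natr natrX; field; exact: t0.
rewrite /dsquare -addrA h2 -h1; ring.
Qed.

Lemma dsum_bound u N a d (M : R) :
  (forall t : R, 0 <= t < 1 -> cabs (u (a + rc t * d)) <= M) -> cabs (dsum u N a d) <= cabs d * M.
Proof.
move=> H; have n0 : 0 < (2 : R) ^+ N by rewrite exprn_gt0.
rewrite /dsum cabsM cabsM cabsV cabsX -mulrA ler_wpM2l ?cabs_ge0 //.
have -> : cabs (2 : C) = 2 by rewrite -rc_nat cabs_rc ger0_norm.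
rewrite mulrC ler_pdivrMr //; apply: le_trans (cabs_sum _ _ _) _.
rewrite (_ : M * _ = \sum_(k < 2 ^ N) M); last by rewrite sumr_const card_ord -[RHS]mulr_natr natrX.
apply: ler_sum => k _.
have -> : (k%:R / 2 ^+ N : C) = rc (k%:R / 2 ^+ N) by rewrite rcM rcV rcX !rc_nat.
apply: H; rewrite divr_ge0 ?ler0n ?ltW //= ltr_pdivrMr // mul1r -natrX ltr_nat //.
Qed.

Lemma dsum_sub u w N a d : dsum (fun x => u x - w x) N a d = dsum u N a d - dsum w N a d.
Proof. by rewrite /dsum -mulrBr -sumrB. Qed.

Lemma dsquare_bound u N p v (M : R) :
  (forall s t : R, 0 <= s <= 1 -> 0 <= t <= 1 -> cabs (u (p + (rc s + 'i * rc t) * v)) <= M) ->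
  cabs (dsquare u N p v) <= 4 * cabs v * M.
Proof.
move=> H.
have z01 : 0 <= (0 : R) <= 1 by rewrite lexx ler01.
have o01 : 0 <= (1 : R) <= 1 by rewrite lexx ler01.
have lt01 (t : R) : 0 <= t < 1 -> 0 <= t <= 1 by move=> /andP[-> /ltW].
have h1 : cabs (dsum u N p v) <= cabs v * M.
  apply: dsum_bound => t /lt01 th; have := H t 0 th z01.
  by rewrite rc0 mulr0 addr0.
have h2 : cabs (dsum u N (p + 'i * v) v) <= cabs v * M.
  apply: dsum_bound => t /lt01 th; have := H t 1 th o01.
  by congr (cabs (u _) <= M); rewrite rc1; ring.
have h3 : cabs (dsum u N (p + v) ('i * v)) <= cabs v * M.
  rewrite -[cabs v]mul1r -cabs_i -cabsM; apply: dsum_bound => t /lt01 th; have := H 1 t o01 th.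
  by congr (cabs (u _) <= M); rewrite rc1; ring.
have h4 : cabs (dsum u N p ('i * v)) <= cabs v * M.
  rewrite -[cabs v]mul1r -cabs_i -cabsM; apply: dsum_bound => t /lt01 th; have := H 0 t z01 th.
  by congr (cabs (u _) <= M); rewrite rc0; ring.
rewrite /dsquare.
have := cabsB (dsum u N p v - dsum u N (p + 'i * v) v + dsum u N (p + v) ('i * v)) (dsum u N p ('i * v)).
have := cabsD (dsum u N p v - dsum u N (p + 'i * v) v) (dsum u N (p + v) ('i * v)).
have := cabsB (dsum u N p v) (dsum u N (p + 'i * v) v).
lra.
Qed.

Lemma dsquare_local u N p v (x A B : C) (e : R) : 0 <= e ->
  (forall s t : R, 0 <= s <= 1 -> 0 <= t <= 1 -> let w := p + (rc s + 'i * rc t) * v in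
     cabs (u w - (A + B * (w - x))) <= e * cabs v) ->
  cabs (dsquare u N p v) <= 4 * e * cabs v ^+ 2.
Proof.
move=> e0 H.
have -> : dsquare u N p v = dsquare (fun w => u w - (A + B * (w - x))) N p v.
  have := dsquare_linear A B x N p v; rewrite /dsquare !dsum_sub => L.
  set a := (X in _ = X); rewrite -[LHS]subr0 -L /a; ring.
apply: le_trans (dsquare_bound N H) _.
by rewrite expr2; apply: le_of_eq; ring.
Qed.

Lemma goursat u p v :
  (forall s t : R, 0 <= s <= 1 -> 0 <= t <= 1 -> derivable (u : C -> C^o) (p + (rc s + 'i * rc t) * v) 1) ->
  forall e : R, 0 < e -> exists N0, forall N, (N0 <= N)%N -> cabs (dsquare u N p v) <= e * cabs v ^+ 2.
Proof.
move=> Hd e e0; apply: contrapT => bad0.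
pose good (q : R * R) k := exists N0, forall N, (N0 <= N)%N ->
  cabs (dsquare u N (p + (rc q.1 + 'i * rc q.2) * v) (v / 2 ^+ k)) <= e * cabs (v / 2 ^+ k) ^+ 2.
have bad00 : ~ good (0, 0) 0%N.
  by rewrite /good /= rc0 mulr0 addr0 mul0r addr0 expr0 divr1.
have half k : v / 2 ^+ k.+1 = v / 2 ^+ k / 2 by rewrite exprSr invfM; field; rewrite expf_neq0 ?two_neq0.
have half2 k : cabs (v / 2 ^+ k.+1) ^+ 2 = cabs (v / 2 ^+ k) ^+ 2 / 4.
  have c2 : cabs (2 : C) = 2 by rewrite -rc_nat cabs_rc ger0_norm.
  by rewrite half cabsM exprMn cabsV c2; field.
have step (q : R * R) k : ~ good q k -> exists q' : R * R, ~ good q' k.+1 /\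
   (q'.1 = q.1 \/ q'.1 = q.1 + (2 ^+ k.+1)^-1) /\ (q'.2 = q.2 \/ q'.2 = q.2 + (2 ^+ k.+1)^-1).
  move=> bq; apply: contrapT => nex; apply: bq.
  have all4 q' : (q'.1 = q.1 \/ q'.1 = q.1 + (2 ^+ k.+1)^-1) -> (q'.2 = q.2 \/ q'.2 = q.2 + (2 ^+ k.+1)^-1) ->
      good q' k.+1.
    by move=> h1 h2; apply: contrapT => ng; apply: nex; exists q'.
  have [N1 H1] := all4 (q.1, q.2) (or_introl erefl) (or_introl erefl).
  have [N2 H2] := all4 (q.1 + (2 ^+ k.+1)^-1, q.2) (or_intror erefl) (or_introl erefl).
  have [N3 H3] := all4 (q.1, q.2 + (2 ^+ k.+1)^-1) (or_introl erefl) (or_intror erefl).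
  have [N4 H4] := all4 (q.1 + (2 ^+ k.+1)^-1, q.2 + (2 ^+ k.+1)^-1) (or_intror erefl) (or_intror erefl).
  exists (maxn (maxn N1 N2) (maxn N3 N4)).+1 => -[//|N]; rewrite ltnS !geq_max => /andP[/andP[n1 n2] /andP[n3 n4]].
  have {n1}H1 := H1 N n1; have {n2}H2 := H2 N n2; have {n3}H3 := H3 N n3; have {n4}H4 := H4 N n4.
  move: H1 H2 H3 H4; rewrite /= half2.
  set V := v / 2 ^+ k.
  have r2 : rc ((2 : R) ^+ k.+1)^-1 = (2 ^+ k.+1)^-1 by rewrite rcV rcX rc_nat.
  have hV : v / 2 ^+ k.+1 = V / 2 by rewrite half.
  have eV : (2 ^+ k.+1)^-1 * v = V / 2 by rewrite mulrC hV.
  rewrite !rcD r2 dsquareS hV => H1 H2 H3 H4.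
  set P := p + (rc q.1 + 'i * rc q.2) * v in H1 *.
  have E2 : p + (rc q.1 + (2 ^+ k.+1)^-1 + 'i * rc q.2) * v = P + V / 2 by rewrite /P -eV; ring.
  have E3 : p + (rc q.1 + 'i * (rc q.2 + (2 ^+ k.+1)^-1)) * v = P + 'i * V / 2 by rewrite /P -mulrA -eV; ring.
  have E4 : p + (rc q.1 + (2 ^+ k.+1)^-1 + 'i * (rc q.2 + (2 ^+ k.+1)^-1)) * v = P + V / 2 + 'i * V / 2.
    by rewrite /P -mulrA -eV; ring.
  rewrite E2 in H2; rewrite E3 in H3; rewrite E4 in H4.
  apply: le_trans (cabsD _ _) _; apply: le_trans (lerD (cabsD _ _) (lexx _)) _.
  apply: le_trans (lerD (lerD (cabsD _ _) (lexx _)) (lexx _)) _.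
  lra.
have [f fP] : {f : (R * R) * nat -> R * R & forall qk, ~ good qk.1 qk.2 -> ~ good (f qk) qk.2.+1 /\
   ((f qk).1 = qk.1.1 \/ (f qk).1 = qk.1.1 + (2 ^+ qk.2.+1)^-1) /\ ((f qk).2 = qk.1.2 \/ (f qk).2 = qk.1.2 + (2 ^+ qk.2.+1)^-1)}.
  apply: (@choice _ _ (fun qk q' => ~ good qk.1 qk.2 -> ~ good q' qk.2.+1 /\
   (q'.1 = qk.1.1 \/ q'.1 = qk.1.1 + (2 ^+ qk.2.+1)^-1) /\ (q'.2 = qk.1.2 \/ q'.2 = qk.1.2 + (2 ^+ qk.2.+1)^-1))).
  move=> [q k] /=; have [g|b] := pselect (good q k); first by exists q.
  by have [q' Hq'] := step q k b; exists q'.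
pose q := fix q k := if k is k'.+1 then f (q k', k') else (0 : R, 0 : R).
have qbad k : ~ good (q k) k by elim: k => [//|k IH]; have [] := fP (q k, k) IH.
have nest (x : nat -> R) : x 0%N = 0 -> (forall k, x k.+1 = x k \/ x k.+1 = x k + (2 ^+ k.+1)^-1) ->
    exists2 xx, 0 <= xx <= 1 & forall k, x k <= xx <= x k + (2 ^+ k)^-1.
  move=> x0 xS.
  have p0 k : 0 < (2 ^+ k : R)^-1 by rewrite invr_gt0 exprn_gt0.
  have pS k : (2 ^+ k : R)^-1 = (2 ^+ k.+1)^-1 + (2 ^+ k.+1)^-1 by rewrite exprS; field; rewrite expf_neq0.
  have mono k : x k <= x k.+1 by have := p0 k.+1; case: (xS k) => ->; lra.
  have anti k : x k.+1 + (2 ^+ k.+1)^-1 <= x k + (2 ^+ k)^-1.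
    by have := p0 k.+1; rewrite (pS k); case: (xS k) => ->; lra.
  have monoD j k : x j <= x (j + k)%N.
    by elim: k => [|k IH]; [rewrite addn0|rewrite addnS (le_trans IH)].
  have antiD j k : x (j + k)%N + (2 ^+ (j + k))^-1 <= x j + (2 ^+ j)^-1.
    by elim: k => [|k IH]; [rewrite addn0|rewrite addnS (le_trans (anti _))].
  have cross j k : x j <= x k + (2 ^+ k)^-1.
    have [jk|/ltnW kj] := leqP j k.
      rewrite -(subnKC jk); apply: le_trans (monoD j (k - j)%N) _; rewrite lerDl ltW //.
    by rewrite -(subnKC kj); apply: le_trans (antiD k (j - k)%N); rewrite lerDl ltW.
  have hs : has_sup (range x).
    split; first by exists (x 0%N); exists 0%N.
    by exists (x 0%N + (2 ^+ 0)^-1) => _ [j _ <-]; exact: cross.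
  have b k : x k <= sup (range x) <= x k + (2 ^+ k)^-1.
    rewrite (ub_le_sup hs.2) /=; last by exists k.
    by apply: ge_sup => [|_ [j _ <-]]; [exact: hs.1|exact: cross].
  exists (sup (range x)) => //; have := b 0%N; rewrite x0 expr0 invr1 add0r //.
have [xx xx01 xxP] := nest (fun k => (q k).1) erefl (fun k => (fP (q k, k) (qbad k)).2.1).
have [yy yy01 yyP] := nest (fun k => (q k).2) erefl (fun k => (fP (q k, k) (qbad k)).2.2).
pose zz := p + (rc xx + 'i * rc yy) * v.
have /derivable_cabsP[B HB] := Hd xx yy xx01 yy01.
have e8 : 0 < e / 8 by rewrite divr_gt0.
have [de de0 {}HB] := HB (e / 8) e8.
have [k kde] : exists k, cabs (v / 2 ^+ k) * 2 < de.
  have : exists k : nat, cabs v * 2 / de < k%:R.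
    exists (Num.bound (cabs v * 2 / de)).
    by apply: le_lt_trans (archi_boundP _); rewrite // divr_ge0 ?mulr_ge0 ?cabs_ge0 // ltW.
  move=> [k kP]; exists k.
  have k2 : (k%:R : R) < 2 ^+ k by rewrite -natrX ltr_nat ltn_expl.
  rewrite cabsM cabsV cabsX -rc_nat cabs_rc ger0_norm // mulrAC ltr_pdivrMr ?exprn_gt0 //.
  move: kP; rewrite ltr_pdivrMr // => kP; apply: lt_trans kP _.
  by rewrite mulrC ltr_pM2l.
apply: (qbad k); exists 0%N => N _.
have := xxP k; have := yyP k; case: (q k) => x y /= yk xk.
set V := v / 2 ^+ k in kde *.
have -> : e * cabs V ^+ 2 = 4 * (e / 4) * cabs V ^+ 2 by field.
apply: (@dsquare_local u N _ V zz (u zz) B); first by rewrite divr_ge0 // ltW.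
move=> s t sh th; set w := p + _ + _.
have wz : w - zz = (rc (x + s / 2 ^+ k - xx) + 'i * rc (y + t / 2 ^+ k - yy)) * v.
  rewrite /w /zz /V !rcB !rcD !rcM rcV rcX rc_nat; ring.
have pk0 : 0 < (2 ^+ k : R)^-1 by rewrite invr_gt0 exprn_gt0.
have bnd (a0 b0 c0 : R) : a0 <= b0 <= a0 + (2 ^+ k)^-1 -> 0 <= c0 <= 1 -> `|a0 + c0 / 2 ^+ k - b0| <= (2 ^+ k)^-1.
  move=> /andP[h1 h2] /andP[h3 h4].
  have h5 : 0 <= c0 / 2 ^+ k by rewrite mulr_ge0 // ltW.
  have h6 : c0 / 2 ^+ k <= (2 ^+ k)^-1 by rewrite -[leRHS]mul1r ler_wpM2r // ltW.
  by rewrite ler_norml; apply/andP; split; lra.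
have wz2 : cabs (w - zz) <= cabs V * 2.
  rewrite wz cabsM /V cabsM cabsV cabsX -rc_nat cabs_rc ger0_norm // mulrC -mulrA ler_wpM2l ?cabs_ge0 //.
  apply: le_trans (cabsD _ _) _; rewrite cabsM cabs_i mul1r !cabs_rc.
  have := bnd _ _ _ xk sh; have := bnd _ _ _ yk th; lra.
have := HB (w - zz) (le_lt_trans wz2 kde).
have -> : zz + (w - zz) = w by rewrite addrC subrK.
have -> : u w - u zz - (w - zz) * B = u w - (u zz + B * (w - zz)) by ring.
move=> h; apply: le_trans h _.
apply: le_trans (ler_wpM2l (ltW e8) wz2) _; apply: le_of_eq; by field.
Qed.

End DiscreteGoursat.

Section MeanValueProperty.
Variable R : realType.
Local Notation C := (cplx R).
Implicit Types (f g h : C -> C) (z w : C) (N : nat).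

Lemma derivable_compC f g z : derivable (g : C -> C^o) z 1 -> derivable (f : C -> C^o) (g z) 1 ->
  derivable ((fun w => f (g w)) : C -> C^o) z 1.
Proof.
move=> /derivable1_diffP dg /derivable1_diffP df; apply/derivable1_diffP.
exact: (@differentiable_comp C C^o C^o C^o g f z dg df).
Qed.

Definition cexp w : C := rc (expR (re w)) * (rc (cos (im w)) + 'i * rc (sin (im w))).

Lemma cexpD z w : cexp (z + w) = cexp z * cexp w.
Proof.
have i2 := sqrCi C.
rewrite /cexp reD imD expRD cosD sinD !rcM rcB !rcD !rcM.
move: i2; set ii := 'i => i2.
set a := rc (expR (re z)); set b := rc (expR (re w)).
set c1 := rc (cos (im z)); set c2 := rc (cos (im w)).
set s1 := rc (sin (im z)); set s2 := rc (sin (im w)).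
transitivity (a * b * (c1 * c2 + ii ^+ 2 * (s1 * s2) + ii * (s1 * c2 + c1 * s2))); last by ring.
by rewrite i2 mulN1r.
Qed.

Lemma cexp_rc (x : R) : cexp (rc x) = rc (expR x).
Proof. by rewrite /cexp re_rc im_rc cos0 sin0 rc0 mulr0 addr0 mulr1. Qed.

Lemma re_i (x : R) : re ('i * rc x) = 0.
Proof. by rewrite /re /= mul0r mulr0 subr0. Qed.

Lemma im_i (x : R) : im ('i * rc x) = x.
Proof. by rewrite /im /= mul1r mul0r add0r. Qed.

Lemma cexp_i (x : R) : cexp ('i * rc x) = rc (cos x) + 'i * rc (sin x).
Proof. by rewrite /cexp re_i im_i expR0 mul1r. Qed.

Lemma cabs_cexp z : cabs (cexp z) = expR (re z).
Proof.
rewrite /cexp cabsM cabs_rc ger0_norm ?expR_ge0 //.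
suff -> : cabs (rc (cos (im z)) + 'i * rc (sin (im z))) = 1 by rewrite mulr1.
apply/eqP; rewrite -(@pexpr_eq1 _ _ 2) ?cabs_ge0 //; apply/eqP/rc_inj.
rewrite cabs_sqr rmorphD rmorphM /= conjCi !rc_conj -(cos2Dsin2 (im z)) rcD !rcX.
have := sqrCi C; set ii := 'i => i2; set c := rc _; set s := rc _.
transitivity (c ^+ 2 - ii ^+ 2 * s ^+ 2); first by ring.
by rewrite i2 mulN1r opprK.
Qed.

Lemma cexp_neq0 z : cexp z != 0.
Proof. by rewrite -cabs_gt0 cabs_cexp expR_gt0. Qed.

Definition tau2 : R := pi *+ 2.

Lemma tau2_gt0 : 0 < tau2.
Proof. by rewrite /tau2 pmulrn_lgt0 // pi_gt0. Qed.

Lemma cexp_tau : cexp ('i * rc tau2) = 1.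
Proof. by rewrite cexp_i /tau2 cos2pi sin2pi rc0 mulr0 addr0. Qed.

Lemma derivable_cexp z : derivable (cexp : C -> C^o) z 1.
Proof.
apply/derivable_cabsP; exists (cexp z) => e e0.
have Z0 : 0 < cabs (cexp z) by rewrite cabs_cexp expR_gt0.
pose e' := Num.min 1 (e / cabs (cexp z) / 10).
have e'0 : 0 < e' by rewrite lt_min ltr01 divr_gt0 // divr_gt0.
have e'1 : e' <= 1 by rewrite ge_min lexx.
have e'2 : e' <= e / cabs (cexp z) / 10 by rewrite ge_min lexx orbT.
have /real_derivP/(_ _ e'0)[d1 d10 H1] : is_derive (0 : R) 1 expR (expR 0) by exact: is_derive_expR.
have /real_derivP/(_ _ e'0)[d2 d20 H2] : is_derive (0 : R) 1 cos (- sin 0) by exact: is_derive_cos.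
have /real_derivP/(_ _ e'0)[d3 d30 H3] : is_derive (0 : R) 1 sin (cos 0) by exact: is_derive_sin.
exists (Num.min (Num.min d1 d2) (Num.min d3 (e' / 2))); first by rewrite !lt_min d10 d20 d30 divr_gt0.
move=> w; rewrite !lt_min => /andP[/andP[w1 w2] /andP[w3 w4]].
have rw := re_le_cabs w; have iw := im_le_cabs w.
set x := re w in rw; set y := im w in iw.
have {}H1 := H1 x (le_lt_trans rw w1).
have {}H2 := H2 y (le_lt_trans iw w2).
have {}H3 := H3 y (le_lt_trans iw w3).
move: H1 H2 H3; rewrite !add0r expR0 cos0 sin0 oppr0 addr0 !mulr1 mulr0 !subr0 => H1 H2 H3.
have -> : cexp (z + w) - cexp z - w * cexp z = cexp z * (cexp w - 1 - w) by rewrite cexpD; ring.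
rewrite cabsM.
suff : cabs (cexp w - 1 - w) <= 10 * e' * cabs w.
  move=> h; apply: le_trans (ler_wpM2l (cabs_ge0 _) h) _.
  have : cabs (cexp z) * (10 * e') <= e.
    by rewrite mulrA -ler_pdivlMl ?mulr_gt0 // mulrC invfM mulrA.
  move=> h2; apply: le_trans (ler_wpM2r (cabs_ge0 w) h2); rewrite !mulrA //.
have -> : cexp w - 1 - w = rc (expR x - 1 - x) + rc (expR x) * (rc (cos y - 1) + 'i * rc (sin y - y))
   + rc (expR x - 1) * ('i * rc y).
  rewrite [X in _ - _ - X](rcE w) /cexp -/x -/y !rcB rc1; ring.
have nx : `|x| <= e' / 2 by rewrite (le_trans rw) // ltW.
have ex : `|expR x - 1| <= 2 * e'.
  have -> : expR x - 1 = (expR x - 1 - x) + x by rewrite subrK.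
  apply: le_trans (ler_normD _ _) _; have := normr_ge0 x; nra.
have ex2 : `|expR x| <= 3.
  have -> : expR x = (expR x - 1) + 1 by rewrite subrK.
  apply: le_trans (ler_normD _ _) _; rewrite normr1; lra.
apply: le_trans (cabsD _ _) _; apply: le_trans (lerD (cabsD _ _) (lexx _)) _.
rewrite !cabsM cabs_i mul1r !cabs_rc.
have t1 : cabs (rc (cos y - 1) + 'i * rc (sin y - y)) <= 2 * e' * cabs w.
  apply: le_trans (cabsD _ _) _; rewrite cabsM cabs_i mul1r !cabs_rc; nra.
have t2 : `|expR x| * cabs (rc (cos y - 1) + 'i * rc (sin y - y)) <= 3 * (2 * e' * cabs w).
  by apply: ler_pM; rewrite ?normr_ge0 ?cabs_ge0.
have t3 : `|expR x - 1| * `|y| <= 2 * e' * cabs w by apply: ler_pM.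
have t4 : `|expR x - 1 - x| <= e' * cabs w by apply: le_trans H1 _; rewrite ler_wpM2l // ltW.
have : 0 <= e' * cabs w by rewrite mulr_ge0 ?cabs_ge0 // ltW.
lra.
Qed.

Definition cmean h (rho : C) N : C := (2 ^+ N)^-1 * \sum_(k < 2 ^ N) h (rho * cexp (k%:R / 2 ^+ N * ('i * rc tau2))).

Definition tends (u : nat -> C) (l : C) : Prop :=
  forall e : R, 0 < e -> exists N0, forall N, (N0 <= N)%N -> cabs (u N - l) <= e.

Lemma tendsD u v (a b : C) : tends u a -> tends v b -> tends (fun N => u N + v N) (a + b).
Proof.
move=> ua vb e e0; have e2 : 0 < e / 2 by rewrite divr_gt0.
have [N1 H1] := ua _ e2; have [N2 H2] := vb _ e2.
exists (maxn N1 N2) => N; rewrite geq_max => /andP[n1 n2].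
have -> : u N + v N - (a + b) = (u N - a) + (v N - b) by ring.
apply: le_trans (cabsD _ _) _; have := H1 N n1; have := H2 N n2; lra.
Qed.

Lemma tends_uniq u (a b : C) : tends u a -> tends u b -> a = b.
Proof.
move=> ua ub; apply/eqP; rewrite -subr_eq0 -cabs_eq0; apply/eqP/le_anti; rewrite cabs_ge0 andbT.
apply/ler_addgt0Pr => e e0; rewrite add0r; have e2 : 0 < e / 2 by rewrite divr_gt0.
have [N1 H1] := ua _ e2; have [N2 H2] := ub _ e2.
have h1 := H1 (maxn N1 N2) (leq_maxl _ _); have h2 := H2 (maxn N1 N2) (leq_maxr _ _).
set x := u _ in h1 h2; have -> : a - b = (x - b) - (x - a) by ring.
apply: le_trans (cabsB _ _) _; lra.
Qed.

Lemma tends_bound u (a : C) (M : R) : tends u a -> (forall N, cabs (u N) <= M) -> cabs a <= M.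
Proof.
move=> ua uM; apply/ler_addgt0Pr => e e0; have [N1 H1] := ua _ e0.
have E : u N1 - (u N1 - a) = a by ring.
have := H1 N1 (leqnn _); have := uM N1; have := cabsB (u N1) (u N1 - a); rewrite E; lra.
Qed.

Lemma cabs2 : cabs (2 : C) = 2.
Proof. by rewrite -rc_nat cabs_rc ger0_norm. Qed.

Lemma cabs_node (N k : nat) : cabs (cexp (k%:R / 2 ^+ N * ('i * rc tau2))) = 1.
Proof.
rewrite cabs_cexp; set x := (X in re X).
have -> : x = 'i * rc (k%:R / 2 ^+ N * tau2) by rewrite /x !rcM rcV rcX !rc_nat; ring.
by rewrite re_i expR0.
Qed.

Lemma cmean_bound h rho N (c : C) (M : R) : (forall w, cabs w = cabs rho -> cabs (h w - c) <= M) ->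
  cabs (cmean h rho N - c) <= M.
Proof.
move=> H; have n0 : 0 < (2 : R) ^+ N by rewrite exprn_gt0.
have t0 : (2 : C) ^+ N != 0 by rewrite expf_neq0 // pnatr_eq0.
have -> : c = (2 ^+ N)^-1 * \sum_(k < 2 ^ N) c.
  by rewrite sumr_const card_ord -[_ *+ (2 ^ N)]mulr_natr natrX mulrCA mulVf // mulr1.
rewrite /cmean -mulrBr -sumrB cabsM cabsV cabsX cabs2 mulrC ler_pdivrMr //.
apply: le_trans (cabs_sum _ _ _) _.
rewrite (_ : M * _ = \sum_(k < 2 ^ N) M); last by rewrite sumr_const card_ord -[RHS]mulr_natr natrX.
by apply: ler_sum => k _; apply: H; rewrite cabsM cabs_node mulr1.
Qed.

(* [h] is holomorphic on a disk of radius larger than 1, apart from a removable singularity at 0. *)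
Definition plusf h : Prop := exists2 r : R, 1 < r &
  (forall w, w != 0 -> cabs w < r -> derivable (h : C -> C^o) w 1) /\ {for 0, continuous h}.

Lemma cexp_nat_period z (k : nat) : cexp (z + k%:R * ('i * rc tau2)) = cexp z.
Proof.
elim: k => [|k IH]; first by rewrite mul0r addr0.
have -> : z + k.+1%:R * ('i * rc tau2) = (z + k%:R * ('i * rc tau2)) + 'i * rc tau2 by rewrite -natr1; ring.
by rewrite cexpD cexp_tau mulr1.
Qed.

Lemma cmean_radius h (r : R) (j : nat) : 1 < r ->
  (forall w, w != 0 -> cabs w < r -> derivable (h : C -> C^o) w 1) ->
  tends (fun N => cmean h (cexp (- (j%:R * rc tau2))) N - cmean h (cexp (- (j.+1%:R * rc tau2))) N) 0.
Proof.
move=> r1 Hd e e0.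
pose u w := h (cexp w); pose p : C := - (j.+1%:R * rc tau2); pose v : C := rc tau2.
have v0 : v != 0 by rewrite rc_eq0 gt_eqF // tau2_gt0.
have cv : 0 < cabs v by rewrite cabs_gt0.
have [|N0 HN] := @goursat R u p v _ (e / cabs v) (divr_gt0 e0 cv).
  move=> s t /andP[s0 s1] /andP[t0 t1]; apply: derivable_compC; first exact: derivable_cexp.
  apply: Hd; first exact: cexp_neq0.
  rewrite cabs_cexp; apply: le_lt_trans r1.
  rewrite -[leRHS](@expR0 R) ler_expR /p /v.
  have -> : - (j.+1%:R * rc tau2) + (rc s + 'i * rc t) * rc tau2 = rc ((s - j.+1%:R) * tau2) + 'i * rc (t * tau2).
    by rewrite !rcM rcB rc_nat; ring.
  rewrite reD re_i re_rc addr0 -natr1; have := tau2_gt0; have : 0 <= (j%:R : R) by rewrite ler0n.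
  nra.
exists N0 => N /HN; rewrite subr0.
have pv : p + v = - (j%:R * rc tau2) by rewrite /p /v -natr1; ring.
have per a : dsum u N (a + 'i * v) v = dsum u N a v.
  rewrite /dsum; congr (_ * _); apply: eq_bigr => k _; rewrite /u.
  have -> : a + 'i * v + k%:R / 2 ^+ N * v = a + k%:R / 2 ^+ N * v + 1%:R * ('i * rc tau2) by rewrite /v; ring.
  by rewrite cexp_nat_period.
have side a : dsum u N a ('i * v) = 'i * v * cmean h (cexp a) N.
  rewrite /dsum /cmean mulrA; congr (_ * _); apply: eq_bigr => k _; rewrite /u cexpD //.
rewrite /dsquare per subrr add0r !side pv -mulrBr !cabsM cabs_i mul1r => H.
rewrite -(ler_pM2l cv); apply: le_trans H _.
by rewrite expr2 mulrA divfK ?gt_eqF // mulrC.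
Qed.

Lemma mean_value h : plusf h -> tends (cmean h 1) (h 0).
Proof.
move=> [r r1 [Hd hc]].
have far j : tends (fun N => cmean h 1 N - cmean h (cexp (- (j%:R * rc tau2))) N) 0.
  elim: j => [|j IH].
    move=> e e0; exists 0%N => N _.
    have -> : cexp (- (0%:R * rc tau2)) = 1 by rewrite mul0r oppr0 -rc0 cexp_rc expR0.
    by rewrite subrr subr0 cabs0 ltW.
  have := tendsD IH (cmean_radius j r1 Hd); rewrite addr0.
  by congr tends; apply/funext => N; ring.
move=> e e0; have e2 : 0 < e / 2 by rewrite divr_gt0.
move/cvg_cabsP : hc => /(_ _ e2)/nbhs_cabsP[d d0 H].
have [j jd] : exists j : nat, expR (- (j%:R * tau2)) < d.
  exists (Num.bound (d^-1 / tau2)).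
  have := archi_boundP (x := d^-1 / tau2); rewrite divr_ge0 ?invr_ge0 ?ltW ?tau2_gt0 // => /(_ isT).
  set b := Num.bound _; rewrite ltr_pdivrMr ?tau2_gt0 // => hb.
  rewrite expRN -[d]invrK ltf_pV2 ?posrE ?expR_gt0 ?invr_gt0 //.
  apply: lt_trans hb _; have := expR_gt1Dx (x := b%:R * tau2).
  have [->|b0] := eqVneq (b%:R * tau2) 0; first by rewrite expR0.
  by move=> /(_ isT); lra.
have [N0 HN] := far j _ e2; exists N0 => N /HN; rewrite subr0.
set rho := cexp _ => h1.
have crho : cabs rho < d.
  rewrite /rho cabs_cexp; apply: le_lt_trans jd; rewrite ler_expR.
  by rewrite -(@rc_nat R) -rcM -rcN re_rc.
have h2 : cabs (cmean h rho N - h 0) <= e / 2.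
  by apply: cmean_bound => w wr; apply: H; rewrite subr0 wr.
have -> : cmean h 1 N - h 0 = (cmean h 1 N - cmean h rho N) + (cmean h rho N - h 0) by ring.
apply: le_trans (cabsD _ _) _; lra.
Qed.

End MeanValueProperty.

Section PlusFunctions.
Variable R : realType.
Local Notation C := (cplx R).
Implicit Types (f g h : C -> C) (z w : C) (N : nat).

Lemma rc_sum (I : Type) (r : seq I) (P : pred I) (F : I -> R) :
  rc (\sum_(i <- r | P i) F i) = \sum_(i <- r | P i) rc (F i).
Proof. exact: (big_morph _ (@rcD R) (@rc0 R)). Qed.

Lemma ctn_cabsP f z : {for z, continuous f} <->
  forall e : R, 0 < e -> exists2 d : R, 0 < d & forall w, cabs (w - z) < d -> cabs (f w - f z) <= e.
Proof.
split=> [/cvg_cabsP c e e0|H]; first exact/nbhs_cabsP/c.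
by apply/(@cvg_cabsP R _ (nbhs z)) => e e0; apply/nbhs_cabsP/H.
Qed.

Lemma derivable_continuousC f z : derivable (f : C -> C^o) z 1 -> {for z, continuous f}.
Proof. by move=> /derivable1_diffP/differentiable_continuous. Qed.

Lemma plusf_holo h (r : R) : 1 < r -> (forall w, cabs w < r -> derivable (h : C -> C^o) w 1) -> plusf h.
Proof.
move=> r1 H; exists r; first exact: r1.
split=> [w _|]; first exact: H.
by apply: derivable_continuousC; apply: H; rewrite cabs0 (lt_trans ltr01).
Qed.

Lemma derivableMC f g z : derivable (f : C -> C^o) z 1 -> derivable (g : C -> C^o) z 1 ->
  derivable ((fun w => f w * g w) : C -> C^o) z 1.
Proof. by move=> df dg; exact: (@derivableM C C^o f g z 1 df dg). Qed.

Lemma derivableDC f g z : derivable (f : C -> C^o) z 1 -> derivable (g : C -> C^o) z 1 ->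
  derivable ((fun w => f w + g w) : C -> C^o) z 1.
Proof. by move=> df dg; exact: (@derivableD C C^o C^o f g z 1 df dg). Qed.

Lemma derivable_cstC (c : C) z : derivable ((fun=> c) : C -> C^o) z 1.
Proof. exact: derivable_cst. Qed.

Lemma derivable_idC z : derivable ((fun w => w) : C -> C^o) z 1.
Proof. exact: derivable_id. Qed.

Lemma derivableBC f g z : derivable (f : C -> C^o) z 1 -> derivable (g : C -> C^o) z 1 ->
  derivable ((fun w => f w - g w) : C -> C^o) z 1.
Proof. by move=> df dg; exact: (@derivableB C C^o C^o f g z 1 df dg). Qed.

Lemma derivableVC f z : f z != 0 -> derivable (f : C -> C^o) z 1 ->
  derivable ((fun w => (f w)^-1) : C -> C^o) z 1.
Proof. by move=> f0 df; exact: (@derivableV C C^o f z 1 f0 df). Qed.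

Lemma derivableXC f (n : nat) z : derivable (f : C -> C^o) z 1 ->
  derivable ((fun w => f w ^+ n) : C -> C^o) z 1.
Proof.
move=> df; elim: n => [|n IH]; first exact: derivable_cstC.
rewrite (_ : (fun w => f w ^+ n.+1) = (fun w => f w * f w ^+ n)); last by apply/funext => w; rewrite exprS.
exact: derivableMC.
Qed.

Lemma derivable_sumC (I : Type) (r : seq I) (F : I -> C -> C) z :
  (forall i, derivable (F i : C -> C^o) z 1) -> derivable ((fun w => \sum_(i <- r) F i w) : C -> C^o) z 1.
Proof.
move=> dF; elim: r => [|i r IH].
  have -> : (fun w => \sum_(j <- [::]) F j w) = (fun=> 0) by apply/funext => w; rewrite big_nil.
  exact: derivable_cstC.
have -> : (fun w => \sum_(j <- i :: r) F j w) = (fun w => F i w + \sum_(j <- r) F j w).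
  by apply/funext => w; rewrite big_cons.
exact: (derivableDC (dF i) IH).
Qed.

Lemma derivable_eq_near f g z : (\forall w \near z, f w = g w) ->
  derivable (f : C -> C^o) z 1 -> derivable (g : C -> C^o) z 1.
Proof.
move=> /nbhs_cabsP[d d0 fg] /derivable_cabsP[D H]; apply/derivable_cabsP; exists D => e e0.
have [de de0 {}H] := H e e0; exists (Num.min d de); first by rewrite lt_min d0.
move=> w; rewrite lt_min => /andP[wd wde].
rewrite -!fg ?subrr ?cabs0 //; first exact: H.
by rewrite addrAC subrr add0r.
Qed.

Lemma plusfM g h : plusf g -> plusf h -> plusf (fun w => g w * h w).
Proof.
move=> [r1 r11 [d1 c1]] [r2 r21 [d2 c2]]; exists (Num.min r1 r2); first by rewrite lt_min r11.
split=> [w w0|]; first by rewrite lt_min => /andP[w1 w2]; apply: derivableMC; [exact: d1|exact: d2].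
exact: (@cvgM C _ _ _ g h _ _ c1 c2).
Qed.

Lemma plusfD g h : plusf g -> plusf h -> plusf (fun w => g w + h w).
Proof.
move=> [r1 r11 [d1 c1]] [r2 r21 [d2 c2]]; exists (Num.min r1 r2); first by rewrite lt_min r11.
split=> [w w0|]; first by rewrite lt_min => /andP[w1 w2]; apply: derivableDC; [exact: d1|exact: d2].
exact: (@cvgD C C _ _ _ g h _ _ c1 c2).
Qed.

Lemma plusf_cst (c : C) : plusf (fun=> c).
Proof. by apply: (@plusf_holo _ 2) => [|w _]; [lra|exact: derivable_cstC]. Qed.

Lemma plusf_id : plusf (fun w => w).
Proof. by apply: (@plusf_holo _ 2) => [|w _]; [lra|exact: derivable_idC]. Qed.

Lemma plusfB g h : plusf g -> plusf h -> plusf (fun w => g w - h w).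
Proof.
move=> pg ph; have := plusfD pg (plusfM (plusf_cst (-1)) ph).
by congr plusf; apply/funext => w; rewrite mulN1r.
Qed.

Lemma plusf_sum (I : Type) (r : seq I) (F : I -> C -> C) :
  (forall i, plusf (F i)) -> plusf (fun w => \sum_(i <- r) F i w).
Proof.
move=> dF; elim: r => [|i r IH].
  have -> : (fun w => \sum_(j <- [::]) F j w) = (fun=> 0) by apply/funext => w; rewrite big_nil.
  exact: plusf_cst.
have -> : (fun w => \sum_(j <- i :: r) F j w) = (fun w => F i w + \sum_(j <- r) F j w).
  by apply/funext => w; rewrite big_cons.
exact: (plusfD (dF i) IH).
Qed.

Lemma conj_cabs_sub z w : cabs (z^* - w^*) = cabs (z - w).
Proof. by rewrite -rmorphB cabs_conj. Qed.

Lemma plusf_conj h : plusf h -> plusf (fun w => (h w^*)^*).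
Proof.
move=> [r r1 [d c]]; exists r; first exact: r1.
split=> [w w0 wr|].
  have /derivable_cabsP[D H] : derivable (h : C -> C^o) w^* 1.
    by apply: d; rewrite ?conjC_eq0 ?cabs_conj.
  apply/derivable_cabsP; exists D^* => e e0; have [de de0 {}H] := H e e0; exists de => // x xde.
  have := H x^*; rewrite cabs_conj => /(_ xde).
  by rewrite -(cabs_conj (h _ - _ - _)) !rmorphB rmorphM rmorphD /= conjCK.
apply/ctn_cabsP => e e0; move/ctn_cabsP : c => /(_ e e0)[de de0 H].
exists de => // w wde; rewrite conj_cabs_sub conjC0; apply: H.
by rewrite -conjC0 conj_cabs_sub.
Qed.

Lemma plusf_bound h (c : C) (M : R) : plusf h -> (forall w, cabs w = 1 -> cabs (h w - c) <= M) ->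
  cabs (h 0 - c) <= M.
Proof.
move=> ph H; have := mean_value (plusfB ph (plusf_cst c)); move/tends_bound; apply=> N.
rewrite -[cmean _ _ _]subr0; apply: cmean_bound => w; rewrite cabs1 subr0; exact: H.
Qed.

Lemma plusf_uniq g h : plusf g -> plusf h -> (forall w, cabs w = 1 -> g w = h w) -> g 0 = h 0.
Proof.
move=> pg ph E; apply/eqP; rewrite -subr_eq0 -cabs_eq0; apply/eqP/le_anti; rewrite cabs_ge0 andbT.
have := plusf_bound (c := 0) (M := 0) (plusfB pg ph); rewrite subr0; apply=> w w1.
by rewrite E // subrr subr0 cabs0.
Qed.

Definition dquot h (d : C) w : C := if w == 0 then d else (h w - h 0) / w.

Lemma plusf_dquot h (d : C) (r : R) : 1 < r -> (forall w, w != 0 -> cabs w < r -> derivable (h : C -> C^o) w 1) ->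
  (forall e : R, 0 < e -> exists2 de : R, 0 < de & forall x : C, cabs x < de ->
      cabs (h (0 + x) - h 0 - x * d) <= e * cabs x) ->
  plusf (dquot h d).
Proof.
move=> r1 dh H; exists r; first exact: r1.
split=> [w w0 wr|].
  apply: (@derivable_eq_near (fun w => (h w - h 0) * w^-1)).
    apply/nbhs_cabsP; exists (cabs w); first by rewrite cabs_gt0.
    move=> x xw; rewrite /dquot; case: eqP xw => // ->.
    by rewrite sub0r cabsN ltxx.
  apply: derivableMC; first by apply: derivableBC; [exact: dh|exact: derivable_cstC].
  by apply: derivableVC => //; exact: derivable_idC.
apply/ctn_cabsP => e e0; have [de de0 {}H] := H e e0.
exists de => // x; rewrite subr0 /dquot eqxx => xde.
case: (eqVneq x 0) => [_|x0]; first by rewrite subrr cabs0 ltW.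
have := H x xde; rewrite add0r.
have -> : h x - h 0 - x * d = x * ((h x - h 0) / x - d) by field.
by rewrite cabsM mulrC ler_pM2r // cabs_gt0.
Qed.

Lemma plusf_rot h (l : C) : cabs l = 1 -> plusf h -> plusf (fun w => h (l * w)).
Proof.
move=> l1 [r r1 [d c]]; exists r; first exact: r1.
have l0 : l != 0 by rewrite -cabs_gt0 l1.
split=> [w w0 wr|].
  apply: (@derivable_compC R h (fun w => l * w)).
    by apply: derivableMC; [exact: derivable_cstC|exact: derivable_idC].
  by apply: d; rewrite ?mulf_neq0 // cabsM l1 mul1r.
apply/ctn_cabsP => e e0; move/ctn_cabsP : c => /(_ e e0)[de de0 H].
by exists de => // w wde; rewrite mulr0; apply: H; rewrite subr0 cabsM l1 mul1r -[w]subr0.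
Qed.

Lemma cabs1_conj z : cabs z = 1 -> z^-1 = z^*.
Proof.
move=> z1; have z0 : z != 0 by rewrite -cabs_gt0 z1.
by apply: (mulfI z0); rewrite -cabs_sqr z1 divff // expr1n.
Qed.

Lemma mean_square_eq0 g (q : C -> C) : {for 1, continuous g} ->
  (forall w, cabs w = 1 -> q w = rc (cabs (g w) ^+ 2)) -> tends (cmean q 1) 0 -> g 1 = 0.
Proof.
move=> cg qE q0; apply/eqP; apply: contraT => g1.
have G0 : 0 < cabs (g 1) by rewrite cabs_gt0.
have G2 : 0 < cabs (g 1) / 2 by rewrite divr_gt0.
move/ctn_cabsP : cg => /(_ _ G2)[d d0 Hg].
have /ctn_cabsP := derivable_continuousC (@derivable_cexp R 0).
have d2 : 0 < d / 2 by rewrite divr_gt0.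
move=> /(_ _ d2)[d' d'0 He].
have [j jP] : exists j : nat, tau2 R < d' * 2 ^+ j.
  exists (Num.bound (tau2 R / d')).
  have := archi_boundP (x := tau2 R / d'); rewrite divr_ge0 ?ltW ?tau2_gt0 // => /(_ isT).
  set b := Num.bound _; rewrite ltr_pdivrMr // mulrC => hb; apply: lt_trans hb _.
  by rewrite ltr_pM2l // -natrX ltr_nat ltn_expl.
pose c := (2 ^+ j : R)^-1 * (cabs (g 1) / 2) ^+ 2.
have p2 n : 0 < (2 : R) ^+ n by rewrite exprn_gt0.
have c0 : 0 < c by rewrite mulr_gt0 ?invr_gt0 ?exprn_gt0.
have [N0 HN] := q0 (c / 2) (divr_gt0 c0 (ltr0Sn _ 1)).
pose N := maxn N0 j.
have := HN N (leq_maxl _ _); rewrite subr0.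
pose node k : C := cexp (k%:R / 2 ^+ N * ('i * rc (tau2 R))).
have -> : cmean q 1 N = rc ((2 ^+ N)^-1 * \sum_(k < 2 ^ N) cabs (g (node k)) ^+ 2).
  rewrite /cmean rcM rcV rcX rc_nat; congr (_ * _).
  rewrite rc_sum; apply: eq_bigr => k _.
  by rewrite mul1r qE // cabs_node.
rewrite cabs_rc ger0_norm; last first.
  apply: mulr_ge0; first by rewrite invr_ge0 ltW.
  by apply: sumr_ge0 => k _; apply: exprn_ge0; exact: cabs_ge0.
have jN : (j <= N)%N by exact: leq_maxr.
have lb : (2 : R) ^+ (N - j) * (cabs (g 1) / 2) ^+ 2 <= \sum_(k < 2 ^ N) cabs (g (node k)) ^+ 2.
  rewrite -(big_mkord xpredT (fun k => cabs (g (node k)) ^+ 2)).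
  rewrite (@big_cat_nat _ _ _ (2 ^ (N - j))) //=; last by rewrite leq_exp2l // leq_subr.
  apply: ler_wpDr; first by apply: sumr_ge0 => k _; apply: exprn_ge0; exact: cabs_ge0.
  rewrite (_ : _ * _ = \sum_(0 <= k < 2 ^ (N - j)) (cabs (g 1) / 2) ^+ 2); last first.
    by rewrite sumr_const_nat subn0 -[RHS]mulr_natl natrX.
  apply: ler_sum_nat => k /andP[_ kN].
  apply: lerXn2r; rewrite ?nnegrE ?cabs_ge0 //; first exact: ltW.
  suff nd : cabs (node k - 1) < d.
    have := Hg _ nd; have := cabsB (g (node k)) (g (node k) - g 1).
    have -> : g (node k) - (g (node k) - g 1) = g 1 by ring.
    lra.
  have := He (k%:R / 2 ^+ N * ('i * rc (tau2 R))); rewrite subr0 -/(node k).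
  have -> : cexp (0 : C) = 1 by rewrite -rc0 cexp_rc expR0.
  have dd : d / 2 < d by lra.
  move=> h; apply: le_lt_trans dd; apply: h.
  rewrite !cabsM cabsV cabsX cabs2 cabs_i mul1r -rc_nat !cabs_rc !ger0_norm ?ler0n ?ltW ?tau2_gt0 //.
  apply: (@le_lt_trans _ _ ((2 ^+ j)^-1 * tau2 R)); last by rewrite mulrC ltr_pdivrMr.
  apply: ler_wpM2r; first by rewrite ltW ?tau2_gt0.
  rewrite ler_pdivrMr //.
  have -> : (2 ^+ j)^-1 * 2 ^+ N = (2 : R) ^+ (N - j).
    by rewrite -{1}(subnKC jN) exprD mulKf // gt_eqF.
  by rewrite -natrX ler_nat; exact: ltnW.
have : c <= (2 ^+ N)^-1 * \sum_(k < 2 ^ N) cabs (g (node k)) ^+ 2.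
  rewrite -[leRHS](mulrC) ler_pdivlMr //; apply: le_trans lb.
  rewrite /c mulrAC; apply: ler_wpM2r; first by apply: exprn_ge0; exact: ltW.
  by rewrite -(subnKC jN) exprD mulKf ?gt_eqF // subnKC.
lra.
Qed.

Lemma liouville hp hm : plusf hp -> plusf hm -> (forall w, cabs w = 1 -> hp w = hm w^-1) ->
  forall w, cabs w = 1 -> hp w = hm 0.
Proof.
move=> pp pm E.
pose ht w := (hm w^*)^*.
have pt : plusf ht by exact: plusf_conj.
have htE w : cabs w = 1 -> ht w = (hp w)^* by move=> w1; rewrite /ht -(cabs1_conj w1) -E.
have c0 : hp 0 = hm 0.
  have pc := plusf_conj pp.
  suff : ht 0 = (hp 0)^* by rewrite /ht conjC0 => /(congr1 Num.conj); rewrite !conjCK.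
  have mc : cmean ht 1 = fun N => (cmean hp 1 N)^*.
    apply/funext => N; rewrite /cmean rmorphM fmorphV rmorphXn rmorph_nat rmorph_sum /=; congr (_ * _).
    by apply: eq_bigr => k _; rewrite mul1r htE // cabs_node.
  have t1 := mean_value pt; rewrite mc in t1.
  apply: tends_uniq t1 _ => e e0; have [N0 HN] := mean_value pp e0; exists N0 => N /HN.
  by rewrite conj_cabs_sub.
move=> l l1.
pose g w := hp (l * w) - hm 0; pose gt w := ht (l * w) - (hm 0)^*.
have pg : plusf g by apply: plusfB; [exact: plusf_rot|exact: plusf_cst].
have pgt : plusf gt by apply: plusfB; [exact: plusf_rot|exact: plusf_cst].
suff : g 1 = 0 by rewrite /g mulr1 => /eqP; rewrite subr_eq0 => /eqP.
apply: (@mean_square_eq0 g (fun w => g w * gt w)).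
- apply: derivable_continuousC; have [r r1 [d _]] := pg; apply: d; first exact: oner_neq0.
  by rewrite cabs1.
- move=> w w1; rewrite cabs_sqr; congr (_ * _).
  by rewrite /gt /g htE ?rmorphB // cabsM l1 w1 mulr1.
- by have := mean_value (plusfM pg pgt); rewrite /= {2}/g mulr0 c0 subrr mul0r.
Qed.

End PlusFunctions.

Section IdentityTheorem.
Variable R : realType.
Local Notation C := (cplx R).
Implicit Types (f g h : C -> C) (z w : C) (N : nat).

Lemma derivable_srd f z : derivable (f : C -> C^o) z 1 -> exists D, forall v, srd f v z (v * D).
Proof.
move=> /derivable_cabsP[D H]; exists D => v; apply/srdP => e e0.
pose K := 1 + cabs v; have K0 : 0 < K by rewrite ltr_wpDr ?cabs_ge0.
have [de de0 {}H] := H (e / K) (divr_gt0 e0 K0).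
exists (de / K); first by rewrite divr_gt0.
move=> t; rewrite ltr_pdivlMr // => tK.
have tv : cabs (rc t * v) <= `|t| * K.
  by rewrite cabsM cabs_rc; apply: ler_wpM2l => //; rewrite lerDr.
have := H _ (le_lt_trans tv tK); rewrite -mulrA => h; apply: le_trans h _.
apply: (@le_trans _ _ (e / K * (`|t| * K))).
  by apply: ler_wpM2l => //; rewrite ltW // divr_gt0.
by apply: le_of_eq; field; rewrite gt_eqF.
Qed.

Lemma derivable_affine f (p c w : C) : derivable (f : C -> C^o) (p + c * w) 1 ->
  derivable ((fun x => f (p + c * x)) : C -> C^o) w 1.
Proof.
move=> df; apply: (@derivable_compC R f (fun x => p + c * x)); last exact: df.
by apply: derivableDC; [exact: derivable_cstC|apply: derivableMC; [exact: derivable_cstC|exact: derivable_idC]].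
Qed.

Lemma derivative_bound f (p D : C) (r M : R) : 0 < r ->
  (forall w, cabs (w - p) < r -> derivable (f : C -> C^o) w 1) ->
  (forall w, cabs (w - p) < r -> cabs (f w - f p) <= M) -> srd f 1 p D -> cabs D <= 2 * M / r.
Proof.
move=> r0 df fM fD.
have r2 : 0 < r / 2 by rewrite divr_gt0.
have /df/derivable_cabsP[d dH] : cabs (p - p) < r by rewrite subrr cabs0.
have {D fD}-> : D = d.
  rewrite -(srd_rderive fD); apply: srd_rderive; apply/srdP => e e0.
  have [de de0 H] := dH e e0; exists de => // t tde.
  by have := H (rc t); rewrite cabs_rc mulr1 => /(_ tde).
pose h w := f (p + rc (r / 2) * w).
have ph : plusf (dquot h (rc (r / 2) * d)).
  apply: (@plusf_dquot R h _ 2) => [|w w0 w2|e e0]; first by lra.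
    apply: derivable_affine; apply: df; rewrite addrAC subrr add0r cabsM cabs_rc ger0_norm ?ltW //.
    by have : r / 2 * cabs w < r / 2 * 2; [rewrite ltr_pM2l|lra].
  have [de de0 H] := dH (e / (r / 2)) (divr_gt0 e0 r2).
  exists (de / (r / 2)); first by rewrite divr_gt0.
  move=> x; rewrite ltr_pdivlMr // => xde.
  have cx : cabs (rc (r / 2) * x) = cabs x * (r / 2) by rewrite cabsM cabs_rc ger0_norm ?ltW // mulrC.
  have := H (rc (r / 2) * x); rewrite cx => /(_ xde).
  rewrite /h add0r mulr0 addr0.
  have -> : x * (rc (r / 2) * d) = rc (r / 2) * x * d by ring.
  move=> h1; apply: le_trans h1 _; apply: le_of_eq; field; rewrite gt_eqF //.
have := plusf_bound (c := 0) (M := M) ph; rewrite subr0 /dquot eqxx.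
have H1 : forall w, cabs w = 1 -> cabs ((if w == 0 then rc (r / 2) * d else (h w - h 0) / w) - 0) <= M.
  move=> w w1; case: eqP w1 => [->|_ w1]; first by rewrite cabs0 => /esym/eqP; rewrite oner_eq0.
  rewrite subr0 cabsM cabsV w1 invr1 mulr1 /h mulr0 addr0; apply: fM.
  rewrite addrAC subrr add0r cabsM cabs_rc w1 mulr1 ger0_norm ?ltW //; lra.
move=> /(_ H1); rewrite cabsM cabs_rc (ger0_norm (ltW r2)) => h2.
by rewrite ler_pdivlMr // mulrC; lra.
Qed.

Lemma identity_local f p : (\forall w \near p, derivable (f : C -> C^o) w 1) ->
  exists2 rho : R, 0 < rho & forall a, cabs (a - p) < rho -> (\forall w \near a, f w = 0) ->
    forall b, cabs (b - p) < rho -> f b = 0.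
Proof.
move=> /nbhs_cabsP[r1 r10 df].
have /df/derivable_continuousC/ctn_cabsP/(_ 1 ltr01)[r2 r20 fb] : cabs (p - p) < r1 by rewrite subrr cabs0.
pose r := Num.min r1 r2; have r0 : 0 < r by rewrite lt_min r10.
have rr1 : r <= r1 by rewrite ge_min lexx.
have rr2 : r <= r2 by rewrite ge_min lexx orbT.
exists (r / 16); first by rewrite divr_gt0.
move=> a ap /nbhs_cabsP[d d0 fa] b bp.
have [->|ba] := eqVneq b a; first by apply: fa; rewrite subrr cabs0.
pose M := 1 + cabs (f p); have M0 : 0 < M by rewrite ltr_wpDr ?cabs_ge0.
have fM w : cabs (w - p) < r -> cabs (f w) <= M.
  move=> wp; have -> : f w = (f w - f p) + f p by rewrite subrK.
  by apply: le_trans (cabsD _ _) _; rewrite lerD2r; apply: fb; exact: lt_le_trans rr2.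
have bar : cabs (b - a) < r / 8.
  have -> : b - a = (b - p) - (a - p) by ring.
  apply: le_lt_trans (cabsB _ _) _; lra.
have key n : cabs (f b) <= M / 3 ^+ n.
  pose g w := f w * ((w - a) ^+ n)^-1; pose h x := g (b + rc (r / 2) * x).
  have dg w : cabs (w - p) < r -> derivable (g : C -> C^o) w 1.
    move=> wp; have [->|wa] := eqVneq w a.
      apply: (@derivable_eq_near _ (fun=> 0)); last exact: derivable_cstC.
      by apply/nbhs_cabsP; exists d => // x xa; rewrite /g fa // mul0r.
    apply: derivableMC; first by apply: df; exact: lt_le_trans rr1.
    apply: derivableVC; first by rewrite expf_neq0 // subr_eq0.
    by apply: derivableXC; apply: derivableBC; [exact: derivable_idC|exact: derivable_cstC].
  have ph : plusf h.
    apply: (@plusf_holo _ h (5 / 4)) => [|x x54]; first by lra.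
    apply: derivable_affine; apply: dg.
    have -> : b + rc (r / 2) * x - p = (b - p) + rc (r / 2) * x by ring.
    apply: le_lt_trans (cabsD _ _) _; rewrite cabsM cabs_rc ger0_norm; last by lra.
    have : r / 2 * cabs x < r / 2 * (5 / 4) by rewrite ltr_pM2l // divr_gt0.
    lra.
  have n0 : 0 < ((3 / 8 * r) ^+ n)^-1 by rewrite invr_gt0 exprn_gt0 // mulr_gt0.
  have := plusf_bound (c := 0) (M := M / (3 / 8 * r) ^+ n) ph.
  rewrite subr0 /h mulr0 addr0 /g => /(_ _) H.
  have {}H : cabs (f b * ((b - a) ^+ n)^-1) <= M / (3 / 8 * r) ^+ n.
    apply: H => x x1; rewrite subr0 cabsM cabsV cabsX.
    have cx : cabs (rc (r / 2) * x) = r / 2 by rewrite cabsM cabs_rc x1 mulr1 ger0_norm //; lra.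
    apply: ler_pM; rewrite ?cabs_ge0 ?invr_ge0 ?exprn_ge0 ?cabs_ge0 //.
      apply: fM; have -> : b + rc (r / 2) * x - p = (b - p) + rc (r / 2) * x by ring.
      by apply: le_lt_trans (cabsD _ _) _; rewrite cx; lra.
    have lb : 3 / 8 * r <= cabs (b + rc (r / 2) * x - a).
      have := cabsB (b + rc (r / 2) * x - a) (b - a).
      have -> : b + rc (r / 2) * x - a - (b - a) = rc (r / 2) * x by ring.
      rewrite cx; lra.
    rewrite lef_pV2 ?posrE; first by apply: lerXn2r => //; rewrite nnegrE ?cabs_ge0 //; lra.
      by apply: exprn_gt0; apply: lt_le_trans lb; lra.
    by apply: exprn_gt0; lra.
  move: H; rewrite cabsM cabsV cabsX.
  have b0 : 0 < cabs (b - a) by rewrite cabs_gt0 subr_eq0.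
  rewrite ler_pdivrMr ?exprn_gt0 // => H; apply: le_trans H _.
  have -> : M / (3 / 8 * r) ^+ n * cabs (b - a) ^+ n = M * ((3 / 8 * r)^-1 * cabs (b - a)) ^+ n.
    by rewrite [in RHS]exprMn exprVn mulrA.
  rewrite ler_pM2l // -exprVn.
  have z1 : 0 <= (3 / 8 * r)^-1 * cabs (b - a) by rewrite mulr_ge0 ?cabs_ge0 // invr_ge0; lra.
  apply: lerXn2r; rewrite ?nnegrE ?invr_ge0 //.
  rewrite mulrC ler_pdivrMr; lra.
apply/eqP; rewrite -cabs_eq0; apply/eqP/le_anti; rewrite cabs_ge0 andbT.
apply/ler_addgt0Pr => e e0; rewrite add0r.
have [n nP] : exists n : nat, M / e < 3 ^+ n.
  exists (Num.bound (M / e)).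
  have := archi_boundP (x := M / e); rewrite divr_ge0 ?ltW // => /(_ isT) h.
  apply: lt_trans h _; rewrite -natrX ltr_nat; exact: ltn_expl.
apply: le_trans (key n) _; rewrite ler_pdivrMr ?exprn_gt0 // mulrC -ler_pdivrMr //.
exact: ltW.
Qed.

Lemma meromorphic_identity (Omega : set C) f p0 : open Omega -> connected Omega -> Omega p0 ->
  meromorphic Omega (f : C -> C^o) -> (\forall z \near p0^', f z = 0) ->
  forall p, Omega p -> \forall z \near p^', f z = 0.
Proof.
move=> oO cO O0 mf f0.
pose Z := [set p | Omega p /\ \forall z \near p^', f z = 0].
have ZO : Z `<=` Omega by move=> p [].
suff -> : Omega = Z by move=> p [].
apply/esym; apply: cO.
- by exists p0.
- exists Z; last by apply/seteqP; split=> [p Zp|p []//]; split=> //; exact: ZO.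
  apply/open_cabsP => p [Op fp].
  move/open_cabsP : oO => /(_ p Op)[d1 d10 H1].
  move/dnbhs_cabsP : fp => [d2 d20 H2].
  exists (Num.min d1 d2); first by rewrite lt_min d10.
  move=> w; rewrite lt_min => /andP[w1 w2]; split; first exact: H1.
  have [->|wp] := eqVneq w p; first by apply/dnbhs_cabsP; exists d2.
  apply/dnbhs_cabsP; exists (Num.min (d2 - cabs (w - p)) (cabs (w - p))).
    by rewrite lt_min subr_gt0 w2 cabs_gt0 subr_eq0.
  move=> x; rewrite lt_min => /andP[x1 x2] xw; apply: H2.
    have -> : x - p = (x - w) + (w - p) by ring.
    by apply: le_lt_trans (cabsD _ _) _; rewrite -ltrBrDr.
  by apply: contraTneq x2 => ->; rewrite -leNgt cabs_distC.
- exists (closure Z); first exact: closed_closure.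
  apply/seteqP; split=> [p Zp|p [Op clp]]; first by split; [exact: ZO|exact: subset_closure].
  split; first exact: Op.
  have [k [g [hg gf]]] := mf p Op.
  have [rho rho0 Hrho] := @identity_local g p hg.
  move/dnbhs_cabsP : gf => [d d0 gf].
  have [|a [[Oa fa] ap]] := clp [set w | cabs (w - p) < Num.min rho d].
    by apply: open_nbhs_nbhs; split; [exact: open_cball|rewrite /= subrr cabs0 lt_min rho0].
  move: ap; rewrite /= lt_min => /andP[a1 a2].
  move/dnbhs_cabsP : fa => [d3 d30 fa].
  pose m := Num.min d3 (Num.min (rho - cabs (a - p)) (d - cabs (a - p))).
  have m0 : 0 < m by rewrite !lt_min d30 !subr_gt0 a1.
  pose c := Num.min m (if a == p then m else cabs (a - p)).
  have c0 : 0 < c by rewrite lt_min m0; case: eqVneq => // ap; rewrite cabs_gt0 subr_eq0.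
  pose a' := a + rc (c / 2).
  have aa' : cabs (a' - a) = c / 2 by rewrite /a' addrAC subrr add0r cabs_rc ger0_norm // divr_ge0 // ltW.
  have cm : c <= m by rewrite ge_min lexx.
  have a'p : cabs (a' - p) < Num.min rho d.
    have -> : a' - p = (a' - a) + (a - p) by ring.
    apply: le_lt_trans (cabsD _ _) _; rewrite aa'.
    have m1 : m <= rho - cabs (a - p) by rewrite !ge_min lexx orbT.
    have m2 : m <= d - cabs (a - p) by rewrite !ge_min lexx !orbT.
    by rewrite lt_min; apply/andP; split; lra.
  have a'np : a' != p.
    apply/eqP => E; have : cabs (a' - a) = cabs (a - p) by rewrite E cabs_distC.
    rewrite aa' /c; case: (eqVneq a p) => [->|ap]; first by rewrite subrr cabs0 minxx; lra.
    have : cabs (a - p) > 0 by rewrite cabs_gt0 subr_eq0.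
    have : Num.min m (cabs (a - p)) <= cabs (a - p) by rewrite ge_min lexx orbT.
    lra.
  have fg w : cabs (w - p) < rho -> g w = 0.
    apply: (Hrho a'); first by move: a'p; rewrite lt_min => /andP[].
    have c4 : 0 < c / 4 by rewrite divr_gt0.
    move: a'p; rewrite lt_min => /andP[_ a'd].
    apply/nbhs_cabsP; exists (Num.min (c / 4) (Num.min (d - cabs (a' - p)) (cabs (a' - p)))).
      by rewrite !lt_min c4 subr_gt0 a'd cabs_gt0 subr_eq0.
    move=> x; rewrite !lt_min => /and3P[x1 x2 x3].
    have xa : x - a = (x - a') + (a' - a) by ring.
    rewrite gf.
    - rewrite fa ?scaler0 //.
        rewrite xa; apply: le_lt_trans (cabsD _ _) _; rewrite aa'.
        have m3 : m <= d3 by rewrite !ge_min lexx.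
        lra.
      apply/eqP => E; move: aa'; rewrite -E => aa'.
      by have := cabs_distC a' x; lra.
    - have -> : x - p = (x - a') + (a' - p) by ring.
      by apply: le_lt_trans (cabsD _ _) _; rewrite -ltrBrDr.
    - by apply: contraTneq x3 => ->; rewrite -leNgt cabs_distC.
  apply/dnbhs_cabsP; exists (Num.min rho d); first by rewrite lt_min rho0.
  move=> w; rewrite lt_min => /andP[w1 w2] wp.
  have := gf w w2 wp; rewrite fg // => /esym/eqP; rewrite scaler_eq0 expf_eq0 subr_eq0 (negPf wp) andbF /=.
  by move/eqP.
Qed.

End IdentityTheorem.

(** * Smooth matrix-valued functions *)

Section Smoothness.
Variable R : realType.
Local Notation C := (cplx R).
Implicit Types (U : set C) (z : C).

Definition dif (V : normedModType C) (f : C -> V) z : Prop := rderivable f 1 z /\ rderivable f 'i z.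

Lemma nearU U z (P : C -> Prop) : open U -> U z -> (forall w, U w -> P w) -> \forall w \near z, P w.
Proof.
move=> oU Uz H; have := open_nbhs_nbhs (conj oU Uz); exact: filterS.
Qed.

Lemma rderive_eq (V : normedModType C) U (f g : C -> V) v z : open U -> U z ->
  (forall w, U w -> f w = g w) -> rderivable f v z -> rderivable g v z /\ rderive v g z = rderive v f z.
Proof.
move=> oU Uz fg /rderivableP fd.
have gd : isrd g v z (rderive v f z) by apply: isrd_eq_near fd; apply: (nearU oU Uz).
by split; [exact: isrd_derivable gd|exact: isrd_rderive gd].
Qed.

Lemma Ck_S (V : normedModType C) k U (f : C -> V) : Ck k.+1 U f -> Ck k U f.
Proof.
elim: k f => [|k IH] f /= [cf [df c1 ci]]; first by [].
by split; [exact: cf|split; [exact: df|exact: IH c1|exact: IH ci]].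
Qed.

Lemma continuous_eq (V : normedModType C) U (f g : C -> V) z : open U -> U z ->
  (forall w, U w -> f w = g w) -> {for z, continuous f} -> {for z, continuous g}.
Proof.
move=> oU Uz fg; rewrite /prop_for /continuous_at -(fg z Uz); apply: cvg_trans.
exact: near_eq_cvg (nearU oU Uz fg).
Qed.

Lemma Ck_eq (V : normedModType C) k U (f g : C -> V) : open U ->
  (forall w, U w -> f w = g w) -> Ck k U f -> Ck k U g.
Proof.
move=> oU; elim: k f g => [|k IH] f g fg /= [cf].
  by move=> _; split; [move=> z Uz; exact: (continuous_eq oU Uz fg (cf z Uz))|].
move=> [df c1 ci]; split; first by move=> z Uz; exact: (continuous_eq oU Uz fg (cf z Uz)).
split.
- move=> z Uz; have [d1 di] := df z Uz.
  by split; [have [] := rderive_eq oU Uz fg d1|have [] := rderive_eq oU Uz fg di].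
- by apply: IH c1 => z Uz; have [d1 di] := df z Uz; have [_ ->] := rderive_eq oU Uz fg d1.
- by apply: IH ci => z Uz; have [d1 di] := df z Uz; have [_ ->] := rderive_eq oU Uz fg di.
Qed.

(* Scalar functions, with the topology of [C] fixed once and for all *)
Definition sCk k U (f : C -> C) : Prop := Ck k U (f : C -> C^o).

Lemma sCkP k U f : sCk k.+1 U f <->
  [/\ forall z, U z -> {for z, continuous f},
      forall z, U z -> srd f 1 z (rderive 1 (f : C -> C^o) z) /\ srd f 'i z (rderive 'i (f : C -> C^o) z),
      sCk k U (rderive 1 (f : C -> C^o)) & sCk k U (rderive 'i (f : C -> C^o))].
Proof.
split=> [[cf [df c1 ci]]|[cf df c1 ci]].
  split; [exact: cf| |exact: c1|exact: ci].
  by move=> z Uz; have [d1 di] := df z Uz; split; exact: rderivable_srd.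
split; first exact: cf.
split; [|exact: c1|exact: ci] => z Uz; have [d1 di] := df z Uz.
by split; [exact: srd_derivable d1|exact: srd_derivable di].
Qed.

Lemma sCk0 U f : sCk 0 U f <-> forall z, U z -> {for z, continuous f}.
Proof. by split=> [[cf _]|cf]; [exact: cf|split; [exact: cf|]]. Qed.

Lemma sCk_S k U f : sCk k.+1 U f -> sCk k U f. Proof. exact: Ck_S. Qed.

Lemma sCk_cts k U f z : sCk k U f -> U z -> {for z, continuous f}.
Proof. by case: k => [|k] [cf _] Uz; exact: cf. Qed.

Lemma sCk_eq k U f g : open U -> (forall w, U w -> f w = g w) -> sCk k U f -> sCk k U g.
Proof. exact: Ck_eq. Qed.

Lemma sCk_build k U (f f1 fi : C -> C) : open U -> (forall z, U z -> {for z, continuous f}) ->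
  (forall z, U z -> srd f 1 z (f1 z)) -> (forall z, U z -> srd f 'i z (fi z)) ->
  sCk k U f1 -> sCk k U fi -> sCk k.+1 U f.
Proof.
move=> oU cf d1 di c1 ci; apply/sCkP; split; first exact: cf.
- by move=> z Uz; rewrite (srd_rderive (d1 z Uz)) (srd_rderive (di z Uz)); split; [exact: d1|exact: di].
- by apply: (sCk_eq oU _ c1) => z Uz; rewrite (srd_rderive (d1 z Uz)).
- by apply: (sCk_eq oU _ ci) => z Uz; rewrite (srd_rderive (di z Uz)).
Qed.

Lemma ctsD (f g : C -> C) z : {for z, continuous f} -> {for z, continuous g} ->
  {for z, continuous (fun w => f w + g w)}.
Proof. by move=> cf cg; exact: (@cvgD C C _ _ _ f g _ _ cf cg). Qed.

Lemma ctsM (f g : C -> C) z : {for z, continuous f} -> {for z, continuous g} ->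
  {for z, continuous (fun w => f w * g w)}.
Proof. by move=> cf cg; exact: (@cvgM C _ _ _ f g _ _ cf cg). Qed.

Lemma cts_cst (c : C) z : {for z, continuous (fun=> c)}.
Proof. by apply/ctn_cabsP => e e0; exists 1 => // w _; rewrite subrr cabs0 ltW. Qed.

Lemma cts_conj (f : C -> C) z : {for z, continuous f} -> {for z, continuous (fun w => (f w)^*)}.
Proof.
move=> /ctn_cabsP cf; apply/ctn_cabsP => e e0; have [d d0 H] := cf e e0; exists d => // w wz.
by rewrite conj_cabs_sub; exact: H.
Qed.

Lemma sCk_cst k U (c : C) : open U -> sCk k U (fun=> c).
Proof.
move=> oU; elim: k c => [|k IH] c; first by apply/sCk0 => z _; exact: cts_cst.
apply: (sCk_build oU _ _ _ (IH 0) (IH 0)) => z _; [exact: cts_cst|exact: srd_cst|exact: srd_cst].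
Qed.

Lemma sCkD k U f g : open U -> sCk k U f -> sCk k U g -> sCk k U (fun z => f z + g z).
Proof.
move=> oU; elim: k f g => [|k IH] f g.
  by move=> /sCk0 cf /sCk0 cg; apply/sCk0 => z Uz; exact: ctsD (cf z Uz) (cg z Uz).
move=> /sCkP[cf df f1 fi] /sCkP[cg dg g1 gi].
apply: (sCk_build oU _ _ _ (IH _ _ f1 g1) (IH _ _ fi gi)) => z Uz.
- exact: ctsD (cf z Uz) (cg z Uz).
- by apply: srdD; [have [] := df z Uz|have [] := dg z Uz].
- by apply: srdD; [have [] := df z Uz|have [] := dg z Uz].
Qed.

Lemma sCkM k U f g : open U -> sCk k U f -> sCk k U g -> sCk k U (fun z => f z * g z).
Proof.
move=> oU; elim: k f g => [|k IH] f g.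
  by move=> /sCk0 cf /sCk0 cg; apply/sCk0 => z Uz; exact: ctsM (cf z Uz) (cg z Uz).
move=> f0 g0; move: (f0) (g0) => /sCkP[cf df f1 fi] /sCkP[cg dg g1 gi].
have {}f0 := sCk_S f0; have {}g0 := sCk_S g0.
apply: (sCk_build oU _ _ _ (sCkD oU (IH _ _ f1 g0) (IH _ _ f0 g1)) (sCkD oU (IH _ _ fi g0) (IH _ _ f0 gi))) => z Uz.
- exact: ctsM (cf z Uz) (cg z Uz).
- by apply: srdM; [have [] := df z Uz|have [] := dg z Uz].
- by apply: srdM; [have [] := df z Uz|have [] := dg z Uz].
Qed.

Lemma sCk_conj k U f : open U -> sCk k U f -> sCk k U (fun z => (f z)^*).
Proof.
move=> oU; elim: k f => [|k IH] f.
  by move=> /sCk0 cf; apply/sCk0 => z Uz; exact: cts_conj (cf z Uz).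
move=> /sCkP[cf df f1 fi].
apply: (sCk_build oU _ _ _ (IH _ f1) (IH _ fi)) => z Uz.
- exact: cts_conj (cf z Uz).
- by apply: srd_conj; have [] := df z Uz.
- by apply: srd_conj; have [] := df z Uz.
Qed.

Lemma sCk_sum (I : Type) (r : seq I) k U (F : I -> C -> C) : open U ->
  (forall i, sCk k U (F i)) -> sCk k U (fun w => \sum_(i <- r) F i w).
Proof.
move=> oU cF; elim: r => [|i r IH].
  have -> : (fun w => \sum_(j <- [::]) F j w) = (fun=> 0) by apply/funext => w; rewrite big_nil.
  exact: (sCk_cst k 0 oU).
have -> : (fun w => \sum_(j <- i :: r) F j w) = (fun w => F i w + \sum_(j <- r) F j w).
  by apply/funext => w; rewrite big_cons.
exact: (sCkD oU (cF i) IH).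
Qed.

Definition smx p q U (f : C -> 'M[C]_(p, q)) : Prop := forall i j k, sCk k U (fun z => f z i j).

Lemma rderive_mx p q (f : C -> 'M[C]_(p, q)) v z i j : rderivable f v z ->
  rderive v f z i j = rderive v ((fun w => f w i j) : C -> C^o) z.
Proof. by move=> /rderivableP/isrd_mxP/(_ i j)/srd_rderive. Qed.

Lemma cts_mxP p q (f : C -> 'M[C]_(p, q)) z :
  {for z, continuous f} <-> forall i j, {for z, continuous (fun w => f w i j)}.
Proof. exact: (@mx_cvgP R _ (nbhs z) _ p q f (f z)). Qed.

Lemma Ck_mx p q k U (f : C -> 'M[C]_(p, q)) : open U ->
  Ck k U f <-> forall i j, sCk k U (fun z => f z i j).
Proof.
move=> oU; elim: k f => [|k IH] f.
  split=> [[cf _] i j|H]; first by apply/sCk0 => z Uz; have /cts_mxP := cf z Uz; exact.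
  split; [move=> z Uz|by []]; apply/cts_mxP => i j; exact: (sCk_cts (H i j) Uz).
split.
  move=> [cf [df /IH c1 /IH ci]] i j; apply/sCkP; split.
  - by move=> z Uz; have /cts_mxP := cf z Uz; exact.
  - move=> z Uz; have [/rderivableP/isrd_mxP/(_ i j) d1 /rderivableP/isrd_mxP/(_ i j) di] := df z Uz.
    by rewrite (srd_rderive d1) (srd_rderive di).
  - by apply: (sCk_eq oU _ (c1 i j)) => z Uz; have [d1 di] := df z Uz; rewrite rderive_mx.
  - by apply: (sCk_eq oU _ (ci i j)) => z Uz; have [d1 di] := df z Uz; rewrite rderive_mx.
move=> H.
have df z : U z -> rderivable f 1 z /\ rderivable f 'i z.
  move=> Uz; split.
    apply: (@isrd_derivable R _ f 1 z (\matrix_(i, j) rderive 1 ((fun w => f w i j) : C -> C^o) z)).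
    by apply/isrd_mxP => i j; rewrite mxE; have /sCkP[_ d _ _] := H i j; have [] := d z Uz.
  apply: (@isrd_derivable R _ f 'i z (\matrix_(i, j) rderive 'i ((fun w => f w i j) : C -> C^o) z)).
  by apply/isrd_mxP => i j; rewrite mxE; have /sCkP[_ d _ _] := H i j; have [] := d z Uz.
split; first by move=> z Uz; apply/cts_mxP => i j; exact: (sCk_cts (H i j) Uz).
split; first exact: df.
- apply/IH => i j; have /sCkP[_ _ c1 _] := H i j.
  by apply: (sCk_eq oU _ c1) => z Uz; have [d1 di] := df z Uz; rewrite rderive_mx.
- apply/IH => i j; have /sCkP[_ _ _ ci] := H i j.
  by apply: (sCk_eq oU _ ci) => z Uz; have [d1 di] := df z Uz; rewrite rderive_mx.
Qed.

Lemma smoothP p q U (f : C -> 'M[C]_(p, q)) : open U -> smooth U f <-> smx U f.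
Proof.
move=> oU; split=> [sf i j k|sf k]; first by have /(Ck_mx _ _ oU) := sf k; exact.
by apply/(Ck_mx _ _ oU) => i j; exact: sf.
Qed.

Section Closure.
Variables (U : set C) (oU : open U).

Lemma smx_cst p q (A : 'M[C]_(p, q)) : smx U (fun=> A).
Proof. by move=> i j k; exact: (sCk_cst _ _ oU). Qed.

Lemma smx_eq p q (f g : C -> 'M[C]_(p, q)) : (forall w, U w -> f w = g w) -> smx U f -> smx U g.
Proof. by move=> fg sf i j k; apply: (sCk_eq oU _ (sf i j k)) => w Uw; rewrite fg. Qed.

Lemma smxE p q (f : C -> 'M[C]_(p, q)) (g : C -> 'I_p -> 'I_q -> C) :
  (forall w i j, f w i j = g w i j) -> (forall i j k, sCk k U (fun w => g w i j)) -> smx U f.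
Proof.
move=> fg H i j k; have -> : (fun z => f z i j) = (fun z => g z i j) by apply/funext => z.
exact: H.
Qed.

Lemma smxD p q (f g : C -> 'M[C]_(p, q)) : smx U f -> smx U g -> smx U (fun z => f z + g z).
Proof.
move=> sf sg; apply: (smxE (g := fun w i j => f w i j + g w i j)) => [w i j|i j k]; first by rewrite mxE.
exact: (sCkD oU).
Qed.

Lemma smx_mul p q r (f : C -> 'M[C]_(p, q)) (g : C -> 'M[C]_(q, r)) :
  smx U f -> smx U g -> smx U (fun z => f z *m g z).
Proof.
move=> sf sg; apply: (smxE (g := fun w i j => \sum_k f w i k * g w k j)) => [w i j|i j k]; first by rewrite mxE.
apply: (@sCk_sum _ _ k U (fun l w => f w i l * g w l j) oU) => l; exact: (sCkM oU).
Qed.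

Lemma smxZ p q (a : C -> C) (f : C -> 'M[C]_(p, q)) :
  (forall k, sCk k U a) -> smx U f -> smx U (fun z => a z *: f z).
Proof.
move=> sa sf; apply: (smxE (g := fun w i j => a w * f w i j)) => [w i j|i j k]; first by rewrite mxE.
exact: (sCkM oU).
Qed.

Lemma smx_conj p q (f : C -> 'M[C]_(p, q)) : smx U f -> smx U (fun z => map_mx Num.conj (f z)).
Proof.
move=> sf; apply: (smxE (g := fun w i j => (f w i j)^*)) => [w i j|i j k]; first by rewrite mxE.
exact: (sCk_conj oU).
Qed.

Lemma smx_reindex p q p' q' (s : 'I_p' -> 'I_q' -> 'I_p) (s' : 'I_p' -> 'I_q' -> 'I_q)
    (f : C -> 'M[C]_(p, q)) (g : C -> 'M[C]_(p', q')) :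
  (forall w i j, g w i j = f w (s i j) (s' i j)) -> smx U f -> smx U g.
Proof. by move=> fg sf; apply: (smxE fg) => i j k; exact: sf. Qed.

Lemma smx_tr p q (f : C -> 'M[C]_(p, q)) : smx U f -> smx U (fun z => (f z)^T).
Proof. by apply: smx_reindex => w i j; rewrite mxE. Qed.

Lemma smx_dif p q (f : C -> 'M[C]_(p, q)) z : smx U f -> U z -> dif f z.
Proof. by move=> /(smoothP _ oU)/(_ 1%N)[_ [df _ _]] Uz; exact: df. Qed.

Lemma smx_rderive p q (f : C -> 'M[C]_(p, q)) : smx U f -> smx U (rderive 1 f) /\ smx U (rderive 'i f).
Proof.
move=> /(smoothP _ oU) sf; split; apply/(smoothP _ oU) => k; have [_ [_ c1 ci]] := sf k.+1;
  [exact: c1|exact: ci].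
Qed.

Lemma smxN p q (f : C -> 'M[C]_(p, q)) : smx U f -> smx U (fun z => - f z).
Proof.
move=> sf; apply: smx_eq (smxZ (fun k => sCk_cst k (-1) oU) sf) => w _.
by rewrite scaleN1r.
Qed.

Lemma smxB p q (f g : C -> 'M[C]_(p, q)) : smx U f -> smx U g -> smx U (fun z => f z - g z).
Proof. by move=> sf sg; apply: smxD => //; exact: smxN. Qed.

Lemma smx_dz p q (f : C -> 'M[C]_(p, q)) : smx U f -> smx U (dz f).
Proof.
move=> /smx_rderive[s1 si]; apply: (smxZ (fun k => sCk_cst k 2^-1 oU)); apply: smxB => //.
exact: (smxZ (fun k => sCk_cst k 'i oU)).
Qed.

Lemma smx_dzb p q (f : C -> 'M[C]_(p, q)) : smx U f -> smx U (dzb f).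
Proof.
move=> /smx_rderive[s1 si]; apply: (smxZ (fun k => sCk_cst k 2^-1 oU)); apply: smxD => //.
exact: (smxZ (fun k => sCk_cst k 'i oU)).
Qed.

Lemma smx_iter_dz p q (f : C -> 'M[C]_(p, q)) n : smx U f -> smx U (iter n (@dz R _) f).
Proof. by move=> sf; elim: n => [//|n IH] /=; exact: smx_dz. Qed.

End Closure.

Lemma sCk_sub k U V (f : C -> C) : V `<=` U -> sCk k U f -> sCk k V f.
Proof.
move=> VU; elim: k f => [|k IH] f.
  by move=> /sCk0 cf; apply/sCk0 => z /VU; exact: cf.
move=> /sCkP[cf df c1 ci]; apply/sCkP; split; [| |exact: IH c1|exact: IH ci].
  by move=> z /VU; exact: cf.
by move=> z /VU; exact: df.
Qed.

Lemma smx_sub p q U V (f : C -> 'M[C]_(p, q)) : V `<=` U -> smx U f -> smx V f.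
Proof. by move=> VU sf i j k; exact: sCk_sub VU (sf i j k). Qed.

End Smoothness.

Section Wirtinger.
Variable R : realType.
Local Notation C := (cplx R).
Implicit Types (U : set C) (z : C).

Lemma dz_isrd (V : normedModType C) (f : C -> V) z d1 di : isrd f 1 z d1 -> isrd f 'i z di ->
  [/\ dif f z, dz f z = 2^-1 *: (d1 - 'i *: di) & dzb f z = 2^-1 *: (d1 + 'i *: di)].
Proof.
move=> h1 hi; split; first by split; [exact: isrd_derivable h1|exact: isrd_derivable hi].
  by rewrite /dz (isrd_rderive h1) (isrd_rderive hi).
by rewrite /dzb (isrd_rderive h1) (isrd_rderive hi).
Qed.

Lemma dif_isrd (V : normedModType C) (f : C -> V) z : dif f z ->
  isrd f 1 z (rderive 1 f z) /\ isrd f 'i z (rderive 'i f z).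
Proof. by case=> h1 hi; split; exact: rderivableP. Qed.

Lemma dif_eq (V : normedModType C) U (f g : C -> V) z : open U -> U z -> (forall w, U w -> f w = g w) ->
  dif f z -> [/\ dif g z, dz g z = dz f z & dzb g z = dzb f z].
Proof.
move=> oU Uz fg /dif_isrd[h1 hi].
have near := nearU oU Uz fg.
have [dg -> ->] := dz_isrd (isrd_eq_near near h1) (isrd_eq_near near hi).
by split.
Qed.

Section Rules.
Variables (z : C).

Lemma dif_mul p q r (f : C -> 'M[C]_(p, q)) (g : C -> 'M[C]_(q, r)) : dif f z -> dif g z ->
  [/\ dif (fun w => f w *m g w) z, dz (fun w => f w *m g w) z = dz f z *m g z + f z *m dz g z &
      dzb (fun w => f w *m g w) z = dzb f z *m g z + f z *m dzb g z].
Proof.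
move=> /dif_isrd[f1 fi] /dif_isrd[g1 gi].
have [d -> ->] := dz_isrd (isrd_mulmx f1 g1) (isrd_mulmx fi gi).
split => //.
  rewrite /dz -scalemxAl -scalemxAr mulmxBl mulmxBr -scalemxAl -scalemxAr -[RHS]scalerDr.
  by rewrite ['i *: (_ + _)]scalerDr opprD addrACA.
rewrite /dzb -scalemxAl -scalemxAr mulmxDl mulmxDr -scalemxAl -scalemxAr -[RHS]scalerDr.
by rewrite ['i *: (_ + _)]scalerDr addrACA.
Qed.

Lemma dif_add p q (f g : C -> 'M[C]_(p, q)) : dif f z -> dif g z ->
  [/\ dif (fun w => f w + g w) z, dz (fun w => f w + g w) z = dz f z + dz g z &
      dzb (fun w => f w + g w) z = dzb f z + dzb g z].
Proof.
move=> /dif_isrd[f1 fi] /dif_isrd[g1 gi].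
have [d -> ->] := dz_isrd (isrdD f1 g1) (isrdD fi gi).
split => //.
  by rewrite /dz -[RHS]scalerDr ['i *: (_ + _)]scalerDr opprD addrACA.
by rewrite /dzb -[RHS]scalerDr ['i *: (_ + _)]scalerDr addrACA.
Qed.

Lemma dif_scale p q (c : C) (f : C -> 'M[C]_(p, q)) : dif f z ->
  [/\ dif (fun w => c *: f w) z, dz (fun w => c *: f w) z = c *: dz f z &
      dzb (fun w => c *: f w) z = c *: dzb f z].
Proof.
move=> /dif_isrd[f1 fi].
have [d -> ->] := dz_isrd (isrdZ (c := c) f1) (isrdZ (c := c) fi).
split => //.
  by rewrite /dz; move: (rderive 1 f z) (rderive 'i f z) => a b; apply/matrixP => i j; rewrite !mxE; ring.
by rewrite /dzb; move: (rderive 1 f z) (rderive 'i f z) => a b; apply/matrixP => i j; rewrite !mxE; ring.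
Qed.

Lemma dif_cst p q (A : 'M[C]_(p, q)) : [/\ dif (fun=> A) z, dz (fun=> A) z = 0 & dzb (fun=> A) z = 0].
Proof.
have [d -> ->] := dz_isrd (isrd_cst A 1 z) (isrd_cst A 'i z).
by rewrite !scaler0 subrr addr0 scaler0.
Qed.

Lemma dif_conj p q (f : C -> 'M[C]_(p, q)) : dif f z ->
  [/\ dif (fun w => map_mx Num.conj (f w)) z,
      dz (fun w => map_mx Num.conj (f w)) z = map_mx Num.conj (dzb f z) &
      dzb (fun w => map_mx Num.conj (f w)) z = map_mx Num.conj (dz f z)].
Proof.
move=> /dif_isrd[f1 fi].
have [d -> ->] := dz_isrd (isrd_conjmx f1) (isrd_conjmx fi).
have c2 : (2^-1 : C)^* = 2^-1 by rewrite fmorphV rmorph_nat.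
split => //; apply/matrixP => i j; rewrite !mxE rmorphM /= c2.
  by rewrite rmorphD rmorphM /= conjCi mulNr.
by rewrite rmorphB rmorphM /= conjCi mulNr opprK.
Qed.

Lemma dif_reindex p q p' q' (s : 'I_p' -> 'I_q' -> 'I_p) (s' : 'I_p' -> 'I_q' -> 'I_q)
    (f : C -> 'M[C]_(p, q)) (g : C -> 'M[C]_(p', q')) :
  (forall w i j, g w i j = f w (s i j) (s' i j)) -> dif f z ->
  [/\ dif g z, dz g z = \matrix_(i, j) dz f z (s i j) (s' i j) & dzb g z = \matrix_(i, j) dzb f z (s i j) (s' i j)].
Proof.
move=> fg /dif_isrd[f1 fi].
have G v d : isrd f v z d -> isrd g v z (\matrix_(i, j) d (s i j) (s' i j)).
  move=> /isrd_mxP H; apply/isrd_mxP => i j; rewrite mxE.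
  have -> : (fun w => g w i j) = (fun w => f w (s i j) (s' i j)) by apply/funext => w.
  exact: H.
have [d -> ->] := dz_isrd (G _ _ f1) (G _ _ fi).
by split => //; apply/matrixP => i j; rewrite !mxE.
Qed.

Lemma dif_tr p q (f : C -> 'M[C]_(p, q)) : dif f z ->
  [/\ dif (fun w => (f w)^T) z, dz (fun w => (f w)^T) z = (dz f z)^T & dzb (fun w => (f w)^T) z = (dzb f z)^T].
Proof.
move=> /(@dif_reindex _ _ q p (fun i j => j) (fun i j => i) f (fun w => (f w)^T)) [|d -> ->].
  by move=> w i j; rewrite mxE.
by split => //; apply/matrixP => i j; rewrite !mxE.
Qed.

Lemma rderive_dz p q (f : C -> 'M[C]_(p, q)) :
  rderive 1 f z = dz f z + dzb f z /\ rderive 'i f z = 'i *: (dz f z - dzb f z).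
Proof.
rewrite /dz /dzb -scalerDr -scalerBr; move: (rderive 1 f z) (rderive 'i f z) => a b.
have two : (2 : C) != 0 by rewrite pnatr_eq0.
have ii := sqrCi C.
split; apply/matrixP => i j; rewrite !mxE.
  by field.
rewrite opprD addrACA subrr add0r -opprD -mulr2n mulrA -[_ *+ 2]mulr_natl.
transitivity (- 'i ^+ 2 * b i j : C); first by rewrite ii opprK mul1r.
by field.
Qed.

End Rules.

Lemma smx_dz_comm p q U (f : C -> 'M[C]_(p, q)) z : open U -> U z -> smx U f -> dz (dzb f) z = dzb (dz f) z.
Proof.
move=> oU Uz sf; have [s1 si] := smx_rderive oU sf.
have [s11 s1i] := smx_rderive oU s1; have [si1 sii] := smx_rderive oU si.
have mix : rderive 'i (rderive 1 f) z = rderive 1 (rderive 'i f) z.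
  apply/matrixP => i j; apply: (@srd_mixed R (fun w => f w i j) (fun w => rderive 1 f w i j)
    (fun w => rderive 'i f w i j) (fun w => rderive 'i (rderive 1 f) w i j)
    (fun w => rderive 1 (rderive 'i f) w i j) 1 'i z).
  - exact: oner_neq0.
  - exact: neq0Ci.
  - apply: (nearU oU Uz) => w Uw.
    have [/isrd_mxP a1 /isrd_mxP a2] := dif_isrd (smx_dif oU sf Uw).
    have [_ /isrd_mxP a3] := dif_isrd (smx_dif oU s1 Uw).
    have [/isrd_mxP a4 _] := dif_isrd (smx_dif oU si Uw).
    by split; [exact: a1|exact: a2|exact: a3|exact: a4].
  - exact: (sCk_cts (s1i i j 0%N) Uz).
  - exact: (sCk_cts (si1 i j 0%N) Uz).
have [d1 di] := (smx_dif oU s1 Uz, smx_dif oU si Uz).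
have [_ e1 e2] := dif_scale 'i di.
have [D1 _ _] := dif_scale 'i di.
have [_ r1 r2] := dif_scale (-1) D1.
have M1 : dif (fun w => - ('i *: rderive 'i f w)) z.
  have [D _ _] := dif_scale (-1) D1.
  have -> // : (fun w => - ('i *: rderive 'i f w)) = (fun w => -1 *: ('i *: rderive 'i f w)).
  by apply/funext => w; rewrite scaleN1r.
have L : dz (dzb f) z = 2^-1 *: (dz (rderive 1 f) z + 'i *: dz (rderive 'i f) z).
  have [S eS _] := dif_add d1 D1; have [_ eZ _] := dif_scale 2^-1 S.
  by rewrite /dzb eZ eS e1.
have L' : dzb (dz f) z = 2^-1 *: (dzb (rderive 1 f) z - 'i *: dzb (rderive 'i f) z).
  have [S _ eS] := dif_add d1 M1; have [_ _ eZ] := dif_scale 2^-1 S.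
  rewrite /dz eZ eS; congr (_ *: (_ + _)).
  have -> : (fun w => - ('i *: rderive 'i f w)) = (fun w => -1 *: ('i *: rderive 'i f w)).
    by apply/funext => w; rewrite scaleN1r.
  by rewrite r2 e2 scaleN1r.
have aux (a b b' c : 'M[C]_(p, q)) : b = b' ->
    2^-1 *: (2^-1 *: (a - 'i *: b) + 'i *: (2^-1 *: (b' - 'i *: c))) =
    2^-1 *: (2^-1 *: (a + 'i *: b) - 'i *: (2^-1 *: (b' + 'i *: c))).
  by move=> ->; apply/matrixP => i j; rewrite !mxE; ring.
exact: (etrans L (etrans (aux (rderive 1 (rderive 1 f) z) _ _ (rderive 'i (rderive 'i f) z) mix) (esym L'))).
Qed.

Lemma derivable_mx p q (f : C -> 'M[C]_(p, q)) z i j : derivable f z 1 ->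
  derivable ((fun w => f w i j) : C -> C^o) z 1.
Proof.
rewrite /derivable => /cvg_ex[d fd]; apply/cvg_ex; exists (d i j).
move/mx_cvgP : fd => /(_ i j); apply: cvg_trans; apply: near_eq_cvg.
by apply: nearW => h; rewrite !mxE.
Qed.

Lemma holo_dif p q (f : C -> 'M[C]_(p, q)) z : derivable f z 1 ->
  exists D, [/\ dif f z, dz f z = D, dzb f z = 0 & forall v, isrd f v z (v *: D)].
Proof.
move=> df.
have /choice[D HD] : forall ij : 'I_p * 'I_q, exists D, forall v, srd (fun w => f w ij.1 ij.2) v z (v * D).
  by move=> [i j]; apply: derivable_srd; exact: derivable_mx.
exists (\matrix_(i, j) D (i, j)).
have H v : isrd f v z (v *: \matrix_(i, j) D (i, j)).
  by apply/isrd_mxP => i j; rewrite !mxE; exact: (HD (i, j)).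
have [d -> ->] := dz_isrd (H 1) (H 'i).
have i2 := sqrCi C.
split => //; apply/matrixP => i j; rewrite !mxE.
  have -> : 1 * D (i, j) - 'i * ('i * D (i, j)) = D (i, j) - 'i ^+ 2 * D (i, j) by ring.
  by rewrite i2 mulN1r opprK; field.
have -> : 1 * D (i, j) + 'i * ('i * D (i, j)) = D (i, j) + 'i ^+ 2 * D (i, j) by ring.
by rewrite i2 mulN1r subrr mulr0.
Qed.

Lemma dz0_cst p q (f : C -> 'M[C]_(p, q)) z0 (r : R) :
  (forall w, cabs (w - z0) < r -> [/\ dif f w, dz f w = 0 & dzb f w = 0]) ->
  forall w, cabs (w - z0) < r -> f w = f z0.
Proof.
move=> H w wz; apply/matrixP => i j.
apply: (@srd0_cst R (fun x => f x i j) z0 r _ w wz) => x xz.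
have [d a b] := H x xz; have [E1 E2] := rderive_dz x f.
have [/isrd_mxP h1 /isrd_mxP hi] := dif_isrd d.
move: (h1 i j) (hi i j); rewrite E1 E2 a b addr0 subr0 scaler0 !mxE.
by split.
Qed.

End Wirtinger.

Lemma dz_entry (R : realType) p q (f : cplx R -> 'M[cplx R]_(p, q)) z i j : dif f z ->
  dz f z i j = dz ((fun w => f w i j) : cplx R -> (cplx R)^o) z.
Proof.
case=> d1 di; have e1 := rderive_mx i j d1; have ei := rderive_mx i j di.
have E (a b : 'M[cplx R]_(p, q)) : (2^-1 *: (a - 'i *: b)) i j = 2^-1 * (a i j - 'i * b i j) by rewrite !mxE.
exact: (etrans (E (rderive 1 f z) (rderive 'i f z)) (f_equal2 (fun u v : cplx R => 2^-1 * (u - 'i * v)) e1 ei)).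
Qed.

(* Unifying two derivatives up to conversion would otherwise unfold the limits. *)
Opaque dz dzb rderive rderivable.

Lemma row_mx_span_rank (R : realType) d r (p : 'M[cplx R]_(d, r)) (v : 'cV[cplx R]_d) :
  \rank p = r -> \rank (row_mx p v) != (r + 1)%N -> exists c, v = p *m c.
Proof.
move=> rk rk2.
have : (v^T <= p^T)%MS.
  have := mxrank_leqif_sup (addsmxSl p^T v^T) => -[le /esym eqv].
  move: eqv; rewrite addsmx_sub submx_refl /= => ->.
  rewrite eqn_leq le /= mxrank_tr rk.
  have E3 : \rank (p^T + v^T)%MS = \rank (row_mx p v).
    by rewrite -[RHS]mxrank_tr tr_row_mx; rewrite (addsmxE p^T v^T).
  have : (\rank (p^T + v^T)%MS < r + 1)%N by rewrite ltn_neqAle E3 rk2 rank_leq_col.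
  by rewrite addn1 ltnS.
move=> /submxP[D /(congr1 trmx)]; rewrite trmx_mul !trmxK => ->.
by exists D^T.
Qed.

Section SmoothLinearAlgebra.
Variable R : realType.
Local Notation C := (cplx R).
Implicit Types (U : set C) (z : C).

Lemma cts_inv (f : C -> C) z : f z != 0 -> {for z, continuous f} -> {for z, continuous (fun w => (f w)^-1)}.
Proof. by move=> f0 cf; exact: (@cvgV C _ _ _ f _ f0 cf). Qed.

Lemma sCk_inv k U (f : C -> C) : open U -> (forall z, U z -> f z != 0) -> sCk k U f -> sCk k U (fun z => (f z)^-1).
Proof.
move=> oU f0; elim: k => [|k IH].
  by move=> /sCk0 cf; apply/sCk0 => z Uz; exact: cts_inv (f0 z Uz) (cf z Uz).
move=> fk; have vk := IH (sCk_S fk); have /sCkP[cf df f1 fi] := fk.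
have v2 := sCkM oU vk vk.
have n1 := sCkM oU (sCk_cst k (-1) oU) (sCkM oU f1 v2).
have ni := sCkM oU (sCk_cst k (-1) oU) (sCkM oU fi v2).
have E a b : b != 0 -> - a / b ^+ 2 = -1 * (a * (b^-1 * b^-1)) :> C.
  by move=> b0; field.
apply: (sCk_build oU _ _ _ n1 ni) => z Uz.
- exact: cts_inv (f0 z Uz) (cf z Uz).
- by rewrite -E ?f0 //; apply: srd_inv; [exact: f0|have [] := df z Uz].
- by rewrite -E ?f0 //; apply: srd_inv; [exact: f0|have [] := df z Uz].
Qed.

Lemma sCk_prod (I : Type) (r : seq I) k U (F : I -> C -> C) : open U ->
  (forall i, sCk k U (F i)) -> sCk k U (fun w => \prod_(i <- r) F i w).
Proof.
move=> oU cF; elim: r => [|i r IH].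
  have -> : (fun w => \prod_(j <- [::]) F j w) = (fun=> 1) by apply/funext => w; rewrite big_nil.
  exact: (sCk_cst k 1 oU).
have -> : (fun w => \prod_(j <- i :: r) F j w) = (fun w => F i w * \prod_(j <- r) F j w).
  by apply/funext => w; rewrite big_cons.
exact: (sCkM oU (cF i) IH).
Qed.

Lemma sCk_det k n U (f : C -> 'M[C]_n) : open U -> smx U f -> sCk k U (fun z => \det (f z)).
Proof.
move=> oU sf; apply: (@sCk_sum R _ _ k U (fun (s : 'S_n) z => (-1) ^+ s * \prod_i f z i (s i)) oU) => s.
apply: (sCkM oU); first exact: (sCk_cst k _ oU).
by apply: (@sCk_prod _ _ k U (fun i z => f z i (s i)) oU) => i; exact: sf.
Qed.

Lemma smx_invmx n U (f : C -> 'M[C]_n) : open U -> (forall z, U z -> f z \in unitmx) -> smx U f ->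
  smx U (fun z => invmx (f z)).
Proof.
move=> oU fu sf.
apply: (@smx_eq R U oU n n (fun z => (\det (f z))^-1 *: \adj (f z))).
  by move=> w Uw; rewrite /invmx fu.
apply: (smxZ oU) => [k|i j k].
  by apply: sCk_inv => [//|z Uz|]; [rewrite -unitfE -unitmxE fu|exact: sCk_det].
have -> : (fun z => (\adj (f z)) i j) = (fun z => (-1) ^+ (j + i) * \det (row' j (col' i (f z)))).
  by apply/funext => z; rewrite mxE.
apply: (sCkM oU); first exact: (sCk_cst k _ oU).
apply: (sCk_det _ oU).
apply: (@smx_reindex R U _ _ _ _ (fun a b => lift j a) (fun a b => lift i b) f) => // w a b.
by rewrite !mxE.
Qed.

Lemma open_cts_neq0 U (f : C -> C) : open U -> (forall z, U z -> {for z, continuous f}) ->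
  open [set z | U z /\ f z != 0].
Proof.
move=> /open_cabsP oU cf; apply/open_cabsP => z [Uz fz].
have [d d0 H] := oU z Uz.
have f2 : 0 < cabs (f z) / 2 by rewrite divr_gt0 // cabs_gt0.
have /ctn_cabsP/(_ _ f2)[d' d'0 H'] := cf z Uz.
exists (Num.min d d'); first by rewrite lt_min d0.
move=> w; rewrite lt_min => /andP[w1 w2]; split; first exact: H.
rewrite -cabs_gt0; have := H' w w2; have := cabsB (f w) (f w - f z).
have -> : f w - (f w - f z) = f z by ring.
have := cabs_gt0 (f z); rewrite fz; lra.
Qed.

Definition hadj p q (A : 'M[C]_(p, q)) : 'M[C]_(q, p) := (map_mx Num.conj A)^T.

Lemma hadjK p q (A : 'M[C]_(p, q)) : hadj (hadj A) = A.
Proof. by apply/matrixP => i j; rewrite !mxE conjCK. Qed.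

Lemma hadjM p q r (A : 'M[C]_(p, q)) (B : 'M[C]_(q, r)) : hadj (A *m B) = hadj B *m hadj A.
Proof. by rewrite /hadj map_mxM trmx_mul. Qed.

Lemma mulmx_hadj_eq0 p q (A : 'M[C]_(p, q)) : A *m hadj A = 0 -> A = 0.
Proof.
move=> E; apply/matrixP => i j; rewrite mxE.
have := congr1 (fun M : 'M[C]_p => M i i) E; rewrite !mxE.
under eq_bigr do rewrite !mxE -normCK.
move=> /eqP; rewrite psumr_eq0; last by move=> k _; rewrite exprn_ge0.
by move=> /allP/(_ j); rewrite mem_index_enum => /(_ isT)/=; rewrite expf_eq0 /= normr_eq0 => /eqP.
Qed.

Lemma gram_unit d r (p : 'M[C]_(d, r)) : (hadj p *m p \in unitmx) = (\rank p == r).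
Proof.
apply/idP/idP => [u|/eqP rk].
  rewrite eqn_leq rank_leq_col /=.
  by have := mxrankM_maxr (hadj p) p; rewrite mxrank_unit.
rewrite -row_free_unit -kermx_eq0; apply/eqP/row_matrixP => i; rewrite row0.
set u := row i _.
have : u *m (hadj p *m p) = 0 by apply/sub_kermxP; rewrite row_sub.
rewrite mulmxA => E.
have : (u *m hadj p) *m hadj (u *m hadj p) = 0 by rewrite hadjM hadjK !mulmxA E mul0mx.
move=> /mulmx_hadj_eq0/(congr1 (@hadj _ _)); rewrite hadjM hadjK => E2.
have {}E2 : (hadj u)^T *m p^T = 0.
  by rewrite -trmx_mul E2 /hadj map_mx0 !trmx0.
have : row_free p^T by rewrite /row_free mxrank_tr rk.
rewrite -kermx_eq0 => /eqP k0.
have : ((hadj u)^T <= kermx p^T)%MS by apply/sub_kermxP.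
rewrite k0 submx0 => /eqP /(congr1 trmx); rewrite trmxK trmx0 => /(congr1 (@hadj _ _)).
by rewrite hadjK /hadj map_mx0 trmx0.
Qed.

Lemma smx_gram d r U (p : C -> 'M[C]_(d, r)) : open U -> smx U p -> smx U (fun z => hadj (p z) *m p z).
Proof. by move=> oU sp; apply: (smx_mul oU) => //; apply: smx_tr; exact: (smx_conj oU). Qed.

Lemma open_rank d r U (p : C -> 'M[C]_(d, r)) : open U -> smx U p -> open [set z | U z /\ \rank (p z) = r].
Proof.
move=> oU sp.
have -> : [set z | U z /\ \rank (p z) = r] = [set z | U z /\ \det (hadj (p z) *m p z) != 0].
  apply/seteqP; split=> z [Uz h]; split=> //.
    by rewrite -unitfE -unitmxE gram_unit h.
  by apply/eqP; rewrite -gram_unit unitmxE unitfE.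
apply: (open_cts_neq0 oU) => z Uz.
exact: (sCk_cts (sCk_det 0 oU (smx_gram oU sp)) Uz).
Qed.

Lemma smooth_coef d r l U (p : C -> 'M[C]_(d, r)) (s : C -> 'M[C]_(d, l)) : open U -> smx U p -> smx U s ->
  (forall z, U z -> \rank (p z) = r) -> (forall z, U z -> exists c, s z = p z *m c) ->
  exists c : C -> 'M[C]_(r, l), smx U c /\ forall z, U z -> s z = p z *m c z.
Proof.
move=> oU sp ss rk H.
have gu z : U z -> hadj (p z) *m p z \in unitmx by move=> Uz; rewrite gram_unit rk.
exists (fun z => invmx (hadj (p z) *m p z) *m (hadj (p z) *m s z)); split.
  apply: (smx_mul oU); first by apply: (smx_invmx oU) => //; exact: smx_gram.
  by apply: (smx_mul oU) => //; apply: smx_tr; exact: (smx_conj oU).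
move=> z Uz; have [c ->] := H z Uz.
by rewrite (mulmxA (hadj _)) mulKmx ?gu.
Qed.

Lemma span_deriv d r l U (p : C -> 'M[C]_(d, r)) (s : C -> 'M[C]_(d, l)) z : open U -> U z -> smx U p -> smx U s ->
  (forall z, U z -> \rank (p z) = r) -> (forall z, U z -> exists c, s z = p z *m c) ->
  (exists a b, dz s z = dz p z *m a + p z *m b) /\ (exists a b, dzb s z = dzb p z *m a + p z *m b).
Proof.
move=> oU Uz sp ss rk H; have [c [sc cE]] := smooth_coef oU sp ss rk H.
have [dpc e1 e2] := dif_mul (smx_dif oU sp Uz) (smx_dif oU sc Uz).
have [_ E1 E2] := dif_eq oU Uz (fun w Uw => esym (cE w Uw)) dpc.
split; first by exists (c z), (dz c z); exact: (etrans E1 e1).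
by exists (c z), (dzb c z); exact: (etrans E2 e2).
Qed.

Lemma generic_span d (O : set C) (v : nat -> C -> 'cV[C]_d) : open O -> O !=set0 -> (forall i, smx O (v i)) ->
  exists (r : nat) (idx : 'I_r -> nat) (V : set C), let p z := \matrix_(a, b) v (idx b) z a 0 in
  [/\ open V, V !=set0, V `<=` O, smx V p & forall z, V z -> \rank (p z) = r /\ forall i, exists c, v i z = p z *m c].
Proof.
move=> oO [z0 Oz0] sv.
pose p r (idx : 'I_r -> nat) z : 'M[C]_(d, r) := \matrix_(a, b) v (idx b) z a 0.
pose P r := `[< exists (idx : 'I_r -> nat) z, O z /\ \rank (p r idx z) = r >].
have P0 : exists r, P r.
  by exists 0%N; apply/asboolP; exists (fun=> 0%N), z0; split=> //; apply/eqP; rewrite -leqn0 rank_leq_col.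
have Pd r : P r -> (r <= d)%N by move=> /asboolP[idx [z [_ <-]]]; exact: rank_leq_row.
case: (ex_maxnP P0 Pd) => r /asboolP[idx [z1 [Oz1 rk1]]] rmax.
have sp n (ix : 'I_n -> nat) : smx O (p n ix).
  move=> a b k; have -> : (fun z => p n ix z a b) = (fun z => v (ix b) z a 0) by apply/funext => z; rewrite mxE.
  exact: sv.
exists r, idx, [set z | O z /\ \rank (p r idx z) = r]; split.
- exact: open_rank (sp _ _).
- by exists z1.
- by move=> z [].
- apply: (smx_sub (U := O)) => [z []//|]; exact: sp.
move=> z [Oz rk]; split=> // i; rewrite -/(p r idx z).
pose ix (b : 'I_(r + 1)) : nat := if fintype.split b is inl b' then idx b' else i.
have E : p (r + 1)%N ix z = row_mx (p r idx z) (v i z).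
  by apply/matrixP => a b; rewrite !mxE /ix; case: fintype.split => [b'|b']; rewrite ?mxE // [b']ord1.
have rk2 : \rank (row_mx (p r idx z) (v i z)) != (r + 1)%N.
  apply/eqP => e; have /rmax : P (r + 1)%N by apply/asboolP; exists ix, z; rewrite E.
  by rewrite addn1 ltnn.
exact: (row_mx_span_rank rk rk2).
Qed.

End SmoothLinearAlgebra.

(** * Loops *)

Section MatrixLoops.
Variable R : realType.
Local Notation C := (cplx R).
Implicit Types (h g : C -> C) (w z : C).

Definition holf h : Prop := exists2 r : R, 1 < r & forall w, cabs w < r -> derivable (h : C -> C^o) w 1.

Lemma holf_plusf h : holf h -> plusf h.
Proof. by move=> [r r1 H]; exact: plusf_holo r1 H. Qed.

Lemma holfM g h : holf g -> holf h -> holf (fun w => g w * h w).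
Proof.
move=> [r1 r11 d1] [r2 r21 d2]; exists (Num.min r1 r2); first by rewrite lt_min r11.
by move=> w; rewrite lt_min => /andP[w1 w2]; apply: derivableMC; [exact: d1|exact: d2].
Qed.

Lemma holfD g h : holf g -> holf h -> holf (fun w => g w + h w).
Proof.
move=> [r1 r11 d1] [r2 r21 d2]; exists (Num.min r1 r2); first by rewrite lt_min r11.
by move=> w; rewrite lt_min => /andP[w1 w2]; apply: derivableDC; [exact: d1|exact: d2].
Qed.

Lemma holf_cst (c : C) : holf (fun=> c).
Proof. by exists 2 => [|w _]; [lra|exact: derivable_cstC]. Qed.

Lemma holf_id : holf (fun w => w).
Proof. by exists 2 => [|w _]; [lra|exact: derivable_idC]. Qed.

Lemma holf_sum (I : Type) (r : seq I) (F : I -> C -> C) :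
  (forall i, holf (F i)) -> holf (fun w => \sum_(i <- r) F i w).
Proof.
move=> dF; elim: r => [|i r IH].
  have -> : (fun w => \sum_(j <- [::]) F j w) = (fun=> 0) by apply/funext => w; rewrite big_nil.
  exact: holf_cst.
have -> : (fun w => \sum_(j <- i :: r) F j w) = (fun w => F i w + \sum_(j <- r) F j w).
  by apply/funext => w; rewrite big_cons.
exact: (holfD (dF i) IH).
Qed.

Lemma holf_dquot h : holf h -> exists d, plusf (dquot h d).
Proof.
move=> [r r1 H]; have /derivable_cabsP[d Hd] := H 0 (eq_ind_r (fun x => x < r) (lt_trans ltr01 r1) (@cabs0 R)).
exists d; apply: (@plusf_dquot R h d r r1) => [w _|]; [exact: H|exact: Hd].
Qed.

Lemma holf_even_dquot h : holf h -> (forall w, cabs w = 1 -> h (- w) = h w) -> plusf (dquot h 0).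
Proof.
move=> hh ev; have [d pd] := holf_dquot hh.
suff E : d = 0 by rewrite -E.
have pn := plusf_rot (l := -1) (etrans (cabsN _) (@cabs1 R)) pd.
have F w : cabs w = 1 -> dquot h d (-1 * w) = -1 * dquot h d w.
  move=> w1; have -> : -1 * w = - w by ring.
  rewrite /dquot oppr_eq0.
  have -> : (w == 0) = false by apply/eqP => w0; move: w1; rewrite w0 cabs0 => /eqP; rewrite eq_sym oner_eq0.
  by rewrite ev // invrN; ring.
have := plusf_uniq pn (plusfM (plusf_cst (-1)) pd) F.
rewrite mulr0 /dquot eqxx => E; have : d *+ 2 = 0 by rewrite mulr2n {1}E; ring.
by move/eqP; rewrite mulrn_eq0 /= => /eqP.
Qed.

Definition holm p q (H : C -> 'M[C]_(p, q)) : Prop := forall i j, holf (fun w => H w i j).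

Lemma holm_cst p q (A : 'M[C]_(p, q)) : holm (fun=> A).
Proof. by move=> i j; exact: holf_cst. Qed.

Lemma holm_mul p q r (H : C -> 'M[C]_(p, q)) (K : C -> 'M[C]_(q, r)) : holm H -> holm K ->
  holm (fun w => H w *m K w).
Proof.
move=> hH hK i j; have -> : (fun w => (H w *m K w) i j) = (fun w => \sum_k H w i k * K w k j).
  by apply/funext => w; rewrite mxE.
by apply: holf_sum => k; exact: holfM.
Qed.

Lemma holm_tr p q (H : C -> 'M[C]_(p, q)) : holm H -> holm (fun w => (H w)^T).
Proof.
move=> hH i j; have -> : (fun w => (H w)^T i j) = (fun w => H w j i) by apply/funext => w; rewrite mxE.
exact: hH.
Qed.

Lemma holm_add p q (H K : C -> 'M[C]_(p, q)) : holm H -> holm K -> holm (fun w => H w + K w).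
Proof.
move=> hH hK i j; have -> : (fun w => (H w + K w) i j) = (fun w => H w i j + K w i j).
  by apply/funext => w; rewrite mxE.
exact: (holfD (hH i j) (hK i j)).
Qed.

Lemma holm_scale p q h (H : C -> 'M[C]_(p, q)) : holf h -> holm H -> holm (fun w => h w *: H w).
Proof.
move=> hh hH i j; have -> : (fun w => (h w *: H w) i j) = (fun w => h w * H w i j).
  by apply/funext => w; rewrite mxE.
exact: (holfM hh (hH i j)).
Qed.

Lemma holm_uniq p q (H K : C -> 'M[C]_(p, q)) : holm H -> holm K -> (forall w, cabs w = 1 -> H w = K w) -> H 0 = K 0.
Proof.
move=> hH hK E; apply/matrixP => i j.
apply: (plusf_uniq (holf_plusf (hH i j)) (holf_plusf (hK i j))) => w w1.
by rewrite E.
Qed.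

Lemma norm1_cabs w : `|w| = 1 <-> cabs w = 1.
Proof. by rewrite -cabsE; split=> [/rc_inj//|->]. Qed.

Lemma holo_holm p q (r : C) (H : C -> 'M[C]_(p, q)) : 1 < r -> (forall w, `|w| < r -> derivable H w 1) -> holm H.
Proof.
move=> r1 dH i j; have /gt0_rc[s s0 rE] := lt_trans ltr01 r1.
exists s; first by rewrite -rc_lt -rE.
move=> w ws; apply: derivable_mx; apply: dH.
by rewrite -cabsE rE rc_lt.
Qed.

Lemma Jmx2 n : Jmx R n *m Jmx R n = 1%:M.
Proof.
rewrite /Jmx mulmx_diag; apply/matrixP => i j; rewrite !mxE.
by rewrite -expr2 sqrr_sign.
Qed.

Lemma Jmx_tr n : (Jmx R n)^T = Jmx R n.
Proof. by rewrite /Jmx tr_diag_mx. Qed.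

Lemma Jmx_conj n : map_mx Num.conj (Jmx R n) = Jmx R n.
Proof.
apply/matrixP => i j; rewrite !mxE; case: (i == j); rewrite ?mulr1n ?mulr0n ?conjC0 //.
by rewrite rmorphXn rmorphN rmorph1.
Qed.

Definition Jinv n (A : 'M[C]_n) : 'M[C]_n := Jmx R n *m A^T *m Jmx R n.

Lemma Jinv_mul n (A : 'M[C]_n) : A^T *m Jmx R n *m A = Jmx R n -> Jinv A *m A = 1%:M.
Proof. by move=> E; rewrite /Jinv -!mulmxA (mulmxA A^T) E Jmx2. Qed.

Lemma Jinv_unit n (A : 'M[C]_n) : A^T *m Jmx R n *m A = Jmx R n -> A \in unitmx.
Proof. by move=> /Jinv_mul/mulmx1_unit[]. Qed.

Lemma Jinv_inv n (A : 'M[C]_n) : A^T *m Jmx R n *m A = Jmx R n -> invmx A = Jinv A.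
Proof.
move=> E; have u := Jinv_unit E; have := Jinv_mul E.
by move=> /(congr1 (mulmx^~ (invmx A))); rewrite mulmxK // mul1mx.
Qed.

Lemma Jinv_mulmx n (A B : 'M[C]_n) : Jinv (A *m B) = Jinv B *m Jinv A.
Proof.
rewrite /Jinv; move: (Jmx2 n); move: (Jmx R n) => J JJ.
by rewrite trmx_mul !mulmxA -(mulmxA (J *m B^T) J J) JJ mulmx1.
Qed.

Lemma holm_Jinv n (H : C -> 'M[C]_n) : holm H -> holm (fun w => Jinv (H w)).
Proof.
move=> hH; apply: holm_mul; last exact: holm_cst.
by apply: holm_mul; [exact: holm_cst|exact: holm_tr].
Qed.

Variable m : nat.
Local Notation mat := 'M[C]_(2 + m * 2).

Definition lpr : mat := block_mx 1%:M 0 0 0.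
Definition smat : mat := block_mx (- 1%:M) 0 0 1%:M.

Definition tau (l : C) (P : mat) : mat := 1%:M + (l - 1) *: lpr + (l ^+ 2 - 1) *: P.

(* [l (Fm2 l)^-1 Fm1 l u] has no pole at 0, since [P1 (Fp1 l u)] vanishes there and is even in [l]. *)
Lemma birkhoff_fixed (Fp1 Fm1 Fp2 Fm2 Fl1 Fl2 : C -> mat) (P1 P2 D : mat) (w0 : 'cV[C]_(2 + m * 2)) (H1 : C -> mat) :
  plus_loop Fp1 -> minus_loop Fm1 -> plus_loop Fp2 -> minus_loop Fm2 ->
  (forall l : C, `|l| = 1 -> Fm1 l = Fl1 l *m Fp1 l) ->
  (forall l : C, `|l| = 1 -> Fm2 l = Fl2 l *m Fp2 l) ->
  (forall l : C, `|l| = 1 -> Jinv (Fl2 l) *m Fl1 l = tau l P2 *m D *m tau l^-1 P1) ->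
  (forall l : C, `|l| = 1 -> (Fl2 l)^T *m Jmx R _ *m Fl2 l = Jmx R _) ->
  holm H1 -> (forall l : C, `|l| = 1 -> Fp1 l = H1 l) ->
  lpr *m w0 = 0 -> P1 *m w0 = 0 -> P1 *m smat = P1 ->
  let u := Jinv (H1 0) *m w0 in
  forall l : C, `|l| = 1 -> Fm2 l *m u = Fm1 l *m u.
Proof.
move=> [tp1 _] [tm1 [r1 [K1 [r11 dK1 K10 EK1]]]] [tp2 [r2 [H2 [r21 dH2 EH2]]]] [tm2 [r3 [K2 [r31 dK2 K20 EK2]]]].
move=> EF1 EF2 ET SF2 hH1 EH1 lw Pw Ps u.
have {r11 dK1}hK1 : holm K1 := holo_holm r11 dK1.
have {r21 dH2}hH2 : holm H2 := holo_holm r21 dH2.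
have {r31 dK2}hK2 : holm K2 := holo_holm r31 dK2.
have c1 (l : C) : cabs l = 1 -> `|l| = 1 by move/norm1_cabs.
have SH1 l : cabs l = 1 -> (H1 l)^T *m Jmx R _ *m H1 l = Jmx R _.
  by move=> /c1 l1; rewrite -EH1 //; have [[]] := tp1 l l1.
have SH10 : (H1 0)^T *m Jmx R _ *m H1 0 = Jmx R _.
  exact: (holm_uniq (holm_mul (holm_mul (holm_tr hH1) (holm_cst (Jmx R _))) hH1) (holm_cst (Jmx R _)) SH1).
have H1u : H1 0 *m u = w0.
  rewrite /u mulmxA; have := Jinv_mul SH10 => /mulmx1C ->; exact: mul1mx.
have sH1 l : cabs l = 1 -> smat *m H1 l *m smat = H1 (- l).
  move=> l1; rewrite -EH1 ?c1 // -EH1; last by rewrite normrN c1.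
  by have [_] := tp1 l (c1 l l1).
have sw0 : smat *m w0 = w0.
  move: lw; rewrite /lpr /smat -[w0]vsubmxK !mul_block_col !mul0mx !mul1mx !addr0 mulNmx mul1mx.
  rewrite add0r -[0 in RHS]vsubmxK => /eq_col_mx[-> _].
  by rewrite -[usubmx 0]/(usubmx 0) (_ : usubmx 0 = 0) ?oppr0 //; apply/matrixP => i j; rewrite !mxE.
have ss : smat *m smat = 1%:M.
  by rewrite /smat mulmx_block !mulmx0 !mul0mx !addr0 !add0r mulNmx mulmxN opprK !mul1mx -scalar_mx_block.
have su : smat *m u = u.
  have sH0 : smat *m H1 0 *m smat = H1 0.
    have hneg : holm (fun w => H1 (0 + -1 * w)).
      move=> i j; have [s s1 Hs] := hH1 i j; exists s; first exact: s1.
      move=> w ws; apply: (@derivable_affine R (fun w => H1 w i j) 0 (-1) w).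
      by apply: Hs; rewrite add0r cabsM cabsN cabs1 mul1r.
    have Hneg w : cabs w = 1 -> smat *m H1 w *m smat = H1 (0 + -1 * w).
      by move=> w1; rewrite sH1 //; congr H1; ring.
    have := holm_uniq (holm_mul (holm_mul (holm_cst smat) hH1) (holm_cst smat)) hneg Hneg.
    by move=> ->; congr H1; ring.
  have iH0 : invmx (H1 0) *m w0 = u by rewrite (Jinv_inv SH10).
  have uH0 := Jinv_unit SH10.
  apply: (can_inj (mulKmx uH0)); rewrite H1u -{1}sH0 -!mulmxA (mulmxA smat smat) ss mul1mx.
  by rewrite H1u sw0.
clearbody u.
pose x w := H1 w *m u.
have hx : holm x := holm_mul hH1 (holm_cst u).
have hPx : holm (fun w => P1 *m x w) := holm_mul (holm_cst P1) hx.
have x0 : x 0 = w0 := H1u.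
have Px0 : P1 *m x 0 = 0 by rewrite x0.
have Pxe l : cabs l = 1 -> P1 *m x (- l) = P1 *m x l.
  by move=> l1; rewrite /x -(sH1 l l1) -(mulmxA _ smat) su !mulmxA Ps.
pose Px1 w : 'cV[C]_(2 + m * 2) := \col_i dquot (fun w => (P1 *m x w) i 0) 0 w.
have pPx1 i : plusf (fun w => Px1 w i 0).
  have -> : (fun w => Px1 w i 0) = dquot (fun w => (P1 *m x w) i 0) 0 by apply/funext => w; rewrite mxE.
  by apply: holf_even_dquot => [|w w1]; [exact: hPx|rewrite Pxe].
have Px1E l : l != 0 -> Px1 l = l^-1 *: (P1 *m x l).
  move=> l0; apply/matrixP => i j; rewrite [j]ord1 !mxE /dquot (negPf l0).
  have -> : (P1 *m x 0) i 0 = 0 by rewrite Px0 mxE.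
  by rewrite subr0 mulrC; congr (_ * _); rewrite mxE.
have Px10 : Px1 0 = 0 by apply/matrixP => i j; rewrite !mxE /dquot eqxx.
pose y w := w *: x w + (1 - w) *: (lpr *m x w) + (- w) *: (P1 *m x w) + Px1 w.
have py i : plusf (fun w => y w i 0).
  have -> : (fun w => y w i 0) = (fun w => (w *: x w + (1 - w) *: (lpr *m x w) + (- w) *: (P1 *m x w)) i 0 + Px1 w i 0).
    by apply/funext => w; rewrite mxE.
  apply: plusfD; last exact: pPx1.
  apply: holf_plusf.
  have hN : holf (fun w => - w).
    have := holfM (holf_cst (-1)) holf_id; congr holf; apply/funext => w; exact: mulN1r.
  have h1N : holf (fun w => 1 - w) := holfD (holf_cst 1) hN.
  have hlx : holm (fun w => lpr *m x w) := holm_mul (holm_cst lpr) hx.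
  exact: (holm_add (holm_add (holm_scale holf_id hx) (holm_scale h1N hlx)) (holm_scale hN hPx)).
have y0 : y 0 = 0 by rewrite /y Px10 x0 lw scale0r oppr0 !scale0r scaler0 !addr0.
have yE l : cabs l = 1 -> y l = l *: (tau l^-1 P1 *m x l).
  move=> l1; have l0 : l != 0 by rewrite -cabs_gt0 l1.
  rewrite /y Px1E // /tau !mulmxDl mul1mx -!scalemxAl.
  rewrite !scalerDr !scalerA -!addrA; congr (_ + (_ + _)).
    by congr (_ *: _); field.
  by rewrite -scalerDl; congr (_ *: _); field.
pose A w := Jinv (H2 w) *m tau w P2 *m D.
have hA : holm A.
  have hN1 : holf (fun w => w - 1) := holfD holf_id (holf_cst (-1)).
  have hN2 : holf (fun w => w ^+ 2 - 1).
    exact: (holfD (holfM holf_id holf_id) (holf_cst (-1))).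
  have ht := holm_add (holm_add (holm_cst 1%:M) (holm_scale hN1 (holm_cst lpr))) (holm_scale hN2 (holm_cst P2)).
  exact: (holm_mul (holm_mul (holm_Jinv hH2) ht) (holm_cst D)).
pose hp w : 'cV[C]_(2 + m * 2) := A w *m y w - w *: u.
pose G w : 'cV[C]_(2 + m * 2) := Jinv (K2 w) *m K1 w *m u.
have hG : holm G := holm_mul (holm_mul (holm_Jinv hK2) hK1) (holm_cst u).
have G0 : G 0 = u by rewrite /G K20 K10 /Jinv trmx1 !mulmx1 Jmx2 mul1mx.
have GE l : cabs l = 1 -> hp l = l *: (G l^-1 - u).
  move=> l1; have nl := c1 l l1; rewrite /hp (yE l l1) -scalemxAr scalerBr; congr (_ - _); congr (_ *: _).
  have l0 : l != 0 by rewrite -cabs_gt0 l1.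
  have nl' : `|l^-1| = 1 by rewrite normfV nl invr1.
  have E1 : A l *m (tau l^-1 P1 *m x l) = Jinv (Fp2 l) *m (tau l P2 *m D *m tau l^-1 P1) *m (Fp1 l *m u).
    by rewrite /A -(EH2 l nl) /x -(EH1 l nl) !mulmxA.
  have E2 : G l^-1 = Jinv (Fl2 l *m Fp2 l) *m (Fl1 l *m Fp1 l) *m u.
    by rewrite /G -(EK2 l nl) -(EK1 l nl) (EF1 l nl) (EF2 l nl).
  by rewrite E1 E2 Jinv_mulmx -(ET l nl) !mulmxA.
move=> l nl; have l1 : cabs l = 1 by apply/norm1_cabs.
have key i : hp l i 0 = 0.
  have php : plusf (fun w => hp w i 0).
    have -> : (fun w => hp w i 0) = (fun w => (\sum_k A w i k * y w k 0) - w * u i 0).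
      by apply/funext => w; rewrite !mxE.
    apply: plusfB; last exact: (plusfM (@plusf_id R) (plusf_cst _)).
    by apply: plusf_sum => k; exact: (plusfM (holf_plusf (hA i k)) (py k)).
  have [d pd] := holf_dquot (hG i 0).
  have E w : cabs w = 1 -> hp w i 0 = dquot (fun w => G w i 0) d w^-1.
    move=> w1; have w0' : w != 0 by rewrite -cabs_gt0 w1.
    by rewrite GE // /dquot invr_eq0 (negPf w0') invrK G0 !mxE mulrC.
  have L := liouville php pd E.
  rewrite (L l l1).
  have Li := plusf_uniq php (plusf_cst (dquot (fun w => G w i 0) d 0)) L.
  by rewrite -Li /hp y0 mulmx0 scale0r subr0 mxE.
have {}key : G l^-1 = u.
  have l0 : l != 0 by rewrite -cabs_gt0 l1.
  have : hp l = 0 by apply/matrixP => i j; rewrite [j]ord1 key mxE.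
  rewrite (GE l l1) => /eqP; rewrite scaler_eq0 (negPf l0) subr_eq0 => /eqP; exact: id.
have SK2 : (Fm2 l)^T *m Jmx R _ *m Fm2 l = Jmx R _ by have [[]] := tm2 l nl.
have key2 : Jinv (Fm2 l) *m (Fm1 l *m u) = u by rewrite mulmxA (EK2 l nl) (EK1 l nl).
by rewrite -{1}key2 (mulmxA (Fm2 l)) (mulmx1C (Jinv_mul SK2)) mul1mx.
Qed.

Lemma plus_minus_loop (Lp Lm : C -> mat) : plus_loop Lp -> minus_loop Lm ->
  (forall l : C, `|l| = 1 -> Lm l = Lp l) -> forall l : C, `|l| = 1 -> Lm l = 1%:M.
Proof.
move=> [_ [r2 [H2 [r21 dH2 EH2]]]] [_ [r3 [K2 [r31 dK2 K20 EK2]]]] E l nl.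
have hH2 := holo_holm r21 dH2; have hK2 := holo_holm r31 dK2.
apply/matrixP => i j; rewrite E // EH2 // -K20.
apply: (liouville (holf_plusf (hH2 i j)) (holf_plusf (hK2 i j))); last by apply/norm1_cabs.
by move=> w /norm1_cabs w1; rewrite -EK2 // -EH2 // E.
Qed.

End MatrixLoops.

(** * The zero-curvature equations *)

Section ZeroCurvature.
Variable R : realType.
Local Notation C := (cplx R).
Implicit Types (U : set C) (z : C).

Lemma zero_curvature n U (G A B : C -> 'M[C]_n) z : open U -> U z -> smx U G -> smx U A -> smx U B ->
  (forall w, U w -> [/\ G w \in unitmx, dz G w = G w *m A w & dzb G w = G w *m B w]) ->
  A z *m B z + dz B z = B z *m A z + dzb A z.
Proof.
move=> oU Uz sG sA sB H.
have [uG e1 e2] := H z Uz.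
have dG := smx_dif oU sG Uz.
have [dGB E1 _] := dif_mul dG (smx_dif oU sB Uz).
have [dGA _ E2] := dif_mul dG (smx_dif oU sA Uz).
have [_ F1 _] := dif_eq oU Uz (fun w Uw => esym (let: And3 _ _ e := H w Uw in e)) dGB.
have [_ _ F2] := dif_eq oU Uz (fun w Uw => esym (let: And3 _ e _ := H w Uw in e)) dGA.
have := smx_dz_comm oU Uz sG; rewrite F1 F2 E1 E2 e1 e2 -!mulmxA -!mulmxDr.
by move/(can_inj (mulKmx uG)).
Qed.

Lemma loop_coeff p q (X Y Z : 'M[C]_(p, q)) : (forall l : C, `|l| = 1 -> l^-1 *: X + Y + l *: Z = 0) ->
  [/\ X = 0, Y = 0 & Z = 0].
Proof.
move=> H.
have ii := sqrCi C.
have iV : ('i : C)^-1 = - 'i.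
  have i0 := neq0Ci C; apply: (mulfI i0); rewrite divff // mulrN -expr2 ii opprK //.
have E i j : [/\ X i j = 0, Y i j = 0 & Z i j = 0].
  have He l : `|l| = 1 -> l^-1 * X i j + Y i j + l * Z i j = 0.
    by move=> /H/matrixP/(_ i j); rewrite !mxE.
  move: (He 1 (normr1 _)) (He (-1) (normrN1 _)) (He 'i (normCi _)); rewrite iV invr1 (@invrN C 1) invr1.
  move: (X i j) (Y i j) (Z i j) => x y t h1 h2 h3.
  have i0 := neq0Ci C.
  have y0 : y = 0.
    have : y *+ 2 = 0 by rewrite -(addr0 0) -{1}h1 -h2; ring.
    by move/eqP; rewrite mulrn_eq0 /= => /eqP.
  have xz : x = - t by move: h1; rewrite y0 addr0 !mul1r => /eqP; rewrite addr_eq0 => /eqP.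
  have : ('i * t) *+ 2 = 0 by rewrite -h3 xz y0; ring.
  move/eqP; rewrite mulrn_eq0 /= mulf_eq0 (negPf i0) => /eqP t0.
  by rewrite xz t0 oppr0.
by split; apply/matrixP => i j; have [? ? ?] := E i j; rewrite mxE.
Qed.

End ZeroCurvature.

Ltac mx_expand := rewrite ?(mulmxDl, mulmxDr, mulmxBl, mulmxBr, mulNmx, mulmxN, mulmxA, opprD, opprK).

Ltac mx_abel :=
  repeat (let t := fresh "t" in set t := (_ *m _); clearbody t);
  apply/matrixP => ? ?; rewrite !mxE; ring.

Section SplitAlgebra.
Variables (R : realType) (m : nat).
Local Notation C := (cplx R).
Local Notation mat := 'M[C]_(2 + m * 2).
Local Notation l := (lpr R m).
Local Notation J := (Jmx R (2 + m * 2)).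

Lemma lpr_idem : l *m l = l.
Proof. by rewrite /lpr mulmx_block !mulmx0 !mul0mx !mulmx1 !addr0. Qed.

Lemma lpr_conj : map_mx Num.conj l = l.
Proof. by rewrite /lpr map_block_mx !map_mx0 map_mx1. Qed.

Lemma lpr_tr : l^T = l.
Proof. by rewrite /lpr tr_block_mx !trmx0 trmx1. Qed.

Lemma smatE : smat R m = 1%:M - 2 *: l.
Proof.
rewrite /smat /lpr (scalar_mx_block 2 (m * 2) (1 : C)) scale_block_mx opp_block_mx add_block_mx !scaler0 !oppr0 !addr0.
by congr block_mx; rewrite scaler_nat mulr2n opprD addrA subrr add0r.
Qed.

Lemma smat2 : smat R m *m smat R m = 1%:M.
Proof.
by rewrite /smat mulmx_block !mulmx0 !mul0mx !addr0 !add0r mulNmx mulmxN opprK !mul1mx -scalar_mx_block.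
Qed.

Lemma Jmx_block : J = block_mx (Jmx R 2) 0 0 1%:M.
Proof.
apply/matrixP => x y; rewrite -[x]splitK -[y]splitK.
case: (fintype.split x) => a; case: (fintype.split y) => b.
- by rewrite /unsplit block_mxEul !mxE /= (inj_eq (@lshift_inj _ _)).
- by rewrite /unsplit block_mxEur !mxE /= eq_lrshift.
- by rewrite /unsplit block_mxEdl !mxE /= eq_rlshift.
- by rewrite /unsplit block_mxEdr !mxE /= (inj_eq (@rshift_inj _ _)).
Qed.

Lemma Jmx_lpr : J *m l = l *m J.
Proof. by rewrite Jmx_block /lpr !mulmx_block !mulmx0 !mul0mx !addr0 !mulmx1 !mul1mx. Qed.

Lemma Jmx_fix p (x : 'M[C]_(2 + m * 2, p)) : l *m x = 0 -> J *m x = x.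
Proof.
rewrite -[x]vsubmxK /lpr mul_block_col !mul0mx !addr0 mul1mx -[0 in RHS]vsubmxK => /eq_col_mx[-> _].
have -> : usubmx (0 : 'M[C]_(2 + m * 2, p)) = 0 by apply/matrixP => i j; rewrite !mxE.
by rewrite Jmx_block mul_block_col !mulmx0 !mul0mx !add0r mul1mx.
Qed.

Lemma smat_comm (X : mat) : smat R m *m X = X *m smat R m -> l *m X = X *m l.
Proof.
rewrite smatE mulmxBl mulmxBr mul1mx mulmx1 -scalemxAl -scalemxAr => /addrI/oppr_inj.
by move/scalerI; apply; rewrite pnatr_eq0.
Qed.

Lemma smat_anticomm (X : mat) : smat R m *m X = - (X *m smat R m) -> X *m l + l *m X = X.
Proof.
rewrite smatE mulmxBl mulmxBr mul1mx mulmx1 -scalemxAl -scalemxAr.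
move: (X *m l) (l *m X) => x y E.
apply: (@scalerI _ _ 2); first by rewrite pnatr_eq0.
apply/matrixP => a b; move/matrixP/(_ a b): E; rewrite !mxE.
move: (x a b) (y a b) (X a b) => t u v E; apply/eqP; rewrite -subr_eq0.
have -> : 2 * (t + u) - 2 * v = - (v - 2 * u - - (v - 2 * t)) by ring.
by rewrite E subrr oppr0.
Qed.

Lemma sigma_kpart (A : mat) : l *m kpart A = kpart A *m l.
Proof.
apply: smat_comm; rewrite /kpart /sigma -/(smat R m); move: smat2; move: (smat R m) => t tt.
rewrite -scalemxAr -scalemxAl mulmxDr mulmxDl !mulmxA tt mul1mx -!mulmxA tt mulmx1; congr (_ *: _).
exact: addrC.
Qed.

Lemma sigma_ppart (A : mat) : ppart A *m l + l *m ppart A = ppart A.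
Proof.
apply: smat_anticomm; rewrite /ppart /sigma -/(smat R m); move: smat2; move: (smat R m) => t tt.
by rewrite -scalemxAr -scalemxAl -scalerN mulmxBr mulmxBl opprB !mulmxA tt mul1mx -!mulmxA tt mulmx1.
Qed.

Lemma ppart_kernel (P : mat) : P *m l + l *m P = P -> l *m P *m l = 0.
Proof.
move=> /(congr1 (mulmx^~ l)); rewrite mulmxDl -mulmxA lpr_idem => /eqP.
by rewrite -subr_eq0 addrAC subrr add0r => /eqP.
Qed.

End SplitAlgebra.

Section CurvatureAlgebra.
Variables (R : realType) (n : nat).
Local Notation mat := 'M[cplx R]_n.

Lemma curvature_commute (X A0 B0 A1 B1 E dE dX dA0 dB0 dzX : mat) :
  dX = E - B0 *m X + X *m B0 ->
  dB0 - dA0 + (A0 *m B0 - B0 *m A0) + (A1 *m B1 - B1 *m A1) = 0 ->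
  dE - (dB0 *m X + B0 *m dzX) + (dzX *m B0 + X *m dB0) + (dA0 *m X + A0 *m dX) - (dX *m A0 + X *m dA0)
   + B0 *m (dzX + A0 *m X - X *m A0) - (dzX + A0 *m X - X *m A0) *m B0
  = dE + A0 *m E - E *m A0 + (A1 *m B1 - B1 *m A1) *m X - X *m (A1 *m B1 - B1 *m A1).
Proof.
move=> ->; set K := A1 *m B1 - B1 *m A1 => /eqP; rewrite addrC addr_eq0 => /eqP ->.
by mx_expand; mx_abel.
Qed.

(* The derivative of [q (pt q)^-1 pt], the projection onto the span of [q] along the kernel of [pt]. *)
Lemma projection_deriv r (q dq : 'M[cplx R]_(n, r)) (pt dpt : 'M[cplx R]_(r, n)) (W dW a b : 'M[cplx R]_r) (A0 : mat) :
  W *m (pt *m q) = 1%:M -> dW *m (pt *m q) + W *m (dpt *m q + pt *m dq) = 0 ->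
  dq = q *m a - A0 *m q -> dpt = b *m pt + pt *m A0 ->
  (dq *m W + q *m dW) *m pt + q *m W *m dpt = q *m W *m pt *m A0 - A0 *m (q *m W *m pt).
Proof.
move=> WG dWG Eq E.
have GW := mulmx1C WG.
have {dWG} : dW = - (W *m b) - a *m W.
  have /(congr1 (mulmx^~ W)) := dWG; rewrite mul0mx mulmxDl -mulmxA GW mulmx1 => /eqP; rewrite addr_eq0 => /eqP ->.
  rewrite E Eq.
  have -> : (b *m pt + pt *m A0) *m q + pt *m (q *m a - A0 *m q) = b *m (pt *m q) + pt *m q *m a.
    by mx_expand; mx_abel.
  by rewrite mulmxDr mulmxDl mulmxA -(mulmxA (W *m b)) GW mulmx1 (mulmxA W) WG mul1mx opprD.
by move=> ->; rewrite E Eq; mx_expand; mx_abel.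
Qed.

Lemma tau_deriv (l P A0 A1 : mat) (x : cplx R) : x != 0 ->
  l *m A0 = A0 *m l -> A1 *m l + l *m A1 = A1 -> l *m A1 = A1 *m P -> P *m A1 = 0 ->
  let t := 1%:M + (x - 1) *: l + (x ^+ 2 - 1) *: P in
  (x^-1 *: A1 + A0) *m t + (x ^+ 2 - 1) *: (P *m A0 - A0 *m P) = t *m (A1 + A0).
Proof.
move=> x0 lA pA lP PA t; rewrite /t; mx_expand.
rewrite !(mulmx1, mul1mx) -!(scalemxAl, scalemxAr) PA lA lP !scaler0.
have {}pA : A1 = A1 *m l + A1 *m P by rewrite -lP pA.
move: pA; move: (A1 *m l) (A1 *m P) (A0 *m l) (P *m A0) (A0 *m P) => y1 y2 y3 y4 y5 ->.
by apply/matrixP => a b; rewrite !mxE; field.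
Qed.

Lemma tau_derivb (l P B0 B1 : mat) (x : cplx R) :
  l *m B0 = B0 *m l -> B1 *m l + l *m B1 = B1 -> P *m B1 = B1 *m l -> B1 *m P = 0 ->
  let t := 1%:M + (x - 1) *: l + (x ^+ 2 - 1) *: P in
  (B0 + x *: B1) *m t + (x ^+ 2 - 1) *: (P *m B0 - B0 *m P) = t *m (B0 + B1).
Proof.
move=> lB pB lP PB t; rewrite /t; mx_expand.
rewrite !(mulmx1, mul1mx) -!(scalemxAl, scalemxAr) PB lB lP !scaler0.
have {}pB : l *m B1 = B1 - B1 *m l by rewrite -{2}pB addrAC subrr add0r.
rewrite pB; move: (B1 *m l) (B0 *m l) (P *m B0) (B0 *m P) => y1 y2 y3 y4.
by apply/matrixP => a b; rewrite !mxE; ring.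
Qed.

End CurvatureAlgebra.

Section ParallelSpan.
Variables (R : realType) (m : nat).
Local Notation C := (cplx R).
Local Notation n := (2 + m * 2)%N.
Local Notation mat := 'M[C]_n.
Local Notation l := (lpr R m).
Local Notation J := (Jmx R n).
Local Notation cj := (map_mx Num.conj).
Variables (U : set C) (A0 A1 B0 B1 : C -> mat).
Variable oU : open U.
Variables (s0 : smx U A0) (s1 : smx U A1).
Variable cB0 : forall z, U z -> B0 z = cj (A0 z).
Variable cB1 : forall z, U z -> B1 z = cj (A1 z).
Variable k0 : forall z, U z -> l *m A0 z = A0 z *m l.
Variable p1 : forall z, U z -> A1 z *m l + l *m A1 z = A1 z.
Variable j0 : forall z, U z -> (A0 z)^T *m J + J *m A0 z = 0.
Variable j1 : forall z, U z -> (A1 z)^T *m J + J *m A1 z = 0.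
Variable fl1 : forall z, U z -> dzb A1 z = A1 z *m B0 z - B0 z *m A1 z.
Variable fl0 : forall z, U z ->
  dz B0 z - dzb A0 z + (A0 z *m B0 z - B0 z *m A0 z) + (A1 z *m B1 z - B1 z *m A1 z) = 0.

(* [D_z^j (A1 l)] for the connection [D_z X = dz X + A0 X - X A0] *)
Definition covder j : C -> mat :=
  iter j (fun X z => dz X z + A0 z *m X z - X z *m A0 z) (fun z => A1 z *m l).

Lemma sB0 : smx U B0.
Proof. by apply: (smx_eq oU) (smx_conj oU s0) => w Uw; rewrite cB0. Qed.

Lemma covder_smx j : smx U (covder j).
Proof.
elim: j => [|j IH]; first exact: (smx_mul oU s1 (smx_cst oU l)).
exact: (smxB oU (smxD oU (smx_dz oU IH) (smx_mul oU s0 IH)) (smx_mul oU IH s0)).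
Qed.

Lemma k0B z : U z -> l *m B0 z = B0 z *m l.
Proof. by move=> Uz; rewrite cB0 // -[l](@lpr_conj R m) -!map_mxM k0. Qed.

Lemma covder_lpr j z : U z -> covder j z *m l = covder j z /\ l *m covder j z = 0.
Proof.
elim: j z => [|j IH] z Uz /=.
  rewrite -mulmxA lpr_idem mulmxA; split=> //; exact: ppart_kernel (p1 Uz).
have dX := smx_dif oU (covder_smx j) Uz.
have [dl el _] := dif_cst z l.
have [d1 E1 _] := dif_mul dX dl; have [d2 E2 _] := dif_mul dl dX.
have [dc ec _] := dif_cst z (0 : mat).
have [_ F1 _] := dif_eq oU Uz (fun w Uw => (IH w Uw).1) d1.
have [_ F2 _] := dif_eq oU Uz (fun w Uw => esym (IH w Uw).2) dc.
have [X1 X2] := IH z Uz.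
move: E1 E2 F1 F2; rewrite -/(covder j) el mul0mx mulmx0 addr0 add0r ec => E1 E2 F1 F2.
rewrite !(mulmxBl, mulmxBr, mulmxDl, mulmxDr) -E1 -F1 -E2 F2; split.
  by rewrite -!mulmxA X1 -(k0 Uz) (mulmxA (covder j z)) X1.
by rewrite add0r (mulmxA l (A0 z)) (k0 Uz) -(mulmxA (A0 z) l) (mulmxA l (covder j z)) X2 mulmx0 mul0mx subr0.
Qed.

Section Generic.
Variable O : set C.
Variables (oO : open O) (OU : O `<=` U).
Variable iso : forall z, O z -> forall i j, (covder i z)^T *m covder j z = 0.

Lemma A1_covder j z : O z -> A1 z *m covder j z = 0.
Proof.
move=> Oz; have Uz := OU Oz; have [X1 X2] := covder_lpr j Uz.
have JX := Jmx_fix X2.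
have E : (A1 z)^T = - (J *m A1 z *m J).
  move/eqP: (j1 Uz); rewrite addr_eq0 => /eqP /(congr1 (mulmx^~ J)).
  by rewrite -mulmxA Jmx2 mulmx1 mulNmx.
have : (covder 0 z)^T *m covder j z = 0 by exact: iso.
rewrite /covder /= -/(covder j) trmx_mul lpr_tr E mulmxN mulNmx -!mulmxA JX mulmxA -Jmx_lpr -mulmxA => /eqP.
rewrite oppr_eq0 => /eqP /(congr1 (mulmx J)); rewrite mulmx0 (mulmxA J J) Jmx2 mul1mx => lE.
by rewrite -(p1 Uz) mulmxDl -mulmxA X2 mulmx0 add0r -mulmxA.
Qed.

Definition covcol i z : 'cV[C]_n := covder (i %/ n) z *m delta_mx (inord (i %% n)) 0.

Lemma covcol_smx i : smx U (covcol i).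
Proof. exact: (smx_mul oU (covder_smx _) (smx_cst oU _)). Qed.

Lemma span_col r q (p : 'M[C]_(n, r)) (M : 'M[C]_(n, q)) :
  (forall k, exists c : 'cV_r, M *m delta_mx k 0 = p *m c) -> exists c, M = p *m c.
Proof.
move=> /choice[c H]; exists (\matrix_(a, b) c b a 0).
apply/matrixP => a b; have /matrixP/(_ a 0) := H b; rewrite -colE !mxE => ->.
by apply: eq_bigr => k _; rewrite !mxE.
Qed.

Lemma span_covder r z (p : 'M[C]_(n, r)) : (forall i, exists c, covcol i z = p *m c) ->
  forall j, exists c, covder j z = p *m c.
Proof.
move=> H j; apply: span_col => k; have [c E] := H (j * n + k)%N.
exists c; rewrite -E /covcol divnMDl // (divn_small (ltn_ord k)) addn0 modnMDl (modn_small (ltn_ord k)).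
by rewrite inord_val.
Qed.

Variables (r : nat) (idx : 'I_r -> nat) (V : set C).
Definition spanmx z : 'M[C]_(n, r) := \matrix_(a, b) covcol (idx b) z a 0.
Local Notation p := spanmx.
Variables (oV : open V) (VO : V `<=` O) (sp : smx V p).
Variable rkp : forall z, V z -> \rank (p z) = r.
Variable spanp : forall z, V z -> forall i, exists c, covcol i z = p z *m c.

Lemma spanmx_col b z : p z *m delta_mx b 0 = covcol (idx b) z.
Proof. by apply/matrixP => a k; rewrite [k]ord1 -colE !mxE. Qed.

Lemma dz_spanmx z : V z -> exists A, dz p z + A0 z *m p z = p z *m A.
Proof.
move=> Vz; have Uz := OU (VO Vz); apply: span_col => b.
have dp := smx_dif oV sp Vz.
have [de ee _] := dif_cst z (delta_mx b 0 : 'cV[C]_r).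
have [dpe E _] := dif_mul dp de.
have [_ F _] := dif_eq oV Vz (fun w _ => spanmx_col b w) dpe.
move: E; rewrite ee mulmx0 addr0 => E.
have dX := smx_dif oU (covder_smx (idx b %/ n)) Uz.
have [dk ek _] := dif_cst z (delta_mx (inord (idx b %% n)) 0 : 'cV[C]_n).
have [_ G _] := dif_mul dX dk; move: G; rewrite ek mulmx0 addr0 => G.
have H := span_covder (spanp Vz).
have [c1 h1] := H (idx b %/ n).+1; have [c2 h2] := H (idx b %/ n)%N.
rewrite mulmxDl -mulmxA spanmx_col -E -F /covcol {1}G mulmxA -mulmxDl.
have -> : dz (covder (idx b %/ n)) z + A0 z *m covder (idx b %/ n) z = p z *m (c1 + c2 *m A0 z).
  by rewrite mulmxDr (mulmxA (p z)) -h1 -h2 /= subrK.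
by exists ((c1 + c2 *m A0 z) *m delta_mx (inord (idx b %% n)) 0); rewrite mulmxA.
Qed.

Lemma dzb_covder j z : V z -> exists c, dzb (covder j) z + B0 z *m covder j z - covder j z *m B0 z = p z *m c.
Proof.
elim: j z => [|j IH] z Vz; have Uz := OU (VO Vz).
  exists 0; rewrite mulmx0.
  have [dl _ el] := dif_cst z l; have [_ _ E] := dif_mul (smx_dif oU s1 Uz) dl.
  rewrite /covder /= {1}E el mulmx0 addr0 fl1 // mulmxBl -!mulmxA k0B //.
  by rewrite subrK subrr.
have sX := covder_smx j; have dX := smx_dif oU sX Uz.
have sdX := smx_dz oU sX; have ddX := smx_dif oU sdX Uz.
have dA := smx_dif oU s0 Uz; have dB := smx_dif oU sB0 Uz.
have [d1 _ e1] := dif_mul dA dX; have [d2 _ e2] := dif_mul dX dA.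
have [d3 _ e3] := dif_add ddX d1.
have [d2' _ e2'] := dif_scale (-1) d2.
have [d4 _ e4] := dif_add d3 d2'.
have cE w : dz (covder j) w + A0 w *m covder j w + -1 *: (covder j w *m A0 w) = covder j.+1 w.
  by rewrite scaleN1r.
have [_ _ E1] := dif_eq oU Uz (fun w _ => cE w) d4.
move: E1; rewrite e4 e3 e1 e2' e2 scaleN1r -(smx_dz_comm oU Uz sX) => E1.
have [c [sc cE2]] := @smooth_coef R _ r _ V p (fun w => dzb (covder j) w + B0 w *m covder j w - covder j w *m B0 w)
  oV sp (smx_sub (fun w Vw => OU (VO Vw)) (smxB oU (smxD oU (smx_dzb oU sX) (smx_mul oU sB0 sX)) (smx_mul oU sX sB0)))
  rkp (fun w Vw => IH w Vw).
have dp := smx_dif oV sp Vz; have [dpc eE _] := dif_mul dp (smx_dif oV sc Vz).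
have [f1 g1 _] := dif_mul dB dX; have [f2 g2 _] := dif_mul dX dB.
have [f1' g1' _] := dif_scale (-1) f1.
have [f3 g3 _] := dif_add dpc f1'; have [f4 g4 _] := dif_add f3 f2.
have cE3 w : V w -> p w *m c w + -1 *: (B0 w *m covder j w) + covder j w *m B0 w = dzb (covder j) w.
  by move=> Vw; rewrite scaleN1r -cE2 //; move: (dzb _ _) (B0 w *m _) (_ *m B0 w) => x y t; apply/matrixP => a b; rewrite !mxE; ring.
have [_ F1 _] := dif_eq oV Vz cE3 f4.
move: F1; rewrite g4 g3 g1' g1 g2 eE scaleN1r => F1.
have [a ha] := dz_spanmx Vz.
have [cX hX] := span_covder (spanp Vz) j.
have [c0 h0] := span_covder (spanp Vz) 0%N.
have dXE : dzb (covder j) z = p z *m c z - B0 z *m covder j z + covder j z *m B0 z.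
  by rewrite -cE3 // scaleN1r.
have X2 := (covder_lpr j Uz).2.
have BX : l *m (B1 z *m covder j z) = B1 z *m covder j z.
  have pB : B1 z *m l + l *m B1 z = B1 z.
    by rewrite (cB1 Uz) -[l](@lpr_conj R m) -!map_mxM -map_mxD (p1 Uz).
  by rewrite -{2}pB mulmxDl -mulmxA X2 mulmx0 add0r mulmxA.
have RX : (A1 z *m B1 z - B1 z *m A1 z) *m covder j z = p z *m (c0 *m (B1 z *m covder j z)).
  rewrite mulmxBl -(mulmxA (B1 z)) A1_covder ?mulmx0 ?subr0; last exact: VO.
  by rewrite -mulmxA -{1}BX (mulmxA (A1 z)) -[A1 z *m l]/(covder 0 z) h0 -(mulmxA (p z)).
have dE : dz p z *m c z + p z *m dz c z + A0 z *m (p z *m c z) = p z *m (a *m c z + dz c z).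
  by rewrite mulmxDr (mulmxA (p z) a) -ha mulmxDl -(mulmxA (A0 z)) addrAC.
have K := curvature_commute (dz p z *m c z + p z *m dz c z) (dz (covder j) z) dXE (fl0 Uz).
exists (a *m c z + dz c z - c z *m A0 z + c0 *m (B1 z *m covder j z) - cX *m (A1 z *m B1 z - B1 z *m A1 z)).
have cS : covder j.+1 z = dz (covder j) z + A0 z *m covder j z - covder j z *m A0 z by [].
have XR : covder j z *m (A1 z *m B1 z - B1 z *m A1 z) = p z *m (cX *m (A1 z *m B1 z - B1 z *m A1 z)).
  by rewrite {1}hX (mulmxA (p z)).
have EA : p z *m c z *m A0 z = p z *m (c z *m A0 z) by rewrite (mulmxA (p z)).
rewrite E1 F1 cS K dE RX XR EA; move: (A1 z *m B1 z - B1 z *m A1 z) (a *m c z + dz c z) => x1 x2.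
move: (c0 *m _) (c z *m _) (cX *m _) => x3 x4 x5.
by rewrite (mulmxBr (p z) (x2 - x4 + x3)) (mulmxDr (p z) (x2 - x4)) (mulmxBr (p z) x2).
Qed.

Lemma dzb_spanmx z : V z -> exists B, dzb p z + B0 z *m p z = p z *m B.
Proof.
move=> Vz; have Uz := OU (VO Vz); apply: span_col => b.
have dp := smx_dif oV sp Vz.
have [de _ ee] := dif_cst z (delta_mx b 0 : 'cV[C]_r).
have [dpe _ E] := dif_mul dp de.
have [_ _ F] := dif_eq oV Vz (fun w _ => spanmx_col b w) dpe.
move: E; rewrite ee mulmx0 addr0 => E.
have dX := smx_dif oU (covder_smx (idx b %/ n)) Uz.
have [dk _ ek] := dif_cst z (delta_mx (inord (idx b %% n)) 0 : 'cV[C]_n).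
have [_ _ G] := dif_mul dX dk; move: G; rewrite ek mulmx0 addr0 => G.
have [c1 h1] := dzb_covder (idx b %/ n) Vz; have [c2 h2] := span_covder (spanp Vz) (idx b %/ n)%N.
rewrite mulmxDl -mulmxA spanmx_col -E -F /covcol {1}G mulmxA -mulmxDl.
have -> : dzb (covder (idx b %/ n)) z + B0 z *m covder (idx b %/ n) z = p z *m (c1 + c2 *m B0 z).
  by rewrite mulmxDr (mulmxA (p z)) -h1 -h2 subrK.
by exists ((c1 + c2 *m B0 z) *m delta_mx (inord (idx b %% n)) 0); rewrite mulmxA.
Qed.

Lemma lpr_spanmx z : V z -> l *m p z = 0.
Proof.
move=> Vz; have Uz := OU (VO Vz).
apply/matrixP => a b; have /matrixP/(_ a 0) : l *m (p z *m delta_mx b (0 : 'I_1)) = 0.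
  by rewrite spanmx_col /covcol (mulmxA l) (covder_lpr _ Uz).2 mul0mx.
by rewrite mulmxA -colE !mxE.
Qed.

Lemma spanmx_iso z : V z -> (p z)^T *m p z = 0.
Proof.
move=> Vz; apply/matrixP => a b.
have /matrixP/(_ 0 0) : (p z *m delta_mx a (0 : 'I_1))^T *m (p z *m delta_mx b (0 : 'I_1)) = 0.
  rewrite !spanmx_col /covcol trmx_mul -mulmxA (mulmxA _ (covder _ _)) (iso (VO Vz)).
  by rewrite mul0mx mulmx0.
rewrite trmx_mul -mulmxA (mulmxA _ (p z)) trmx_delta.
by move: ((p z)^T *m p z) => M; rewrite -rowE -colE !mxE.
Qed.

(* The orthogonal projection onto the conjugate of the span of [p]. *)
Definition conjproj z : mat :=
  cj (p z) *m invmx ((p z)^T *m cj (p z)) *m (p z)^T.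
Local Notation P := conjproj.
Local Notation gram z := ((p z)^T *m cj (p z)).

Lemma gram_inv z : V z -> invmx (gram z) *m gram z = 1%:M.
Proof.
move=> Vz; rewrite mulVmx //.
have -> : gram z = (hadj (p z) *m p z)^T by rewrite trmx_mul /hadj trmxK.
by rewrite unitmx_tr gram_unit rkp.
Qed.

Lemma cj_mul a b c (X : 'M[C]_(a, b)) (X' : 'M[C]_(b, c)) : cj (X *m X') = cj X *m cj X'.
Proof. exact: map_mxM. Qed.

Lemma skew_conj (X : mat) : X^T *m J + J *m X = 0 -> (cj X)^T *m J + J *m cj X = 0.
Proof.
by move=> /(congr1 cj); rewrite map_mxD !map_mxM Jmx_conj map_mx0 map_trmx.
Qed.

Lemma skew_fix q (A : mat) (x : 'M[C]_(n, q)) : A^T *m J + J *m A = 0 -> l *m A = A *m l -> l *m x = 0 ->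
  x^T *m A^T = - (x^T *m A).
Proof.
move=> /eqP sk lA lx.
have /eqP AT : A^T == - (J *m A *m J).
  move: sk; rewrite addr_eq0 => /eqP /(congr1 (mulmx^~ J)).
  by rewrite -mulmxA Jmx2 mulmx1 mulNmx => ->.
have xJ : x^T *m J = x^T by rewrite -{1}Jmx_tr -trmx_mul (Jmx_fix lx).
have y0 : l *m (x^T *m A)^T = 0.
  by rewrite -{1}lpr_tr -trmx_mul -mulmxA -lA mulmxA -{1}lpr_tr -trmx_mul lx trmx0 mul0mx trmx0.
rewrite AT mulmxN !mulmxA xJ; congr (- _).
by apply: trmx_inj; rewrite trmx_mul Jmx_tr (Jmx_fix y0).
Qed.

Lemma conjproj_smx : smx V P.
Proof.
have sg : smx V (fun z => gram z) by apply: (smx_mul oV); [exact: (smx_tr sp)|exact: (smx_conj oV sp)].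
apply: (smx_mul oV); last exact: (smx_tr sp).
apply: (smx_mul oV); first exact: (smx_conj oV sp).
apply: (smx_invmx oV) sg => z Vz; have /mulmx1_unit[_ //] := gram_inv Vz.
Qed.

Lemma conjproj_parallel z : V z -> dz P z = P z *m A0 z - A0 z *m P z /\ dzb P z = P z *m B0 z - B0 z *m P z.
Proof.
move=> Vz; have Uz := OU (VO Vz).
have [A EA] := dz_spanmx Vz; have [B EB] := dzb_spanmx Vz.
have lp := lpr_spanmx Vz.
have sg : smx V (fun z => gram z) by apply: (smx_mul oV); [exact: (smx_tr sp)|exact: (smx_conj oV sp)].
have ug w : V w -> gram w \in unitmx by move=> /gram_inv/mulmx1_unit[].
have sW := smx_invmx oV ug sg.
have [dq q1 q2] := dif_conj (smx_dif oV sp Vz); have [dt t1 t2] := dif_tr (smx_dif oV sp Vz).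
have dW := smx_dif oV sW Vz.
have [dg g1 g2] := dif_mul dt dq.
have [dWg w1 w2] := dif_mul dW dg.
have [d1 i1 i2] := dif_cst z (1%:M : 'M[C]_r).
have [_ j1' j2'] := dif_eq oV Vz (fun w Vw => esym (gram_inv Vw)) d1.
have [dqW e1 e2] := dif_mul dq dW; have [dP f1 f2] := dif_mul dqW dt.
have AT (X : mat) : X^T *m J + J *m X = 0 -> l *m X = X *m l -> (p z)^T *m X^T = - ((p z)^T *m X).
  by move=> sX lX; exact: (skew_fix sX lX lp).
have sB : (B0 z)^T *m J + J *m B0 z = 0.
  by rewrite (cB0 Uz); exact: (skew_conj (j0 Uz)).
have Ep : dz p z = p z *m A - A0 z *m p z by rewrite -EA addrK.
have Epb : dzb p z = p z *m B - B0 z *m p z by rewrite -EB addrK.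
have cBB : cj (B0 z) = A0 z by rewrite (cB0 Uz); apply/matrixP => a b; rewrite !mxE conjCK.
split.
  rewrite /P {1}f1 {1}e1; apply: (projection_deriv (a := cj B) (b := A^T) (gram_inv Vz)).
  - by rewrite -g1 -w1 j1' i1.
  - rewrite q1 Epb map_mxB (cj_mul (p z) B) (cj_mul (B0 z)) cBB; reflexivity.
  - by rewrite t1 Ep linearB /= !trmx_mul (AT _ (j0 Uz) (k0 Uz)) opprK.
rewrite /P {1}f2 {1}e2; apply: (projection_deriv (a := cj A) (b := B^T) (gram_inv Vz)).
- by rewrite -g2 -w2 j2' i2.
- rewrite q2 Ep map_mxB (cj_mul (p z) A) (cj_mul (A0 z)) -(cB0 Uz); reflexivity.
- by rewrite t2 Epb linearB /= !trmx_mul (AT _ sB (k0B Uz)) opprK.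
Qed.

Lemma conjproj_lpr z : V z -> [/\ P z *m l = 0, l *m P z = 0 & P z *m P z = P z].
Proof.
move=> Vz; have lp := lpr_spanmx Vz.
have lq : l *m cj (p z) = 0 by rewrite -[l](@lpr_conj R m) -map_mxM lp map_mx0.
split; rewrite /P.
- by rewrite -(mulmxA _ _ l) -{1}[l](lpr_tr R m) -trmx_mul lp trmx0 mulmx0.
- by rewrite !mulmxA lq !mul0mx.
rewrite !mulmxA -(mulmxA (cj (p z) *m _) (p z)^T) -(mulmxA (cj (p z)) _ (gram z)) (gram_inv Vz) mulmx1.
by [].
Qed.

Lemma conjproj_A1 z : V z -> [/\ P z *m A1 z = 0, l *m A1 z = A1 z *m P z, P z *m B1 z = B1 z *m l & B1 z *m P z = 0].
Proof.
move=> Vz; have Uz := OU (VO Vz); have lp := lpr_spanmx Vz; have pp := spanmx_iso Vz.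
have [Pl lP PP] := conjproj_lpr Vz.
have [c0 h0] := span_covder (spanp Vz) 0%N; rewrite /covder /= in h0.
have Pp : P z *m p z = 0 by rewrite /P -mulmxA pp mulmx0.
have Pq : P z *m cj (p z) = cj (p z) by rewrite /P -!mulmxA (gram_inv Vz) mulmx1.
have tP : (p z)^T *m P z = (p z)^T.
  have /mulmx1C g := gram_inv Vz.
  by rewrite /P !mulmxA g mul1mx.
have qtP : (cj (p z))^T *m P z = 0.
  by rewrite /P !mulmxA map_trmx -map_mxM pp map_mx0 !mul0mx.
have E : (A1 z)^T = - (J *m A1 z *m J).
  move/eqP: (j1 Uz); rewrite addr_eq0 => /eqP /(congr1 (mulmx^~ J)).
  by rewrite -mulmxA Jmx2 mulmx1 mulNmx.
have lA : l *m A1 z = - (J *m c0^T *m (p z)^T).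
  have tJ : (p z)^T *m J = (p z)^T by rewrite -{1}[J](@Jmx_tr R n) -trmx_mul Jmx_fix.
  have F : A1 z = - (J *m (A1 z)^T *m J).
    by rewrite E mulmxN mulNmx opprK !mulmxA Jmx2 mul1mx -mulmxA Jmx2 mulmx1.
  rewrite {1}F mulmxN !mulmxA -Jmx_lpr -(mulmxA J l) -{1}[l](lpr_tr R m) -trmx_mul h0 trmx_mul.
  by rewrite -!mulmxA tJ.
have B1l : B1 z *m l = cj (p z) *m cj c0 by rewrite (cB1 Uz) -[l](@lpr_conj R m) -!map_mxM h0.
have lB : l *m B1 z = - (J *m (cj c0)^T *m (cj (p z))^T).
  by rewrite (cB1 Uz) -{1}[l](@lpr_conj R m) -map_mxM lA map_mxN !map_mxM Jmx_conj !map_trmx.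
have pB : B1 z *m l + l *m B1 z = B1 z.
  by rewrite (cB1 Uz) -[l](@lpr_conj R m) -!map_mxM -map_mxD (p1 Uz).
split.
- by rewrite -(p1 Uz) mulmxDr h0 !mulmxA Pp Pl !mul0mx addr0.
- by rewrite -{2}(p1 Uz) mulmxDl -(mulmxA (A1 z)) lP mulmx0 add0r lA mulNmx -(mulmxA _ _ (P z)) tP.
- by rewrite -{1}pB mulmxDr (mulmxA _ l) Pl mul0mx addr0 B1l mulmxA Pq.
- by rewrite -pB mulmxDl -mulmxA lP mulmx0 add0r lB mulNmx -(mulmxA _ _ (P z)) qtP mulmx0 oppr0.
Qed.

End Generic.
End ParallelSpan.

Section ExtendedFrame.
Variables (R : realType) (m : nat).
Local Notation C := (cplx R).
Local Notation n := (2 + m * 2)%N.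
Local Notation mat := 'M[C]_n.
Local Notation l := (lpr R m).
Local Notation J := (Jmx R n).
Local Notation cj := (map_mx Num.conj).
Variables (U : set C) (F : C -> mat) (Fl : C -> C -> mat).
Variables (oU : open U) (sF : smx U F).
Variable hF : forall z, U z -> in_SOplus (F z).
Variable hext : extended_frame U F Fl.

Definition mc0 z : mat := kpart (invmx (F z) *m dz F z).
Definition mc1 z : mat := ppart (invmx (F z) *m dz F z).
Definition mcb0 z : mat := kpart (invmx (F z) *m dzb F z).
Definition mcb1 z : mat := ppart (invmx (F z) *m dzb F z).

Lemma SOplus_unit (A : mat) : in_SOplus A -> A \in unitmx.
Proof. by case=> _ /Jinv_unit. Qed.

Lemma kpart_ppart (A : mat) : ppart A + kpart A = A.
Proof.
rewrite /kpart /ppart; move: (sigma A) => B; apply/matrixP => a b; rewrite !mxE.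
have two : (2 : C) != 0 by rewrite pnatr_eq0.
by field.
Qed.

Lemma smx_sigma V (A : C -> mat) : open V -> smx V A -> smx V (fun z => sigma (A z)).
Proof. by move=> oV sA; apply: (smx_mul oV (smx_mul oV (smx_cst oV _) sA) (smx_cst oV _)). Qed.

Lemma smx_kpart V (A : C -> mat) : open V -> smx V A -> smx V (fun z => kpart (A z)).
Proof.
move=> oV sA; apply: (smxZ (a := fun=> 2^-1) oV); first by move=> k; exact: sCk_cst.
exact: (smxD oV sA (smx_sigma oV sA)).
Qed.

Lemma smx_ppart V (A : C -> mat) : open V -> smx V A -> smx V (fun z => ppart (A z)).
Proof.
move=> oV sA; apply: (smxZ (a := fun=> 2^-1) oV); first by move=> k; exact: sCk_cst.
exact: (smxB oV sA (smx_sigma oV sA)).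
Qed.

Lemma smx_mc : smx U (fun z => invmx (F z) *m dz F z) /\ smx U (fun z => invmx (F z) *m dzb F z).
Proof.
have sI := smx_invmx oU (fun w Uw => SOplus_unit (hF Uw)) sF.
by split; apply: (smx_mul oU sI); [exact: smx_dz|exact: smx_dzb].
Qed.

Lemma mc_smx : [/\ smx U mc0, smx U mc1, smx U mcb0 & smx U mcb1].
Proof.
have [s1 s2] := smx_mc.
by split; [exact: smx_kpart|exact: smx_ppart|exact: smx_kpart|exact: smx_ppart].
Qed.

Lemma conj_sigma (A : mat) : cj (sigma A) = sigma (cj A).
Proof.
by rewrite /sigma !map_mxM map_block_mx map_mxN !map_mx0 !map_mx1.
Qed.

Lemma conj_kpart (A : mat) : cj (kpart A) = kpart (cj A).
Proof. by rewrite /kpart map_mxZ map_mxD conj_sigma fmorphV rmorph_nat. Qed.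

Lemma conj_ppart (A : mat) : cj (ppart A) = ppart (cj A).
Proof. by rewrite /ppart map_mxZ map_mxB conj_sigma fmorphV rmorph_nat. Qed.

Lemma mc_conj z : U z -> mcb0 z = cj (mc0 z) /\ mcb1 z = cj (mc1 z).
Proof.
move=> Uz; have [_ _ E] := dif_conj (smx_dif oU sF Uz).
have [dc _ _] := dif_conj (smx_dif oU sF Uz).
have rF w : U w -> cj (F w) = F w by case/hF.
have [_ _ E2] := dif_eq oU Uz rF dc.
have E3 : cj (invmx (F z) *m dz F z) = invmx (F z) *m dzb F z.
  by rewrite map_mxM map_invmx (rF z Uz) E2 E.
by split; rewrite /mcb0 /mcb1 /mc0 /mc1 ?conj_kpart ?conj_ppart E3.
Qed.

Lemma skew_sigma (A : mat) : A^T *m J + J *m A = 0 -> (sigma A)^T *m J + J *m sigma A = 0.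
Proof.
rewrite /sigma -/(smat R m); have Js : smat R m *m J = J *m smat R m.
  by rewrite smatE mulmxBl mulmxBr mul1mx mulmx1 -scalemxAl -scalemxAr Jmx_lpr.
have ts : (smat R m)^T = smat R m by rewrite smatE linearB linearZ /= trmx1 lpr_tr.
move: (smat R m) Js ts => t Js ts E.
have -> : (t *m A *m t)^T *m J + J *m (t *m A *m t) = t *m (A^T *m J + J *m A) *m t.
  rewrite !trmx_mul ts mulmxDr mulmxDl; congr (_ + _); first by rewrite -!mulmxA Js.
  by rewrite !mulmxA -Js.
by rewrite E mulmx0 mul0mx.
Qed.

Lemma skew_parts (A : mat) : A^T *m J + J *m A = 0 ->
  (kpart A)^T *m J + J *m kpart A = 0 /\ (ppart A)^T *m J + J *m ppart A = 0.
Proof.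
move=> sA; have sS := skew_sigma sA; rewrite /kpart /ppart.
split; rewrite linearZ /= -scalemxAl -scalemxAr -scalerDr; apply/eqP; rewrite scaler_eq0; apply/orP; right; apply/eqP.
  by rewrite linearD /= mulmxDl mulmxDr addrACA sA sS addr0.
by rewrite linearB /= mulmxBl mulmxBr addrACA -opprD sA sS subr0.
Qed.

Lemma log_skew (V : set C) (f : C -> mat) z : open V -> V z -> dif f z ->
  (forall w, V w -> (f w)^T *m J *m f w = J) ->
  (invmx (f z) *m dz f z)^T *m J + J *m (invmx (f z) *m dz f z) = 0.
Proof.
move=> oV Vz df fJ; have [dT t1 _] := dif_tr df.
have [dJ j1 _] := dif_cst z J.
have [d1 e1 _] := dif_mul dT dJ; have [d2 e2 _] := dif_mul d1 df.
have [_ E _] := dif_eq oV Vz (fun w Vw => esym (fJ w Vw)) dJ.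
have u := Jinv_unit (fJ z Vz).
move: E; rewrite e2 e1 t1 j1 mulmx0 addr0.
have dE : dz f z = f z *m (invmx (f z) *m dz f z) by rewrite mulKVmx.
move: dE; move: (invmx (f z) *m dz f z) => X ->.
rewrite trmx_mul -(mulmxA X^T) -(mulmxA X^T) (fJ z Vz) (mulmxA _ (f z) X) (fJ z Vz) => E.
exact: E.
Qed.

Lemma mc_skew z : U z -> (mc0 z)^T *m J + J *m mc0 z = 0 /\ (mc1 z)^T *m J + J *m mc1 z = 0.
Proof.
move=> Uz; apply: skew_parts; apply: (log_skew oU Uz (smx_dif oU sF Uz)) => w Uw.
by have [_ -> _ _] := hF Uw.
Qed.

Lemma ext_deriv (x : C) z : `|x| = 1 -> U z ->
  [/\ Fl x z \in unitmx, dz (Fl x) z = Fl x z *m (x^-1 *: mc1 z + mc0 z)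
    & dzb (Fl x) z = Fl x z *m (mcb0 z + x *: mcb1 z)].
Proof.
move=> x1 Uz; have [_ _ /(_ z Uz)[/SOplus_unit u e1 e2]] := hext x1.
by split=> //; [rewrite -[dz _ _](mulKVmx u) e1|rewrite -[dzb _ _](mulKVmx u) e2].
Qed.

Lemma mc_flat z : U z ->
  dzb mc1 z = mc1 z *m mcb0 z - mcb0 z *m mc1 z /\
  dz mcb0 z - dzb mc0 z + (mc0 z *m mcb0 z - mcb0 z *m mc0 z) + (mc1 z *m mcb1 z - mcb1 z *m mc1 z) = 0.
Proof.
move=> Uz; have [s0 s1 sb0 sb1] := mc_smx.
have d0 := smx_dif oU s0 Uz; have d1 := smx_dif oU s1 Uz.
have db0 := smx_dif oU sb0 Uz; have db1 := smx_dif oU sb1 Uz.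
have [] := @loop_coeff R n n (mc1 z *m mcb0 z - mcb0 z *m mc1 z - dzb mc1 z)
  (dz mcb0 z - dzb mc0 z + (mc0 z *m mcb0 z - mcb0 z *m mc0 z) + (mc1 z *m mcb1 z - mcb1 z *m mc1 z))
  (mc0 z *m mcb1 z - mcb1 z *m mc0 z + dz mcb1 z).
  move=> x x1.
  have [/(smoothP _ oU) sFl _ _] := hext x1.
  have cst (c : C) k : sCk k U (fun=> c) by exact: sCk_cst.
  have sA : smx U (fun w => x^-1 *: mc1 w + mc0 w).
    exact: (smxD oU (smxZ (a := fun=> x^-1) oU (cst _) s1) s0).
  have sB : smx U (fun w => mcb0 w + x *: mcb1 w).
    exact: (smxD oU sb0 (smxZ (a := fun=> x) oU (cst _) sb1)).
  have E := zero_curvature oU Uz sFl sA sB (fun w Uw => ext_deriv x1 Uw).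
  have [f1 _ g1] := dif_scale x^-1 d1; have [f2 _ g2] := dif_add f1 d0.
  have [f3 g3 _] := dif_scale x db1; have [f4 g4 _] := dif_add db0 f3.
  move: E; rewrite g2 g1 g4 g3 => E.
  have x0 : x != 0 by rewrite -normr_gt0 x1.
  move: E; move: (dz mcb0 z) (dz mcb1 z) (dzb mc0 z) (dzb mc1 z) => a1 a2 a3 a4.
  move: (mc0 z) (mc1 z) (mcb0 z) (mcb1 z) => b1 b2 b3 b4 /eqP; rewrite -subr_eq0 => /eqP <-.
  mx_expand; rewrite -!(scalemxAl, scalemxAr).
  repeat (let t := fresh "t" in set t := (_ *m _); clearbody t).
  by apply/matrixP => ? ?; rewrite !mxE; field.
by move=> /eqP + -> _; rewrite subr_eq0 => /eqP <-.
Qed.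

Lemma tau_inv (P : mat) (x : C) : x != 0 -> P *m l = 0 -> l *m P = 0 -> P *m P = P -> tau x P *m tau x^-1 P = 1%:M.
Proof.
move=> x0 Pl lP PP; rewrite /tau; have ll := lpr_idem R m; move: (lpr R m) Pl lP ll => t Pt tP tt.
mx_expand; rewrite !(mulmx1, mul1mx) -!(scalemxAl, scalemxAr) PP Pt tP tt !scaler0.
by apply/matrixP => a b; rewrite !mxE; field.
Qed.

Lemma dressing_deriv (P : C -> mat) (x : C) (V : set C) w : open V -> V w -> V `<=` U -> `|x| = 1 -> smx V P ->
  (dz P w = P w *m mc0 w - mc0 w *m P w /\ dzb P w = P w *m mcb0 w - mcb0 w *m P w) ->
  [/\ P w *m mc1 w = 0, l *m mc1 w = mc1 w *m P w, P w *m mcb1 w = mcb1 w *m l & mcb1 w *m P w = 0] ->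
  let Psi := fun w => Fl x w *m tau x (P w) *m invmx (Fl 1 w) in
  [/\ dif Psi w, dz Psi w = 0 & dzb Psi w = 0].
Proof.
move=> oV Vw VU x1 sP [P1 P2] [h1 h2 h3 h4] Psi; have Uw := VU w Vw.
have x0 : x != 0 by rewrite -normr_gt0 x1.
have [sFx _ _] := hext x1; have [sF1 _ _] := hext (normr1 _).
move/(smoothP _ oU) in sFx; move/(smoothP _ oU) in sF1.
have [ux e1 e2] := ext_deriv x1 Uw.
have [u1 e3 e4] := ext_deriv (normr1 _) Uw.
have si : smx U (fun w => invmx (Fl 1 w)).
  by apply: (smx_invmx oU) sF1 => y Uy; have [] := ext_deriv (normr1 _) Uy.
have di := smx_dif oU si Uw.
have [dI i1 i2] := dif_mul di (smx_dif oU sF1 Uw).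
have [dc c1 c2] := dif_cst w (1%:M : mat).
have iF y : U y -> 1%:M = invmx (Fl 1 y) *m Fl 1 y.
  by move=> Uy; have [uy _ _] := ext_deriv (normr1 _) Uy; rewrite mulVmx.
have [_ j1 j2] := dif_eq oU Uw iF dc.
have Ei (d g : mat) : 0 = d *m Fl 1 w + invmx (Fl 1 w) *m (Fl 1 w *m g) -> d = - g *m invmx (Fl 1 w).
  rewrite (mulKmx u1) => /esym/eqP; rewrite addr_eq0 => /eqP /(congr1 (mulmx^~ (invmx (Fl 1 w)))).
  by rewrite mulmxK.
have k1 : dz (fun w => invmx (Fl 1 w)) w = - (mc1 w + mc0 w) *m invmx (Fl 1 w).
  apply: Ei; rewrite -c1 -j1 i1 e3 invr1 scale1r; reflexivity.
have k2 : dzb (fun w => invmx (Fl 1 w)) w = - (mcb0 w + mcb1 w) *m invmx (Fl 1 w).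
  apply: Ei; rewrite -c2 -j2 i2 e4 scale1r; reflexivity.
have [dt1 t1 t1'] := dif_cst w (1%:M + (x - 1) *: l).
have [dt2 t2 t2'] := dif_scale (x ^+ 2 - 1) (smx_dif oV sP Vw).
have [dt t3 t3'] := dif_add dt1 dt2.
have [dFt f1 f1'] := dif_mul (smx_dif oU sFx Uw) dt.
have [dPsi f2 f2'] := dif_mul dFt di.
have lA z : l *m mc0 z = mc0 z *m l := sigma_kpart _.
have lB z : l *m mcb0 z = mcb0 z *m l := sigma_kpart _.
have pA z : mc1 z *m l + l *m mc1 z = mc1 z := sigma_ppart _.
have pB z : mcb1 z *m l + l *m mcb1 z = mcb1 z := sigma_ppart _.
have alg (f A d t g h : mat) : A *m t + d = t *m g -> (f *m A *m t + f *m d) *m h + f *m t *m (- g *m h) = 0.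
  move=> E; have -> : f *m A *m t + f *m d = f *m (A *m t + d) by rewrite mulmxDr mulmxA.
  by rewrite E; mx_expand; rewrite subrr.
split; first exact: dPsi.
  have := tau_deriv x0 (lA w) (pA w) h2 h1; rewrite -P1 => T.
  rewrite /Psi /tau; apply: (etrans f2).
  rewrite f1 t3 t1 add0r t2 e1 k1; apply: alg; exact: T.
have := tau_derivb x (lB w) (pB w) h3 h4; rewrite -P2 => T.
rewrite /Psi /tau; apply: (etrans f2').
rewrite f1' t3' t1' add0r t2' e2 k2; apply: alg; exact: T.
Qed.

Lemma dressing (O : set C) : open O -> O !=set0 -> O `<=` U ->
  (forall z, O z -> forall i j, (covder mc0 mc1 i z)^T *m covder mc0 mc1 j z = 0) ->
  exists (z1 : C) (r : R) (P D : C -> mat),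
  [/\ 0 < r, forall w, cabs (w - z1) < r -> O w,
     forall w x, cabs (w - z1) < r -> `|x| = 1 ->
       Jinv (Fl x w) *m Fl x z1 = tau x (P w) *m D w *m tau x^-1 (P z1),
     P z1 *m smat R m = P z1
   & forall w0 : 'cV[C]_n, (forall j, (covder mc0 mc1 j z1)^T *m w0 = 0) -> P z1 *m w0 = 0].
Proof.
move=> oO O0 OU iso.
have [s0 s1 sb0 sb1] := mc_smx.
have cB0 z : U z -> mcb0 z = cj (mc0 z) by move=> /mc_conj[].
have cB1 z : U z -> mcb1 z = cj (mc1 z) by move=> /mc_conj[].
have lA z : U z -> l *m mc0 z = mc0 z *m l by move=> _; exact: sigma_kpart.
have pA z : U z -> mc1 z *m l + l *m mc1 z = mc1 z by move=> _; exact: sigma_ppart.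
have j0 z : U z -> (mc0 z)^T *m J + J *m mc0 z = 0 by move=> /mc_skew[].
have j1 z : U z -> (mc1 z)^T *m J + J *m mc1 z = 0 by move=> /mc_skew[].
have f1 z : U z -> dzb mc1 z = mc1 z *m mcb0 z - mcb0 z *m mc1 z by move=> /mc_flat[].
have f0 z : U z -> dz mcb0 z - dzb mc0 z + (mc0 z *m mcb0 z - mcb0 z *m mc0 z) + (mc1 z *m mcb1 z - mcb1 z *m mc1 z) = 0.
  by move=> /mc_flat[].
have sv i : smx O (covcol mc0 mc1 i) := smx_sub OU (covcol_smx oU s0 s1 i).
have [r [idx [V [oV [z1 Vz1] VO sp H]]]] := generic_span oO O0 sv.
pose P := conjproj mc0 mc1 idx.
have rk z : V z -> \rank (spanmx mc0 mc1 idx z) = r by move=> /H[].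
have spn z : V z -> forall i, exists c, covcol mc0 mc1 i z = spanmx mc0 mc1 idx z *m c by move=> /H[].
have VU : V `<=` U by move=> z /VO/OU.
have [d d0 Hd] : exists2 d : R, 0 < d & forall w, cabs (w - z1) < d -> V w by move/open_cabsP : oV; exact.
have sP : smx V P := conjproj_smx oV sp rk.
have par z (Vz : V z) := conjproj_parallel oU s0 s1 cB0 cB1 lA pA j0 j1 f1 f0 OU iso oV VO sp rk spn Vz.
have alg z (Vz : V z) := conjproj_A1 oU s0 s1 cB1 lA pA j1 OU iso VO rk spn Vz.
have Pl z (Vz : V z) := conjproj_lpr oU s0 s1 lA pA OU VO rk Vz.
have key x w : `|x| = 1 -> cabs (w - z1) < d ->
    Fl x w *m tau x (P w) *m invmx (Fl 1 w) = Fl x z1 *m tau x (P z1) *m invmx (Fl 1 z1).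
  move=> x1; apply: (dz0_cst (f := fun w => Fl x w *m tau x (P w) *m invmx (Fl 1 w))) => {}w wd.
  exact: (dressing_deriv oV (Hd w wd) VU x1 sP (par w (Hd w wd)) (alg w (Hd w wd))).
exists z1, d, P, (fun w => invmx (Fl 1 w) *m Fl 1 z1); split=> //.
- by move=> w /Hd/VO.
- move=> w x wd x1; have Uw := VU w (Hd w wd); have Uz := VU z1 Vz1.
  have x0 : x != 0 by rewrite -normr_gt0 x1.
  have [_ _ /(_ w Uw)[[_ SJ _ _] _ _]] := hext x1.
  have [u1 _ _] := ext_deriv (normr1 _) Uz; have [uz _ _] := ext_deriv x1 Uz.
  have [a1 a2 a3] := Pl z1 Vz1; have ti := tau_inv x0 a1 a2 a3.
  have E := key x w x1 wd.
  have {}E : tau x (P w) *m invmx (Fl 1 w) = Jinv (Fl x w) *m (Fl x z1 *m tau x (P z1) *m invmx (Fl 1 z1)).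
    by rewrite -E !mulmxA (Jinv_mul SJ) mul1mx.
  rewrite (mulmxA (tau x (P w))) E -!mulmxA (mulKmx u1) ti mulmx1; exact: erefl.
- have [a1 a2 a3] := Pl z1 Vz1.
  by rewrite smatE mulmxBr mulmx1 -scalemxAr a1 scaler0 subr0.
move=> w0 H0; rewrite /P /conjproj -mulmxA.
suff -> : (spanmx mc0 mc1 idx z1)^T *m w0 = 0 by rewrite mulmx0.
apply/matrixP => a b; rewrite [b]ord1.
have : (spanmx mc0 mc1 idx z1 *m delta_mx a (0 : 'I_1))^T *m w0 = 0.
  by rewrite spanmx_col /covcol trmx_mul -mulmxA H0 mulmx0.
rewrite trmx_mul -mulmxA trmx_delta; move: (_^T *m w0) => M /matrixP/(_ 0 0).
by rewrite -rowE !mxE.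
Qed.

End ExtendedFrame.

(** * Geometry of the surface *)

Section InnerProduct.
Variables (R : realType) (n : nat).
Local Notation C := (cplx R).
Local Notation vec := 'cV[C]_n.
Local Notation J := (Jmx R n).
Local Notation cj := (map_mx Num.conj).
Implicit Types (x y w : vec) (c : C).

Lemma ipE x w : x^T *m J *m w = (ip x w)%:M.
Proof. by apply/matrixP => a b; rewrite [a]ord1 [b]ord1 /ip [RHS]mxE mulr1n. Qed.

Lemma ip_eq0 x w : x^T *m J *m w = 0 <-> ip x w = 0.
Proof.
split=> [E|E]; first by rewrite /ip E mxE.
by rewrite ipE E; apply/matrixP => a b; rewrite !mxE mul0rn.
Qed.

Lemma ipC x w : ip x w = ip w x.
Proof.
have : x^T *m J *m w = (w^T *m J *m x)^T by rewrite !trmx_mul trmxK Jmx_tr mulmxA.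
by move/matrixP/(_ 0 0); rewrite /ip => ->; rewrite mxE.
Qed.

Lemma ipDl x y w : ip (x + y) w = ip x w + ip y w.
Proof. by rewrite /ip linearD /= !mulmxDl mxE. Qed.

Lemma ipDr x y w : ip w (x + y) = ip w x + ip w y.
Proof. by rewrite /ip mulmxDr mxE. Qed.

Lemma ipZl c x w : ip (c *: x) w = c * ip x w.
Proof. by rewrite /ip linearZ /= -!scalemxAl mxE. Qed.

Lemma ipZr c x w : ip w (c *: x) = c * ip w x.
Proof. by rewrite /ip -!scalemxAr mxE. Qed.

Lemma ip_sumr (I : Type) (r : seq I) (Q : pred I) (f : I -> vec) w :
  ip w (\sum_(k <- r | Q k) f k) = \sum_(k <- r | Q k) ip w (f k).
Proof. by rewrite /ip mulmx_sumr summxE. Qed.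

Lemma ip_conj x w : ip (cj x) (cj w) = (ip x w)^*.
Proof.
by rewrite /ip map_trmx -{1}(@Jmx_conj R n) -!map_mxM mxE.
Qed.

Lemma ip_mx x w (A : 'M[C]_n) : A^T *m J *m A = J -> ip (A *m x) (A *m w) = ip x w.
Proof. by move=> E; rewrite /ip trmx_mul !mulmxA -(mulmxA _ A^T) -(mulmxA _ (A^T *m J)) E. Qed.

Lemma ip_add0 x y x' y' : x^T *m J *m y + x'^T *m J *m y' = 0 -> ip x y + ip x' y' = 0.
Proof. by move/matrixP/(_ 0 0); rewrite /ip; move: (_ *m y) (_ *m y') => a b; rewrite !mxE. Qed.

Lemma ip_half x y : ip y x + ip x y = 0 -> ip x y = 0.
Proof. by rewrite ipC -mulr2n => /eqP; rewrite mulrn_eq0 => /eqP. Qed.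

Lemma ip_deriv (O : set C) (f g : C -> vec) (c : C) : open O -> smx O f -> smx O g ->
  (forall z, O z -> ip (f z) (g z) = c) ->
  forall z, O z -> ip (dz f z) (g z) + ip (f z) (dz g z) = 0 /\ ip (dzb f z) (g z) + ip (f z) (dzb g z) = 0.
Proof.
move=> oO sf sg H z Oz.
have [dT t1 t2] := dif_tr (smx_dif oO sf Oz); have dg := smx_dif oO sg Oz.
have [dJ j1 j2] := dif_cst z J.
have [d1 e1 e2] := dif_mul dT dJ; have [d2 f1 f2] := dif_mul d1 dg.
have [dc c1 c2] := dif_cst z (c%:M : 'M[C]_1).
have E (u : C) : O u -> c%:M = (f u)^T *m J *m g u by move=> Ou; rewrite ipE H.
have [_ E1 E2] := dif_eq oO Oz E dc.
have alg (A B D : 'rV[C]_n) (K : 'M[C]_n) (g1 g2 : vec) (t : 'M[C]_1) :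
  t = A *m g1 + D *m g2 -> A = B *m J + (f z)^T *m K -> K = 0 -> t = 0 -> B *m J *m g1 + D *m g2 = 0.
  by move=> -> -> ->; rewrite mulmx0 addr0.
have F1 := alg _ _ _ _ _ _ _ f1 e1 j1 (etrans E1 c1).
have F2 := alg _ _ _ _ _ _ _ f2 e2 j2 (etrans E2 c2).
rewrite t1 in F1; rewrite t2 in F2.
split; [exact: (ip_add0 F1)|exact: (ip_add0 F2)].
Qed.

End InnerProduct.

Section Jets.
Variables (R : realType) (n : nat) (V : set (cplx R)) (I : Type) (phi : I -> cplx R -> 'cV[cplx R]_n).
Local Notation C := (cplx R).
Variables (oV : open V) (sphi : forall i, smx V (phi i)).

(* The module over the smooth functions generated by the [z]-derivatives of [phi]. *)
Inductive jets q : (C -> 'M[C]_(n, q)) -> Prop :=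
| jet_base i j (M : C -> 'M[C]_(1, q)) : smx V M -> jets (fun z => iter j (@dz R _) (phi i) z *m M z)
| jet_add f g : jets f -> jets g -> jets (fun z => f z + g z)
| jet_eq f g : (forall z, V z -> f z = g z) -> jets f -> jets g.

Lemma jets_smx q (f : C -> 'M[C]_(n, q)) : jets f -> smx V f.
Proof.
elim=> {f} [i j M sM|f g _ sf _ sg|f g E _ sf].
- by apply: (smx_mul oV) sM; exact: smx_iter_dz.
- exact: smxD.
- exact: smx_eq sf.
Qed.

Lemma jets_mul q r (f : C -> 'M[C]_(n, q)) (M : C -> 'M[C]_(q, r)) : smx V M -> jets f -> jets (fun z => f z *m M z).
Proof.
move=> sM; elim=> {f} [i j A sA|f g _ jf _ jg|f g E _ jf].
- apply: jet_eq (jet_base i j (smx_mul oV sA sM)) => z _; exact: mulmxA.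
- apply: jet_eq (jet_add jf jg) => z _; exact/esym/mulmxDl.
- by apply: jet_eq jf => z Vz; rewrite E.
Qed.

Lemma jets_dz q (f : C -> 'M[C]_(n, q)) : jets f -> jets (dz f).
Proof.
elim=> {f} [i j A sA|f g jf1 jf jg1 jg|f g E jf1 jf].
- apply: jet_eq (jet_add (jet_base i j.+1 sA) (jet_base i j (smx_dz oV sA))) => z Vz.
  have [_ e _] := dif_mul (smx_dif oV (smx_iter_dz oV j (sphi i)) Vz) (smx_dif oV sA Vz).
  exact: esym e.
- apply: jet_eq (jet_add jf jg) => z Vz.
  have [_ e _] := dif_add (smx_dif oV (jets_smx jf1) Vz) (smx_dif oV (jets_smx jg1) Vz).
  exact: esym e.
- apply: jet_eq jf => z Vz.
  have [_ e _] := dif_eq oV Vz E (smx_dif oV (jets_smx jf1) Vz).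
  exact: esym e.
Qed.

Lemma jets_iter q (f : C -> 'M[C]_(n, q)) j : jets f -> jets (iter j (@dz R _) f).
Proof. by move=> jf; elim: j => // j; exact: jets_dz. Qed.

Lemma jet_phi i j : jets (iter j (@dz R _) (phi i)).
Proof.
by apply: jet_eq (jet_base i j (smx_cst oV (1%:M : 'M[C]_1))) => z _; exact: mulmx1.
Qed.

Lemma jets_perp (w : C -> 'cV[C]_n) q (f : C -> 'M[C]_(n, q)) z : V z ->
  (forall i j, ip (w z) (iter j (@dz R _) (phi i) z) = 0) -> jets f -> (w z)^T *m Jmx R n *m f z = 0.
Proof.
move=> Vz H; elim=> {f} [i j A _|f g _ jf _ jg|f g E _ jf].
- by rewrite mulmxA (ip_eq0 _ _).2 ?mul0mx.
- by rewrite mulmxDr jf jg addr0.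
- by rewrite -E.
Qed.

End Jets.

Section SurfaceGeometry.
Variables (R : realType) (m : nat).
Local Notation C := (cplx R).
Local Notation n := (2 + m * 2)%N.
Local Notation vec := 'cV[C]_n.
Local Notation J := (Jmx R n).
Local Notation cj := (map_mx Num.conj).
Variables (O : set C) (Y N kappa : C -> vec) (s mu : C -> C) (E : 'I_m -> C -> vec).
Variables (oO : open O) (hY : canonical_lift Y O) (hN : is_N Y O N) (hk : hopf_schwarzian Y O kappa s).
Variables (hT : totally_isotropic Y O) (hE : H_frame Y O E).
Variable smu : forall k, sCk k O mu.
Variable ric : forall z, O z -> dz (mu : C -> C^o) z - mu z ^+ 2 / 2 - s z = 0.

Local Notation X := (dz (dzb Y)).
Local Notation T j := (iter j (@dz R _) Y).

Lemma sY : smx O Y.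
Proof. by apply/(smoothP _ oO); case: hY. Qed.

Lemma sT j : smx O (T j).
Proof. exact: (smx_iter_dz oO j sY). Qed.

Lemma sE k : smx O (E k).
Proof. by apply/(smoothP _ oO); exact: (H_smooth hE). Qed.

Lemma sX : smx O X.
Proof. exact: (smx_dz oO (smx_dzb oO sY)). Qed.

Lemma Y_real z : O z -> cj (Y z) = Y z /\ cj (dz Y z) = dzb Y z.
Proof.
move=> Oz; have rY w : O w -> cj (Y w) = Y w by move=> Ow; have [_ /(_ w Ow)[]] := hY.
split; first exact: rY.
have [d _ e] := dif_conj (smx_dif oO sY Oz).
by have [_ _ ->] := dif_eq oO Oz rY d.
Qed.

Lemma XE z : O z -> dzb (dz Y) z = X z.
Proof. by move=> Oz; rewrite (smx_dz_comm oO Oz sY). Qed.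

Lemma ip_YY z : O z -> ip (Y z) (Y z) = 0.
Proof. by move=> Oz; have [_ /(_ z Oz)[]] := hY. Qed.

Lemma ip_YYz z : O z -> ip (Y z) (dz Y z) = 0 /\ ip (Y z) (dzb Y z) = 0.
Proof.
move=> Oz; have [e1 e2] := ip_deriv oO sY sY ip_YY Oz.
by split; [exact: (ip_half e1)|exact: (ip_half e2)].
Qed.

Lemma ip_YzYz z : O z -> ip (dz Y z) (dz Y z) = 0 /\ ip (dzb Y z) (dzb Y z) = 0.
Proof.
move=> Oz; have e : ip (dz Y z) (dz Y z) = 0 := @hT 1 1 isT isT z Oz.
split; first exact: e.
by have [_ <-] := Y_real Oz; rewrite ip_conj e conjC0.
Qed.

Lemma ip_YzYzb z : O z -> ip (dz Y z) (dzb Y z) = 2^-1.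
Proof.
move=> Oz; have [_ /(_ z Oz)[_ _ _ /(_ 1)]] := hY.
have [-> _] := rderive_dz z Y; have [e1 e2] := ip_YzYz Oz.
move: (dz Y z) (dzb Y z) e1 e2 => a b e1 e2.
rewrite !(ipDl, ipDr) e1 e2 add0r addr0 normr1 expr1n (ipC b) -mulr2n => h.
have two : (2 : C) != 0 by rewrite pnatr_eq0.
by apply: (mulfI two); rewrite divff // mulr_natl h.
Qed.

Lemma ip_X z : O z -> [/\ ip (Y z) (X z) = - 2^-1, ip (dz Y z) (X z) = 0 & ip (dzb Y z) (X z) = 0].
Proof.
move=> Oz; have s1 := smx_dz oO sY; have s2 := smx_dzb oO sY.
have [_ e1] := ip_deriv oO sY s1 (fun w Ow => (ip_YYz Ow).1) Oz.
have [_ e2] := ip_deriv oO s1 s1 (fun w Ow => (ip_YzYz Ow).1) Oz.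
have [e3 _] := ip_deriv oO s2 s2 (fun w Ow => (ip_YzYz Ow).2) Oz.
rewrite (XE Oz) in e1 e2.
split.
- by move: e1; rewrite ipC (ip_YzYzb Oz) => /eqP; rewrite addrC addr_eq0 => /eqP.
- exact: (ip_half e2).
- exact: (ip_half e3).
Qed.

Lemma ip_TT j i z : O z -> ip (T j z) (T i z) = 0.
Proof.
have YT k w : O w -> ip (Y w) (T k.+1 w) = 0.
  elim: k w => [|k IH] w Ow; first exact: (ip_YYz Ow).1.
  have [e _] := ip_deriv oO sY (sT k.+1) IH Ow.
  have h : ip (dz Y w) (T k.+1 w) = 0 := @hT 1 k.+1 isT isT w Ow.
  by move: e; rewrite h add0r.
move=> Oz; case: j i => [|j] [|i]; first exact: ip_YY.
- exact: YT.
- by rewrite ipC; exact: YT.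
- exact: hT.
Qed.

Lemma row_mx_perp p q (A : 'M[C]_(n, p)) (B : 'M[C]_(n, q)) (v : vec) :
  (row_mx A B)^T *m J *m v = 0 -> A^T *m J *m v = 0 /\ B^T *m J *m v = 0.
Proof.
rewrite tr_row_mx !mul_col_mx => h.
split; apply/matrixP => a b.
  by move/matrixP/(_ (lshift q a) b): h; rewrite col_mxEu => ->; rewrite !mxE.
by move/matrixP/(_ (rshift p a) b): h; rewrite col_mxEd => ->; rewrite !mxE.
Qed.

Lemma VperpE z v : in_Vperp Y z v ->
  [/\ ip (Y z) v = 0, ip (dz Y z) v = 0, ip (dzb Y z) v = 0 & ip (X z) v = 0].
Proof.
rewrite /in_Vperp /Vmx; move: (Y z) (dz Y z) (dzb Y z) (X z) => a b c d.
move=> h; have [h12 h34] := @row_mx_perp (1 + 1) (1 + 1) (row_mx a b) (row_mx c d) v h.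
have [h1 h2] := @row_mx_perp 1 1 a b v h12; have [h3 h4] := @row_mx_perp 1 1 c d v h34.
by split; apply/ip_eq0.
Qed.

Lemma row_mx_span (x y : vec) (w : 'cV[C]_(1 + 1)) : exists a b, row_mx x y *m w = a *: x + b *: y.
Proof.
exists (usubmx w 0 0), (dsubmx w 0 0); rewrite -{1}(vsubmxK w) mul_row_col.
by rewrite {1}(mx11_scalar (usubmx w)) {1}(mx11_scalar (dsubmx w)) !mul_mx_scalar.
Qed.

Lemma Vmx_span z (w : 'cV[C]_(2 + 2)) :
  exists a b c d, Vmx Y z *m w = a *: Y z + b *: dz Y z + c *: dzb Y z + d *: X z.
Proof.
rewrite /Vmx; move: (Y z) (dz Y z) (dzb Y z) (X z) => y0 y1 y2 y3.
have [a [b e1]] := row_mx_span y0 y1 (usubmx w); have [c [d e2]] := row_mx_span y2 y3 (dsubmx w).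
exists a, b, c, d; rewrite -{1}(vsubmxK w) mul_row_col -[RHS]addrA.
by congr (_ + _); [exact: e1|exact: e2].
Qed.

Lemma E_Vperp (k : 'I_m) z : O z -> (0 < k)%N -> in_Vperp Y z (E k z) /\ in_Vperp Y z (cj (E k z)).
Proof.
move=> Oz k0; split; apply/(H_normal hE Oz).
  exists (fun j => (j == k)%:R), (fun=> 0); rewrite (bigD1 k) //= eqxx scale1r scale0r addr0 big1 ?addr0 //.
  by move=> j /andP[_ /negPf ->]; rewrite !scale0r addr0.
exists (fun=> 0), (fun j => (j == k)%:R); rewrite (bigD1 k) //= eqxx scale1r scale0r add0r big1 ?addr0 //.
by move=> j /andP[_ /negPf ->]; rewrite !scale0r addr0.
Qed.

Lemma ip_E k j z : O z -> ip (E k z) (E j z) = 0.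
Proof. by move=> Oz; exact: (H_isotropic hE Oz). Qed.

Lemma ip_TE_low j (k : 'I_m) z : O z -> (0 < k)%N -> (j <= m)%N -> ip (T j z) (E k z) = 0.
Proof.
move=> Oz k0; have [e _ _ _] := VperpE (E_Vperp Oz k0).1.
case: j => [|j] jm; first exact: e.
have [a [c ->]] := H_osculating hE Oz (Ordinal jm).
rewrite ipDl ipZl e mulr0 add0r ipC ip_sumr big1 // => i _.
by rewrite ipZr ip_E // mulr0.
Qed.

Lemma kappa_span z : O z -> exists a : 'I_m -> C, kappa z = \sum_(k : 'I_m | (0 < k)%N) a k *: E k z.
Proof.
move=> Oz; have [kp eT] := hk Oz.
have [a [b kE]] := (H_normal hE Oz (kappa z)).1 kp.
exists a; rewrite kE; apply: eq_bigr => k k0.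
suff -> : b k = 0 by rewrite scale0r addr0.
have [e _ _ _] := VperpE (E_Vperp Oz k0).1.
have k2 : (2 <= m)%N by apply: leq_trans (ltn_ord k).
have := ip_TE_low Oz k0 k2; rewrite /= eT ipDl ipZl e mulr0 add0r ipC kE ip_sumr (bigD1 k) //= big1 => [|j /andP[j0 jk]].
  rewrite addr0 ipDr !ipZr ip_E // mulr0 add0r (H_unitary hE Oz) eqxx mul1r => /eqP.
  by rewrite mulf_eq0 pnatr_eq0 orbF => /eqP.
by rewrite ipDr !ipZr ip_E // mulr0 add0r (H_unitary hE Oz) eq_sym (negPf jk) mul0r mulr0.
Qed.

Lemma N_formula z : O z -> N z = (2 * ip (X z) (X z)) *: Y z + 2 *: X z.
Proof.
move=> Oz; have [[_ iV] [n1 n2] n3 n4] := hN Oz.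
have [a [b [c [d NE]]]] : exists a b c d : C, N z = a *: Y z + b *: dz Y z + c *: dzb Y z + d *: X z.
  move: iV => /submxP[w /(congr1 trmx)]; rewrite trmx_mul !trmxK => ->.
  exact: Vmx_span.
move: (ip_X Oz) (ip_YYz Oz) (ip_YzYz Oz) (ip_YzYzb Oz) (ip_YY Oz) (N z) NE n1 n2 n3 n4.
move: (Y z) (dz Y z) (dzb Y z) (X z) => y0 yz yb x [x1 x2 x3] [y1 y2] [y3 y4] y5 y6 v NE n1 n2 n3 n4.
have two : (2 : C) != 0 by rewrite pnatr_eq0.
have dE : d = 2.
  move: n4; rewrite NE !(ipDl, ipZl) y6 (ipC yz) y1 (ipC yb) y2 (ipC x) x1 !mulr0 !add0r => /eqP.
  rewrite mulrN eqr_opp => /eqP h; apply: (mulIf (invr_neq0 two)); by rewrite h divff.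
have cE : c = 0.
  move: n1; rewrite NE !(ipDl, ipZl) y1 y3 (ipC yb) y5 (ipC x) x2 !mulr0 !add0r addr0 => /eqP.
  by rewrite mulf_eq0 invr_eq0 (negPf two) orbF => /eqP.
have bE : b = 0.
  move: n2; rewrite NE !(ipDl, ipZl) y2 y5 y4 (ipC x) x3 !mulr0 !add0r !addr0 => /eqP.
  by rewrite mulf_eq0 invr_eq0 (negPf two) orbF => /eqP.
move: n3; rewrite NE bE cE dE !scale0r !addr0 => n3.
congr (_ *: _ + _).
move: n3; rewrite !(ipDl, ipDr, ipZl, ipZr) y6 (ipC x y0) x1; move: (ip x x) => q h.
apply/eqP; rewrite -subr_eq0; apply/eqP; apply: (mulfI two).
have -> : 2 * (a - 2 * q) = - (a * (a * 0 + 2 * - 2^-1) + (a * (2 * - 2^-1) + 2 * (2 * q))) by field.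
by rewrite h oppr0 mulr0.
Qed.

Definition evec (k : 'I_m) z : vec := if k == 0%N :> nat then 2 *: dz Y z + mu z *: Y z else E k z.

Lemma evecE (k : 'I_m) z : (0 < k)%N -> evec k z = E k z.
Proof. by rewrite /evec; case: (nat_of_ord k). Qed.

Lemma evec0 (k : 'I_m) z : k = 0%N :> nat -> evec k z = 2 *: dz Y z + mu z *: Y z.
Proof. by rewrite /evec => ->. Qed.

Lemma evec_smx k : smx O (evec k).
Proof.
have [k0|k0] := posnP k; last by apply: (smx_eq oO) (sE k) => z _; rewrite evecE.
apply: (smx_eq oO) (smxD oO (smxZ (a := fun=> 2) oO (fun j => sCk_cst j 2 oO) (sT 1)) (smxZ oO smu sY)) => z _.
by rewrite evec0.
Qed.

Lemma evec_gram z k j : O z ->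
  ip (evec k z) (evec j z) = 0 /\ ip (evec k z) (cj (evec j z)) = (k == j)%:R * 2.
Proof.
move=> Oz; have [r1 r2] := Y_real Oz.
have EV (i : 'I_m) : (0 < i)%N -> [/\ ip (E i z) (Y z) = 0, ip (E i z) (dz Y z) = 0, ip (cj (E i z)) (dz Y z) = 0 & ip (cj (E i z)) (Y z) = 0].
  move=> i0; have [h1 h2] := E_Vperp Oz i0.
  have [a1 a2 _ _] := VperpE h1; have [a3 a4 _ _] := VperpE h2.
  by split; rewrite ipC.
move: (ip_YYz Oz) (ip_YzYz Oz) (ip_YzYzb Oz) (ip_YY Oz) r1 r2 EV.
have c0 (i : 'I_m) : cj (evec i z) = if i == 0%N :> nat then 2 *: cj (dz Y z) + (mu z)^* *: cj (Y z) else cj (E i z).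
  by rewrite /evec; case: ifP => // _; rewrite map_mxD !map_mxZ rmorph_nat.
rewrite c0 /evec; move: (Y z) (dz Y z) (dzb Y z) => y yz yb [y1 y2] [y3 y4] y5 y6 r1 r2 EV.
have two : (2 : C) != 0 by rewrite pnatr_eq0.
case: eqP => [k0|/eqP k0]; case: eqP => [j0|/eqP j0].
- have -> : k = j by apply: val_inj; rewrite /= k0 j0.
  rewrite r1 r2 eqxx !(ipDl, ipDr, ipZl, ipZr) (ipC yz y) y1 y2 y3 y5 y6.
  by split; [ring|rewrite [true%:R](_ : _ = 1) //; field].
- rewrite -lt0n in j0; have [a1 a2 a3 a4] := EV j j0.
  rewrite !(ipDl, ipZl) !(ipC yz) !(ipC y) a1 a2 a3 a4; split; first by ring.
  have /negPf -> : k != j by apply/eqP => kj; move: j0; rewrite -kj k0.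
  by rewrite mul0r !mulr0 addr0.
- rewrite -lt0n in k0; have [a1 a2 a3 a4] := EV k k0.
  have b1 : ip (E k z) (cj yz) = 0 by rewrite -[E k z](_ : cj (cj (E k z)) = _) ?ip_conj ?a3 ?conjC0 //; apply/matrixP => a b; rewrite !mxE conjCK.
  rewrite !(ipDr, ipZr) a1 a2 r1 b1 a1; split; first by ring.
  have /negPf -> : k != j by apply/eqP => kj; move: k0; rewrite kj j0.
  by rewrite mul0r !mulr0 addr0.
by split; [exact: ip_E|exact: (H_unitary hE Oz)].
Qed.

Lemma dz_evec0 (k : 'I_m) z : O z -> k = 0%N :> nat ->
  exists a : 'I_m -> C, dz (evec k) z = (mu z / 2) *: evec k z + \sum_(j : 'I_m | (0 < j)%N) a j *: E j z.
Proof.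
move=> Oz k0; have [a kE] := kappa_span Oz; have [_ eT] := hk Oz.
exists (fun j => 2 * a j).
have smm : smx O (fun z => (mu z)%:M : 'M[C]_1).
  move=> x y q; rewrite [x]ord1 [y]ord1; apply: (sCk_eq oO) (smu q) => w _.
  by rewrite mxE mulr1n.
have dY := smx_dif oO sY Oz; have dm := smx_dif oO smm Oz.
have [d1 e1 _] := dif_scale 2 (smx_dif oO (sT 1) Oz).
have [d2 e2 _] := dif_mul dY dm; have [d3 e3 _] := dif_add d1 d2.
have EE w : O w -> 2 *: T 1 w + Y w *m (mu w)%:M = evec k w by move=> _; rewrite evec0 // mul_mx_scalar.
have [_ F _] := dif_eq oO Oz EE d3.
have dmE : dz (fun z => (mu z)%:M : 'M[C]_1) z = (mu z ^+ 2 / 2 + s z)%:M.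
  have h : dz (mu : C -> C^o) z = mu z ^+ 2 / 2 + s z.
    by apply/eqP; rewrite -subr_eq0 opprD addrA; apply/eqP; exact: ric.
  apply/matrixP => x y; rewrite (dz_entry x y dm) [x]ord1 [y]ord1 [RHS]mxE mulr1n -h.
  have fE : (fun w => ((mu w)%:M : 'M[C]_1) 0 0) = mu by apply/funext => w; rewrite mxE mulr1n.
  exact: (f_equal (fun f : C -> C^o => dz f z) fE).
rewrite (etrans F (etrans e3 (f_equal2 +%R e1 e2))) dmE !mul_mx_scalar.
have -> : dz (T 1) z = - (s z / 2) *: Y z + kappa z := eT.
have sE2 : \sum_(j : 'I_m | (0 < j)%N) (2 * a j) *: E j z = 2 *: kappa z.
  by rewrite kE scaler_sumr; apply: eq_bigr => j _; rewrite scalerA.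
rewrite sE2 (evec0 z k0) /=.
move: (Y z) (dz Y z) (kappa z) (mu z) (s z) => y yz v t u.
have two : (2 : C) != 0 by rewrite pnatr_eq0.
by apply/matrixP => x w; rewrite !mxE; field.
Qed.

Lemma frame_solve (y yz yb x t v g e : vec) (a b c d : C) :
  ip y x = - 2^-1 -> ip yz x = 0 -> ip y y = 0 -> ip y yz = 0 -> ip y yb = 0 -> ip yz yz = 0 -> ip yz yb = 2^-1 ->
  ip y t = 0 -> ip yz t = 0 -> e = t + v -> v = a *: y + b *: yz + c *: yb + d *: x ->
  ip yb g + ip y e = 0 -> ip yb g = 0 -> ip x g + ip yz e = 0 -> ip x g = 0 -> e = t + a *: y + b *: yz.
Proof.
move=> x1 x2 y6 y1 y2 y3 y5 s1 s2 -> -> f1 g1 f2 g2; move: f1 f2; rewrite g1 g2.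
rewrite !add0r !(ipDr, ipZr) s1 s2 (ipC yz y) x1 x2 y1 y2 y3 y5 y6 => f1 f2.
have two : (2 : C) != 0 by rewrite pnatr_eq0.
have d0 : d = 0.
  apply: (mulIf (invr_neq0 two)); rewrite mul0r; apply: oppr_inj; rewrite oppr0 -[RHS]f1; ring.
have c0 : c = 0 by apply: (mulIf (invr_neq0 two)); rewrite mul0r -[RHS]f2; ring.
by rewrite d0 c0 !scale0r !addr0 addrA.
Qed.

Lemma dzb_E (k : 'I_m) z : O z -> (0 < k)%N ->
  exists (c : 'I_m -> C) (a b : C), dzb (E k) z = \sum_(l : 'I_m | (0 < l)%N) c l *: E l z + a *: Y z + b *: dz Y z.
Proof.
move=> Oz k0; have [c Dc] := H_condition hE Oz k0.
have [w' dE] : exists w' : 'cV[C]_(2 + 2), dzb (E k) z = \sum_(l : 'I_m | (0 < l)%N) c l *: E l z + Vmx Y z *m w'.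
  move: Dc; rewrite /Dzb /nproj -mulmxA; move: (\sum_(_ | _) _) (invmx _ *m _) => v w /eqP; rewrite subr_eq => /eqP Dc.
  by exists w; exact: Dc.
have [a [b [c' [d VE]]]] := Vmx_span z w'.
exists c, a, b.
have EV (i : 'I_m) : (0 < i)%N -> ip (Y z) (E i z) = 0 /\ ip (dz Y z) (E i z) = 0.
  by move=> i0; have [] := VperpE (E_Vperp Oz i0).1.
have sum0 (v : vec) : (forall i : 'I_m, (0 < i)%N -> ip v (E i z) = 0) -> ip v (\sum_(l : 'I_m | (0 < l)%N) c l *: E l z) = 0.
  by move=> h; rewrite ip_sumr big1 // => i i0; rewrite ipZr h // mulr0.
have s1 := sum0 _ (fun i i0 => (EV i i0).1); have s2 := sum0 _ (fun i i0 => (EV i i0).2).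
have YE w0 : O w0 -> ip (Y w0) (E k w0) = 0 by move=> Ow; have [] := VperpE (E_Vperp Ow k0).1.
have YzE w0 : O w0 -> ip (dz Y w0) (E k w0) = 0 by move=> Ow; have [] := VperpE (E_Vperp Ow k0).1.
have [_ f1] := ip_deriv oO sY (sE k) YE Oz.
have [_ f2] := ip_deriv oO (sT 1) (sE k) YzE Oz.
have [_ _ g1 g2] := VperpE (E_Vperp Oz k0).1.
rewrite (XE Oz) in f2.
have [x1 x2 _] := ip_X Oz; have [y1 y2] := ip_YYz Oz; have [y3 _] := ip_YzYz Oz.
exact: (frame_solve x1 x2 (ip_YY Oz) y1 y2 y3 (ip_YzYzb Oz) s1 s2 dE VE f1 g1 f2 g2).
Qed.

Definition Tmx q z : 'M[C]_(n, q) := \matrix_(a < n, b < q) T b z a 0.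

Lemma Tmx_smx q : smx O (Tmx q).
Proof.
move=> a b k; have -> : (fun z => Tmx q z a b) = (fun z => T b z a 0) by apply/funext => z; rewrite mxE.
exact: sT.
Qed.

Lemma Tmx_col q z (b : 'I_q) : Tmx q z *m delta_mx b 0 = T b z.
Proof. by apply/matrixP => x y; rewrite [y]ord1 -colE !mxE. Qed.

Lemma ip_Tmx q z (c : 'cV[C]_q) v : (forall b : 'I_q, ip (T b z) v = 0) -> ip (Tmx q z *m c) v = 0.
Proof.
move=> H; apply/ip_eq0; rewrite trmx_mul -!mulmxA; suff -> : (Tmx q z)^T *m (J *m v) = 0 by rewrite mulmx0.
apply/row_matrixP => b; rewrite row0 rowE mulmxA -[delta_mx 0 b]trmx_delta -trmx_mul Tmx_col mulmxA.
by apply/ip_eq0; exact: H.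
Qed.

Lemma T_generic_top z : O z -> \rank (Tmx m.+1 z) = m.+1 -> forall k, exists c, E k z = Tmx m.+1 z *m c.
Proof.
move=> Oz rk k.
pose Em : 'M[C]_(n, m) := \matrix_(a, b) E b z a 0.
have Ecol b : Em *m delta_mx b 0 = E b z by apply/matrixP => x y; rewrite [y]ord1 -colE !mxE.
have [A EA] : exists A : 'M[C]_(1 + m, m.+1), Tmx m.+1 z = row_mx (Y z) Em *m A.
  apply: span_col => -[[|b] hb]; rewrite Tmx_col /=.
    by exists (col_mx 1%:M 0); rewrite mul_row_col mulmx1 mulmx0 addr0.
  have [a [c e]] := H_osculating hE Oz (Ordinal (hb : b < m)%N).
  exists (col_mx a%:M (\sum_(l : 'I_m | (l <= b)%N) c l *: delta_mx l 0)).
  apply: (etrans e).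
  rewrite mul_row_col mul_mx_scalar mulmx_sumr; congr (_ + _).
  by apply: eq_bigr => i _; rewrite -scalemxAr Ecol.
have uA : (A : 'M[C]_m.+1) \in unitmx.
  rewrite -row_free_unit -row_leq_rank; have := mxrankM_maxr (row_mx (Y z) Em) A.
  by rewrite -EA rk.
exists (invmx (A : 'M[C]_m.+1) *m delta_mx (rshift 1 k) 0).
rewrite EA -mulmxA (mulKVmx uA) -colE colKr; apply/matrixP => x y.
by rewrite [y]ord1 !mxE.
Qed.

Lemma T_generic_low (V : set C) q : open V -> V `<=` O -> (forall z, V z -> \rank (Tmx q z) = q) ->
  (forall z, V z -> \rank (Tmx (q + 1) z) != (q + 1)%N) ->
  forall j z, V z -> exists c, T j z = Tmx q z *m c.
Proof.
move=> oV VO rk rk1.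
have Tl j z : (j < q)%N -> exists c, T j z = Tmx q z *m c.
  by move=> jq; exists (delta_mx (Ordinal jq) 0); rewrite Tmx_col.
have Tq z : V z -> exists c, T q z = Tmx q z *m c.
  move=> Vz; apply: row_mx_span_rank; first exact: rk.
  suff <- : Tmx (q + 1) z = row_mx (Tmx q z) (T q z) by exact: rk1.
  apply/matrixP => a b; rewrite -[b]splitK; case: (fintype.split b) => c; rewrite /unsplit.
    by rewrite row_mxEl !mxE.
  by rewrite row_mxEr !mxE [c]ord1 /= addn0.
have sV j : smx V (T j) := smx_sub VO (sT j).
elim=> [|j IH] z Vz.
  have [q0|q0] := posnP q; last exact: Tl.
  by have [c e] := Tq z Vz; exists c; rewrite -e q0.
have [[a [b e]] _] := span_deriv oV Vz (smx_sub VO (@Tmx_smx q)) (sV j) rk IH.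
have [c dT] : exists c, dz (Tmx q) z = Tmx q z *m c.
  apply: span_col => b'.
  have [dd ed _] := dif_cst z (delta_mx b' 0 : 'cV[C]_q).
  have [dm em _] := dif_mul (smx_dif oO (@Tmx_smx q) (VO z Vz)) dd.
  have [_ F _] := dif_eq oO (VO z Vz) (fun w _ => Tmx_col w b') dm.
  have {}F : dz (Tmx q) z *m delta_mx b' 0 = T b'.+1 z.
    by rewrite ed mulmx0 addr0 in em; rewrite -em; exact: esym F.
  rewrite F; have [h|h] := ltnP b'.+1 q; first exact: Tl.
  have -> : b'.+1 = q by apply/eqP; rewrite eqn_leq h ltn_ord.
  exact: Tq.
exists (c *m a + b); rewrite mulmxDr (mulmxA _ c) -dT; exact: e.
Qed.

Lemma T_generic (O1 : set C) : open O1 -> O1 !=set0 -> O1 `<=` O ->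
  exists V : set C, [/\ open V, V !=set0, V `<=` O1 &
    forall z, V z -> forall j (k : 'I_m), (0 < k)%N -> ip (T j z) (E k z) = 0].
Proof.
move=> oO1 [z0 Oz0] O1O.
pose P q := `[< exists z, O1 z /\ \rank (Tmx q z) = q >] && (q <= m.+1)%N.
have P0 : exists q, P q.
  exists 0%N; rewrite /P andbT; apply/asboolP; exists z0; split=> //.
  by apply/eqP; rewrite -leqn0 rank_leq_col.
have Pm q : P q -> (q <= m.+1)%N by case/andP.
case: (ex_maxnP P0 Pm) => q /andP[/asboolP[z1 [Oz1 rk1]] qm] qmax.
pose V := [set z | O1 z /\ \rank (Tmx q z) = q].
have oV : open V := open_rank oO1 (smx_sub O1O (@Tmx_smx q)).
have VO : V `<=` O by move=> z [/O1O].
exists V; split=> //; [by exists z1|by move=> z []|].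
move=> z Vz j k k0.
have [qm1|qm1] := ltnP q m.+1.
  have [] := @T_generic_low V q oV VO _ _ j z Vz.
  - by move=> w [].
  - move=> w [Ow _]; apply/eqP => e; have /qmax : P (q + 1)%N.
      by apply/andP; split; [apply/asboolP; exists w|rewrite addn1].
    by rewrite addn1 ltnn.
  move=> c ->; apply: ip_Tmx => b; apply: ip_TE_low k0 _; first exact: VO.
  by apply: leq_trans (ltnW (ltn_ord b)) _.
have qE : q = m.+1 by apply/eqP; rewrite eqn_leq qm.
have rk : \rank (Tmx m.+1 z) = m.+1 by case: Vz => _; rewrite qE.
have [c ->] := T_generic_top (VO z Vz) rk k.
by rewrite ipC; apply: ip_Tmx => b; apply: ip_TT; exact: VO.
Qed.

Local Notation Yh := (adjoint_lift Y N mu).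

Lemma ip_smx (f g : C -> vec) : smx O f -> smx O g -> forall k, sCk k O (fun z => ip (f z) (g z)).
Proof. by move=> sf sg k; exact: (smx_mul oO (smx_mul oO (smx_tr sf) (smx_cst oO J)) sg). Qed.

Definition adjoint_coef z : C := 2 * ip (X z) (X z) + 2^-1 * (mu z * (mu z)^*).

Lemma adjoint_coef_smooth k : sCk k O adjoint_coef.
Proof.
apply: (sCkD oO); first exact: (sCkM oO (sCk_cst k 2 oO) (ip_smx sX sX k)).
exact: (sCkM oO (sCk_cst k 2^-1 oO) (sCkM oO (smu k) (sCk_conj oO (smu k)))).
Qed.

Lemma adjointE z : O z -> Yh z = adjoint_coef z *: Y z + 2 *: X z + ((mu z)^* *: dz Y z + mu z *: dzb Y z).
Proof.
move=> Oz; rewrite /adjoint_lift (N_formula Oz) /adjoint_coef -normCK.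
move: (Y z) (dz Y z) (dzb Y z) (X z) => y yz yb x; move: (ip x x) (`|mu z| ^+ 2) => a b.
by apply/matrixP => c d; rewrite !mxE; ring.
Qed.

Lemma ip_Yhe0 z (k : 'I_m) : O z -> k = 0%N :> nat -> ip (Yh z) (evec k z) = 0.
Proof.
move=> Oz k0; rewrite adjointE // evec0 //.
have [x1 x2 x3] := ip_X Oz; have [y1 y2] := ip_YYz Oz; have [y3 y4] := ip_YzYz Oz.
move: (ip_YzYzb Oz) (ip_YY Oz) x1 x2 x3 y1 y2 y3 y4.
move: (Y z) (dz Y z) (dzb Y z) (X z) (adjoint_coef z) => y yz yb x c y5 y6 x1 x2 x3 y1 y2 y3 y4.
rewrite !(ipDl, ipDr, ipZl, ipZr) (ipC x y) (ipC x yz) (ipC yz y) (ipC yb yz) (ipC yb y) x1 x2 y1 y2 y3 y5 y6.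
have two : (2 : C) != 0 by rewrite pnatr_eq0.
by field.
Qed.

Lemma iter_dz_dzb j z : O z -> iter j (@dz R _) (dzb Y) z = dzb (T j) z.
Proof.
elim: j z => [//|j IH] z Oz; rewrite iterS.
have [_ e _] := dif_eq oO Oz (fun w Ow => esym (IH w Ow)) (smx_dif oO (smx_dzb oO (sT j)) Oz).
exact: (etrans e (smx_dz_comm oO Oz (sT j))).
Qed.

Lemma perp_generic (O1 : set C) : open O1 -> O1 !=set0 -> O1 `<=` O ->
  exists V : set C, [/\ open V, V !=set0, V `<=` O1 &
    forall z, V z -> forall j k, ip (evec k z) (T j z) = 0 /\ ip (evec k z) (iter j (@dz R _) Yh z) = 0].
Proof.
move=> oO1 ne O1O; have [V [oV neV VO1 TE]] := T_generic oO1 ne O1O.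
exists V; split; [exact: oV|exact: neV|exact: VO1|].
have VO : V `<=` O by move=> z /VO1/O1O.
have sVT j : smx V (T j) := smx_sub VO (sT j).
(* the module generated by the derivatives of [Y] and [dzb Y] contains [Yh] and is orthogonal to [E k] *)
pose phi (b : bool) : C -> vec := if b then dzb Y else Y.
have sphi b : smx V (phi b) by case: b; apply: (smx_sub VO); [exact: (smx_dzb oO sY)|exact: sY].
have phiE b j (k : 'I_m) z : V z -> (0 < k)%N -> ip (E k z) (iter j (@dz R _) (phi b) z) = 0.
  move=> Vz k0; have Oz := VO z Vz; case: b; last by rewrite ipC; exact: TE.
  rewrite /phi (iter_dz_dzb j Oz) ipC.
  have [_ e] := ip_deriv oV (sVT j) (smx_sub VO (sE k)) (fun w Vw => TE w Vw j k k0) Vz.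
  have [c [a [b dE]]] := dzb_E Oz k0.
  have e2 : ip (T j z) (dzb (E k) z) = 0.
    rewrite dE !ipDr (ipZr a) (ipZr b) ip_sumr big1 => [|i i0]; last by rewrite ipZr TE // mulr0.
    by rewrite (@ip_TT j 0 z Oz) (@ip_TT j 1 z Oz) !mulr0 !addr0.
  by move: e; rewrite e2 addr0.
have sc f : (forall k, sCk k O f) -> smx V (fun z => (f z)%:M : 'M[C]_1).
  move=> sf; apply: (smx_sub VO) => a b k; rewrite [a]ord1 [b]ord1.
  by apply: (sCk_eq oO) (sf k) => z _; rewrite mxE mulr1n.
have jYh : jets V phi Yh.
  have j1 := jets_mul oV (sc _ adjoint_coef_smooth) (jet_phi phi oV false 0).
  have j2 := jets_mul oV (sc _ (fun k => sCk_cst k 2 oO)) (jet_phi phi oV true 1).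
  have j3 := jets_mul oV (sc _ (fun k => sCk_conj oO (smu k))) (jet_phi phi oV false 1).
  have j4 := jets_mul oV (sc _ smu) (jet_phi phi oV true 0).
  apply: jet_eq (jet_add (jet_add j1 j2) (jet_add j3 j4)) => z Vz.
  exact: (etrans (f_equal2 +%R (f_equal2 +%R (mul_mx_scalar (adjoint_coef z) (Y z)) (mul_mx_scalar 2 (X z)))
    (f_equal2 +%R (mul_mx_scalar (mu z)^* (dz Y z)) (mul_mx_scalar (mu z) (dzb Y z)))) (esym (adjointE (VO z Vz)))).
have YhE j (k : 'I_m) z : V z -> (0 < k)%N -> ip (E k z) (iter j (@dz R _) Yh z) = 0.
  move=> Vz k0; apply/ip_eq0.
  by apply: (jets_perp (w := E k) Vz _ (jets_iter oV sphi j jYh)) => b i; exact: phiE.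
have sYh j : smx V (iter j (@dz R _) Yh) := jets_smx oV sphi (jets_iter oV sphi j jYh).
move=> z Vz j k; have [k0|k0] := posnP k; last by rewrite evecE // YhE // ipC TE.
have Oz := VO z Vz; split.
  by rewrite evec0 // ipDl (ipZl 2) (ipZl (mu z)) (@ip_TT 1 j z Oz) (@ip_TT 0 j z Oz) !mulr0 addr0.
elim: j z Vz {Oz} => [|j IH] z Vz; first by rewrite ipC; exact: (ip_Yhe0 (VO z Vz) k0).
have [e _] := ip_deriv oV (smx_sub VO (@evec_smx k)) (sYh j) IH Vz.
have [a dE] := dz_evec0 (VO z Vz) k0.
move: e; rewrite dE ipDl (ipZl (mu z / 2)) IH // mulr0 add0r ipC ip_sumr big1 ?add0r // => i i0.
by rewrite ipZr ipC YhE // mulr0.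
Qed.

Lemma Yh_smx : smx O Yh.
Proof.
have s1 := smxZ oO adjoint_coef_smooth sY.
have s2 := smxZ (a := fun=> 2) oO (fun k => sCk_cst k 2 oO) sX.
have s3 := smxZ oO (fun k => sCk_conj oO (smu k)) (sT 1).
have s4 := smxZ oO smu (smx_dzb oO sY).
by apply: (smx_eq oO) (smxD oO (smxD oO s1 s2) (smxD oO s3 s4)) => z Oz; rewrite adjointE.
Qed.

End SurfaceGeometry.

Section LiftGeometry.
Variables (R : realType) (m : nat).
Local Notation C := (cplx R).
Local Notation n := (2 + m * 2)%N.
Local Notation mat := 'M[C]_n.
Local Notation vec := 'cV[C]_n.
Local Notation l := (lpr R m).
Local Notation J := (Jmx R n).
Local Notation cj := (map_mx Num.conj).

(* The columns of [w] span a maximal isotropic subspace, which is its own orthogonal complement. *)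
Lemma isotropic_complement p q (w : 'M[C]_(m * 2, m)) (x : 'M[C]_(m * 2, p)) (y : 'M[C]_(m * 2, q)) :
  w^T *m w = 0 -> w^T *m cj w = 2%:M -> w^T *m x = 0 -> w^T *m y = 0 -> x^T *m y = 0.
Proof.
move=> ww wc wx wy.
have two : (2 : C) != 0 by rewrite pnatr_eq0.
have cw : (cj w)^T *m w = 2%:M.
  by apply: trmx_inj; rewrite trmx_mul trmxK wc tr_scalar_mx.
have cc : (cj w)^T *m cj w = 0 by rewrite map_trmx -map_mxM ww map_mx0.
pose M := row_mx w (cj w); pose M' := col_mx (cj w)^T w^T.
have MM : M' *m M = 2%:M.
  by rewrite /M /M' mul_col_row cw cc ww wc -scalar_mx_block.
have rM : \rank M = (m + m)%N.
  apply/eqP; rewrite eqn_leq rank_leq_col /=.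
  have := mxrankM_maxr M' M; rewrite MM mxrank_unit //.
  by rewrite unitmxE det_scalar unitfE expf_neq0.
have fM : row_free M by rewrite /row_free rM muln2 addnn.
have MM2 : M *m M' = 2%:M.
  apply: (row_free_inj fM); rewrite -mulmxA MM mul_mx_scalar mul_scalar_mx; exact: erefl.
have y2 : 2 *: y = w *m ((cj w)^T *m y).
  by rewrite -mul_scalar_mx -MM2 -mulmxA /M' mul_col_mx wy /M mul_row_col mulmx0 addr0.
apply: (scalerI two); rewrite scaler0 scalemxAr y2 (mulmxA x^T).
have -> : x^T *m w = 0 by apply: trmx_inj; rewrite trmx_mul trmxK wx trmx0.
by rewrite mul0mx.
Qed.

Variables (U O V : set C) (F : C -> mat) (I : Type) (gen : I -> C -> vec) (phi : C -> 'M[C]_(n, 2)).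
Variable e : 'I_m -> C -> vec.
Variables (oU : open U) (sF : smx U F) (hF : forall z, U z -> in_SOplus (F z)).
Variable hrep : forall z, U z -> represents (F z) (phi z).
Variables (oV : open V) (VU : V `<=` U) (sgen : forall i, smx V (gen i)).
Variable jphi : jets V gen phi.
Variable perp : forall z, V z -> forall i j k, ip (e k z) (iter j (@dz R _) (gen i) z) = 0.
Variable gram : forall z, V z -> forall k j, ip (e k z) (e j z) = 0 /\ ip (e k z) (cj (e j z)) = (k == j)%:R * 2.

Lemma in_K_lsub (A : mat) (p : 'M[C]_(n, 2)) : A^T *m J *m A = J -> represents A p ->
  let a := Jmx R 2 *m (lsubmx A)^T *m J *m p in
  A *m l = p *m (Jinv a *m row_mx 1%:M 0) /\ in_SOplus a /\ p = lsubmx A *m a.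
Proof.
move=> SA [k [[a [b [-> Sa _ _]]] <-]] a'.
have LA : lsubmx A = A *m col_mx 1%:M 0.
  by rewrite -{2}[A]hsubmxK mul_row_col mulmx1 mulmx0 addr0.
have pE : lsubmx (A *m block_mx a 0 0 b) = lsubmx A *m a.
  by rewrite -{1}[A]hsubmxK mul_row_block !mulmx0 addr0 row_mxKl.
have LL : (lsubmx A)^T *m J *m lsubmx A = Jmx R 2.
  rewrite LA trmx_mul !mulmxA -(mulmxA _ A^T) -(mulmxA _ (A^T *m J)) SA Jmx_block.
  by rewrite tr_col_mx trmx1 trmx0 mul_row_block !mulmx0 !mul0mx !addr0 mul1mx mul_row_col mulmx1 mul0mx addr0.
have aE : a' = a.
  by rewrite /a' pE !mulmxA -(mulmxA _ _ J) -(mulmxA _ _ (lsubmx A)) LL Jmx2 mul1mx.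
rewrite aE pE; split=> //; have [_ Sj _ _] := Sa.
rewrite (mulmxA (lsubmx A *m a)) -(mulmxA (lsubmx A) a (Jinv a)) (mulmx1C (Jinv_mul Sj)) mulmx1 LA /lpr.
by rewrite -(mulmxA A) mul_col_row mulmx1 mulmx0 !mul0mx.
Qed.

Lemma jets_lift : jets V gen (fun z => F z *m l).
Proof.
have sL : smx V (fun z => lsubmx (F z)).
  by apply: (smx_sub VU); apply: (smx_reindex (s := fun i j => i) (s' := fun i j => lshift _ j)) sF => z i j; rewrite mxE.
have sp := jets_smx oV sgen jphi.
pose a z := Jmx R 2 *m (lsubmx (F z))^T *m J *m phi z.
have sa : smx V a.
  exact: (smx_mul oV (smx_mul oV (smx_mul oV (smx_cst oV _) (smx_tr sL)) (smx_cst oV _)) sp).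
have sJ : smx V (fun z => Jinv (a z) *m row_mx 1%:M 0 : 'M[C]_(2, n)).
  exact: (smx_mul oV (smx_mul oV (smx_mul oV (smx_cst oV _) (smx_tr sa)) (smx_cst oV _)) (smx_cst oV _)).
apply: jet_eq (jets_mul oV sJ jphi) => z Vz.
have [_ SA _ _] := hF (VU Vz).
by have [-> _] := in_K_lsub SA (hrep (VU Vz)).
Qed.

Local Notation X := (covder (mc0 F) (mc1 F)).

Lemma jets_covder j : jets V gen (fun z => F z *m X j z).
Proof.
have [s0 s1 _ _] := mc_smx oU sF hF.
have lA z : l *m mc0 F z = mc0 F z *m l := sigma_kpart _.
have pA z : mc1 F z *m l + l *m mc1 F z = mc1 F z := sigma_ppart _.
have dF z : V z -> dz F z = F z *m (mc1 F z + mc0 F z).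
  by move=> Vz; rewrite kpart_ppart mulKVmx // SOplus_unit //; exact: (hF (VU Vz)).
have sN q (f : C -> 'M[C]_(n, q)) : jets V gen f -> jets V gen (fun z => f z *m (- 1%:M)).
  by move=> jf; exact: (jets_mul oV (smx_cst oV _) jf).
have s0V := smx_sub VU s0; have s1V := smx_sub VU s1.
elim: j => [|j IH].
  have h := jet_add (jets_dz oV sgen jets_lift) (sN _ _ (jets_mul oV s0V jets_lift)).
  apply: jet_eq h => z Vz.
  have [dl el _] := dif_cst z l; have [_ E _] := dif_mul (smx_dif oU sF (VU Vz)) dl.
  rewrite mulmxN mulmx1; apply: (etrans (f_equal2 +%R E erefl)).
  rewrite el mulmx0 addr0 (dF z Vz) /covder /= !mulmxDr !mulmxDl -!mulmxA lA.
  by rewrite addrK.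
have sX : smx V (X j) := smx_sub VU (covder_smx oU s0 s1 j).
have h1 := jets_dz oV sgen IH.
have h2 := jets_mul oV (smx_mul oV s1V sX) jets_lift.
have h3 := jets_mul oV s0V IH.
apply: jet_eq (jet_add h1 (sN _ _ (jet_add h2 h3))) => z Vz.
have [_ E _] := dif_mul (smx_dif oU sF (VU Vz)) (smx_dif oV sX Vz).
rewrite mulmxN mulmx1; apply: (etrans (f_equal2 +%R E erefl)).
rewrite dF // [X j.+1 z]/(dz (X j) z + mc0 F z *m X j z - X j z *m mc0 F z).
have lX : l *m X j z = 0 := (covder_lpr oU s0 s1 (fun z _ => lA z) (fun z _ => pA z) j (VU Vz)).2.
have AX : mc1 F z *m X j z = l *m (mc1 F z *m X j z).
  by rewrite -{1}pA mulmxDl -mulmxA lX mulmx0 add0r mulmxA.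
have -> : F z *m l *m (mc1 F z *m X j z) = F z *m (mc1 F z *m X j z) by rewrite -mulmxA -AX.
move: (F z) (mc1 F z) (mc0 F z) (X j z) (dz (X j) z) => f a1 a0 x dx.
by mx_expand; mx_abel.
Qed.

Definition pull k z : vec := Jinv (F z) *m e k z.

Lemma pull_F k z : V z -> F z *m pull k z = e k z.
Proof.
move=> Vz; have [_ SA _ _] := hF (VU Vz).
by rewrite /pull mulmxA (mulmx1C (Jinv_mul SA)) mul1mx.
Qed.

Lemma pull_perp q (A : C -> 'M[C]_(n, q)) z k : V z -> jets V gen (fun z => F z *m A z) ->
  (pull k z)^T *m J *m A z = 0.
Proof.
move=> Vz jA; have [_ SA _ _] := hF (VU Vz).
have := jets_perp (w := e k) Vz (fun i j => perp Vz i j k) jA.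
by rewrite -(pull_F k Vz) trmx_mul !mulmxA -(mulmxA _ _ J) -(mulmxA _ _ (F z)) SA.
Qed.

Lemma pull_lpr k z : V z -> l *m pull k z = 0.
Proof.
move=> Vz; have := pull_perp k Vz jets_lift; rewrite -mulmxA Jmx_lpr mulmxA => /(congr1 (mulmx^~ J)).
rewrite -mulmxA Jmx2 mulmx1 mul0mx => h.
by apply: trmx_inj; rewrite trmx_mul lpr_tr h trmx0.
Qed.

Lemma covder_facts j z : V z -> X j z = J *m X j z /\ l *m X j z = 0.
Proof.
move=> Vz; have [s0 s1 _ _] := mc_smx oU sF hF.
have lX : l *m X j z = 0 := (covder_lpr oU s0 s1 (fun z _ => sigma_kpart _) (fun z _ => sigma_ppart _) j (VU Vz)).2.
by rewrite (Jmx_fix lX).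
Qed.

Lemma covder_pull j k z : V z -> (X j z)^T *m pull k z = 0.
Proof.
move=> Vz; have := pull_perp k Vz (jets_covder j).
rewrite -mulmxA -(covder_facts j Vz).1 => h.
by apply: trmx_inj; rewrite trmx_mul trmxK h trmx0.
Qed.

Lemma covder_iso i j z : V z -> (X i z)^T *m X j z = 0.
Proof.
move=> Vz.
have [_ SA _ _] := hF (VU Vz); have [rA _ _ _] := hF (VU Vz).
pose w : 'M[C]_(n, m) := \matrix_(a, k) pull k z a 0.
have wcol k : w *m delta_mx k (0 : 'I_1) = pull k z by apply/matrixP => a b; rewrite [b]ord1 -colE !mxE.
have lw : l *m w = 0.
  apply/matrixP => a b; have /matrixP/(_ a 0) : l *m (w *m delta_mx b (0 : 'I_1)) = 0 by rewrite wcol pull_lpr.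
  by rewrite mulmxA -colE !mxE.
have wX q : (X q z)^T *m w = 0.
  apply/matrixP => a b; have /matrixP/(_ a 0) : (X q z)^T *m (w *m delta_mx b (0 : 'I_1)) = 0 by rewrite wcol covder_pull.
  by rewrite mulmxA -colE !mxE.
have lower p (x : 'M[C]_(n, p)) : l *m x = 0 -> x = col_mx 0 (dsubmx x).
  move=> lx; rewrite -{1}[x]vsubmxK; congr col_mx.
  move: lx; rewrite -{1}[x]vsubmxK /lpr mul_block_col !mul0mx mul1mx !addr0 => /(congr1 (@usubmx _ 2 _ _)).
  by rewrite col_mxKu => ->; apply/matrixP => a b; rewrite !mxE.
have prod p q (x : 'M[C]_(n, p)) (y : 'M[C]_(n, q)) : l *m x = 0 -> l *m y = 0 -> x^T *m y = (dsubmx x)^T *m dsubmx y.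
  by move=> lx ly; rewrite {1}(lower _ x lx) {1}(lower _ y ly) tr_col_mx mul_row_col mulmx0 add0r.
have lX q : l *m X q z = 0 := (covder_facts q Vz).2.
have lcw : l *m cj w = 0 by rewrite -[l](@lpr_conj R m) -map_mxM lw map_mx0.
have ent (x : 'M[C]_(n, m)) a b : (w^T *m x) a b = ((pull a z)^T *m (x *m delta_mx b (0 : 'I_1))) 0 0.
  rewrite -wcol trmx_mul trmx_delta -mulmxA (mulmxA w^T); move: (w^T *m x) => M.
  by rewrite -rowE -colE !mxE.
have ipp a b : (pull a z)^T *m pull b z = (ip (e a z) (e b z))%:M.
  rewrite -(Jmx_fix (pull_lpr b Vz)) mulmxA ipE; congr (_%:M).
  by rewrite -(pull_F a Vz) -(pull_F b Vz) ip_mx.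
have ipc a b : (pull a z)^T *m cj (pull b z) = (ip (e a z) (cj (e b z)))%:M.
  have lc : l *m cj (pull b z) = 0 by rewrite -[l](@lpr_conj R m) -map_mxM pull_lpr // map_mx0.
  rewrite -(Jmx_fix lc) mulmxA ipE; congr (_%:M).
  by rewrite -(pull_F a Vz) -(pull_F b Vz) (cj_mul (F z) (pull b z)) rA ip_mx.
have ww : w^T *m w = 0.
  apply/matrixP => a b; rewrite ent wcol ipp !mxE mulr1n.
  by have [] := gram Vz a b.
have wc : w^T *m cj w = 2%:M.
  apply/matrixP => a b; rewrite ent.
  have -> : cj w *m delta_mx b (0 : 'I_1) = cj (pull b z) by rewrite -wcol map_mxM map_delta_mx.
  rewrite ipc !mxE mulr1n; have [_ ->] := gram Vz a b.
  by case: (a == b); rewrite ?mul1r ?mulr1n ?mul0r ?mulr0n.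
rewrite (prod _ _ _ _ (lX i) (lX j)).
apply: (@isotropic_complement _ _ (dsubmx w)).
- by rewrite -prod.
- by rewrite map_dsubmx -prod.
- by rewrite -prod // -[RHS]trmx0 -(wX i) trmx_mul trmxK.
- by rewrite -prod // -[RHS]trmx0 -(wX j) trmx_mul trmxK.
Qed.

End LiftGeometry.

(** * The kernel of the potential *)

Section Vanishing.
Variables (R : realType) (m : nat).
Local Notation C := (cplx R).
Local Notation n := (2 + m * 2)%N.
Local Notation mat := 'M[C]_n.
Local Notation vec := 'cV[C]_n.
Local Notation l := (lpr R m).
Local Notation J := (Jmx R n).
Variables (U O : set C) (F eta : C -> mat) (Fl Fm Fp : C -> C -> mat) (e : 'I_m -> C -> vec).
Variables (oU : open U) (sF : smx U F) (hF : forall z, U z -> in_SOplus (F z)) (hext : extended_frame U F Fl).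
Variables (oO : open O) (OU : O `<=` U).
Variable hB : forall z, O z ->
  [/\ minus_loop (fun lam => Fm lam z), plus_loop (fun lam => Fp lam z)
    & forall lam : C, `|lam| = 1 -> [/\ Fm lam z = Fl lam z *m Fp lam z, holo_at (Fm lam) z
      & invmx (Fm lam z) *m dz (Fm lam) z = lam^-1 *: eta z]].
Variable key : forall O1 : set C, open O1 -> O1 !=set0 -> O1 `<=` O ->
  exists V : set C, [/\ open V, V !=set0, V `<=` O1 & forall z, V z ->
    [/\ forall i j, (covder (mc0 F) (mc1 F) i z)^T *m covder (mc0 F) (mc1 F) j z = 0,
        forall j k, (covder (mc0 F) (mc1 F) j z)^T *m pull F e k z = 0
      & forall k, l *m pull F e k z = 0]].

Lemma local_vanish (O1 : set C) : open O1 -> O1 !=set0 -> O1 `<=` O ->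
  exists2 z1 : C, O1 z1 & forall H1 : C -> mat, holm H1 -> (forall lam : C, `|lam| = 1 -> Fp lam z1 = H1 lam) ->
    forall k, \forall z \near z1, eta z *m (Jinv (H1 0) *m pull F e k z1) = 0.
Proof.
move=> oO1 ne O1O; have [V [oV neV VO1 HV]] := key oO1 ne O1O.
have VU : V `<=` U by move=> z /VO1/O1O/OU.
have [z1 [r [P [D [r0 Hr HD PS HP]]]]] := dressing oU sF hF hext oV neV VU (fun z Vz => let: And3 h _ _ := HV z Vz in h).
have Vz1 : V z1 by apply: Hr; rewrite subrr cabs0.
have Oz1 : O z1 by apply: O1O; exact: VO1.
exists z1; first exact: VO1.
move=> H1 hH1 EH1 k.
have [_ X0 L0] := HV z1 Vz1.
have [m1 q1 B1] := hB Oz1.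
pose u := Jinv (H1 0) *m pull F e k z1.
have fixu w : cabs (w - z1) < r -> Fm 1 w *m u = Fm 1 z1 *m u.
  move=> wr; have Vw := Hr w wr; have Ow : O w by apply: O1O; exact: VO1.
  have [m2 q2 B2] := hB Ow.
  have EF1 (x : C) : `|x| = 1 -> Fm x z1 = Fl x z1 *m Fp x z1 by move=> x1; have [] := B1 x x1.
  have EF2 (x : C) : `|x| = 1 -> Fm x w = Fl x w *m Fp x w by move=> x1; have [] := B2 x x1.
  have SF (x : C) : `|x| = 1 -> (Fl x w)^T *m J *m Fl x w = J.
    by move=> x1; have [_ _ /(_ w (VU w Vw))[[_ ? _ _] _ _]] := hext x1.
  exact: (birkhoff_fixed q1 m1 q2 m2 EF1 EF2 (fun x => HD w x wr) SF hH1 EH1 (L0 k) (HP _ (fun j => X0 j k)) PS (normr1 _)).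
apply/nbhs_cabsP; exists r; first exact: r0.
move=> w wr; have Ow : O w by apply: O1O; apply: VO1; exact: Hr.
have [_ _ /(_ 1 (normr1 _))[_ hol E]] := hB Ow.
have [Dw [dFm _ _ _]] := holo_dif (nbhs_singleton hol).
have [du eu _] := dif_cst w u; have [dFu E1 _] := dif_mul dFm du.
have [dc ec _] := dif_cst w (Fm 1 z1 *m u).
have ob := @open_cball R z1 r.
have [_ E2 _] := dif_eq ob (wr : [set x | cabs (x - z1) < r] w) (fun x xr => esym (fixu x xr)) dc.
rewrite -/u; move: E; rewrite invr1 scale1r => <-.
have : dz (Fm 1) w *m u = 0.
  have alg (a b c t : vec) : a = b + c -> c = 0 -> a = t -> t = 0 -> b = 0 by move=> h1 c0 h2 t0; rewrite -t0 -h2 h1 c0 addr0.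
  by apply: (alg _ _ _ _ E1 _ E2 ec); rewrite eu mulmx0.
by rewrite -mulmxA => ->; rewrite mulmx0.
Qed.

End Vanishing.

Section Gronwall.
Variable R : realType.
Local Notation C := (cplx R).

Lemma srd_abs_cts (f : C -> C) (u p c d : C) (t : R) : srd f u (p + rc t * u) d ->
  {for t, continuous (fun s : R => cabs (f (p + rc s * u) - c))}.
Proof.
move=> /srdP/(_ 1 ltr01)[de de0 H]; apply/cvgrPdist_le => e e0.
pose K := 1 + cabs d; have K0 : 0 < K by rewrite ltr_pwDl ?cabs_ge0.
near=> s.
have st : `|s - t| < Num.min de (e / K).
  near: s; apply/nbhs_ballP; exists (Num.min de (e / K)); first by rewrite /= lt_min de0 divr_gt0.
  by move=> s; rewrite /ball /= distrC.
move: st; rewrite lt_min => /andP[s1 s2]; have := H (s - t) s1; rewrite mul1r.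
have -> : p + rc t * u + rc (s - t) * u = p + rc s * u by rewrite rcB; ring.
move: (f (p + rc s * u)) (f (p + rc t * u)) => x y h.
have h2 : cabs (x - y) <= K * `|s - t|.
  have -> : x - y = (x - y - rc (s - t) * d) + rc (s - t) * d by rewrite subrK.
  apply: le_trans (cabsD _ _) _; rewrite cabsM cabs_rc /K; nra.
have h3 : `|cabs (y - c) - cabs (x - c)| <= cabs (x - y).
  rewrite ler_norml; apply/andP; split.
    have := cabsD (x - y) (y - c); rewrite addrA subrK; lra.
  have := cabsD (y - x) (x - c); rewrite addrA subrK (cabs_distC y x); lra.
apply: le_trans h3 _; apply: le_trans h2 _.
by rewrite mulrC -ler_pdivlMr //; exact: ltW.
Unshelve. all: by end_near.
Qed.

Variable n : nat.
Local Notation mat := 'M[C]_n.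

Definition dist1 (A : mat) : R := \sum_a \sum_b cabs (A a b - (1%:M : mat) a b).

Lemma dist1_ge0 A : 0 <= dist1 A.
Proof. by apply: sumr_ge0 => a _; apply: sumr_ge0 => b _; exact: cabs_ge0. Qed.

Lemma dist1_entry (A : mat) a b : cabs (A a b - (1%:M : mat) a b) <= dist1 A.
Proof.
rewrite /dist1 (bigD1 a) //= (bigD1 b) //= -addrA lerDl addr_ge0 //.
  by apply: sumr_ge0 => c _; exact: cabs_ge0.
by apply: sumr_ge0 => d _; apply: sumr_ge0 => c _; exact: cabs_ge0.
Qed.

Lemma dist1_bound (A B : mat) (K : R) : (forall a b, cabs (A a b - B a b) <= K) -> dist1 A <= dist1 B + (n ^ 2)%:R * K.
Proof.
move=> H; have : dist1 A <= \sum_(a < n) \sum_(b < n) (cabs (B a b - (1%:M : mat) a b) + K).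
  apply: ler_sum => a _; apply: ler_sum => b _.
  have -> : A a b - (1%:M : mat) a b = (B a b - (1%:M : mat) a b) + (A a b - B a b) by ring.
  by apply: le_trans (cabsD _ _) _; rewrite lerD2l.
under eq_bigr do rewrite big_split /=; rewrite big_split /= => h; apply: le_trans h _.
rewrite lerD2l; under eq_bigr do rewrite sumr_const card_ord.
have -> : (n ^ 2)%:R * K = K *+ n *+ n by rewrite -mulrnA mulr_natl mulnn.
by rewrite sumr_const card_ord.
Qed.

Lemma segment_gronwall (G : C -> mat) (p u : C) (h K : R) : 0 <= h -> 0 <= K -> (n ^ 2)%:R * K * h <= 2^-1 ->
  (forall t : R, 0 <= t <= h -> forall a b, exists2 d : C, srd (fun z => G z a b) u (p + rc t * u) d &
     cabs d <= K * (1 + dist1 (G (p + rc t * u)))) ->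
  dist1 (G (p + rc h * u)) <= 2 * dist1 (G p) + 2 * ((n ^ 2)%:R * K * h).
Proof.
move=> h0 K0 small H.
pose phi (t : R) := dist1 (G (p + rc t * u)).
have cphi (t : R) : 0 <= t <= h -> {for t, continuous phi}.
  move=> th.
  have csum (I : Type) (r : seq I) (f : I -> R -> R) : (forall i, {for t, continuous (f i)}) ->
    {for t, continuous (fun s => \sum_(i <- r) f i s)}.
    move=> cf; elim: r => [|i r IH].
      have -> : (fun s => \sum_(i <- [::]) f i s) = (fun=> 0) by apply/funext => s; rewrite big_nil.
      exact: cvg_cst.
    have -> : (fun s => \sum_(j <- i :: r) f j s) = (fun s => f i s + \sum_(j <- r) f j s).
      by apply/funext => s; rewrite big_cons.
    exact: cvgD (cf i) IH.
  apply: (csum _ _ (fun a s => \sum_b cabs (G (p + rc s * u) a b - (1%:M : mat) a b))) => a.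
  apply: (csum _ _ (fun b s => cabs (G (p + rc s * u) a b - (1%:M : mat) a b))) => b.
  have [d Hd _] := H t th a b. refine (@srd_abs_cts (fun z => G z a b) u p ((1%:M : mat) a b) d t Hd).
have [|c cI cmax] := @EVT_max R phi 0 h h0.
  by apply: continuous_in_subspaceT => t; rewrite inE /= in_itv /=; exact: cphi.
have ch : 0 <= c <= h by move: cI; rewrite in_itv.
have bound : forall a b, cabs (G (p + rc c * u) a b - G p a b) <= K * (1 + phi c) * h.
  move=> a b; have c0 : 0 <= c by case/andP: ch.
  apply: le_trans (@mvt_ineq R (fun z => G z a b) u p c (K * (1 + phi c)) c0 _) _.
    move=> t /andP[t0 tc]; have th : 0 <= t <= h by rewrite t0 (le_trans tc) //; case/andP: ch.
    have [d Hd dK] := H t th a b; exists d; first exact: Hd.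
    apply: le_trans dK _; apply: ler_wpM2l => //; rewrite lerD2l.
    by apply: cmax; rewrite in_itv.
  apply: ler_wpM2l; last by case/andP: ch.
  by apply: mulr_ge0 => //; rewrite addr_ge0 // dist1_ge0.
have := dist1_bound bound; rewrite -/(phi c) => hb.
have hh : phi h <= phi c by apply: cmax; rewrite in_itv /= h0 lexx.
rewrite -/(phi h); have p0 : 0 <= phi c := dist1_ge0 _.
move: small hb hh; rewrite (_ : (n ^ 2)%:R * (K * (1 + phi c) * h) = (n ^ 2)%:R * K * h * (1 + phi c)); last by ring.
move: ((n ^ 2)%:R * K * h) => k small hb hh; nra.
Qed.

Lemma ball_gronwall (G : C -> mat) (r K : R) : 0 <= K -> G 0 = 1%:M ->
  (forall z, cabs z < r -> forall a b, exists d1 d2 : C, [/\ srd (fun z => G z a b) 1 z d1, srd (fun z => G z a b) 'i z d2,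
     cabs d1 <= K * (1 + dist1 (G z)) & cabs d2 <= K * (1 + dist1 (G z))]) ->
  forall z, cabs z < r -> (n ^ 2)%:R * K * cabs z <= 2^-1 -> dist1 (G z) <= 6 * ((n ^ 2)%:R * K * cabs z).
Proof.
move=> K0 G0 H z zr small.
have nK : 0 <= (n ^ 2)%:R * K by rewrite mulr_ge0 // ler0n.
have axis (q u : C) (x : R) : (u = 1) \/ (u = 'i) -> `|x| <= cabs z ->
    (forall t, `|t| <= `|x| -> cabs (q + rc t * u) < r) ->
    dist1 (G (q + rc x * u)) <= 2 * dist1 (G q) + 2 * ((n ^ 2)%:R * K * cabs z).
  move=> uE xz Hq.
  have Hd t : `|t| <= `|x| -> forall a b, exists2 d : C, srd (fun z => G z a b) u (q + rc t * u) d &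
      cabs d <= K * (1 + dist1 (G (q + rc t * u))).
    move=> tx a b; have [d1 [d2 [D1 D2 k1 k2]]] := H _ (Hq t tx) a b.
    by case: uE D1 D2 k1 k2 => -> D1 D2 k1 k2; [exists d1|exists d2].
  have mono : (n ^ 2)%:R * K * `|x| <= (n ^ 2)%:R * K * cabs z by rewrite ler_wpM2l.
  have small' : (n ^ 2)%:R * K * `|x| <= 2^-1 := le_trans mono small.
  have fin : dist1 (G (q + rc x * u)) <= 2 * dist1 (G q) + 2 * ((n ^ 2)%:R * K * `|x|).
    have [x0|x0] := leP 0 x.
      rewrite ger0_norm // in small' Hd *; apply: segment_gronwall => // t /andP[t0 tx] a b.
      by apply: Hd; rewrite ger0_norm.
    rewrite ltr0_norm // in small' Hd *.
    have -> : rc x * u = rc (- x) * (- u) by rewrite rcN mulrNN.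
    apply: segment_gronwall => //; first by rewrite oppr_ge0 ltW.
    move=> t /andP[t0 tx] a b; have [|d D k] := Hd (- t) _ a b; first by rewrite normrN ger0_norm.
    have e : q + rc (- t) * u = q + rc t * - u by rewrite rcN mulNr mulrN.
    rewrite e in D k; exists (- d); last by rewrite cabsN.
    exact: srd_oppdir D.
  apply: le_trans fin _; rewrite lerD2l ler_pM2l //.
pose x := re z; pose y := im z.
have zE : z = 0 + rc x * 1 + rc y * 'i by rewrite mulr1 add0r [rc y * _]mulrC -rcE.
have n2 (a b : R) : cabs (rc a + rc b * 'i) ^+ 2 = a ^+ 2 + b ^+ 2.
  apply: rc_inj; rewrite cabs_sqr rmorphD rmorphM /= !rc_conj conjCi rcD !rcX.
  have := sqrCi C; set ii := 'i; move=> i2.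
  transitivity (rc a ^+ 2 - rc b ^+ 2 * ii ^+ 2); first by ring.
  by rewrite i2 mulrN1 opprK.
have n2z : cabs z ^+ 2 = x ^+ 2 + y ^+ 2.
  by rewrite -n2; congr (cabs _ ^+ 2); rewrite [rc y * _]mulrC -rcE.
have h1 : dist1 (G (0 + rc x * 1)) <= 2 * dist1 (G 0) + 2 * ((n ^ 2)%:R * K * cabs z).
  apply: axis; [by left|exact: re_le_cabs|move=> t tx]; apply: le_lt_trans zr.
  rewrite add0r mulr1 cabs_rc (le_trans tx) //; exact: re_le_cabs.
have h2 : dist1 (G z) <= 2 * dist1 (G (0 + rc x * 1)) + 2 * ((n ^ 2)%:R * K * cabs z).
  rewrite {1}zE; apply: axis; [by right|exact: im_le_cabs|move=> t ty]; apply: le_lt_trans zr.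
  rewrite add0r mulr1 -(@ler_pXn2r _ 2) ?nnegrE ?cabs_ge0 // n2z n2 lerD2l.
  by rewrite -[leLHS]real_normK ?num_real // -[leRHS]real_normK ?num_real // ler_pXn2r // nnegrE.
have d0 : dist1 (G 0) = 0.
  by rewrite G0 /dist1 big1 // => a _; rewrite big1 // => b _; rewrite subrr cabs0.
move: h1 h2; rewrite d0; move: ((n ^ 2)%:R * K * cabs z) => k; lra.
Qed.

End Gronwall.

Section EntryBounds.
Variable R : realType.
Local Notation C := (cplx R).

Definition mxle p q (K : R) (A : 'M[C]_(p, q)) : Prop := forall a b, cabs (A a b) <= K.

Lemma mxle_le p q (K K' : R) (A : 'M[C]_(p, q)) : K <= K' -> mxle K A -> mxle K' A.
Proof. by move=> KK H a b; exact: le_trans (H a b) KK. Qed.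

Lemma mxle_mul p q r (K K' : R) (A : 'M[C]_(p, q)) (B : 'M[C]_(q, r)) : 0 <= K ->
  mxle K A -> mxle K' B -> mxle (q%:R * (K * K')) (A *m B).
Proof.
move=> K0 HA HB a b; rewrite mxE; apply: le_trans (cabs_sum _ _ _) _.
apply: (@le_trans _ _ (\sum_(c < q) K * K')).
  by apply: ler_sum => c _; rewrite cabsM; apply: ler_pM; rewrite ?cabs_ge0.
by rewrite sumr_const card_ord mulr_natl.
Qed.

Lemma mxle_add p q (K K' : R) (A B : 'M[C]_(p, q)) : mxle K A -> mxle K' B -> mxle (K + K') (A + B).
Proof. by move=> HA HB a b; rewrite mxE; apply: le_trans (cabsD _ _) _; exact: lerD. Qed.

Lemma mxle_opp p q (K : R) (A : 'M[C]_(p, q)) : mxle K A -> mxle K (- A).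
Proof. by move=> HA a b; rewrite mxE cabsN. Qed.

Lemma mxle_scale p q (K : R) (c : C) (A : 'M[C]_(p, q)) : cabs c = 1 -> mxle K A -> mxle K (c *: A).
Proof. by move=> c1 HA a b; rewrite mxE cabsM c1 mul1r. Qed.

Lemma mxle_Jinv n (K : R) (A : 'M[C]_n) : mxle K A -> mxle K (Jinv A).
Proof.
move=> HA a b; rewrite /Jinv /Jmx mul_mx_diag mxE mul_diag_mx !mxE !cabsM.
by rewrite !cabsX cabsN cabs1 !expr1n mul1r mulr1.
Qed.

Lemma cts_bounded p q (f : C -> 'M[C]_(p, q)) : (forall a b, {for 0, continuous (fun z => f z a b)}) ->
  forall e : R, 0 < e -> exists2 r : R, 0 < r & forall z, cabs z < r -> mxle e (f z - f 0).
Proof.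
move=> cf e e0; have H (ab : 'I_p * 'I_q) : exists r : R, 0 < r /\ forall z, cabs z < r -> cabs (f z ab.1 ab.2 - f 0 ab.1 ab.2) <= e.
  have /ctn_cabsP/(_ e e0)[d d0 Hd] := cf ab.1 ab.2; exists d; split=> // z zd.
  by apply: Hd; rewrite subr0.
have [r Hr] := choice H.
exists (\big[Num.min/1]_ab r ab); first by apply: lt_bigmin => // ab _; have [] := Hr ab.
move=> z zr a b; rewrite !mxE; apply: (Hr (a, b)).2; apply: lt_le_trans zr _.
exact: bigmin_le_cond.
Qed.

Lemma meromorphic_comb (W : set C) p q (A : C -> 'M[C]_(p, q)) (c : 'I_p -> 'I_q -> C) : meromorphic W A ->
  meromorphic W ((fun z => \sum_a \sum_b c a b * A z a b) : C -> C^o).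
Proof.
move=> mA z0 Wz; have [k [g [hg E]]] := mA z0 Wz.
exists k, (fun z => \sum_a \sum_b c a b * g z a b); split.
  apply: filterS hg => z dg; apply: derivable_sumC => a; apply: derivable_sumC => b.
  by apply: derivableMC; [exact: derivable_cstC|exact: derivable_mx].
apply: filterS E => z E; rewrite [RHS]mulr_sumr; apply: eq_bigr => a _.
by rewrite mulr_sumr; apply: eq_bigr => b _; rewrite E mxE mulrCA.
Qed.

End EntryBounds.

Section Limit.
Variables (R : realType) (m : nat).
Local Notation C := (cplx R).
Local Notation n := (2 + m * 2)%N.
Local Notation mat := 'M[C]_n.
Local Notation vec := 'cV[C]_n.
Local Notation l := (lpr R m).
Local Notation J := (Jmx R n).
Variables (U O : set C) (F eta : C -> mat) (Fl Fm Fp : C -> C -> mat) (e : 'I_m -> C -> vec).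
Variables (oU : open U) (sF : smx U F) (hF : forall z, U z -> in_SOplus (F z)) (hext : extended_frame U F Fl).
Variables (oO : open O) (OU : O `<=` U).
Variable hB : forall z, O z ->
  [/\ minus_loop (fun lam => Fm lam z), plus_loop (fun lam => Fp lam z)
    & forall lam : C, `|lam| = 1 -> [/\ Fm lam z = Fl lam z *m Fp lam z, holo_at (Fm lam) z
      & invmx (Fm lam z) *m dz (Fm lam) z = lam^-1 *: eta z]].
Variables (O0 : O 0) (F0 : F 0 = 1%:M).

Lemma smx_bounded p q (f : C -> 'M[C]_(p, q)) : smx O f ->
  exists2 M : R, 0 <= M & exists2 r : R, 0 < r & forall z, cabs z < r -> mxle M (f z).
Proof.
move=> sf.
have [r r0 H] : exists2 r : R, 0 < r & forall z, cabs z < r -> mxle 1 (f z - f 0).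
  by apply: cts_bounded ltr01 => a b; exact: (sCk_cts (sf a b 0) O0).
pose M0 := \sum_a \sum_b cabs (f 0 a b).
have M00 : 0 <= M0 by apply: sumr_ge0 => a _; apply: sumr_ge0 => b _; exact: cabs_ge0.
exists (1 + M0); first by rewrite addr_ge0.
exists r => // z zr; rewrite -[f z](subrK (f 0)); apply: mxle_add; first exact: H.
move=> a b; rewrite /M0 (bigD1 a) //= (bigD1 b) //= -addrA lerDl addr_ge0 //.
  by apply: sumr_ge0 => c _; exact: cabs_ge0.
by apply: sumr_ge0 => d _; apply: sumr_ge0 => c _; exact: cabs_ge0.
Qed.

Lemma Fm_SOC z (x : C) : O z -> `|x| = 1 -> (Fm x z)^T *m J *m Fm x z = J.
Proof. by move=> Oz x1; have [[tm _] _ _] := hB Oz; have [[]] := tm x x1. Qed.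

Lemma eta_bounded : exists2 M : R, 0 <= M & exists2 r : R, 0 < r & forall z, cabs z < r -> mxle M (eta z).
Proof.
have /open_cabsP/(_ 0 O0)[r1 r10 H1] := oO.
have Oz z : cabs z < r1 -> O z by move=> zr; apply: H1; rewrite subr0.
have dFm z : cabs z < r1 -> derivable (Fm 1) z 1.
  by move=> zr; have [_ _ /(_ 1 (normr1 _))[_ h _]] := hB (Oz z zr); exact: nbhs_singleton h.
have cf a b : {for 0, continuous (fun z => Fm 1 z a b)}.
  by apply: derivable_continuousC; apply: derivable_mx; apply: dFm; rewrite cabs0.
have [r2 r20 H2] := cts_bounded cf ltr01.
pose r := Num.min r1 r2; have r0 : 0 < r by rewrite lt_min r10.
have rr1 : r <= r1 by rewrite ge_min lexx.
have rr2 : r <= r2 by rewrite ge_min lexx orbT.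
pose M0 := 1 + \sum_a \sum_b cabs (Fm 1 0 a b).
have M00 : 0 <= M0.
  by apply: addr_ge0 => //; apply: sumr_ge0 => a _; apply: sumr_ge0 => b _; exact: cabs_ge0.
have FmM z : cabs z < r -> mxle M0 (Fm 1 z).
  move=> zr; rewrite -[Fm 1 z](subrK (Fm 1 0)); apply: mxle_add; first by apply: H2; exact: lt_le_trans rr2.
  move=> a b; rewrite (bigD1 a) //= (bigD1 b) //= -addrA lerDl addr_ge0 //.
    by apply: sumr_ge0 => c _; exact: cabs_ge0.
  by apply: sumr_ge0 => d _; apply: sumr_ge0 => c _; exact: cabs_ge0.
have dM z : cabs z < r / 2 -> mxle (2 * 2 / (r / 2)) (dz (Fm 1) z).
  move=> zr a b; have zr1 : cabs z < r1 by apply: lt_le_trans rr1; apply: lt_trans zr _; lra.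
  have [D [_ dE _ isr]] := holo_dif (dFm z zr1).
  have hw w : cabs (w - z) < r / 2 -> cabs w < r.
    move=> wz; have -> : w = (w - z) + z by rewrite subrK.
    apply: le_lt_trans (cabsD _ _) _; lra.
  rewrite dE; apply: (@derivative_bound R (fun w => Fm 1 w a b) z (D a b) (r / 2) 2).
  - by rewrite divr_gt0.
  - by move=> w wz; apply: derivable_mx; apply: dFm; apply: lt_le_trans rr1; exact: hw.
  - move=> w wz.
    have k1 : cabs (Fm 1 w a b - Fm 1 0 a b) <= 1.
      by have := H2 w (lt_le_trans (hw w wz) rr2) a b; rewrite !mxE.
    have k2 : cabs (Fm 1 z a b - Fm 1 0 a b) <= 1.
      by have := H2 z (lt_le_trans (lt_trans zr (ltac:(lra) : r / 2 < r)) rr2) a b; rewrite !mxE.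
    have -> : Fm 1 w a b - Fm 1 z a b = (Fm 1 w a b - Fm 1 0 a b) - (Fm 1 z a b - Fm 1 0 a b) by ring.
    by apply: le_trans (cabsB _ _) _; lra.
  have /isrd_mxP/(_ a b) := isr 1; by rewrite scale1r.
exists (n%:R * (M0 * (2 * 2 / (r / 2)))).
  by rewrite mulr_ge0 ?ler0n // mulr_ge0 // ltW // divr_gt0 ?divr_gt0 //; lra.
exists (r / 2); first by rewrite divr_gt0.
move=> z zr; have zr' : cabs z < r by apply: lt_trans zr _; lra.
have Ozz := Oz z (lt_le_trans zr' rr1).
have [_ _ /(_ 1 (normr1 _))[_ _]] := hB Ozz; rewrite invr1 scale1r => <-.
rewrite (Jinv_inv (Fm_SOC Ozz (normr1 _))).
by apply: mxle_mul => //; [apply: mxle_Jinv; exact: FmM|exact: dM].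
Qed.

Lemma Fp0 (x : C) : `|x| = 1 -> Fp x 0 = 1%:M.
Proof.
move=> x1; have [tm tp H] := hB O0.
have E (y : C) : `|y| = 1 -> Fm y 0 = Fp y 0.
  by move=> y1; have [-> _ _] := H y y1; have [_ -> _] := hext y1; rewrite mul1mx.
by rewrite -E // (plus_minus_loop tp tm E x1).
Qed.

Lemma quotient_rule (d f i g t a p : mat) : d = - g *m i -> f = a *m t -> i *m a = p ->
  d *m a + i *m f = p *m t - g *m p.
Proof. by move=> -> -> <-; rewrite mulNmx mulNmx addrC !mulmxA. Qed.

Lemma Fp_deriv z (x : C) : O z -> `|x| = 1 ->
  [/\ dif (Fp x) z, dz (Fp x) z = x^-1 *: (Fp x z *m eta z) - (x^-1 *: mc1 F z + mc0 F z) *m Fp x z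
    & dzb (Fp x) z = - (mcb0 F z + x *: mcb1 F z) *m Fp x z].
Proof.
move=> Oz x1; have Uz := OU Oz.
have [/(smoothP _ oU) sFx _ _] := hext x1.
have ux w : U w -> Fl x w \in unitmx by move=> Uw; have [] := ext_deriv hext x1 Uw.
have [_ e1 e2] := ext_deriv hext x1 Uz.
have di := smx_dif oU (smx_invmx oU ux sFx) Uz.
have [dI i1 i2] := dif_mul di (smx_dif oU sFx Uz).
have [dc c1 c2] := dif_cst z (1%:M : mat).
have iF y : U y -> 1%:M = invmx (Fl x y) *m Fl x y by move=> Uy; rewrite mulVmx // ux.
have [_ j1 j2] := dif_eq oU Uz iF dc.
have Ei (d g : mat) : 0 = d *m Fl x z + invmx (Fl x z) *m (Fl x z *m g) -> d = - g *m invmx (Fl x z).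
  rewrite (mulKmx (ux z Uz)) => /esym/eqP; rewrite addr_eq0 => /eqP /(congr1 (mulmx^~ (invmx (Fl x z)))).
  by rewrite (mulmxK (ux z Uz)).
have k1 : dz (fun w => invmx (Fl x w)) z = - (x^-1 *: mc1 F z + mc0 F z) *m invmx (Fl x z).
  apply: Ei; rewrite -c1 -j1 i1 e1; reflexivity.
have k2 : dzb (fun w => invmx (Fl x w)) z = - (mcb0 F z + x *: mcb1 F z) *m invmx (Fl x z).
  apply: Ei; rewrite -c2 -j2 i2 e2; reflexivity.
have [_ _ /(_ x x1)[FmE hol etaE]] := hB Oz.
have [Dw [dFm _ dFmb _]] := holo_dif (nbhs_singleton hol).
have [dP p1 p2] := dif_mul di dFm.
have FpE w : O w -> invmx (Fl x w) *m Fm x w = Fp x w.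
  by move=> Ow; have [_ _ /(_ x x1)[-> _ _]] := hB Ow; exact: (mulKmx (ux w (OU Ow))).
have [dFp q1 q2] := dif_eq oO Oz FpE dP.
have uFm := Jinv_unit (Fm_SOC Oz x1).
have dFmE : dz (Fm x) z = Fm x z *m (x^-1 *: eta z) :=
  etrans (esym (mulKVmx uFm (dz (Fm x) z))) (f_equal (mulmx (Fm x z)) etaE).
have FpEz := FpE z Oz.
split; first exact: dFp.
  by apply: (etrans q1); apply: (etrans p1); apply: (etrans (quotient_rule k1 dFmE FpEz)); rewrite -scalemxAr.
have dFmE' : dzb (Fm x) z = Fm x z *m 0 := etrans dFmb (esym (mulmx0 _ _)).
by apply: (etrans q2); apply: (etrans p2); apply: (etrans (quotient_rule k2 dFmE' FpEz)); rewrite mulmx0 sub0r mulNmx.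
Qed.

Lemma Fp_bound : exists2 K : R, 0 <= K & exists2 r : R, 0 < r & forall z (x : C), cabs z < r -> `|x| = 1 ->
  dist1 (Fp x z) <= K * cabs z.
Proof.
have [s0 s1 sb0 sb1] := mc_smx oU sF hF.
have [M M0 [r r0 HM]] := eta_bounded.
have [Ma Ma0 [ra ra0 Ha]] := smx_bounded (smx_sub OU s0).
have [Mb Mb0 [rb rb0 Hb]] := smx_bounded (smx_sub OU s1).
have [Mc Mc0 [rc rc0 Hc]] := smx_bounded (smx_sub OU sb0).
have [Md Md0 [rd rd0 Hd]] := smx_bounded (smx_sub OU sb1).
have /open_cabsP/(_ 0 O0)[r1 r10 H1] := oO.
pose rr := Num.min r1 (Num.min (Num.min r ra) (Num.min (Num.min rb rc) rd)).
have rr0 : 0 < rr by rewrite !lt_min r10 r0 ra0 rb0 rc0 rd0.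
pose N : R := n%:R; have N0 : 0 <= N by rewrite ler0n.
pose K := N * M + N * (Mb + Ma) + N * (Mc + Md).
have K0 : 0 <= K by rewrite !addr_ge0 // mulr_ge0 // addr_ge0.
pose k : R := (n ^ 2)%:R * K; have k0 : 0 <= k by rewrite mulr_ge0 // ler0n.
exists (6 * k); first by rewrite mulr_ge0.
exists (Num.min rr (2^-1 / (1 + k))); first by rewrite lt_min rr0 divr_gt0 // ltr_pwDl.
move=> z x zr x1; have cx : cabs x = 1 by apply/norm1_cabs.
rewrite -mulrA; move: zr; rewrite lt_min => /andP[zr zk].
apply: (@ball_gronwall R n (Fp x) rr K K0 (Fp0 x1)) zr _; last first.
  move: zk; rewrite ltr_pdivlMr; last by lra.
  by rewrite -/k mulrDr mulr1 mulrC; have := cabs_ge0 z; lra.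
move=> {zk} w; rewrite !lt_min => /andP[w1 /andP[/andP[wr wa] /andP[/andP[wb wc] wd]]] a b.
have Ow : O w by apply: H1; rewrite subr0.
have [dFp E1 E2] := Fp_deriv Ow x1.
have [h1 h2] := dif_isrd dFp; have [R1 Ri] := rderive_dz w (Fp x).
exists (rderive 1 (Fp x) w a b), (rderive 'i (Fp x) w a b); split.
- by move/isrd_mxP : h1; exact.
- by move/isrd_mxP : h2; exact.
all: have D0 : 0 <= 1 + dist1 (Fp x w) by rewrite addr_ge0 // dist1_ge0.
all: have FpM : mxle (1 + dist1 (Fp x w)) (Fp x w).
all: try (move=> c d; have -> : Fp x w c d = (1%:M : mat) c d + (Fp x w c d - (1%:M : mat) c d) by rewrite addrC subrK);
  try (apply: le_trans (cabsD _ _) _; apply: lerD; last exact: dist1_entry);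
  try (rewrite mxE; case: (c == d); by rewrite ?mulr1n ?mulr0n ?cabs1 ?cabs0).
all: have g1 : mxle (N * (M * (1 + dist1 (Fp x w)))) (x^-1 *: (Fp x w *m eta w)).
all: try (apply: mxle_scale; [by rewrite cabsV cx invr1|];
  rewrite [M * _]mulrC; apply: mxle_mul => //; exact: HM).
all: have g2 : mxle (N * ((Mb + Ma) * (1 + dist1 (Fp x w)))) ((x^-1 *: mc1 F w + mc0 F w) *m Fp x w).
all: try (apply: mxle_mul => //; [exact: addr_ge0|apply: mxle_add; [apply: mxle_scale; [by rewrite cabsV cx invr1|exact: Hb]|exact: Ha]]).
all: have g3 : mxle (N * ((Mc + Md) * (1 + dist1 (Fp x w)))) ((mcb0 F w + x *: mcb1 F w) *m Fp x w).
all: try (apply: mxle_mul => //; [exact: addr_ge0|apply: mxle_add; [exact: Hc|apply: mxle_scale; [exact: cx|exact: Hd]]]).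
all: have KE : N * (M * (1 + dist1 (Fp x w))) + N * ((Mb + Ma) * (1 + dist1 (Fp x w))) + N * ((Mc + Md) * (1 + dist1 (Fp x w)))
   = K * (1 + dist1 (Fp x w)) by rewrite /K; ring.
all: have gz : mxle (N * (M * (1 + dist1 (Fp x w))) + N * ((Mb + Ma) * (1 + dist1 (Fp x w)))) (dz (Fp x) w)
  by rewrite E1; apply: mxle_add => //; exact: mxle_opp.
all: have gb : mxle (N * ((Mc + Md) * (1 + dist1 (Fp x w)))) (dzb (Fp x) w)
  by rewrite E2 mulNmx; exact: mxle_opp.
- rewrite R1 -KE; exact: mxle_add.
rewrite Ri -KE; apply: mxle_scale; first exact: cabs_i.
by apply: mxle_add => //; exact: mxle_opp.
Qed.

End Limit.

Section Kernel.
Variables (R : realType) (m : nat).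
Local Notation C := (cplx R).
Local Notation n := (2 + m * 2)%N.
Local Notation mat := 'M[C]_n.
Local Notation vec := 'cV[C]_n.
Local Notation l := (lpr R m).
Local Notation J := (Jmx R n).
Variables (U O Omega : set C) (F eta : C -> mat) (Fl Fm Fp : C -> C -> mat) (e : 'I_m -> C -> vec).
Variables (oU : open U) (sF : smx U F) (hF : forall z, U z -> in_SOplus (F z)) (hext : extended_frame U F Fl).
Variables (oO : open O) (OU : O `<=` U).
Variable hB : forall z, O z ->
  [/\ minus_loop (fun lam => Fm lam z), plus_loop (fun lam => Fp lam z)
    & forall lam : C, `|lam| = 1 -> [/\ Fm lam z = Fl lam z *m Fp lam z, holo_at (Fm lam) z
      & invmx (Fm lam z) *m dz (Fm lam) z = lam^-1 *: eta z]].
Variables (O0 : O 0) (F0 : F 0 = 1%:M) (se : forall k, smx O (e k)).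
Variables (oM : open Omega) (cM : connected Omega) (OM : O `<=` Omega) (hmero : meromorphic Omega eta).
Variable key : forall O1 : set C, open O1 -> O1 !=set0 -> O1 `<=` O ->
  exists V : set C, [/\ open V, V !=set0, V `<=` O1 & forall z, V z ->
    [/\ forall i j, (covder (mc0 F) (mc1 F) i z)^T *m covder (mc0 F) (mc1 F) j z = 0,
        forall j k, (covder (mc0 F) (mc1 F) j z)^T *m pull F e k z = 0
      & forall k, l *m pull F e k z = 0]].

Lemma cts_punctured (f : C -> C) (b : C) : {for b, continuous f} -> (\forall z \near b^', f z = 0) -> f b = 0.
Proof.
move=> /ctn_cabsP cf /dnbhs_cabsP[d d0 Hd]; apply/eqP; rewrite -cabs_eq0; apply/eqP/le_anti; rewrite cabs_ge0 andbT.
apply/ler_addgt0Pr => eps eps0; rewrite add0r; have [d1 d10 H1] := cf eps eps0.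
pose t := Num.min d d1 / 2; have t0 : 0 < t by rewrite divr_gt0 // lt_min d0.
have td : t < d /\ t < d1 by split; rewrite ltr_pdivrMr //; [have := ge_min d d d1|have := ge_min d1 d d1]; rewrite lexx ?orbT => h; lra.
have wE : b + rc t - b = rc t by ring.
have ct : cabs (b + rc t - b) = t by rewrite wE cabs_rc gtr0_norm.
have := H1 (b + rc t); rewrite ct => /(_ td.2); rewrite Hd ?ct; [|exact: td.1|].
  by rewrite sub0r cabsN.
by rewrite -subr_eq0 wE -cabs_gt0 cabs_rc normr_gt0 gt_eqF.
Qed.

Lemma eta_vanish_fixed : exists2 rho : R, 0 < rho & forall (u : vec) z1, O z1 -> (\forall z \near z1, eta z *m u = 0) ->
  forall z, cabs z < rho -> z != 0 -> eta z *m u = 0.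
Proof.
have [k [g [/nbhs_cabsP[r1 r10 hg] /dnbhs_cabsP[r2 r20 gE]]]] := hmero (OM O0).
have /open_cabsP/(_ 0 (OM O0))[r3 r30 H3] := oM.
exists (Num.min r3 (Num.min r1 r2)); first by rewrite !lt_min r30 r10 r20.
move=> u z1 Oz1 near1 z; rewrite !lt_min => /andP[zr3 /andP[zr1 zr2]] z0.
pose f (i : 'I_n) (w : C) : C := (eta w *m u) i 0.
have mf i : meromorphic Omega (f i : C -> C^o).
  have -> : f i = (fun w => \sum_a \sum_b ((a == i)%:R * u b 0) * eta w a b).
    apply/funext => w; rewrite (bigD1 i) //= eqxx [X in _ + X]big1 => [|a ai].
      by rewrite addr0 /f mxE; apply: eq_bigr => b _; rewrite mul1r mulrC.
    by rewrite big1 // => b _; rewrite (negPf ai) mul0r mul0r.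
  exact: (meromorphic_comb (fun a b => (a == i)%:R * u b 0) hmero).
have Mz : Omega z by apply: H3; rewrite subr0.
have fz i : \forall w \near z^', f i w = 0.
  apply: (meromorphic_identity oM cM (OM Oz1) (mf i) _ Mz).
  by apply: cvg_within; apply: filterS near1 => w E; rewrite /f E mxE.
have gz i : (g z *m u) i 0 = 0.
  apply: (@cts_punctured (fun w => (g w *m u) i 0)).
    have -> : (fun w => (g w *m u) i 0) = (fun w => \sum_b g w i b * u b 0) by apply/funext => w; rewrite mxE.
    apply: derivable_continuousC; apply: derivable_sumC => b.
    apply: derivableMC; last exact: derivable_cstC.
    by apply: derivable_mx; apply: hg; rewrite subr0.
  have nz : \forall w \near z^', g w = (w - 0) ^+ k *: eta w.
    apply/dnbhs_cabsP; exists (Num.min (cabs z) (r2 - cabs z)); first by rewrite lt_min cabs_gt0 z0 subr_gt0.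
    move=> w; rewrite lt_min => /andP[w1 w2] _; apply: gE.
      rewrite subr0; have -> : w = (w - z) + z by rewrite subrK.
      by apply: le_lt_trans (cabsD _ _) _; rewrite -ltrBrDr.
    by apply/eqP => w0; move: w1; rewrite w0 sub0r cabsN ltxx.
  apply: filterS2 (fz i) nz => w fw ->; rewrite -scalemxAl mxE -[(eta w *m u) i 0]/(f i w) fw mulr0.
  exact: erefl.
have gz0 : g z = z ^+ k *: eta z by rewrite gE ?subr0.
apply/matrixP => i j; rewrite [j]ord1 [RHS]mxE; have := gz i; rewrite gz0 -scalemxAl mxE => /eqP.
by rewrite mulf_eq0 expf_eq0 (negPf z0) andbF /= => /eqP.
Qed.

Lemma pull0 k : pull F e k 0 = e k 0.
Proof. by rewrite /pull F0 /Jinv trmx1 mulmx1 Jmx2 mul1mx. Qed.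

Lemma pull_smx k : smx O (pull F e k).
Proof.
exact: (smx_mul oO (smx_mul oO (smx_mul oO (smx_cst oO J) (smx_tr (smx_sub OU sF))) (smx_cst oO J)) (se k)).
Qed.

Lemma plus_loop_value z (H1 : C -> mat) (kap : R) : holm H1 -> (forall x : C, `|x| = 1 -> Fp x z = H1 x) ->
  (forall x : C, `|x| = 1 -> dist1 (Fp x z) <= kap) -> mxle kap (Jinv (H1 0) - 1%:M).
Proof.
move=> hH EH HK; have h a b : cabs (H1 0 a b - (1%:M : mat) a b) <= kap.
  apply: (plusf_bound (holf_plusf (hH a b))) => w w1.
  have nw : `|w| = 1 by apply/norm1_cabs.
  by rewrite -EH //; apply: le_trans (dist1_entry _ _ _) _; exact: HK.
have -> : Jinv (H1 0) - 1%:M = Jinv (H1 0 - 1%:M).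
  have J1 : J *m 1%:M^T *m J = 1%:M by rewrite trmx1 mulmx1 Jmx2.
  by rewrite /Jinv linearB /= mulmxBr mulmxBl J1.
by apply: mxle_Jinv => a b; rewrite !mxE; have := h a b; rewrite mxE.
Qed.

Lemma eta_kills k : exists2 rho : R, 0 < rho & forall z, cabs z < rho -> z != 0 -> eta z *m e k 0 = 0.
Proof.
have [rho rho0 Hrho] := eta_vanish_fixed; exists rho; first exact: rho0.
move=> z zr z0.
have [K K0 [r1 r10 HK]] := Fp_bound oU sF hF hext oO OU hB O0.
have [M M0 [r2 r20 HM]] := smx_bounded O0 (@pull_smx k).
have /open_cabsP/(_ 0 O0)[r3 r30 H3] := oO.
have approx (eps : R) : 0 < eps -> exists2 u : vec, eta z *m u = 0 & mxle eps (u - e k 0).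
  move=> eps0.
  have cp a b : {for 0, continuous (fun w => pull F e k w a b)} := sCk_cts (@pull_smx k a b 0) O0.
  have e20 : 0 < eps / 2 by rewrite divr_gt0.
  have [r4 r40 H4] := cts_bounded cp e20.
  pose L := 1 + n%:R * (K * M); have L0 : 0 < L by rewrite ltr_pwDl // mulr_ge0 ?ler0n // mulr_ge0.
  pose r := Num.min (Num.min r1 r2) (Num.min (Num.min r3 r4) (eps / 2 / L)).
  have r0 : 0 < r by rewrite !lt_min r10 r20 r30 r40 divr_gt0.
  have [||w wr|z1 z1r Hz1] := @local_vanish R m U O F eta Fl Fm Fp e oU sF hF hext OU hB key [set w | cabs (w - 0) < r].
  - exact: open_cball.
  - by exists 0; rewrite /= subrr cabs0.
  - by apply: H3; move: wr; rewrite /= !lt_min => /andP[_ /andP[/andP[]]].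
  move: z1r; rewrite /= subr0 !lt_min => /andP[/andP[w1 w2] /andP[/andP[w3 w4] w5]].
  have Oz1 : O z1 by apply: H3; rewrite subr0.
  have [_ [_ [rr [H1 [rr1 dH1 EH1]]]] _] := hB Oz1.
  have hH1 := holo_holm rr1 dH1.
  exists (Jinv (H1 0) *m pull F e k z1); first exact: (Hrho _ z1 Oz1 (Hz1 H1 hH1 EH1 k) z zr z0).
  have d1 := plus_loop_value hH1 EH1 (fun x => HK z1 x w1).
  have K1 : 0 <= K * cabs z1 by rewrite mulr_ge0 // cabs_ge0.
  have d2 := mxle_mul K1 d1 (HM z1 w2).
  have -> : Jinv (H1 0) *m pull F e k z1 - e k 0 =
     (Jinv (H1 0) - 1%:M) *m pull F e k z1 + (pull F e k z1 - pull F e k 0).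
    by rewrite mulmxBl mul1mx addrA subrK pull0.
  apply: mxle_le (mxle_add d2 (H4 z1 w4)).
  move: w5; rewrite ltr_pdivlMr // /L => w5.
  have := cabs_ge0 z1; move: w5 => w5 c0.
  have -> : n%:R * (K * cabs z1 * M) = cabs z1 * (n%:R * (K * M)) by ring.
  rewrite mulrDr mulr1 in w5; lra.
apply/matrixP => a b; rewrite [b]ord1 [RHS]mxE; apply/eqP; rewrite -cabs_eq0.
apply/eqP/le_anti; rewrite cabs_ge0 andbT; apply/ler_addgt0Pr => eps eps0; rewrite add0r.
pose S := 1 + \sum_c \sum_d cabs (eta z c d).
have sum0 : 0 <= \sum_c \sum_d cabs (eta z c d) by apply: sumr_ge0 => c _; apply: sumr_ge0 => d _; exact: cabs_ge0.
have S0 : 0 < S by rewrite ltr_pwDl.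
have nS : 0 < n%:R * S by rewrite mulr_gt0 // ltr0n.
have [u eu ue] := approx (eps / (n%:R * S)) (divr_gt0 eps0 nS).
have etaS : mxle S (eta z).
  move=> c d; rewrite /S (bigD1 c) //= (bigD1 d) //=.
  have h1 : 0 <= \sum_(i | i != d) cabs (eta z c i) by apply: sumr_ge0 => ? _; exact: cabs_ge0.
  have h2 : 0 <= \sum_(i | i != c) \sum_d0 cabs (eta z i d0) by apply: sumr_ge0 => ? _; apply: sumr_ge0 => ? _; exact: cabs_ge0.
  lra.
have := mxle_mul (ltW S0) etaS ue => /(_ a 0); rewrite mulmxBr eu sub0r mxE cabsN => h.
apply: le_trans h _; rewrite mulrA mulrCA divff ?mulr1 //; exact: lt0r_neq0.
Qed.

End Kernel.

(** * The normal form *)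

Section RealBasis.
Variables (R : realType) (m : nat).
Local Notation C := (cplx R).
Local Notation n := (2 + m * 2)%N.
Local Notation mat := 'M[C]_n.
Local Notation cj := (map_mx Num.conj).

(* For [p = 2 + m * 2] this is the block that occurs in [positive_frame]. *)
Definition reim p (v : 'I_m -> 'cV[C]_p) : 'M[C]_(p, m * 2) :=
  \matrix_(i < p) mxvec (\matrix_(j < m, e < 2) if e == 0 then 'Re (v j i 0) else 'Im (v j i 0)).

Lemma reimE p (v : 'I_m -> 'cV[C]_p) i j (e : 'I_2) :
  reim v i (mxvec_index j e) = if e == 0 then 'Re (v j i 0) else 'Im (v j i 0).
Proof. by rewrite mxE mxvecE mxE. Qed.

Lemma reim_real p (v : 'I_m -> 'cV[C]_p) : cj (reim v) = reim v.
Proof.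
apply/matrixP => i k; case/mxvec_indexP: k => j e; rewrite mxE reimE.
by case: ifP => _; apply: CrealP; [exact: Creal_Re|exact: Creal_Im].
Qed.

Lemma dsubmx_reim p q (v : 'I_m -> 'cV[C]_(p + q)) : dsubmx (reim v) = reim (fun j => dsubmx (v j)).
Proof. by apply/matrixP => i k; case/mxvec_indexP: k => j e; rewrite mxE !reimE !mxE. Qed.

Lemma usubmx_reim p q (v : 'I_m -> 'cV[C]_(p + q)) : usubmx (reim v) = reim (fun j => usubmx (v j)).
Proof. by apply/matrixP => i k; case/mxvec_indexP: k => j e; rewrite mxE !reimE !mxE. Qed.

Lemma reim_orth p (v : 'I_m -> 'cV[C]_p) :
  (forall j k, (v j)^T *m v k = 0) -> (forall j k, (v j)^T *m cj (v k) = ((j == k)%:R * 2)%:M) ->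
  (reim v)^T *m reim v = 1%:M.
Proof.
move=> h1 h2; apply/matrixP => a b; case/mxvec_indexP: a => j e; case/mxvec_indexP: b => k f.
pose d : C := (j == k)%:R * 2.
have s1 : \sum_i v j i 0 * v k i 0 = 0.
  have e1 : ((v j)^T *m v k) 0 0 = \sum_i v j i 0 * v k i 0 by rewrite mxE; apply: eq_bigr => i _; rewrite mxE.
  by rewrite -e1 h1 mxE.
have s2 : \sum_i v j i 0 * (v k i 0)^* = d.
  have e1 : ((v j)^T *m cj (v k)) 0 0 = \sum_i v j i 0 * (v k i 0)^* by rewrite mxE; apply: eq_bigr => i _; rewrite !mxE.
  by rewrite -e1 h2 mxE mulr1n.
have cS (g : 'I_p -> C) : (\sum_i g i)^* = \sum_i (g i)^* by exact: rmorph_sum.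
have cM (x y : C) : (x * y)^* = x^* * y^* by exact: rmorphM.
have dr : d^* = d by rewrite /d rmorphM !rmorph_nat.
have s3 : \sum_i (v j i 0)^* * v k i 0 = d.
  by rewrite -dr -s2 cS; apply: eq_bigr => i _; rewrite cM conjCK.
have s4 : \sum_i (v j i 0)^* * (v k i 0)^* = 0.
  have := congr1 Num.conj s1; rewrite cS conjC0; apply: etrans.
  by apply: eq_bigr => i _; rewrite cM.
have lin (c1 c2 c3 c4 : C) : \sum_i (c1 * (v j i 0 * v k i 0) + c2 * (v j i 0 * (v k i 0)^*)
    + c3 * ((v j i 0)^* * v k i 0) + c4 * ((v j i 0)^* * (v k i 0)^*)) = (c2 + c3) * d.
  by rewrite !big_split /= -!mulr_sumr s1 s2 s3 s4 !mulr0 add0r addr0 -mulrDl.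
have two : (2 : C) != 0 by rewrite pnatr_eq0.
have ii := sqrCi C.
have e01 (x : 'I_2) : x = 0 \/ x = 1 by case: x => [[|[|//]]] h; [left|right]; apply: val_inj.
have entry : ((reim v)^T *m reim v) (mxvec_index j e) (mxvec_index k f) =
    \sum_i reim v i (mxvec_index j e) * reim v i (mxvec_index k f).
  by rewrite mxE; apply: eq_bigr => i _; rewrite mxE.
rewrite entry [RHS]mxE.
have -> : (mxvec_index j e == mxvec_index k f) = (j == k) && (e == f).
  apply/eqP/andP => [E|[/eqP -> /eqP ->] //].
  have := congr1 (fun x => mxvec (delta_mx j e : 'M[C]_(m, 2)) 0 x) E; rewrite !mxvecE !mxE !eqxx /=.
  case: (boolP ((k == j) && (f == e))) => [/andP[/eqP -> /eqP ->] _|_ /eqP]; first by rewrite !eqxx.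
  by rewrite oner_eq0.
have [->|->] := e01 e; have [->|->] := e01 f.
- transitivity (\sum_i (4^-1 * (v j i 0 * v k i 0) + 4^-1 * (v j i 0 * (v k i 0)^*)
    + 4^-1 * ((v j i 0)^* * v k i 0) + 4^-1 * ((v j i 0)^* * (v k i 0)^*))).
    by apply: eq_bigr => i _; rewrite !reimE /= !ReE; field.
  by rewrite lin /d andbT; case: (j == k) => /=; rewrite ?mulr1n ?mulr0n; field.
- transitivity (\sum_i (- ('i / 4) * (v j i 0 * v k i 0) + ('i / 4) * (v j i 0 * (v k i 0)^*)
    + - ('i / 4) * ((v j i 0)^* * v k i 0) + ('i / 4) * ((v j i 0)^* * (v k i 0)^*))).
    by apply: eq_bigr => i _; rewrite !reimE /= ReE ImE; field.
  by rewrite lin andbF subrr mul0r.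
- transitivity (\sum_i (- ('i / 4) * (v j i 0 * v k i 0) + - ('i / 4) * (v j i 0 * (v k i 0)^*)
    + ('i / 4) * ((v j i 0)^* * v k i 0) + ('i / 4) * ((v j i 0)^* * (v k i 0)^*))).
    by apply: eq_bigr => i _; rewrite !reimE /= ReE ImE; field.
  by rewrite lin andbF addNr mul0r.
transitivity (\sum_i (- 4^-1 * (v j i 0 * v k i 0) + 4^-1 * (v j i 0 * (v k i 0)^*)
    + 4^-1 * ((v j i 0)^* * v k i 0) + - 4^-1 * ((v j i 0)^* * (v k i 0)^*))).
  apply: eq_bigr => i _; rewrite !reimE /= !ImE; move: (v j i 0) (v k i 0) => x y.
  have -> : 'i * (x^* - x) / 2 * ('i * (y^* - y) / 2) = 'i ^+ 2 * ((x^* - x) * (y^* - y)) / 4 by field.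
  by rewrite ii; field.
by rewrite lin /d eqxx andbT; case: (j == k) => /=; rewrite ?mulr1n ?mulr0n; field.
Qed.

Lemma reim_mul (v : 'I_m -> 'cV[C]_(m * 2)) (B : 'M[C]_(2, m * 2)) i j : B *m v j = 0 ->
  (B *m reim v) i (mxvec_index j 1) = 'i * (B *m reim v) i (mxvec_index j 0).
Proof.
move=> /matrixP/(_ i 0); rewrite !mxE => h.
have ii := sqrCi C.
have E : (\sum_k B i k * reim v k (mxvec_index j 0)) + 'i * (\sum_k B i k * reim v k (mxvec_index j 1)) = 0.
  apply: (etrans _ h); rewrite mulr_sumr -big_split /=; apply: eq_bigr => k _; rewrite !reimE /= [in RHS](Crect (v j k 0)).
  by ring.
move: E; move: (\sum_k _) (\sum_k B i k * reim v k (mxvec_index j 1)) => x y E.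
have -> : x = - ('i * y) by apply/eqP; rewrite -addr_eq0 E.
by rewrite mulrN mulrA -expr2 ii mulN1r opprK.
Qed.

Lemma potential_form (G : mat) :
  (forall i j : 'I_2, G (lshift _ i) (lshift _ j) = 0) ->
  (forall i j : 'I_(m * 2), G (rshift 2 i) (rshift 2 j) = 0) ->
  (forall (i : 'I_(m * 2)) (j : 'I_2), G (rshift 2 i) (lshift _ j) + (-1) ^+ (j == 0%N :> nat) * G (lshift _ j) (rshift 2 i) = 0) ->
  (forall (i : 'I_2) (j : 'I_m), G (lshift _ i) (rshift 2 (mxvec_index j 1)) - 'i * G (lshift _ i) (rshift 2 (mxvec_index j 0)) = 0) ->
  G = isotropic_potential (fun j => G (lshift _ 0) (rshift 2 (mxvec_index j 0))) (fun j => G (lshift _ 1) (rshift 2 (mxvec_index j 0))).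
Proof.
move=> e1 e2 e3 e4.
have up (i : 'I_2) k : G (lshift _ i) (rshift 2 k) =
   (col_mx (isotropic_row (fun j => G (lshift _ 0) (rshift 2 (mxvec_index j 0))))
           (isotropic_row (fun j => G (lshift _ 1) (rshift 2 (mxvec_index j 0)))) : 'M[C]_(2, m * 2)) i k.
  case/mxvec_indexP: k => j f.
  have e01 (x : 'I_2) : x = 0 \/ x = 1 by case: x => [[|[|//]]] h; [left|right]; apply: val_inj.
  have gen : G (lshift _ i) (rshift 2 (mxvec_index j f)) = 'i ^+ f * G (lshift _ i) (rshift 2 (mxvec_index j 0)).
    have [->|->] := e01 f; first by rewrite expr0 mul1r.
    by apply/eqP; rewrite -subr_eq0 expr1 e4.
  have row (h : 'I_m -> C) : isotropic_row h 0 (mxvec_index j f) = 'i ^+ f * h j by rewrite mxvecE mxE.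
  have z0 : lshift 1 (0 : 'I_1) = 0 :> 'I_2 by apply: val_inj.
  have z1 : rshift 1 (0 : 'I_1) = 1 :> 'I_2 by apply: val_inj.
  have up0 (u w : 'rV[C]_(m * 2)) k : (col_mx u w : 'M[C]_(2, m * 2)) 0 k = u 0 k by rewrite -z0 (col_mxEu u w).
  have up1 (u w : 'rV[C]_(m * 2)) k : (col_mx u w : 'M[C]_(2, m * 2)) 1 k = w 0 k by rewrite -z1 (col_mxEd u w).
  by rewrite gen; have [->|->] := e01 i; rewrite ?up0 ?up1 row.
rewrite /isotropic_potential; move: up; move: (isotropic_row _) (isotropic_row _) => r0 r1 up.
apply/matrixP => a b; rewrite -[a]splitK -[b]splitK.
case: (fintype.split a) => i; case: (fintype.split b) => k; rewrite /unsplit.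
- by rewrite block_mxEul e1 mxE.
- by rewrite block_mxEur up.
- have gen (B : 'M[C]_(2, m * 2)) : (- (B^T *m Jmx R 2)) i k = - ((-1) ^+ (k == 0%N :> nat) * B k i).
    by rewrite mxE /Jmx mul_mx_diag !mxE mulrC.
  by rewrite block_mxEdl gen -up; apply/eqP; rewrite -addr_eq0; apply/eqP; exact: e3.
by rewrite block_mxEdr e2 mxE.
Qed.

End RealBasis.

Section BasePoint.
Variables (R : realType) (m : nat).
Local Notation C := (cplx R).
Local Notation n := (2 + m * 2)%N.
Local Notation mat := 'M[C]_n.
Local Notation vec := 'cV[C]_n.
Local Notation J := (Jmx R n).
Local Notation cj := (map_mx Num.conj).

Lemma plane_frameE (y yh : vec) : let c : C := (sqrtC 2)^-1 in
  row_mx (c *: (y + yh)) (c *: (- y + yh)) =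
  y *m row_mx c%:M (- c)%:M + yh *m row_mx c%:M c%:M :> 'M[C]_(n, 2).
Proof.
by move=> c; rewrite !mul_mx_row !mul_mx_scalar add_row_mx !scalerDr scalerN scaleNr.
Qed.

(* Passing from (y, N, Re E, Im E) to the positive frame of the plane and of [v] is unimodular. *)
Lemma frame_det (y N yh : vec) (E v : 'I_m -> vec) (nu : 'I_m -> C) (c : C) (r : 'cV[C]_(m * 2)) :
  cj y = y -> (forall j, v j = E j + nu j *: y) -> yh = N + c *: y + reim v *m r ->
  \det (row_mx (y *m row_mx (sqrtC 2)^-1%:M (- (sqrtC 2)^-1)%:M + yh *m row_mx (sqrtC 2)^-1%:M (sqrtC 2)^-1%:M : 'M[C]_(n, 2)) (reim v) : mat)
  = \det (row_mx (row_mx y N : 'M[C]_(n, 2)) (reim E) : mat).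
Proof.
move=> ry vE yhE; set s : C := (sqrtC 2)^-1.
have s2 : s * s *+ 2 = 1.
  have two : (2 : C) != 0 by rewrite pnatr_eq0.
  by rewrite -expr2 /s exprVn sqrtCK -mulr_natl divff.
have yr i : (y i 0)^* = y i 0 by move/matrixP/(_ i 0): ry; rewrite mxE.
pose rn : 'M[C]_(1, m * 2) := reim (fun j => (nu j)%:M : 'cV[C]_1).
have vr : reim v = reim E + y *m rn.
  apply/matrixP => i k; case/mxvec_indexP: k => j e; rewrite [RHS]mxE !reimE mxE big_ord1 reimE vE !mxE mulr1n.
  have yreal : y i 0 \is Num.real by apply/CrealP.
  have two : (2 : C) != 0 by rewrite pnatr_eq0.
  case: ifP => _; first by rewrite raddfD /= mulrC (ReMl yreal).
  by rewrite raddfD /= mulrC (ImMl yreal).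
pose P : 'M[C]_(n, 1 + 1) := row_mx y N.
pose T1 : 'M[C]_(1 + 1 + m * 2) := block_mx 1%:M (col_mx rn 0) 0 1%:M.
pose T2 : 'M[C]_(1 + 1) := block_mx 1%:M 0 1%:M 1%:M *m block_mx s%:M (- s)%:M 0 (s + s)%:M.
pose T3 : 'M[C]_(1 + 1) := block_mx 1%:M c%:M 0 1%:M.
pose T4 : 'M[C]_(1 + 1 + m * 2) := block_mx (T3 *m T2) 0 (row_mx 0 r *m T2) 1%:M.
have E1 : (row_mx P (reim E) : 'M[C]_(n, 1 + 1 + m * 2)) *m T1 = row_mx P (reim v).
  rewrite /T1 mul_row_block !mulmx1 mulmx0 addr0 /P mul_row_col mulmx0 addr0 vr; congr row_mx; exact: addrC.
have E2 : (row_mx P (reim v) : 'M[C]_(n, 1 + 1 + m * 2)) *m T4 =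
    row_mx (y *m row_mx s%:M (- s)%:M + yh *m row_mx s%:M s%:M) (reim v).
  rewrite /T4 mul_row_block mulmx0 mulmx1 add0r; congr row_mx.
  have PT : P *m T3 = row_mx y (c *: y + N) by rewrite /P /T3 mul_row_block !mulmx1 mulmx0 addr0 mul_mx_scalar.
  have RT : reim v *m (row_mx 0 r : 'M[C]_(m * 2, 1 + 1)) = row_mx 0 (reim v *m r) by rewrite mul_mx_row mulmx0.
  have ST : row_mx y yh *m T2 = row_mx (s *: (y + yh)) (s *: (- y + yh)).
    rewrite /T2 mulmxA mul_row_block !mulmx1 mulmx0 add0r mul_row_block mulmx0 addr0 !mul_mx_scalar.
    congr row_mx; apply/matrixP => a b; rewrite !mxE; ring.
  have -> : y *m row_mx s%:M (- s)%:M + yh *m row_mx s%:M s%:M = row_mx (s *: (y + yh)) (s *: (- y + yh)).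
    exact: esym (plane_frameE y yh).
  rewrite (mulmxA P) (mulmxA (reim v)) -mulmxDl PT RT add_row_mx addr0 (addrC (c *: y)) -yhE; exact: ST.
have d1 : \det T1 = 1 by rewrite /T1 det_ublock !det1 mulr1.
have d2 : \det T4 = 1.
  by rewrite /T4 det_lblock det1 mulr1 det_mulmx /T3 det_ublock !det1 mulr1 mul1r /T2 det_mulmx det_lblock det_ublock !det1 mulr1 mul1r !det_scalar1 mulrDr -mulr2n.
have := congr1 (fun M : 'M[C]_(1 + 1 + m * 2) => \det M) E2.
rewrite /= (det_mulmx (row_mx P (reim v) : 'M[C]_(1 + 1 + m * 2))) d2 mulr1 -E1.
rewrite (det_mulmx (row_mx P (reim E) : 'M[C]_(1 + 1 + m * 2))) d1 mulr1 => h.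
exact: esym h.
Qed.

Variables (U O : set C) (Y N kappa : C -> vec) (s mu : C -> C) (E : 'I_m -> C -> vec) (F : C -> mat).
Variables (oO : open O) (hY : canonical_lift Y O) (hN : is_N Y O N) (hk : hopf_schwarzian Y O kappa s).
Variables (hT : totally_isotropic Y O) (hE : H_frame Y O E).
Variable smu : forall k, sCk k O mu.
Variable ric : forall z, O z -> dz (mu : C -> C^o) z - mu z ^+ 2 / 2 - s z = 0.
Local Notation Yh := (adjoint_lift Y N mu).
Local Notation ev := (evec Y mu E).

Lemma evec_perp k z : O z -> ip (ev k z) (Y z) = 0 /\ ip (ev k z) (Yh z) = 0.
Proof.
move=> Oz; have [k0|k0] := posnP k.
  split; last by rewrite ipC; exact: (ip_Yhe0 mu E oO hY hN hT Oz k0).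
  have [y1 _] := ip_YYz oO hY Oz; have y2 := ip_YY hY Oz.
  rewrite (evec0 Y mu E z k0); move: (dz Y z) (Y z) y1 y2 => a b y1 y2.
  by rewrite ipDl !ipZl (ipC a) y1 y2 !mulr0 addr0.
have [e1 e2 e3 e4] := VperpE (E_Vperp hE Oz k0).1.
rewrite (evecE Y mu E z k0) (adjointE mu oO hY hN hT Oz); move: e1 e2 e3 e4.
move: (Y z) (dz Y z) (dzb Y z) (dz (dzb Y) z) (E k z) => y yz yb x e e1 e2 e3 e4.
by split; [rewrite ipC e1|rewrite ipC !ipDl !ipZl e1 e2 e3 e4 !mulr0 !addr0].
Qed.

Lemma geometry_key : open U -> smx U F -> (forall z, U z -> in_SOplus (F z)) ->
  (forall z, U z -> represents (F z) (plane_frame Y Yh z)) -> O `<=` U ->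
  forall O1 : set C, open O1 -> O1 !=set0 -> O1 `<=` O ->
  exists V : set C, [/\ open V, V !=set0, V `<=` O1 & forall z, V z ->
    [/\ forall i j, (covder (mc0 F) (mc1 F) i z)^T *m covder (mc0 F) (mc1 F) j z = 0,
        forall j k, (covder (mc0 F) (mc1 F) j z)^T *m pull F ev k z = 0
      & forall k, lpr R m *m pull F ev k z = 0]].
Proof.
move=> oU sF hF hrep OU O1 oO1 ne O1O.
have [V [oV neV VO1 HV]] := perp_generic oO hY hN hk hT hE smu ric oO1 ne O1O.
exists V; split; [exact: oV|exact: neV|exact: VO1|].
have VO : V `<=` O by move=> z /VO1/O1O.
have VU : V `<=` U by move=> z /VO/OU.
pose gen (b : bool) : C -> vec := if b then Yh else Y.
have sgen b : smx V (gen b).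
  by case: b; apply: (smx_sub VO); [exact: (Yh_smx oO hY hN hT smu)|exact: (sY oO hY)].
have jphi : jets V gen (plane_frame Y Yh).
  have j1 := jets_mul oV (smx_cst oV (row_mx (sqrtC 2)^-1%:M (- (sqrtC 2)^-1)%:M : 'M[C]_(1, 2))) (jet_phi gen oV false 0).
  have j2 := jets_mul oV (smx_cst oV (row_mx (sqrtC 2)^-1%:M (sqrtC 2)^-1%:M : 'M[C]_(1, 2))) (jet_phi gen oV true 0).
  apply: jet_eq (jet_add j1 j2) => z _; exact: esym (plane_frameE (Y z) (Yh z)).
have perp z : V z -> forall (i : bool) j k, ip (ev k z) (iter j (@dz R _) (gen i) z) = 0.
  by move=> Vz i j k; have [h1 h2] := HV z Vz j k; case: i; [exact: h2|exact: h1].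
have gram z : V z -> forall k j, ip (ev k z) (ev j z) = 0 /\ ip (ev k z) (cj (ev j z)) = (k == j)%:R * 2.
  by move=> Vz k j; exact: (evec_gram mu oO hY hT hE k j (VO z Vz)).
move=> z Vz; split.
- move=> i j; exact: (covder_iso oU sF hF hrep oV VU sgen jphi perp gram i j Vz).
- move=> j k; exact: (covder_pull oU sF hF hrep oV VU sgen jphi perp j k Vz).
move=> k; exact: (pull_lpr sF hF hrep oV VU sgen jphi perp k Vz).
Qed.

Lemma base_frame : O 0 -> exists (v : 'I_m -> vec) (nu : 'I_m -> C),
  [/\ forall j, v j = E j 0 + nu j *: Y 0,
      forall j, exists2 x : C, x != 0 & ev j 0 = x *: v j,
      forall j k, ip (v j) (v k) = 0 /\ ip (v j) (cj (v k)) = (j == k)%:R * 2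
    & (0 < m)%N -> exists (c : C) (r : 'cV[C]_(m * 2)), Yh 0 = N 0 + c *: Y 0 + reim v *m r].
Proof.
move=> O0.
have [m0|mpos] := posnP m.
  have no (j : 'I_m) : False by case: j => j; rewrite m0.
  by exists (fun=> 0), (fun=> 0); split; [move=> j; case: (no j)|move=> j; case: (no j)|move=> j; case: (no j)|].
pose i0 : 'I_m := Ordinal mpos.
have [a [c TE]] := H_osculating hE O0 i0.
have {}TE : dz Y 0 = a *: Y 0 + c i0 *: E i0 0.
  apply: (etrans TE); congr (_ + _); rewrite (bigD1 i0) //= big1 ?addr0 // => j /andP[j0 ji].
  by move: ji; rewrite -val_eqE /= -lt0n ltnNge j0.
have [y1 y2] := ip_YYz oO hY O0; have y3 := ip_YY hY O0; have y5 := ip_YzYzb oO hY hT O0.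
have [rY rYz] := Y_real oO hY O0.
have c0 : c i0 != 0.
  apply/eqP => c0; move: y5; rewrite TE c0 scale0r addr0 ipZl y2 mulr0 => /eqP.
  by rewrite eq_sym invr_eq0 pnatr_eq0.
have YE j : ip (Y 0) (E j 0) = 0.
  have [j0|j0] := posnP j; last by have [] := VperpE (E_Vperp hE O0 j0).1.
  have -> : j = i0 by apply: val_inj.
  move: y1; rewrite TE ipDr (ipZr a) (ipZr (c i0)) y3 mulr0 add0r => /eqP.
  by rewrite mulf_eq0 (negPf c0) => /eqP.
have YEc j : ip (Y 0) (cj (E j 0)) = 0 by rewrite -rY ip_conj YE conjC0.
pose nu (j : 'I_m) : C := if j == 0%N :> nat then (2 * a + mu 0) / (2 * c i0) else 0.
pose v j := E j 0 + nu j *: Y 0.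
have two : (2 : C) != 0 by rewrite pnatr_eq0.
exists v, nu; split=> //.
- move=> j; have [j0|j0] := posnP j; last first.
    exists 1; first exact: oner_neq0.
    by rewrite scale1r evecE // /v /nu -[_ == _]negbK -lt0n j0 scale0r addr0.
  exists (2 * c i0); first by rewrite mulf_neq0.
  have -> : j = i0 by apply: val_inj.
  rewrite evec0 // TE /v /nu eqxx; move: (E i0 0) (Y 0) => x y.
  by apply/matrixP => p q; rewrite !mxE; field; rewrite c0.
- move=> j k; have [e1 e2] : ip (E j 0) (E k 0) = 0 /\ ip (E j 0) (cj (E k 0)) = (j == k)%:R * 2.
    by split; [exact: (H_isotropic hE O0)|exact: (H_unitary hE O0)].
  have cv : cj (v k) = cj (E k 0) + (nu k)^* *: Y 0 by rewrite /v map_mxD map_mxZ rY.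
  rewrite cv /v; split; rewrite !(ipDl, ipDr, ipZl, ipZr) ?(ipC (E j 0) (Y 0)) !YE ?YEc y3 ?e1 ?e2; ring.
move=> _; pose t : C := (mu 0)^* * c i0.
pose w : C := (mu 0)^* * (a - c i0 * nu i0).
exists (2^-1 * `|mu 0| ^+ 2 + (w + w^*)).
exists ((2 * 'Re t) *: delta_mx (mxvec_index i0 0) 0 - (2 * 'Im t) *: delta_mx (mxvec_index i0 1) 0).
have col e : reim v *m (delta_mx (mxvec_index i0 e) (0 : 'I_1) : 'cV[C]_(m * 2)) = \col_i (if e == 0 then 'Re (v i0 i 0) else 'Im (v i0 i 0)).
  by apply/matrixP => p q; rewrite [q]ord1 -colE [LHS]mxE [RHS]mxE reimE.
have E0 : dz Y 0 = (a - c i0 * nu i0) *: Y 0 + c i0 *: v i0.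
  by rewrite TE /v; move: (E i0 0) (Y 0) => x y; apply/matrixP => p q; rewrite !mxE; ring.
clearbody v.
rewrite mulmxBr -!scalemxAr !col /adjoint_lift -rYz E0.
have yr i : (Y 0 i 0)^* = Y 0 i 0 by move/matrixP/(_ i 0): rY; rewrite mxE.
have cM (x y : C) : (x * y)^* = x^* * y^* by exact: rmorphM.
have cD (x y : C) : (x + y)^* = x^* + y^* by exact: rmorphD.
apply/matrixP => p q; rewrite [q]ord1 !mxE /= cD !cM yr !ReE !ImE.
move: (v i0 p 0) (Y 0 p 0) (N 0 p 0) (`|mu 0| ^+ 2) => x y z u.
have ii := sqrCi C.
have ct : t^* = mu 0 * (c i0)^* by rewrite /t cM conjCK.
rewrite conjCK ct /w /t; move: (mu 0) ((mu 0)^*) (a - c i0 * nu i0) ((a - c i0 * nu i0)^*) (c i0) ((c i0)^*) (x^*) => f f' g g' h h' x'.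
have -> : 2 * ('i * (f * h' - f' * h) / 2) * ('i * (x' - x) / 2) = 'i ^+ 2 * ((f * h' - f' * h) * (x' - x) / 2) by field.
by rewrite ii; field.
Qed.

End BasePoint.

Section PotentialSpread.
Variables (R : realType) (m : nat).
Local Notation C := (cplx R).
Local Notation n := (2 + m * 2)%N.
Local Notation mat := 'M[C]_n.
Local Notation vec := 'cV[C]_n.
Local Notation J := (Jmx R n).
Local Notation cj := (map_mx Num.conj).

Lemma eta_sigma (O : set C) (Fm : C -> C -> mat) (eta : mat) z : open O -> O z ->
  (forall w, O w -> twisted_loop (fun lam => Fm lam w)) -> holo_at (Fm 1) z -> holo_at (Fm (-1)) z ->
  (forall lam : C, `|lam| = 1 -> invmx (Fm lam z) *m dz (Fm lam) z = lam^-1 *: eta) ->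
  sigma eta = - eta /\ eta^T *m J + J *m eta = 0.
Proof.
move=> oO Oz tm h1 h2 H.
have [_ [d1 _ _ _]] := holo_dif (nbhs_singleton h1).
have e1 := H 1 (normr1 _); rewrite invr1 scale1r in e1.
split; last first.
  rewrite -e1; apply: (log_skew oO Oz d1) => w Ow.
  by have [[-> _] _] := tm w Ow 1 (normr1 _).
have e2 := H (-1) (normrN1 _).
have [ds es _] := dif_cst z (smat R m).
have [d3 f3 _] := dif_mul ds d1; have [d4 f4 _] := dif_mul d3 ds.
have sE w : O w -> smat R m *m Fm 1 w *m smat R m = Fm (-1) w.
  by move=> Ow; have [_ h] := tm w Ow 1 (normr1 _); exact: h.
have [_ g _] := dif_eq oO Oz sE d4.
have dE : dz (Fm (-1)) z = smat R m *m dz (Fm 1) z *m smat R m.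
  apply: (etrans g); apply: (etrans f4); rewrite es mulmx0 addr0; congr (_ *m _).
  by apply: (etrans f3); rewrite es mul0mx add0r.
have uF : Fm 1 z \in unitmx by have [[h _] _] := tm z Oz 1 (normr1 _); exact: Jinv_unit h.
have iE : invmx (Fm (-1) z) = smat R m *m invmx (Fm 1 z) *m smat R m.
  have L : (smat R m *m invmx (Fm 1 z) *m smat R m) *m Fm (-1) z = 1%:M.
    have ss := smat2 R m; rewrite -(sE z Oz); move: (Fm 1 z) uF => M uM.
    by rewrite !mulmxA -(mulmxA _ (smat R m) (smat R m)) ss mulmx1 -(mulmxA (smat R m)) (mulVmx uM) mulmx1 ss.
  have u2 : Fm (-1) z \in unitmx by have /mulmx1_unit[] := L.
  by rewrite -[RHS](mulmxK u2) L mul1mx.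
have : sigma eta = invmx (Fm (-1) z) *m dz (Fm (-1)) z.
  rewrite iE dE -e1 /sigma -/(smat R m); move: (invmx (Fm 1 z)) (dz (Fm 1) z) => a b.
  by rewrite !mulmxA -(mulmxA _ (smat R m) (smat R m)) smat2 mulmx1.
by rewrite e2 invrN invr1 scaleN1r.
Qed.

Lemma potential_block (eta : mat) : sigma eta = - eta -> eta^T *m J + J *m eta = 0 ->
  eta = block_mx 0 (ursubmx eta) (- ((ursubmx eta)^T *m Jmx R 2)) 0.
Proof.
move=> hs hj.
have half (p q : nat) (A : 'M[C]_(p, q)) : A = - A -> A = 0.
  by move=> h; apply/matrixP => a b; move/matrixP/(_ a b): h; rewrite !mxE => /eqP; rewrite -subr_eq0 opprK -mulr2n mulrn_eq0 => /eqP.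
move: hs hj; rewrite -[eta]submxK; move: (ulsubmx eta) (ursubmx eta) (dlsubmx eta) (drsubmx eta) => a b c d.
rewrite block_mxKur /sigma !mulmx_block !mulmx0 !mul0mx !addr0 !add0r !mulNmx !mulmxN !mul1mx !mulmx1 opp_block_mx.
move=> /eq_block_mx[ha _ _ hd].
have {ha}-> : a = 0 by apply: half; rewrite -{1}[a]opprK ha.
have {hd}-> : d = 0 by apply: half.
rewrite Jmx_block tr_block_mx !trmx0 !mulmx_block !mulmx0 !mul0mx !mul1mx !mulmx1 !addr0 !add0r add_block_mx.
rewrite -[0 in RHS]submxK => /eq_block_mx[_ _ h _].
have -> : c = - (b^T *m Jmx R 2) by apply/eqP; rewrite -addr_eq0 addrC h; apply/eqP/matrixP => x y; rewrite !mxE.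
by [].
Qed.

Variables (Omega : set C) (eta : C -> mat) (Q Qi : mat).
Variables (oM : open Omega) (cM : connected Omega) (M0 : Omega 0) (hmero : meromorphic Omega eta).

Lemma conj_entry A i j : (Q *m A *m Qi) i j = \sum_a \sum_b (Q i a * Qi b j) * A a b.
Proof.
rewrite mxE exchange_big /=; apply: eq_bigr => b _; rewrite mxE mulr_suml.
by apply: eq_bigr => a _; ring.
Qed.

Lemma conj_meromorphic i j : meromorphic Omega ((fun z => (Q *m eta z *m Qi) i j) : C -> C^o).
Proof.
have -> : (fun z => (Q *m eta z *m Qi) i j) = (fun z => \sum_a \sum_b (Q i a * Qi b j) * eta z a b).
  by apply/funext => z; exact: conj_entry.
exact: (meromorphic_comb (fun a b => Q i a * Qi b j) hmero).
Qed.

Lemma spread_relation (c1 c2 : C) i j k l :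
  (\forall z \near 0^', c1 * (Q *m eta z *m Qi) i j + c2 * (Q *m eta z *m Qi) k l = 0) ->
  forall p, Omega p -> \forall z \near p^', c1 * (Q *m eta z *m Qi) i j + c2 * (Q *m eta z *m Qi) k l = 0.
Proof.
apply: meromorphic_identity => //.
have -> : (fun z => c1 * (Q *m eta z *m Qi) i j + c2 * (Q *m eta z *m Qi) k l) =
   (fun z => \sum_a \sum_b (c1 * (Q i a * Qi b j) + c2 * (Q k a * Qi b l)) * eta z a b).
  apply/funext => z; rewrite !conj_entry !mulr_sumr -big_split /=; apply: eq_bigr => a _.
  by rewrite !mulr_sumr -big_split /=; apply: eq_bigr => b _; ring.
exact: meromorphic_comb hmero.
Qed.

Variable near0 : \forall z \near 0^', exists B : 'M[C]_(2, m * 2),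
  Q *m eta z *m Qi = block_mx 0 B (- (B^T *m Jmx R 2)) 0 /\
  forall i j, B i (mxvec_index j 1) = 'i * B i (mxvec_index j 0).

Lemma potential_spread p : Omega p -> let G z := Q *m eta z *m Qi in
  \forall z \near p^', G z = isotropic_potential (fun j => G z (lshift _ 0) (rshift 2 (mxvec_index j 0)))
                                           (fun j => G z (lshift _ 1) (rshift 2 (mxvec_index j 0))).
Proof.
move=> Op G.
have rel c1 c2 i j k l : (forall (B : 'M[C]_(2, m * 2)), (forall i j, B i (mxvec_index j 1) = 'i * B i (mxvec_index j 0)) ->
    c1 * (block_mx 0 B (- (B^T *m Jmx R 2)) 0 : mat) i j + c2 * (block_mx 0 B (- (B^T *m Jmx R 2)) 0 : mat) k l = 0) ->
    \forall z \near p^', c1 * G z i j + c2 * G z k l = 0.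
  move=> h; apply: (spread_relation _ Op); apply: filterS near0 => z [B [-> hB]]; exact: h.
have r1 : \forall z \near p^', forall ij : 'I_2 * 'I_2, 1 * G z (lshift _ ij.1) (lshift _ ij.2) + 0 * G z 0 0 = 0.
  apply: filter_forall => -[i j]; apply: rel => B _; by rewrite /= block_mxEul mxE mulr0 mul0r addr0.
have r2 : \forall z \near p^', forall ij : 'I_(m * 2) * 'I_(m * 2), 1 * G z (rshift 2 ij.1) (rshift 2 ij.2) + 0 * G z 0 0 = 0.
  apply: filter_forall => -[i j]; apply: rel => B _; by rewrite /= block_mxEdr mxE mulr0 mul0r addr0.
have r3 : \forall z \near p^', forall ij : 'I_(m * 2) * 'I_2, 1 * G z (rshift 2 ij.1) (lshift _ ij.2) +
    (-1) ^+ (ij.2 == 0%N :> nat) * G z (lshift _ ij.2) (rshift 2 ij.1) = 0.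
  apply: filter_forall => -[i j]; apply: rel => B _; rewrite /= block_mxEdl block_mxEur mul1r /Jmx mul_mx_diag !mxE.
  by rewrite mulrC addNr.
have r4 : \forall z \near p^', forall ij : 'I_2 * 'I_m, 1 * G z (lshift _ ij.1) (rshift 2 (mxvec_index ij.2 1)) +
    (- 'i) * G z (lshift _ ij.1) (rshift 2 (mxvec_index ij.2 0)) = 0.
  apply: filter_forall => -[i j]; apply: rel => B hB; by rewrite /= !block_mxEur hB mul1r mulNr subrr.
near=> z; apply: potential_form.
- move=> i j; have : forall ij : 'I_2 * 'I_2, 1 * G z (lshift _ ij.1) (lshift _ ij.2) + 0 * G z 0 0 = 0 by near: z.
  by move=> /(_ (i, j)); rewrite mul1r mul0r addr0.
- move=> i j; have : forall ij : 'I_(m * 2) * 'I_(m * 2), 1 * G z (rshift 2 ij.1) (rshift 2 ij.2) + 0 * G z 0 0 = 0 by near: z.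
  by move=> /(_ (i, j)); rewrite mul1r mul0r addr0.
- move=> i j; have : forall ij : 'I_(m * 2) * 'I_2, 1 * G z (rshift 2 ij.1) (lshift _ ij.2) +
    (-1) ^+ (ij.2 == 0%N :> nat) * G z (lshift _ ij.2) (rshift 2 ij.1) = 0 by near: z.
  by move=> /(_ (i, j)); rewrite mul1r.
move=> i j; have : forall ij : 'I_2 * 'I_m, 1 * G z (lshift _ ij.1) (rshift 2 (mxvec_index ij.2 1)) +
    (- 'i) * G z (lshift _ ij.1) (rshift 2 (mxvec_index ij.2 0)) = 0 by near: z.
by move=> /(_ (i, j)); rewrite mul1r mulNr.
Unshelve. all: by end_near.
Qed.

End PotentialSpread.

Section Normalization.
Variables (R : realType) (m : nat).
Local Notation C := (cplx R).
Local Notation n := (2 + m * 2)%N.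
Local Notation mat := 'M[C]_n.
Local Notation vec := 'cV[C]_n.
Local Notation J := (Jmx R n).
Local Notation cj := (map_mx Num.conj).

Lemma represents_id (phi : 'M[C]_(n, 2)) : represents 1%:M phi ->
  exists2 a : 'M[C]_2, in_SOplus a & phi = col_mx a 0.
Proof.
move=> [k [[a [b [kE ha _ _]]] <-]]; exists a; first exact: ha.
by rewrite mul1mx kE block_mxEh row_mxKl.
Qed.

Lemma usubmx_perp (a : 'M[C]_2) (v : vec) : in_SOplus a ->
  (col_mx a 0)^T *m J *m v = 0 -> usubmx v = 0.
Proof.
move=> [_ aJ _ _]; have ua := Jinv_unit aJ.
rewrite -{1}[v]vsubmxK tr_col_mx trmx0 Jmx_block mul_row_block !mulmx0 !mul0mx !addr0 mul_row_col mul0mx addr0.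
move=> h; have uJ : Jmx R 2 \in unitmx by have /mulmx1_unit[] := Jmx2 R 2.
have ut : a^T \in unitmx by rewrite unitmx_tr.
by rewrite -[LHS](mulKmx uJ) -[Jmx R 2 *m _](mulKmx ut) (mulmxA a^T) h !mulmx0.
Qed.

Lemma plane_frame_perp (Y Yh : C -> vec) z v : ip v (Y z) = 0 -> ip v (Yh z) = 0 ->
  (plane_frame Y Yh z)^T *m J *m v = 0.
Proof.
rewrite (ipC v (Y z)) (ipC v (Yh z)) => /ip_eq0 h1 /ip_eq0 h2.
rewrite /plane_frame plane_frameE linearD /= !trmx_mul !mulmxDl -!mulmxA (mulmxA (Y z)^T) (mulmxA (Yh z)^T) h1 h2.
by rewrite !mulmx0 addr0.
Qed.

Lemma SOplus1 : in_SOplus (1%:M : 'M[C]_2).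
Proof.
split; first exact: map_mx1.
- by rewrite trmx1 mul1mx mulmx1.
- exact: det1.
by move=> i _; rewrite mxE eqxx ltr01.
Qed.

Variable v : 'I_m -> vec.
Variable v0 : forall j, usubmx (v j) = 0.
Variable gram : forall j k, ip (v j) (v k) = 0 /\ ip (v j) (cj (v k)) = (j == k)%:R * 2.
Local Notation b := (reim (fun j => dsubmx (v j)))^T.

Lemma ip_dsubmx (x y : vec) : usubmx x = 0 -> (dsubmx x)^T *m dsubmx y = (ip x y)%:M.
Proof.
move=> x0; rewrite /ip -{2}[x]vsubmxK -{2}[y]vsubmxK x0 tr_col_mx trmx0 Jmx_block mul_row_block !mulmx0 !mul0mx !add0r mulmx1.
by rewrite mul_row_col mul0mx add0r -mx11_scalar.
Qed.

Lemma rotation_O : in_O b.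
Proof.
split; first by rewrite /real_mx -map_trmx reim_real.
rewrite trmxK; apply: mulmx1C; apply: reim_orth => j k.
  by rewrite (ip_dsubmx _ (v0 j)) (gram j k).1 raddf0.
have -> : cj (dsubmx (v k)) = dsubmx (cj (v k)) by apply/matrixP => x y; rewrite !mxE.
by rewrite (ip_dsubmx _ (v0 j)) (gram j k).2.
Qed.

Lemma rotation_reim : reim v = col_mx 0 b^T.
Proof.
rewrite trmxK -[LHS]vsubmxK dsubmx_reim usubmx_reim; congr col_mx.
by apply/matrixP => i k; case/mxvec_indexP: k => j e; rewrite reimE v0 mxE mxE raddf0 raddf0 if_same.
Qed.

Definition rotation : mat := block_mx 1%:M 0 0 b.

Lemma rotation_inv : invmx rotation = block_mx 1%:M 0 0 b^T.
Proof.
have [_ bb] := rotation_O.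
have h : block_mx 1%:M 0 0 b^T *m rotation = 1%:M.
  by rewrite /rotation mulmx_block !mulmx0 !mul0mx !addr0 !add0r mulmx1 bb -scalar_mx_block.
have [_ u] := mulmx1_unit h.
by rewrite -[LHS]mul1mx -h (mulmxK u).
Qed.

Lemma rotation_Kpm : in_Kpm rotation.
Proof. by exists 1%:M, b; split; [|exact: SOplus1|exact: rotation_O]. Qed.

Lemma rotation_K (a : 'M[C]_2) : in_SOplus a -> ((0 < m)%N -> 0 < \det (row_mx (col_mx a 0) (reim v) : mat)) -> in_K rotation.
Proof.
move=> [_ _ da _] hp; exists 1%:M, b; split; [by []|exact: SOplus1|exact: rotation_O|].
have [m0|m0] := posnP m.
  have s0 : (m * 2 = 0)%N by rewrite m0.
  by move: b; rewrite s0 => c; rewrite det_mx00.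
have [br bb] := rotation_O.
have := hp m0; rewrite rotation_reim -block_mxEh det_ublock da mul1r det_tr.
move=> d0; have := congr1 determinant bb; rewrite det_mulmx det_tr det1 -expr2 => /eqP.
rewrite sqrf_eq1 => /orP[/eqP//|/eqP d]; move: d0; rewrite d => h.
by have := lt_trans h (ltrN10 _); rewrite ltxx.
Qed.

Lemma rotation_potential (eta : mat) : eta = block_mx 0 (ursubmx eta) (- ((ursubmx eta)^T *m Jmx R 2)) 0 ->
  (forall j, eta *m v j = 0) ->
  exists B : 'M[C]_(2, m * 2), rotation *m eta *m invmx rotation = block_mx 0 B (- (B^T *m Jmx R 2)) 0 /\
   forall i j, B i (mxvec_index j 1) = 'i * B i (mxvec_index j 0).
Proof.
move: (ursubmx eta) => B -> ev; exists (B *m b^T); split.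
  rewrite rotation_inv /rotation !mulmx_block !mulmx0 !mul0mx !addr0 !add0r !mulmx1 !mul1mx.
  by rewrite trmx_mul [(_^T)^T]trmxK mulmxN mulmxA mul0mx.
move=> i j; rewrite trmxK; apply: reim_mul; have := ev j.
rewrite -{1}[v j]vsubmxK v0 mul_block_col !mulmx0 !mul0mx !addr0 add0r -[0 in RHS]vsubmxK => /eq_col_mx[-> _].
by apply/matrixP => x y; rewrite !mxE.
Qed.

End Normalization.

Section Main.
Variables (R : realType) (m : nat).
Local Notation C := (cplx R).
Local Notation n := (2 + m * 2)%N.
Local Notation mat := 'M[C]_n.
Local Notation vec := 'cV[C]_n.
Local Notation J := (Jmx R n).
Local Notation cj := (map_mx Num.conj).

Lemma open_domain (D : set C) : D = [set z | `|z| < 1] \/ D = setT -> open D.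
Proof.
case=> ->; last exact: openT.
have -> : [set z : C | `|z| < 1] = [set w | cabs (w - 0) < 1]; last exact: open_cball.
by apply/seteqP; split=> z; rewrite /= subr0 -cabsE -rc_lt rc1.
Qed.

Lemma canonical_lift_sub (D O : set C) (Y : C -> vec) : open D -> open O -> O `<=` D ->
  canonical_lift Y D -> canonical_lift Y O.
Proof.
move=> oD oO OD [sY h]; split; last by move=> z /OD/h.
by apply/(smoothP _ oO); apply: (smx_sub OD); apply/(smoothP _ oD).
Qed.

Lemma H_frame_sub (W O : set C) (Y : C -> vec) (E : 'I_m -> C -> vec) : open W -> open O -> O `<=` W ->
  H_frame Y W E -> H_frame Y O E.
Proof.
move=> oW oO OW [h1 h2 h3 h4 h5 h6]; constructor.
- by move=> j; apply/(smoothP _ oO); apply: (smx_sub OW); apply/(smoothP _ oW).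
- by move=> z /OW; exact: h2.
- by move=> z /OW; exact: h3.
- by move=> z /OW; exact: h4.
- by move=> z /OW; exact: h5.
by move=> z /OW; exact: h6.
Qed.

Variables (D U W Omega : set C) (Y N kappa : C -> vec) (s mu : C -> C) (eta : C -> mat) (E : 'I_m -> C -> vec).
Variables (oD : open D) (hY : canonical_lift Y D) (hN : is_N Y D N) (hkappa : hopf_schwarzian Y D kappa s).
Variables (hT : totally_isotropic Y D) (oW : open W) (W0 : W 0) (hE : H_frame Y W E).
Variables (oU : open U) (U0 : U 0) (UD : U `<=` D) (hmu : adjoint_transform Y U kappa s mu).
Variable hbase : represents 1%:M (plane_frame Y (adjoint_lift Y N mu) 0).
Variable heta : normalized_potential U (plane_frame Y (adjoint_lift Y N mu)) eta.
Variables (oM : open Omega) (cM : connected Omega) (UM : U `<=` Omega) (hmero : meromorphic Omega eta).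

Lemma framed_potential : exists Q : mat,
  [/\ in_Kpm Q, positive_frame Y N E 0 -> in_K Q
    & exists h hh : 'I_m -> C -> C,
      (forall j, meromorphic Omega (h j : C -> C^o) /\ meromorphic Omega (hh j : C -> C^o)) /\
      forall p, Omega p -> \forall z \near p^',
        Q *m eta z *m invmx Q = isotropic_potential (fun j => h j z) (fun j => hh j z)].
Proof.
have [F [Fl [Fm [Fp [S [[[sF hF] F0] hext [S0 hS] hmF hB]]]]]] := heta.
have /dnbhs_cabsP[r r0 Hr] := hS 0 U0.
pose O := U `&` W `&` [set w | cabs (w - 0) < r].
have oO : open O by apply: openI; [exact: openI|exact: open_cball].
have O0 : O 0 by split; [|rewrite /= subrr cabs0].
have OU : O `<=` U by move=> z [[]].
have OW : O `<=` W by move=> z [[]].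
have OD : O `<=` D by move=> z /OU/UD.
have OS z : O z -> ~ S z.
  move=> [_ zr]; have [->|z0] := eqVneq z 0; first exact: S0.
  by apply: Hr.
have hYO := canonical_lift_sub oD oO OD hY.
have hNO : is_N Y O N by move=> z /OD; exact: hN.
have hkO : hopf_schwarzian Y O kappa s by move=> z /OD; exact: hkappa.
have hTO : totally_isotropic Y O by move=> j l j0 l0 z /OD; exact: hT.
have hEO := H_frame_sub oW oO OW hE.
have smu k : sCk k O mu by apply: (sCk_sub OU); exact: hmu.1.
have ric z : O z -> dz (mu : C -> C^o) z - mu z ^+ 2 / 2 - s z = 0 by move=> /OU/hmu.2[].
have hBO z : O z -> [/\ minus_loop (fun lam => Fm lam z), plus_loop (fun lam => Fp lam z)
    & forall lam : C, `|lam| = 1 -> [/\ Fm lam z = Fl lam z *m Fp lam z, holo_at (Fm lam) z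
      & invmx (Fm lam z) *m dz (Fm lam) z = lam^-1 *: eta z]].
  by move=> Oz; exact: (hB z (OU z Oz) (OS z Oz)).
have sFU : smx U F by apply/(smoothP _ oU).
have hFU z : U z -> in_SOplus (F z) by move=> /hF[].
have hrep z : U z -> represents (F z) (plane_frame Y (adjoint_lift Y N mu) z) by move=> /hF[].
have key := geometry_key oO hYO hNO hkO hTO hEO smu ric oU sFU hFU hrep OU.
have OM : O `<=` Omega by move=> z /OU/UM.
have kills := eta_kills oU sFU hFU hext oO OU hBO O0 F0 (evec_smx oO hYO hEO smu) oM cM OM hmero key.
have [v [nu [vE ev gram Yhv]]] := base_frame N mu oO hYO hTO hEO O0.
have [a ha pE] := represents_id hbase.
have v0 j : usubmx (v j) = 0.
  apply: (usubmx_perp ha); rewrite -pE.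
  have [x x0 xE] := ev j; have [p1 p2] := evec_perp mu oO hYO hNO hTO hEO j O0.
  apply: plane_frame_perp; [move: p1|move: p2]; rewrite xE ipZl => /eqP; rewrite mulf_eq0 (negPf x0) => /eqP; exact.
have near0 : \forall z \near 0^', exists B : 'M[C]_(2, m * 2),
  rotation v *m eta z *m invmx (rotation v) = block_mx 0 B (- (B^T *m Jmx R 2)) 0 /\
  forall i j, B i (mxvec_index j 1) = 'i * B i (mxvec_index j 0).
  have kv : \forall z \near 0^', forall j, eta z *m v j = 0.
    apply: filter_forall => j; have [rho rho0 H] := kills j; apply/dnbhs_cabsP; exists rho => // z zr z0.
    rewrite subr0 in zr; have [x x0 xE] := ev j.
    have := H z zr z0; rewrite xE -scalemxAr => /eqP; rewrite scaler_eq0 (negPf x0) => /eqP; exact.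
  have Oz : \forall z \near 0^', O z by apply: cvg_within; apply: open_nbhs_nbhs; split.
  apply: filterS2 kv Oz => z kz Oz; apply: (rotation_potential v0 gram) kz.
  have tw w : O w -> twisted_loop (fun lam => Fm lam w) by move=> /hBO[[]].
  have [_ _ hl] := hBO z Oz.
  have [_ h1 _] := hl 1 (normr1 _); have [_ h2 _] := hl (-1) (normrN1 _).
  have [e1 e2] := eta_sigma oO Oz tw h1 h2 (fun lam nl => let: And3 _ _ h := hl lam nl in h).
  exact: potential_block.
exists (rotation v); split.
- exact: rotation_Kpm.
- move=> pos; apply: (rotation_K v0 gram ha) => m0; rewrite -pE.
  have [c [q YhE]] := Yhv m0; have [rY _] := Y_real oO hYO O0.
  rewrite /plane_frame plane_frameE (frame_det rY vE YhE); exact: pos.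
pose G z := rotation v *m eta z *m invmx (rotation v).
exists (fun j z => G z (lshift _ 0) (rshift 2 (mxvec_index j 0))), (fun j z => G z (lshift _ 1) (rshift 2 (mxvec_index j 0))).
split; first by move=> j; split; exact: conj_meromorphic.
move=> p Mp; exact: (potential_spread oM cM (UM U0) hmero near0 Mp).
Qed.

End Main.

Theorem theorem4p4 (R : realType) (m : nat)
  (D U Omega : set (cplx R))
  (Y N kappa : cplx R -> 'cV[cplx R]_(2 + m * 2)) (s mu : cplx R -> cplx R)
  (eta : cplx R -> 'M[cplx R]_(2 + m * 2))
  (hD : D = [set z | `|z| < 1] \/ D = setT)
  (hY : canonical_lift Y D)
  (hN : is_N Y D N)
  (hkappa : hopf_schwarzian Y D kappa s)
  (hH : H_totally_isotropic Y m D)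
  (hU : open U) (hU0 : U 0) (hUD : U `<=` D)
  (hmu : adjoint_transform Y U kappa s mu)
  (hbase : represents 1%:M (plane_frame Y (adjoint_lift Y N mu) 0))
  (heta : normalized_potential U (plane_frame Y (adjoint_lift Y N mu)) eta)
  (hOmega : open Omega) (hOmegac : connected Omega)
  (hUOmega : U `<=` Omega) (hOmegaD : Omega `<=` D)
  (hmero : meromorphic Omega eta) :
  exists Q : 'M[cplx R]_(2 + m * 2),
  [/\ in_Kpm Q,
      (exists (W : set (cplx R)) (E : 'I_m -> cplx R -> 'cV[cplx R]_(2 + m * 2)),
         [/\ open W /\ W 0, W `<=` D, H_frame Y W E & positive_frame Y N E 0]) -> in_K Q
    & exists h hh : 'I_m -> cplx R -> cplx R,
      (forall j, meromorphic Omega (h j : cplx R -> (cplx R)^o) /\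
                 meromorphic Omega (hh j : cplx R -> (cplx R)^o)) /\
      forall p, Omega p -> \forall z \near p^',
        Q *m eta z *m invmx Q
        = isotropic_potential (fun j => h j z) (fun j => hh j z)].
Proof.
have oD := open_domain hD.
have [hT hW] := hH.
have core W E := @framed_potential R m D U W Omega Y N kappa s mu eta E oD hY hN hkappa hT.
have [[W [E [[oW W0] WD hE pos]]]|npos] :=
  pselect (exists (W : set (cplx R)) (E : 'I_m -> cplx R -> 'cV[cplx R]_(2 + m * 2)),
         [/\ open W /\ W 0, W `<=` D, H_frame Y W E & positive_frame Y N E 0]).
  have [Q [h1 h2 h3]] := core W E oW W0 hE hU hU0 hUD hmu hbase heta hOmega hOmegac hUOmega hmero.
  by exists Q; split; [exact: h1|move=> _; exact: h2|exact: h3].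
have [W [E [oW W0 WD hE]]] := hW 0 (hUD _ hU0).
have [Q [h1 _ h3]] := core W E oW W0 hE hU hU0 hUD hmu hbase heta hOmega hOmegac hUOmega hmero.
by exists Q; split; [exact: h1|move=> /npos|exact: h3].
Qed.
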